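(* In the setting of the context (Neimark--Sacker bifurcation of a $2\pi$-periodically forced system), assume $\omega^\star\notin\{\frac13,\frac14\}$. For $|\varepsilon|$ sufficiently small, the system $$\mathsf S_{\infty,3}\boldsymbol G(\boldsymbol z_3(\theta,\phi),\lambda,\theta;\varepsilon)-\frac{\partial}{\partial\theta}\boldsymbol z_3(\theta,\phi)-\omega\frac{\partial}{\partial\phi}\boldsymbol z_3(\theta,\phi)=\boldsymbol 0,\qquad\boldsymbol\gamma(\boldsymbol z_3)-\widehat{\boldsymbol e}_1=\boldsymbol 0,$$ for $\lambda,\omega\in\mathbb R$ and $\boldsymbol z_3:\mathbb S^1\times\mathbb S^1\to\mathbb R^n$ having only Fourier $\phi$-modes $0,1,2,3$, has a locally unique solution (near $\lambda=\lambda^\star$, $\omega=\omega^\star$, $\boldsymbol z_3=\boldsymbol a^\star(\phi)$) $$\lambda^F(\varepsilon),\quad\omega^F(\varepsilon),\quad\boldsymbol z^F(\theta,\phi;\varepsilon)=\boldsymbol a^\star(\phi)+\boldsymbol a_0^F(\theta;\varepsilon)+\sum_{m=1}^3\left\{\boldsymbol a_m^F(\theta;\varepsilon)\cos m\phi+\boldsymbol b_m^F(\theta;\varepsilon)\sin m\phi\right\}.$$ The amplitude and phase conditions force $$\langle\boldsymbol a_1^F(\theta;\varepsilon),\boldsymbol e_1\rangle+\langle\boldsymbol b_1^F(\theta;\varepsilon),\boldsymbol e_2\rangle=0=\langle\boldsymbol a_1^F(\theta;\varepsilon),\boldsymbol e_2\rangle-\langle\boldsymbol b_1^F(\theta;\varepsilon),\boldsymbol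 e_1\rangle.$$ Comparison with the asymptotic solution $\lambda^E(\varepsilon),\omega^E(\varepsilon),\boldsymbol z^E(\theta,\phi;\varepsilon)$ defined in the context gives, as $\varepsilon\to0$, $$|\lambda^E(\varepsilon)-\lambda^F(\varepsilon)|=O(\varepsilon^4),\qquad|\omega^E(\varepsilon)-\omega^F(\varepsilon)|=O(\varepsilon^4),$$ $$\|\boldsymbol a_m^E(\theta;\varepsilon)-\boldsymbol a_m^F(\theta;\varepsilon)\|=O(\varepsilon^3)\ (m=0,2),\qquad\|\boldsymbol b_m^E(\theta;\varepsilon)-\boldsymbol b_m^F(\theta;\varepsilon)\|=O(\varepsilon^3)\ (m=2),$$ $$\|\boldsymbol a_m^E(\theta;\varepsilon)-\boldsymbol a_m^F(\theta;\varepsilon)\|=O(\varepsilon^4)\ (m=1,3),\qquad\|\boldsymbol b_m^E(\theta;\varepsilon)-\boldsymbol b_m^F(\theta;\varepsilon)\|=O(\varepsilon^4)\ (m=1,3),$$ uniformly in $\theta$.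
   Context: Setting (periodically forced Neimark--Sacker bifurcation). $\mathbb S^1=\mathbb R/2\pi\mathbb Z$; $\boldsymbol F:\mathbb R^n\times\mathbb S^1\times\mathbb R\to\mathbb R^n$ is smooth; the system is $\frac{d\boldsymbol v}{d\theta}(\theta)=\boldsymbol F(\boldsymbol v,\theta,\lambda)$; $\mathsf J(\boldsymbol v,\theta,\lambda)$ is the Jacobian matrix of $\boldsymbol F$ with respect to $\boldsymbol v$. Assume: (1) $\boldsymbol v^\star:\mathbb S^1\to\mathbb R^n$ satisfies $\boldsymbol F(\boldsymbol v^\star(\theta),\theta,\lambda^\star)-\frac{d}{d\theta}\boldsymbol v^\star(\theta)=\boldsymbol 0$ for all $\theta$. (2) There are $\mathsf E^\star\in\mathbb R^{n\times n}$ and $\mathsf P^\star:\mathbb S^1\to\mathbb R^{n\times n}$ with $\mathsf P^\star(\theta)$ non-singular for all $\theta$ (so all Floquet vectors are taken $2\pi$-periodic) such that $\mathsf J(\boldsymbol v^\star(\theta),\theta,\lambda^\star)\mathsf P^\star(\theta)-\dot{\mathsf P}^\star(\theta)=\mathsf P^\star(\theta)\mathsf E^\star$, $\mathsf E^\star=\mathrm{diag}(\widehat{\mathsf E}^\star,\widetilde{\mathsf E}^\star)$, $\widehat{\mathsf E}^\star=\begin{pmatrix}0&-\omega^\star\\ \omega^\star&0\end{pmatrix}$, $\omega^\star>0$, and $\widetilde{\mathsf E}^\star\in\mathbb R^{(n-2)\times(n-2)}$ with no eigenvalues on the imaginary axis. The imaginary parts of the eigenvalues of $\mathsf E^\star$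 (Floquet exponents) are taken in $(-\frac12,\frac12)$, so that $0<\omega^\star<\frac12$. Consequently, for $\lambda$ near $\lambda^\star$ there are smooth continuations $\boldsymbol v^\star(\theta;\lambda)$, $\mathsf P(\theta;\lambda)$ (non-singular, $2\pi$-periodic in $\theta$), $\mathsf E(\lambda)$ of $\boldsymbol v^\star,\mathsf P^\star,\mathsf E^\star$ with $\boldsymbol F(\boldsymbol v^\star(\theta;\lambda),\theta,\lambda)=\frac{d}{d\theta}\boldsymbol v^\star(\theta;\lambda)$, $\mathsf J(\boldsymbol v^\star(\theta;\lambda),\theta,\lambda)\mathsf P(\theta;\lambda)-\dot{\mathsf P}(\theta;\lambda)=\mathsf P(\theta;\lambda)\mathsf E(\lambda)$ (here $\dot{\mathsf P}=\partial\mathsf P/\partial\theta$), $\mathsf E(\lambda)=\mathrm{diag}(\widehat{\mathsf E}(\lambda),\widetilde{\mathsf E}(\lambda))$, $\widehat{\mathsf E}(\lambda)=\begin{pmatrix}\alpha_R(\lambda)&-\alpha_I(\lambda)\\ \alpha_I(\lambda)&\alpha_R(\lambda)\end{pmatrix}$. (3) Transversality: $\dot\alpha_R(\lambda^\star)\neq0$ (dot on $\alpha_R$ denotes $d/d\lambda$). Notation. $\boldsymbol a^\star(\phi)=(\cos\phi,\sin\phi,0,\dots,0)^T$, $\dot{\boldsymbol a}^\star(\phi)=(-\sin\phi,\cos\phi,0,\dots,0)^T\in\mathbb R^n$; $\boldsymbol e_1,\boldsymbol e_2$ are the first two unit vectors of $\mathbb R^n$; $\widehat{\boldsymbol e}_1=(1,0)^T$;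 $\|\cdot\|$ is the Euclidean norm. $\langle\boldsymbol w_1,\boldsymbol w_2\rangle=\frac1{2\pi}\int_0^{2\pi}\boldsymbol w_1(\theta)\cdot\boldsymbol w_2(\theta)\,d\theta$; $\langle\langle\boldsymbol w_1,\boldsymbol w_2\rangle\rangle=\frac1{(2\pi)^2}\int_0^{2\pi}\int_0^{2\pi}\boldsymbol w_1(\theta,\phi)\cdot\boldsymbol w_2(\theta,\phi)\,d\theta\,d\phi$. For $\boldsymbol z:\mathbb S^1\times\mathbb S^1\to\mathbb R^n$, $\boldsymbol\gamma(\boldsymbol z)=(\langle\langle\boldsymbol z,\boldsymbol a^\star(\phi)\rangle\rangle,\langle\langle\boldsymbol z,\dot{\boldsymbol a}^\star(\phi)\rangle\rangle)^T$ (the equations $\boldsymbol\gamma(\boldsymbol z)=\widehat{\boldsymbol e}_1$ are the amplitude and phase conditions), and $$\boldsymbol G(\boldsymbol z,\lambda,\theta;\varepsilon)=\tfrac1\varepsilon\mathsf P(\theta;\lambda)^{-1}\Big\{\boldsymbol F\big(\boldsymbol v^\star(\theta;\lambda)+\varepsilon\mathsf P(\theta;\lambda)\boldsymbol z,\theta,\lambda\big)-\boldsymbol F\big(\boldsymbol v^\star(\theta;\lambda),\theta,\lambda\big)-\varepsilon\dot{\mathsf P}(\theta;\lambda)\boldsymbol z\Big\}$$ (with $\boldsymbol G=\mathsf E(\lambda)\boldsymbol z$ at $\varepsilon=0$). $\mathsf S_{\infty,3}:L^2\to L^2$ truncates a double Fourier series to $\phi$-modes $0,\dots,3$, keeping all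 $\theta$-modes. Asymptotic solution. $\lambda^E(\varepsilon)=\lambda^\star+\varepsilon^2\lambda_2^E$, $\omega^E(\varepsilon)=\omega^\star+\varepsilon^2\omega_2^E$, $\boldsymbol z^E(\theta,\phi;\varepsilon)=\boldsymbol a^\star(\phi)+\varepsilon\boldsymbol z_2^E(\theta,\phi)+\varepsilon^2\boldsymbol z_3^E(\theta,\phi)$, with $\boldsymbol z_2^E$ having only $\phi$-modes $0,2$ and $\boldsymbol z_3^E$ only $\phi$-modes $1,3$, is the asymptotic solution of $$\boldsymbol G(\boldsymbol z,\lambda,\theta;\varepsilon)-\frac{\partial\boldsymbol z}{\partial\theta}-\omega\frac{\partial\boldsymbol z}{\partial\phi}=\boldsymbol 0,\qquad\boldsymbol\gamma(\boldsymbol z)=\widehat{\boldsymbol e}_1$$ up to and including $\varepsilon^2$ terms (remainder $O(\varepsilon^3)$), which exists when $\omega^\star\notin\{\frac13,\frac14\}$. It is written in $\phi$-modes as $\boldsymbol z^E=\boldsymbol a^\star(\phi)+\boldsymbol a_0^E(\theta;\varepsilon)+\sum_{m=1}^3\{\boldsymbol a_m^E(\theta;\varepsilon)\cos m\phi+\boldsymbol b_m^E(\theta;\varepsilon)\sin m\phi\}$, with $\boldsymbol a_0^E,\boldsymbol a_2^E,\boldsymbol b_2^E$ being $\varepsilon$-terms and $\boldsymbol a_1^E,\boldsymbol b_1^E,\boldsymbol a_3^E,\boldsymbol b_3^E$ being $\varepsilon^2$-terms. *)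

(* Defs.v *)
From HB Require Import structures.
From mathcomp Require Import all_boot all_order all_algebra.
From mathcomp Require Import all_classical all_reals all_analysis.
From mathcomp Require Import complex.

Set Implicit Arguments.
Unset Strict Implicit.
Unset Printing Implicit Defensive.

Import Order.TTheory GRing.Theory Num.Theory.
Import numFieldNormedType.Exports.

Local Open Scope classical_set_scope.
Local Open Scope ring_scope.

(* Functions on the circle R / 2 pi Z are functions on R of period pi *+ 2.   *)

Section Smoothness.
Context {R : realType} {V W : normedModType R}.

Fixpoint iter_derive (f : V -> W) (vs : seq V) : V -> W :=
  if vs is v :: vs' then fun x => 'D_v (iter_derive f vs') x else f.

(* C^infinity on an open set A of a finite-dimensional space V: all iterated  *)
(* directional derivatives exist and are continuous on A.                     *)
Definition smooth_on (A : set V) (f : V -> W) : Prop :=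
  forall (vs : seq V) (x : V), A x ->
    {for x, continuous (iter_derive f vs)} /\
    forall v, derivable (iter_derive f vs) x v.

End Smoothness.

Section EuclideanSpace.
Context {R : realType} {n : nat}.
Implicit Types u v : 'cV[R]_n.

Definition dotv u v : R := \sum_(i < n) u i 0 * v i 0.

(* The library norm on matrices is the sup norm. *)
Definition enorm u : R := Num.sqrt (dotv u u).

Definition integral_2pi (f : R -> R) : R :=
  \int[@lebesgue_measure R]_(t in `[0, pi *+ 2]) f t.

Definition ip (w1 w2 : R -> 'cV[R]_n) : R :=
  (pi *+ 2)^-1 * integral_2pi (fun theta => dotv (w1 theta) (w2 theta)).

Definition ip2 (w1 w2 : R -> R -> 'cV[R]_n) : R :=
  (pi *+ 2) ^- 2 *
  integral_2pi (fun phi =>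
    integral_2pi (fun theta => dotv (w1 theta phi) (w2 theta phi))).

Definition unif_bigO (T : Type) (err : R -> T -> 'cV[R]_n) (k : nat) : Prop :=
  exists C : R, \forall eps \near (0 : R),
    forall t : T, enorm (err eps t) <= C * `|eps| ^+ k.

End EuclideanSpace.

Section FourierModes.
Context {R : realType} {n : nat}.

Record modes := Modes {
  cos_mode : nat -> R -> 'cV[R]_n ;
  sin_mode : nat -> R -> 'cV[R]_n }.

(* For k = 0 the summand is cos_mode c 0 theta, and sin_mode c 0 is unused.   *)
Definition synth (ms : seq nat) (c : modes) (theta phi : R) : 'cV[R]_n :=
  \sum_(k <- ms) (cos (k%:R * phi) *: cos_mode c k theta +
                  sin (k%:R * phi) *: sin_mode c k theta).

Definition phi_mode_factor (k : nat) : R :=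
  if k == 0%N then (pi *+ 2)^-1 else pi^-1.

Definition phi_modes (w : R -> R -> 'cV[R]_n) : modes := Modes
  (fun k theta => \col_i (phi_mode_factor k *
     integral_2pi (fun phi => w theta phi i 0 * cos (k%:R * phi))))
  (fun k theta => \col_i (phi_mode_factor k *
     integral_2pi (fun phi => w theta phi i 0 * sin (k%:R * phi)))).

(* The Fourier truncation S_{oo,M}: every theta-mode is kept exactly when the *)
(* coefficients of cos k phi and sin k phi, k <= M, are kept as functions of  *)
(* theta.                                                                     *)
Definition S_trunc (M : nat) (w : R -> R -> 'cV[R]_n) : R -> R -> 'cV[R]_n :=
  synth (iota 0 M.+1) (phi_modes w).

(* Regularity of the unknowns: 2 pi-periodic in both angles and having the    *)
(* derivatives that occur in the equations.                                   *)
Definition torus_function (z : R -> R -> 'cV[R]_n) : Prop :=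
  [/\ forall phi, periodic (fun theta => z theta phi) (pi *+ 2),
      forall theta, periodic (z theta) (pi *+ 2),
      forall theta phi, derivable (fun t => z t phi) theta 1
    & forall theta phi, derivable (z theta) phi 1].

Definition has_only_phi_modes (ms : seq nat) (z : R -> R -> 'cV[R]_n) : Prop :=
  exists c : modes, forall theta phi, z theta phi = synth ms c theta phi.

End FourierModes.

Arguments modes : clear implicits.

Section NeimarkSacker.
Context {R : realType} {m : nat}.
Local Notation n := (2 + m)%N.
Local Notation vec := 'cV[R]_n.
Local Notation mat := 'M[R]_n.

Definition e1 : vec := delta_mx (lshift m 0) 0.
Definition e2 : vec := delta_mx (lshift m 1) 0.
Definition astar (phi : R) : vec := cos phi *: e1 + sin phi *: e2.
Definition dastar (phi : R) : vec := - sin phi *: e1 + cos phi *: e2.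

Definition gamma (z : R -> R -> vec) : 'cV[R]_2 :=
  \col_(i < 2) (if i == 0 then ip2 z (fun _ phi => astar phi)
                else ip2 z (fun _ phi => dastar phi)).
Definition ehat1 : 'cV[R]_2 := delta_mx 0 0.

(* The matrix ((a, -b), (b, a)). *)
Definition rot_block (a b : R) : 'M[R]_2 :=
  \matrix_(i, j) (if i == j then a else if i == 0 then - b else b).

Definition exponent_mx (a b : R) (Et : 'M[R]_m) : mat :=
  block_mx (rot_block a b) 0 0 Et.

Definition complex_eigenvalue (k : nat) (A : 'M[R]_k) (mu : R[i]) : bool :=
  eigenvalue (map_mx (real_complex R) A) mu.

Definition jac (F : vec -> R -> R -> vec) (v : vec) (theta lam : R) : mat :=
  \matrix_(i, j) ('D_(delta_mx j 0) (fun u => F u theta lam) v) i 0.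

Definition forcing (F : vec -> R -> R -> vec) : Prop :=
  smooth_on setT (fun x : vec * R * R => F x.1.1 x.1.2 x.2) /\
  forall v lam, periodic (fun theta => F v theta lam) (pi *+ 2).

Definition periodic_orbit (F : vec -> R -> R -> vec) (lam : R)
    (v : R -> vec) : Prop :=
  periodic v (pi *+ 2) /\
  forall theta : R, is_derive theta (1 : R) v (F (v theta) theta lam).

Definition floquet_form (F : vec -> R -> R -> vec) (lam : R) (v : R -> vec)
    (P : R -> mat) (E : mat) : Prop :=
  [/\ periodic P (pi *+ 2),
      forall theta, P theta \in unitmx,
      forall theta, derivable P theta 1
    & forall theta, jac F (v theta) theta lam *m P theta - derive1 P theta
        = P theta *m E].

Definition neimark_sacker_point (F : vec -> R -> R -> vec) (lams : R)
    (vs : R -> vec) (Ps : R -> mat) (oms : R) (Ets : 'M[R]_m) : Prop :=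
  [/\ periodic_orbit F lams vs,
      floquet_form F lams vs Ps (exponent_mx 0 oms Ets),
      0 < oms,
      forall mu, complex_eigenvalue Ets mu -> complex.Re mu != 0
    & forall mu, complex_eigenvalue (exponent_mx 0 oms Ets) mu ->
        - 2^-1 < complex.Im mu < 2^-1].

Definition smooth_continuation (F : vec -> R -> R -> vec) (lams : R)
    (vs : R -> vec) (Ps : R -> mat) (oms : R) (Ets : 'M[R]_m)
    (r : R) (v : R -> R -> vec) (P : R -> R -> mat)
    (alphaR alphaI : R -> R) (Et : R -> 'M[R]_m) : Prop :=
  [/\ (forall theta, v theta lams = vs theta) /\
      (forall theta, P theta lams = Ps theta),
      [/\ alphaR lams = 0, alphaI lams = oms & Et lams = Ets],
      smooth_on [set x : R * R | `|x.2 - lams| < r] (fun x => v x.1 x.2) /\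
      smooth_on [set x : R * R | `|x.2 - lams| < r] (fun x => P x.1 x.2),
      [/\ smooth_on [set lam : R | `|lam - lams| < r] alphaR,
          smooth_on [set lam : R | `|lam - lams| < r] alphaI
        & smooth_on [set lam : R | `|lam - lams| < r] Et]
    & forall lam, `|lam - lams| < r ->
        periodic_orbit F lam (v ^~ lam) /\
        floquet_form F lam (v ^~ lam) (P ^~ lam)
          (exponent_mx (alphaR lam) (alphaI lam) (Et lam))].

Definition G_fun (F : vec -> R -> R -> vec) (v : R -> R -> vec)
    (P : R -> R -> mat) (E : R -> mat)
    (z : vec) (lam theta eps : R) : vec :=
  if eps == 0 then E lam *m z else
  eps^-1 *: (invmx (P theta lam) *m
    (F (v theta lam + eps *: (P theta lam *m z)) theta lam
     - F (v theta lam) theta lam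
     - eps *: (derive1 (P ^~ lam) theta *m z))).

Definition pde_residual (g : R -> R -> vec) (om : R) (z : R -> R -> vec)
    (theta phi : R) : vec :=
  g theta phi - derive1 (z ^~ phi) theta - om *: derive1 (z theta) phi.

Definition truncated_solution (G : vec -> R -> R -> R -> vec)
    (eps lam om : R) (z : R -> R -> vec) : Prop :=
  [/\ torus_function z,
      has_only_phi_modes [:: 0; 1; 2; 3]%N z,
      forall theta phi,
        pde_residual (S_trunc 3 (fun t p => G (z t p) lam t eps))
          om z theta phi = 0
    & gamma z - ehat1 = 0].

Definition near_bifurcation (d lams oms lam om : R) (z : R -> R -> vec) : Prop :=
  [/\ `|lam - lams| < d, `|om - oms| < d
    & forall theta phi, enorm (z theta phi - astar phi) < d].

Definition lamE (lams lam2 eps : R) : R := lams + eps ^+ 2 * lam2.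
Definition omE (oms om2 eps : R) : R := oms + eps ^+ 2 * om2.

(* c collects the modes of z2 (k = 0, 2) and of z3 (k = 1, 3). *)
Definition z2E (c : modes R n) : R -> R -> vec := synth [:: 0; 2]%N c.
Definition z3E (c : modes R n) : R -> R -> vec := synth [:: 1; 3]%N c.
Definition zE (c : modes R n) (eps theta phi : R) : vec :=
  astar phi + eps *: z2E c theta phi + eps ^+ 2 *: z3E c theta phi.

Definition aE (c : modes R n) (k : nat) (eps theta : R) : vec :=
  (if odd k then eps ^+ 2 else eps) *: cos_mode c k theta.
Definition bE (c : modes R n) (k : nat) (eps theta : R) : vec :=
  (if odd k then eps ^+ 2 else eps) *: sin_mode c k theta.

Definition asymptotic_solution (G : vec -> R -> R -> R -> vec)
    (lams oms lam2 om2 : R) (c : modes R n) : Prop :=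
  [/\ torus_function (z2E c), torus_function (z3E c),
      unif_bigO (fun eps (x : R * R) =>
        pde_residual (fun t p => G (zE c eps t p) (lamE lams lam2 eps) t eps)
          (omE oms om2 eps) (zE c eps) x.1 x.2) 3
    & unif_bigO (fun eps (_ : unit) => gamma (zE c eps) - ehat1) 3].

Definition zF (c : R -> modes R n) (eps theta phi : R) : vec :=
  astar phi + synth [:: 0; 1; 2; 3]%N (c eps) theta phi.

End NeimarkSacker.

(* Main.v *)
Require Import Defs.
From mathcomp Require Import all_boot all_order all_algebra.
From mathcomp Require Import all_classical all_reals all_analysis.
From mathcomp Require Import complex.
From mathcomp Require Import ring lra.

(* In phi-modes the truncated system becomes, for k <= 3, a periodic linear
   system for a_k - i b_k with generator E(lams) - i k oms, plus small
   corrections.  Since E(lams) is hyperbolic off the critical plane and oms is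
   below 1/2 and neither 1/3 nor 1/4, no Floquet multiplier is 1: on the
   critical plane they are exp(2 pi i j oms) with 0 < |j| <= 4.  The only
   exception is the critical vector at k = 1, where j = 0.  The mean of that
   component is pinned by the amplitude and phase conditions, and its solvability
   condition determines lam (by transversality) and om.  This turns the system
   into a fixed-point problem for a contraction, hence existence and uniqueness.

   In the contraction estimate the even modes act on the odd ones, on lam and on
   om only through a factor eps.  The asymptotic solution is an approximate fixed
   point: its residual is O(eps^3), and even O(eps^4) in the odd modes, since
   (z, eps, phi) -> (-z, -eps, phi + pi) is a symmetry of the equation.  Feeding
   these two orders into the estimate gives exactly the orders of the theorem. *)

Set Implicit Arguments.
Unset Strict Implicit.
Unset Printing Implicit Defensive.

Import Order.TTheory GRing.Theory Num.Theory.
Import numFieldNormedType.Exports.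

Local Open Scope classical_set_scope.
Local Open Scope ring_scope.

(** The unknown is a point of a product: one coordinate for [lam], one for [om] and one for each
    entry of each mode at each theta. Distances are sup norms of these coordinates. No derivative
    enters the norm, since a step of the iteration solves the mode equations exactly and the
    theta-derivative is read off the equation.

    Two distances are carried side by side, one for [lam], [om] and the odd modes, one for the even
    modes. The linear part couples a mode only to itself and to [lam] and [om], so parities mix only
    through the nonlinearity. A single distance would give O(eps^3) for every quantity.

    The asymptotic solution is known only through its O(eps^3) residual. The fourth order in the odd
    modes therefore comes from a Taylor expansion of eps times the residual to order five: by the
    symmetry an odd part in eps appears, its term of degree four cancels, and dividing by eps leaves
    order four.

    Smoothness is given by iterated directional derivatives, while all estimates must be uniform in
    theta, phi and the state. This is why families in two real variables with bounds uniform in a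
    further parameter are used instead of derivatives on function spaces. *)

Local Notation der f x d := (is_derive x 1 f d).

(** * Real derivatives and integrals over a period *)

Section RealCalculus.
Context {R : realType}.
Implicit Types (f g U : R -> R) (a b x y M : R).

Lemma der_cst c x : der (fun _ : R => c : R) x 0.
Proof. exact: is_derive_cst. Qed.

Lemma der_id x : der (fun t : R => t) x 1.
Proof. exact: is_derive_id. Qed.

Lemma der_add f g x a b : der f x a -> der g x b ->
  der (fun t => f t + g t) x (a + b).
Proof. exact: is_deriveD. Qed.

Lemma der_opp f x a : der f x a -> der (fun t => - f t) x (- a).
Proof. exact: is_deriveN. Qed.

Lemma der_sub f g x a b : der f x a -> der g x b ->
  der (fun t => f t - g t) x (a - b).
Proof. exact: is_deriveB. Qed.

Lemma der_mul f g x a b : der f x a -> der g x b ->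
  der (fun t => f t * g t) x (f x * b + g x * a).
Proof. exact: is_deriveM. Qed.

Lemma der_scale c f x a : der f x a -> der (fun t => c * f t) x (c * a).
Proof. exact: is_deriveZ. Qed.

Lemma der_comp f g x a b : der f (g x) a -> der g x b ->
  der (fun t => f (g t)) x (a * b).
Proof. exact: is_derive1_comp. Qed.

Lemma der_sum (I : Type) (s : seq I) (f : I -> R -> R) (d : I -> R) x :
  (forall i, der (f i) x (d i)) ->
  der (fun t => \sum_(i <- s) f i t) x (\sum_(i <- s) d i).
Proof.
move=> H; elim: s => [|i s IH].
  rewrite big_nil (_ : (fun _ => _) = (fun=> 0)) ?funeqE => [|t]; last by rewrite big_nil.
  exact: der_cst.
rewrite big_cons (_ : (fun _ => _) = (fun t => f i t + \sum_(i <- s) f i t)).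
  exact: der_add.
by rewrite funeqE => t; rewrite big_cons.
Qed.

Lemma der_ext f g x a : (forall t, f t = g t) -> der f x a -> der g x a.
Proof. by move=> /funext->. Qed.

Lemma der_val f x a b : a = b -> der f x a -> der f x b.
Proof. by move=> ->. Qed.

Lemma der_uniq f x a b : der f x a -> der f x b -> a = b.
Proof. by move=> [_ <-] [_ <-]. Qed.

Lemma der_continuous f x a : der f x a -> {for x, continuous f}.
Proof. by move=> [/derivable1_diffP/differentiable_continuous]. Qed.

Lemma der_shift f x c a : der f (x + c) a -> der (fun t => f (t + c)) x a.
Proof.
move=> H; apply: (@der_val _ _ (a * (1 + 0))); by rewrite addr0 mulr1.
Qed.

Lemma der_inv f x a : f x != 0 -> der f x a ->
  der (fun t => (f t)^-1) x (- (f x)^-1 * (f x)^-1 * a).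
Proof.
move=> fx0 [df <-]; split; first exact: derivableV.
rewrite (_ : (fun t => _) = (fun t => (f t)^-1)) // deriveV //.
by transitivity (- (f x) ^- 2 * 'D_1 f x) => //; rewrite expr2 invfM !mulNr.
Qed.

Lemma mvt_bound f (df : R -> R) a b M : a <= b ->
  (forall x, a <= x <= b -> der f x (df x)) ->
  (forall x, a <= x <= b -> `|df x| <= M) ->
  `|f b - f a| <= M * (b - a).
Proof.
move=> ab Hf HM; have [c|| c cab ->] := @MVT_segment R f df a b ab.
- by rewrite in_itv/= => /andP[ac cb]; apply: Hf; rewrite !ltW.
- apply: derivable_within_continuous => t; rewrite in_itv/= => tab.
  by have [] := Hf t tab.
- by rewrite normrM (ger0_norm (x := b - a)) ?subr_ge0// ler_wpM2r ?subr_ge0// HM.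
Qed.

(** The form without order on [a] and [b] is needed because eps takes both signs. *)
Lemma mvt_bound_dist f (df : R -> R) a b M :
  (forall x, `|x - a| <= `|b - a| -> der f x (df x)) ->
  (forall x, `|x - a| <= `|b - a| -> `|df x| <= M) ->
  `|f b - f a| <= M * `|b - a|.
Proof.
move=> Hf HM; case: (leP a b) => ab.
  rewrite (ger0_norm (x := b - a)) ?subr_ge0//.
  by apply: (mvt_bound (df := df)) => // x /andP[h1 h2]; [apply: Hf|apply: HM];
    rewrite !ger0_norm ?subr_ge0// lerD2r.
have ba := ltW ab.
rewrite distrC (distrC b) (ger0_norm (x := a - b)) ?subr_ge0//.
apply: (mvt_bound (df := df)) ba _ _ => x /andP[h1 h2]; [apply: Hf|apply: HM];
  rewrite distrC (distrC b) !ger0_norm ?subr_ge0// ?lerD2l ?lerN2//;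
  exact: ltW.
Qed.

Lemma der0_const f : (forall x, der f x 0) -> forall x y, f x = f y.
Proof.
move=> H x y; apply/eqP; rewrite -subr_eq0 -normr_le0.
have := @mvt_bound_dist f (fun=> 0) y x 0 (fun t _ => H t) (fun t _ => _).
by rewrite mul0r; apply => t; rewrite normr0.
Qed.

(** The integral from [a] to [x] is differentiable only for [x] to the right of [a], so no single
    base point serves the whole line. After subtraction of its value at 0 the integral no longer
    depends on the base point, as the difference of two choices has derivative 0; the base point may
    then vary with [x]. *)
Lemma antiderivative f : continuous f -> exists U, forall x, der U x (f x).
Proof.
move=> cf.
pose I a x := \int[@lebesgue_measure R]_(t in `[a, x]) f t.
have dI a x : a < x -> der (I a) x (f x).
  move=> ax; have xx1 : x < x + 1 by rewrite ltrDl.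
  have [|d1 d2] := continuous_FTC1_closed xx1 _ ax (cf x).
    apply: continuous_compact_integrable; first exact: segment_compact.
    exact: continuous_subspaceT.
  by apply: DeriveDef; [exact: d1|rewrite -derive1E; exact: d2].
pose W a x := I a x - I a 0.
have dW a x : a < x -> der (W a) x (f x).
  by move=> ax; rewrite -[f x]subr0; exact: (der_sub (dI a x ax) (der_cst _ _)).
have W0 a : W a 0 = 0 by rewrite /W subrr.
have WE a b x : a < 0 -> b < 0 -> a < x -> b < x -> W a x = W b x.
  move=> a0 b0 ax bx; pose D t := W a t - W b t.
  have dD t : a < t -> b < t -> der D t 0.
    by move=> ta tb; rewrite -[0](subrr (f t)); exact: (der_sub (dW a t ta) (dW b t tb)).
  suff : D x = D 0 by rewrite /D !W0 subrr => /eqP; rewrite subr_eq0 => /eqP.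
  apply/eqP; rewrite -subr_eq0 -normr_le0; case: (leP 0 x) => x0.
    rewrite -[leRHS](mul0r (x - 0)).
    apply: (mvt_bound (df := fun=> 0)) => // t /andP[t0 _]; last by rewrite normr0.
    by apply: dD; [exact: lt_le_trans t0|exact: lt_le_trans t0].
  rewrite distrC -[leRHS](mul0r (0 - x)).
  apply: (mvt_bound (df := fun=> 0)) => [|t /andP[t0 _]|]; first exact: ltW.
    by apply: dD; [exact: lt_le_trans t0|exact: lt_le_trans t0].
  by move=> ? _; rewrite normr0.
(* A base point to the left of 0 and of every point at distance at most 1/2 from [x], so that the
   function attached to [x] also represents the antiderivative near [x]. *)
pose b0 x := - `|x| - 1.
have b00 x : b0 x < 0 by rewrite /b0 subr_lt0 (le_lt_trans _ ltr01)// oppr_le0.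
have b0x x y : `|y| <= `|x| + 1 / 2 -> b0 x < y.
  by move=> xy; have := ler_norm (- y); rewrite normrN /b0; lra.
exists (fun x => W (b0 x) x) => x.
apply: near_eq_is_derive (dW (b0 x) x (b0x _ _ ltac:(lra))).
near=> t; apply: WE => //; apply: b0x; last lra.
have : `|x - t| < 1 / 2 by near: t; apply: cvgr_dist_lt => //; exact: cvg_id.
have := ler_normB x (x - t); rewrite opprB addrCA subrr addr0; lra.
Unshelve. all: by end_near.
Qed.

Lemma integral_2piE f U : (forall x, der U x (f x)) -> continuous f ->
  integral_2pi f = U (pi *+ 2) - U 0.
Proof.
move=> HU cf; rewrite /integral_2pi /Rintegral.
have pi20 : 0 < (pi : R) *+ 2 by rewrite mulrn_wgt0 // pi_gt0.
rewrite (@continuous_FTC2 _ f U 0 (pi *+ 2)) //.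
- exact: continuous_subspaceT.
- have cU x : {for x, continuous U} by apply: der_continuous; exact: HU.
  split=> [x _||]; first by have [] := HU x.
  + exact/cvg_at_right_filter/cU.
  + exact/cvg_at_left_filter/cU.
- by move=> x _; rewrite derive1E; have [_ ->] := HU x.
Qed.

End RealCalculus.

(** * Integration over a period and orthogonality of the trigonometric functions *)

Section Integral2pi.
Context {R : realType}.
Implicit Types (f g U : R -> R) (a b c x y M : R).
Local Notation I2 := (@integral_2pi R).
Local Notation T2 := ((pi : R) *+ 2).

Lemma twopi_gt0 : 0 < T2.
Proof. by rewrite mulrn_wgt0 // pi_gt0. Qed.

Lemma twopi_neq0 : T2 != 0.
Proof. by rewrite gt_eqF // twopi_gt0. Qed.

Lemma continuous_add f g : continuous f -> continuous g ->
  continuous (fun x => f x + g x).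
Proof. by move=> cf cg x; apply: cvgD; [exact: cf|exact: cg]. Qed.

Lemma continuous_mul f g : continuous f -> continuous g ->
  continuous (fun x => f x * g x).
Proof. by move=> cf cg x; apply: cvgM; [exact: cf|exact: cg]. Qed.

Lemma continuous_cst c : continuous (fun _ : R => c).
Proof. by move=> x; exact: cvg_cst. Qed.

Lemma continuous_sub f g : continuous f -> continuous g ->
  continuous (fun x => f x - g x).
Proof. by move=> cf cg x; apply: cvgB; [exact: cf|exact: cg]. Qed.

Lemma continuous_sum (I : Type) (s : seq I) (f : I -> R -> R) :
  (forall i, continuous (f i)) -> continuous (fun x => \sum_(i <- s) f i x).
Proof.
move=> cf; elim: s => [|i s IH].
  rewrite (_ : (fun _ => _) = (fun=> 0)) ?funeqE => [|t]; last by rewrite big_nil.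
  exact: continuous_cst.
rewrite (_ : (fun _ => _) = (fun t => f i t + \sum_(i <- s) f i t)).
  exact: continuous_add.
by rewrite funeqE => t; rewrite big_cons.
Qed.

(** Integrals are read off antiderivatives, so linearity of the integral comes from linearity of the
    derivative and continuity is the only integrability condition. *)
Lemma int2D f g : continuous f -> continuous g ->
  I2 (fun x => f x + g x) = I2 f + I2 g.
Proof.
move=> cf cg; have [U HU] := antiderivative cf; have [V HV] := antiderivative cg.
rewrite (integral_2piE HU cf) (integral_2piE HV cg).
rewrite (integral_2piE (fun x => der_add (HU x) (HV x))); last exact: continuous_add.
ring.
Qed.

Lemma int2Z c f : continuous f -> I2 (fun x => c * f x) = c * I2 f.
Proof.
move=> cf; have [U HU] := antiderivative cf.
rewrite (integral_2piE HU cf) (integral_2piE (fun x => der_scale c (HU x))).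
  ring.
by apply: continuous_mul => //; exact: continuous_cst.
Qed.

Lemma int2_cst c : I2 (fun=> c) = T2 * c.
Proof.
have d x : der (fun x => c * x) x c by apply: der_val (der_scale c (der_id x)); rewrite mulr1.
rewrite (integral_2piE d); first by ring.
exact: continuous_cst.
Qed.

Lemma int2N f : continuous f -> I2 (fun x => - f x) = - I2 f.
Proof.
by move=> cf; rewrite -mulN1r -int2Z//; congr I2; apply/funext => x; rewrite mulN1r.
Qed.

Lemma int2B f g : continuous f -> continuous g ->
  I2 (fun x => f x - g x) = I2 f - I2 g.
Proof.
move=> cf cg; rewrite -int2N// -int2D// => x; apply: cvgN; exact: cg.
Qed.

Lemma int2_sum (I : Type) (s : seq I) (f : I -> R -> R) :
  (forall i, continuous (f i)) ->
  I2 (fun x => \sum_(i <- s) f i x) = \sum_(i <- s) I2 (f i).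
Proof.
move=> cf; elim: s => [|i s IH].
  rewrite big_nil (_ : (fun _ => _) = (fun=> 0)) ?funeqE => [|t]; last by rewrite big_nil.
  by rewrite int2_cst mulr0.
rewrite big_cons -IH -int2D; [|exact: cf|exact: continuous_sum].
by congr I2; apply/funext => t; rewrite big_cons.
Qed.

Lemma int2_bound f M : continuous f -> (forall x, `|f x| <= M) ->
  `|I2 f| <= T2 * M.
Proof.
move=> cf HM; have [U HU] := antiderivative cf; rewrite (integral_2piE HU cf).
have := @mvt_bound _ U f 0 T2 M (ltW twopi_gt0) (fun x _ => HU x) (fun x _ => HM x).
by rewrite subr0 mulrC.
Qed.

(** For an antiderivative U the increment U(x + 2 pi) - U(x) has derivative 0 by periodicity, so its
    values at [c] and at 0 agree. *)
Lemma int2_shift f c : continuous f -> periodic f T2 ->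
  I2 (fun x => f (x + c)) = I2 f.
Proof.
move=> cf pf; have [U HU] := antiderivative cf.
have cfc : continuous (fun x => f (x + c)).
  by move=> x; apply: (continuous_comp (f := fun x => x + c)); [apply: cvgD; [exact: cvg_id|exact: cvg_cst]|exact: cf].
rewrite (integral_2piE (fun x => der_shift (HU (x + c))) cfc) (integral_2piE HU cf) add0r.
pose V x := U (x + T2) - U x.
have dV x : der V x 0.
  rewrite -[0](subrr (f x)); apply: der_sub => //.
  by rewrite -[f x]pf; exact: der_shift.
by have := der0_const dV c 0; rewrite /V add0r [c + _]addrC.
Qed.

(** The floor of x / (2 pi) may have either sign, whereas periodicity is iterated a natural number
    of times; the disjunction records on which side the shift is made. *)
Lemma periodic_repr x : exists n : nat, exists y, 0 <= y <= T2 /\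
  (x = y + T2 *+ n \/ y = x + T2 *+ n).
Proof.
pose k := Num.floor (x / T2).
have [h1 h2] : k%:~R <= x / T2 /\ x / T2 < (k + 1)%:~R.
  by split; [exact: Num.Theory.floor_le|exact: floorD1_gt].
have := twopi_gt0; move=> t0.
rewrite ler_pdivlMr // in h1; rewrite ltr_pdivrMr // in h2.
rewrite intrD mulrDl mul1r in h2.
exists `|k|%N, (x - k%:~R * T2); split; first by apply/andP; split; lra.
case: {h1 h2} k => n; [left|right].
  by rewrite -[T2 *+ _]mulr_natl subrK.
by rewrite NegzE mulrNz mulNr opprK -[T2 *+ _]mulr_natl.
Qed.

Lemma periodic_bounded f : continuous f -> periodic f T2 ->
  exists M, 0 <= M /\ forall x, `|f x| <= M.
Proof.
move=> cf pf.
have [y _ Hy] := @EVT_max R (fun x => `|f x|) 0 T2 (ltW twopi_gt0)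
  (continuous_subspaceT (fun x => cvg_norm (cf x))).
exists `|f y|; split=> // x.
have [n [z [zI [->|zE]]]] := periodic_repr x.
  by rewrite periodicn//; apply: Hy; rewrite in_itv.
by rewrite -(periodicn pf n) -zE; apply: Hy; rewrite in_itv.
Qed.

Lemma der_cos_mul c x : der (fun t => cos (c * t)) x (- c * sin (c * x)).
Proof.
have e : - sin (c * x) * (c * 1) = - c * sin (c * x) by ring.
exact: (der_val e (@der_comp _ cos _ x _ _ (is_derive_cos _) (der_scale c (der_id x)))).
Qed.

Lemma der_sin_mul c x : der (fun t => sin (c * t)) x (c * cos (c * x)).
Proof.
have e : cos (c * x) * (c * 1) = c * cos (c * x) by ring.
exact: (der_val e (@der_comp _ sin _ x _ _ (is_derive_sin _) (der_scale c (der_id x)))).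
Qed.

Lemma continuous_cos_mul c : continuous (fun t => cos (c * t)).
Proof. by move=> x; exact: der_continuous (der_cos_mul c x). Qed.

Lemma continuous_sin_mul c : continuous (fun t => sin (c * t)).
Proof. by move=> x; exact: der_continuous (der_sin_mul c x). Qed.

Lemma int2_cos c : c != 0 -> sin (c * T2) = 0 -> I2 (fun x => cos (c * x)) = 0.
Proof.
move=> c0 s0; have d x : der (fun x => c^-1 * sin (c * x)) x (cos (c * x)).
  by apply: der_val (der_scale c^-1 (der_sin_mul c x)); rewrite mulrA mulVf// mul1r.
rewrite (integral_2piE d); last exact: continuous_cos_mul.
by rewrite s0 [c * 0]mulr0 sin0 subrr.
Qed.

Lemma int2_sin c : c != 0 -> cos (c * T2) = 1 -> I2 (fun x => sin (c * x)) = 0.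
Proof.
move=> c0 s0; have d x : der (fun x => - c^-1 * cos (c * x)) x (sin (c * x)).
  by apply: der_val (der_scale (- c^-1) (der_cos_mul c x)); rewrite mulrA mulrNN mulVf// mul1r.
rewrite (integral_2piE d); last exact: continuous_sin_mul.
by rewrite s0 [c * 0]mulr0 cos0 subrr.
Qed.

Lemma sin_nat_twopi (k : nat) : sin (k%:R * T2) = 0.
Proof. by rewrite mulr_natl -[_ *+ k]add0r (periodicn (@sinD2pi R)) sin0. Qed.

Lemma cos_nat_twopi (k : nat) : cos (k%:R * T2) = 1.
Proof. by rewrite mulr_natl -[_ *+ k]add0r (periodicn (@cosD2pi R)) cos0. Qed.

Lemma sin_natB_twopi (k l : nat) : sin ((k%:R - l%:R) * T2) = 0.
Proof. by rewrite mulrBl sinB !sin_nat_twopi !mul0r mulr0 subrr. Qed.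

Lemma cos_natB_twopi (k l : nat) : cos ((k%:R - l%:R) * T2) = 1.
Proof. by rewrite mulrBl cosB !sin_nat_twopi !cos_nat_twopi; ring. Qed.

Lemma natB_neq0 (k l : nat) : k != l -> (k%:R - l%:R : R) != 0.
Proof. by move=> kl; rewrite subr_eq0 eqr_nat. Qed.

Lemma int2_cos_natB (k l : nat) :
  I2 (fun x => cos ((k%:R - l%:R) * x)) = (k == l)%:R * T2.
Proof.
have [->|kl] := eqVneq k l; last first.
  by rewrite mul0r int2_cos ?natB_neq0// sin_natB_twopi.
rewrite (_ : (fun _ => _) = (fun=> 1)) ?int2_cst ?mulr1 ?mul1r//.
by apply/funext => x; rewrite subrr mul0r cos0.
Qed.

Lemma int2_sin_natB (k l : nat) : I2 (fun x => sin ((k%:R - l%:R) * x)) = 0.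
Proof.
have [->|kl] := eqVneq k l; last by rewrite int2_sin ?natB_neq0// cos_natB_twopi.
rewrite (_ : (fun _ => _) = (fun=> 0)) ?int2_cst ?mulr0//.
by apply/funext => x; rewrite subrr mul0r sin0.
Qed.

Lemma int2_cos_natD (k l : nat) :
  I2 (fun x => cos ((k%:R + l%:R) * x)) = (k + l == 0)%:R * T2.
Proof.
rewrite -(int2_cos_natB (k + l) 0); congr I2; apply/funext => x.
by rewrite natrD subr0.
Qed.

Lemma int2_sin_natD (k l : nat) : I2 (fun x => sin ((k%:R + l%:R) * x)) = 0.
Proof.
rewrite -[RHS](int2_sin_natB (k + l) 0); congr I2; apply/funext => x.
by rewrite natrD subr0.
Qed.

(** The indicator of [k + l == 0] supplies the second [pi] when both indices vanish and the
    integrand is 1. *)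
Lemma int2_cos_cos (k l : nat) :
  I2 (fun x => cos (k%:R * x) * cos (l%:R * x)) =
  ((k == l)%:R + (k + l == 0)%:R) * pi.
Proof.
transitivity (I2 (fun x => 2^-1 * (cos ((k%:R - l%:R) * x) + cos ((k%:R + l%:R) * x)))).
  by congr I2; apply/funext => x; rewrite mulrBl mulrDl cosB cosD; field.
rewrite int2Z ?int2D ?int2_cos_natB ?int2_cos_natD; last 3 first.
- exact: continuous_cos_mul.
- exact: continuous_cos_mul.
- by apply: continuous_add; exact: continuous_cos_mul.
by field.
Qed.

Lemma int2_sin_sin (k l : nat) :
  I2 (fun x => sin (k%:R * x) * sin (l%:R * x)) =
  ((k == l)%:R - (k + l == 0)%:R) * pi.
Proof.
transitivity (I2 (fun x => 2^-1 * (cos ((k%:R - l%:R) * x) - cos ((k%:R + l%:R) * x)))).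
  by congr I2; apply/funext => x; rewrite mulrBl mulrDl cosB cosD; field.
rewrite int2Z ?int2B ?int2_cos_natB ?int2_cos_natD; last 3 first.
- exact: continuous_cos_mul.
- exact: continuous_cos_mul.
- by apply: continuous_sub; exact: continuous_cos_mul.
by field.
Qed.

Lemma int2_sin_cos (k l : nat) :
  I2 (fun x => sin (k%:R * x) * cos (l%:R * x)) = 0.
Proof.
transitivity (I2 (fun x => 2^-1 * (sin ((k%:R - l%:R) * x) + sin ((k%:R + l%:R) * x)))).
  by congr I2; apply/funext => x; rewrite mulrBl mulrDl sinB sinD; field.
rewrite int2Z ?int2D ?int2_sin_natB ?int2_sin_natD; last 3 first.
- exact: continuous_sin_mul.
- exact: continuous_sin_mul.
- by apply: continuous_add; exact: continuous_sin_mul.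
by rewrite addr0 mulr0.
Qed.

Lemma int2_cos_sin (k l : nat) :
  I2 (fun x => cos (k%:R * x) * sin (l%:R * x)) = 0.
Proof.
by rewrite -(int2_sin_cos l k); congr I2; apply/funext => x; rewrite mulrC.
Qed.

End Integral2pi.

(** * Periodic solutions of non-resonant linear systems *)

Section ComplexCalculus.
Context {R : realType}.
Local Notation C := R[i].
Local Notation re := (@complex.Re R).
Local Notation im := (@complex.Im R).
Local Notation T2 := ((pi : R) *+ 2).
Implicit Types (u w : R -> C) (z mu : C) (s t : R).

Lemma reD z1 z2 : re (z1 + z2) = re z1 + re z2. Proof. by case: z1; case: z2. Qed.
Lemma imD z1 z2 : im (z1 + z2) = im z1 + im z2. Proof. by case: z1; case: z2. Qed.
Lemma reN z : re (- z) = - re z. Proof. by case: z. Qed.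
Lemma imN z : im (- z) = - im z. Proof. by case: z. Qed.
Lemma reM z1 z2 : re (z1 * z2) = re z1 * re z2 - im z1 * im z2.
Proof. by case: z1; case: z2. Qed.
Lemma imM z1 z2 : im (z1 * z2) = re z1 * im z2 + im z1 * re z2.
Proof. by case: z1; case: z2. Qed.

Lemma complex_eq z1 z2 : re z1 = re z2 -> im z1 = im z2 -> z1 = z2.
Proof. by case: z1 => a b; case: z2 => c d /= -> ->. Qed.

(** The l1 norm is submultiplicative and dominates both parts, so complex bounds split into real
    ones without square roots. *)
Definition cnorm z : R := `|re z| + `|im z|.

Lemma cnorm_ge0 z : 0 <= cnorm z. Proof. by rewrite addr_ge0. Qed.

Lemma cnorm0 : cnorm 0 = 0. Proof. by rewrite /cnorm /= !normr0 addr0. Qed.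

Lemma cnormD z1 z2 : cnorm (z1 + z2) <= cnorm z1 + cnorm z2.
Proof.
rewrite /cnorm reD imD; have := ler_normD (re z1) (re z2).
by have := ler_normD (im z1) (im z2); lra.
Qed.

Lemma cnormM z1 z2 : cnorm (z1 * z2) <= cnorm z1 * cnorm z2.
Proof.
rewrite /cnorm reM imM mulrDl !mulrDr -!normrM.
have := ler_normB (re z1 * re z2) (im z1 * im z2).
by have := ler_normD (re z1 * im z2) (im z1 * re z2); lra.
Qed.

Lemma cnorm_sum (I : Type) (s : seq I) (F : I -> C) :
  cnorm (\sum_(i <- s) F i) <= \sum_(i <- s) cnorm (F i).
Proof.
elim/big_ind2: _ => [|x1 x2 y1 y2 h1 h2|//]; first by rewrite cnorm0.
by apply: le_trans (cnormD _ _) _; exact: lerD.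
Qed.

Definition cder u t z := is_derive t 1 (fun x => re (u x)) (re z) /\
  is_derive t 1 (fun x => im (u x)) (im z).

Definition ccont u := continuous (fun x => re (u x)) /\
  continuous (fun x => im (u x)).

Lemma cder_ccont u (du : R -> C) : (forall t, cder u t (du t)) -> ccont u.
Proof. by move=> H; split=> t; have [h1 h2] := H t; [exact: der_continuous h1|exact: der_continuous h2]. Qed.

Lemma cder_val u t z1 z2 : z1 = z2 -> cder u t z1 -> cder u t z2.
Proof. by move=> ->. Qed.

Lemma cder_cst z t : cder (fun=> z) t 0.
Proof. by split; exact: der_cst. Qed.

Lemma cder_add u w t z1 z2 : cder u t z1 -> cder w t z2 ->
  cder (fun x => u x + w x) t (z1 + z2).
Proof.
move=> [a b] [c d]; split; rewrite ?reD ?imD.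
  by apply: der_ext (der_add a c) => x; rewrite reD.
by apply: der_ext (der_add b d) => x; rewrite imD.
Qed.

Lemma cder_opp u t z : cder u t z -> cder (fun x => - u x) t (- z).
Proof.
move=> [a b]; split; rewrite ?reN ?imN.
  by apply: der_ext (der_opp a) => x; rewrite reN.
by apply: der_ext (der_opp b) => x; rewrite imN.
Qed.

Lemma cder_sub u w t z1 z2 : cder u t z1 -> cder w t z2 ->
  cder (fun x => u x - w x) t (z1 - z2).
Proof. by move=> h1 /cder_opp; exact: cder_add. Qed.

Lemma cder_mul u w t z1 z2 : cder u t z1 -> cder w t z2 ->
  cder (fun x => u x * w x) t (z1 * w t + u t * z2).
Proof.
move=> [a b] [c d]; split.
  apply: der_ext (fun x => esym (reM _ _)) _.
  by apply: der_val (der_sub (der_mul a c) (der_mul b d)); rewrite reD !reM; ring.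
apply: der_ext (fun x => esym (imM _ _)) _.
by apply: der_val (der_add (der_mul a d) (der_mul b c)); rewrite imD !imM; ring.
Qed.

Lemma cder_scale z u t z1 : cder u t z1 -> cder (fun x => z * u x) t (z * z1).
Proof. by move=> h; apply: cder_val (cder_mul (cder_cst z t) h); rewrite mul0r add0r. Qed.

Lemma cder_shift u t c z : cder u (t + c) z -> cder (fun x => u (x + c)) t z.
Proof. by move=> [a b]; split; [exact: (der_shift a)|exact: (der_shift b)]. Qed.

Lemma cder0_const u : (forall t, cder u t 0) -> forall s t, u s = u t.
Proof.
move=> H s t; apply: complex_eq.
  by apply: (@der0_const _ (fun x => re (u x))) => x; case: (H x).
by apply: (@der0_const _ (fun x => im (u x))) => x; case: (H x).
Qed.

Lemma cantiderivative u : ccont u -> exists w, forall t, cder w t (u t).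
Proof.
by move=> [/antiderivative[a Ha] /antiderivative[b Hb]]; exists (fun t => Complex (a t) (b t)) => t; split; [exact: Ha|exact: Hb].
Qed.

Lemma ccont_mul u w : ccont u -> ccont w -> ccont (fun x => u x * w x).
Proof.
move=> [a b] [c d]; split.
  rewrite (_ : (fun _ => _) = (fun x => re (u x) * re (w x) - im (u x) * im (w x))).
    by apply: continuous_sub; exact: continuous_mul.
  by apply/funext => x; rewrite reM.
rewrite (_ : (fun _ => _) = (fun x => re (u x) * im (w x) + im (u x) * re (w x))).
  by apply: continuous_add; exact: continuous_mul.
by apply/funext => x; rewrite imM.
Qed.

(** The mean value theorem is applied to the real and the imaginary part separately; each increment
    is at most M (b - a), whence the factor 2. *)
Lemma cmvt_bound u (du : R -> C) a b M : a <= b ->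
  (forall t, a <= t <= b -> cder u t (du t)) ->
  (forall t, a <= t <= b -> cnorm (du t) <= M) ->
  cnorm (u b - u a) <= 2 * M * (b - a).
Proof.
move=> ab Hu HM; rewrite /cnorm reD imD reN imN.
have h1 := @mvt_bound _ (fun x => re (u x)) (fun x => re (du x)) a b M ab
  (fun t tab => (Hu t tab).1).
have h2 := @mvt_bound _ (fun x => im (u x)) (fun x => im (du x)) a b M ab
  (fun t tab => (Hu t tab).2).
have -> : 2 * M * (b - a) = M * (b - a) + M * (b - a) by ring.
apply: lerD; [apply: h1|apply: h2] => t /HM; apply: le_trans;
  by rewrite /cnorm ?lerDl ?lerDr.
Qed.

Definition cexp mu t : C :=
  Complex (expR (re mu * t) * cos (im mu * t)) (expR (re mu * t) * sin (im mu * t)).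

Lemma cexp0 mu : cexp mu 0 = 1.
Proof. by rewrite /cexp !mulr0 expR0 cos0 sin0 mulr1 mulr0. Qed.

Lemma cexpD mu s t : cexp mu (s + t) = cexp mu s * cexp mu t.
Proof.
apply: complex_eq; rewrite ?reM ?imM /= !mulrDr expRD ?cosD ?sinD; ring.
Qed.

Lemma cexpN mu t : cexp (- mu) t * cexp mu t = 1.
Proof.
rewrite (_ : cexp (- mu) t = cexp mu (- t)); first by rewrite -cexpD addNr cexp0.
by rewrite /cexp reN imN !mulNr !mulrN.
Qed.

Lemma cder_cexp mu t : cder (cexp mu) t (mu * cexp mu t).
Proof.
have e : der (fun x => expR (re mu * x)) t (re mu * expR (re mu * t)).
  have e0 : expR (re mu * t) * (re mu * 1) = re mu * expR (re mu * t) by ring.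
  exact: (der_val e0 (@der_comp _ (@expR R) _ t _ _ (is_derive_expR _) (der_scale (re mu) (der_id t)))).
split.
  apply: der_val (der_mul e (der_cos_mul (im mu) t)); rewrite reM /=; ring.
apply: der_val (der_mul e (der_sin_mul (im mu) t)); rewrite imM /=; ring.
Qed.

Lemma cnorm_cexp_le mu t : 0 <= t <= T2 -> cnorm (cexp mu t) <= 2 * expR (`|re mu| * T2).
Proof.
move=> /andP[t0 tT]; rewrite /cnorm /= !normrM (ger0_norm (expR_ge0 _)) mulr_natl mulr2n.
have h : expR (re mu * t) <= expR (`|re mu| * T2).
  rewrite ler_expR; apply: le_trans (_ : `|re mu| * t <= _).
    by apply: ler_wpM2r => //; exact: ler_norm.
  exact: ler_wpM2l.
by apply: lerD; rewrite -[leRHS]mulr1; apply: ler_pM; rewrite ?expR_ge0 ?cos_max ?sin_max.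
Qed.

Lemma cexpT_opp mu : cexp mu T2 != 1 -> cexp (- mu) T2 - 1 != 0.
Proof.
apply: contra_neq => /eqP; rewrite subr_eq0 => /eqP h.
by have := cexpN mu T2; rewrite h mul1r.
Qed.

(** Variation of constants over one full period: with U' = exp(-mu t) u, the function exp(mu t) (U(t
    + T) - U(t)) solves the equation with u multiplied by exp(-mu T) - 1. Non-resonance makes this
    number invertible, and [k] is its inverse. *)
Lemma scalar_periodic_solution mu u : cexp mu T2 != 1 -> ccont u -> periodic u T2 ->
  exists a, periodic a T2 /\ forall t, cder a t (mu * a t + u t).
Proof.
move=> nr cu pu; pose k := (cexp (- mu) T2 - 1)^-1.
have k1 : k * (cexp (- mu) T2 - 1) = 1 by rewrite mulVf// cexpT_opp.
have [U HU] : exists U, forall t, cder U t (cexp (- mu) t * u t).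
  by apply/cantiderivative/ccont_mul => //; exact: cder_ccont (cder_cexp _).
pose c := U T2 - cexp (- mu) T2 * U 0.
(* U is periodic up to a multiplier and a constant, since its derivative is multiplied by exp(-mu T)
   under the shift; this yields the periodicity of the solution. *)
have HUT t : U (t + T2) = cexp (- mu) T2 * U t + c.
  suff <- : U (t + T2) - cexp (- mu) T2 * U t = c by rewrite [RHS]addrC subrK.
  have := @cder0_const (fun t => U (t + T2) - cexp (- mu) T2 * U t) _ t 0.
  rewrite add0r; apply => x.
  apply: cder_val (cder_sub (cder_shift (HU (x + T2))) (cder_scale (cexp (- mu) T2) (HU x))).
  by rewrite pu cexpD; ring.
exists (fun t => k * (cexp mu t * (U (t + T2) - U t))); split=> t.
  have e : cexp mu T2 * cexp (- mu) T2 = 1 by rewrite mulrC cexpN.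
  rewrite [U (t + T2 + T2)]HUT cexpD [in LHS](HUT t) [in RHS](HUT t).
  transitivity (k * (cexp mu t * ((cexp mu T2 * cexp (- mu) T2) * (cexp (- mu) T2 * U t + c - U t)))); last by rewrite e mul1r.
  by ring.
apply: cder_val (cder_scale k (cder_mul (cder_cexp mu t) (cder_sub (cder_shift (HU (t + T2))) (HU t)))).
rewrite pu cexpD.
have e : cexp (- mu) t * cexp mu t = 1 by rewrite cexpN.
transitivity (mu * (k * (cexp mu t * (U (t + T2) - U t))) +
  (cexp (- mu) t * cexp mu t) * (k * (cexp (- mu) T2 - 1)) * u t); first by ring.
by rewrite e k1 !mul1r.
Qed.

(** The same formula read backwards: the increment of exp(-mu (s - t)) a(s) over one period is
    (exp(-mu T) - 1) a(t), and its derivative only contains [u]. The constant depends on [mu] alone,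
    and uniqueness of the periodic solution is the case M = 0. *)
Lemma scalar_periodic_bound mu : cexp mu T2 != 1 ->
  exists2 K, 0 <= K & forall (a u : R -> C) M, periodic a T2 ->
    (forall t, cder a t (mu * a t + u t)) -> (forall t, cnorm (u t) <= M) ->
    forall t, cnorm (a t) <= K * M.
Proof.
move=> nr; pose k := (cexp (- mu) T2 - 1)^-1.
have k1 : k * (cexp (- mu) T2 - 1) = 1 by rewrite mulVf// cexpT_opp.
have T0 : 0 <= T2 by exact/ltW/twopi_gt0.
pose B := 2 * expR (`|re (- mu)| * T2).
have B0 : 0 <= B by rewrite mulr_ge0 ?expR_ge0.
exists (cnorm k * (2 * B * T2)); first by rewrite !mulr_ge0 ?cnorm_ge0.
move=> a u M pa Ha HM t.
(* Centring the exponential at [t] keeps its argument in [0, 2 pi], so the bound does not depend on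
   [t]. *)
pose b s := cexp (- mu) (s - t) * a s.
have bE : a t = k * (b (t + T2) - b t).
  rewrite /b pa subrr cexp0 mul1r addrAC subrr add0r.
  by rewrite -[LHS]mul1r -k1; ring.
have db s : cder b s (cexp (- mu) (s - t) * u s).
  apply: cder_val (cder_mul (cder_shift (cder_cexp (- mu) (s - t))) (Ha s)); ring.
have M0 : 0 <= M by apply: le_trans (HM 0); exact: cnorm_ge0.
rewrite bE; apply: le_trans (cnormM _ _) _; rewrite -[leRHS]mulrA; apply: ler_wpM2l; first exact: cnorm_ge0.
apply: le_trans (@cmvt_bound b _ t (t + T2) (B * M) _ (fun s _ => db s) _) _.
- by rewrite lerDl.
- move=> s /andP[s1 s2]; apply: le_trans (cnormM _ _) _; apply: ler_pM; rewrite ?cnorm_ge0//.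
  by apply: cnorm_cexp_le; rewrite subr_ge0 s1 lerBlDl.
- by rewrite addrAC subrr add0r le_eqVlt; apply/orP; left; apply/eqP; ring.
Qed.

End ComplexCalculus.

(** * Linear vector systems reduced to scalar equations *)

Section ComplexVectorODE.
Context {R : realType}.
Local Notation C := R[i].
Local Notation T2 := ((pi : R) *+ 2).

Lemma cder_sum (I : Type) (s : seq I) (u : I -> R -> C) (d : I -> C) t :
  (forall i, cder (u i) t (d i)) ->
  cder (fun x => \sum_(i <- s) u i x) t (\sum_(i <- s) d i).
Proof.
move=> H; elim: s => [|i s IH].
  rewrite big_nil (_ : (fun _ => _) = (fun=> 0)); last by apply/funext => x; rewrite big_nil.
  exact: cder_cst.
rewrite big_cons (_ : (fun _ => _) = (fun x => u i x + \sum_(i <- s) u i x)).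
  exact: cder_add.
by apply/funext => x; rewrite big_cons.
Qed.

Section Dim.
Context {n : nat}.
Implicit Types (x y f h : R -> 'cV[C]_n) (A : 'M[C]_n).

Definition vder x t (d : 'cV[C]_n) := forall i, cder (fun s => x s i 0) t (d i 0).
Definition vcont x := forall i, ccont (fun s => x s i 0).
Definition vbound f (M : R) := forall t i, cnorm (f t i 0) <= M.

Lemma vder_val x t d1 d2 : d1 = d2 -> vder x t d1 -> vder x t d2.
Proof. by move=> ->. Qed.

Lemma vder_add x y t d1 d2 : vder x t d1 -> vder y t d2 ->
  vder (fun s => x s + y s) t (d1 + d2).
Proof.
move=> h1 h2 i; rewrite mxE (_ : (fun _ => _) = (fun s => x s i 0 + y s i 0)).
  exact: cder_add.
by apply/funext => s; rewrite mxE.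
Qed.

Lemma vder_mulmx A x t d : vder x t d -> vder (fun s => A *m x s) t (A *m d).
Proof.
move=> hx i; rewrite mxE (_ : (fun _ => _) = (fun s => \sum_j A i j * x s j 0)).
  by apply: cder_sum => j; apply: cder_scale.
by apply/funext => s; rewrite mxE.
Qed.

Lemma vder_vcont x (d : R -> 'cV[C]_n) : (forall t, vder x t (d t)) -> vcont x.
Proof. by move=> H i; apply: (@cder_ccont _ _ (fun t => d t i 0)) => t; exact: H. Qed.

Definition mxsum A : R := \sum_i \sum_j cnorm (A i j).

Lemma mxsum_ge0 A : 0 <= mxsum A.
Proof. by apply: sumr_ge0 => i _; apply: sumr_ge0 => j _; exact: cnorm_ge0. Qed.

Lemma vbound_mulmx A f M : 0 <= M -> vbound f M -> vbound (fun t => A *m f t) (mxsum A * M).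
Proof.
move=> M0 Hf t i; rewrite mxE; apply: le_trans (cnorm_sum _ _) _.
rewrite /mxsum [X in _ <= X * _](bigD1 i)//= mulrDl mulr_suml -[leLHS]addr0; apply: lerD.
  apply: ler_sum => j _; apply: le_trans (cnormM _ _) _.
  by apply: ler_wpM2l; [exact: cnorm_ge0|exact: Hf].
rewrite mulr_ge0//; apply: sumr_ge0 => k _; apply: sumr_ge0 => j _; exact: cnorm_ge0.
Qed.

Definition prod_shift A (l : seq C) : 'M[C]_n :=
  foldr (fun mu B => (A - mu%:M) *m B) 1%:M l.

Lemma shift_comm A mu : A *m (A - mu%:M) = (A - mu%:M) *m A.
Proof. by rewrite mulmxBl mulmxBr mul_scalar_mx mul_mx_scalar. Qed.

Lemma shift_shift_comm A mu nu :
  (A - nu%:M) *m (A - mu%:M) = (A - mu%:M) *m (A - nu%:M).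
Proof.
rewrite [LHS]mulmxBl [RHS]mulmxBr shift_comm; congr (_ - _).
by rewrite mul_scalar_mx mul_mx_scalar.
Qed.

Lemma prod_shift_comm A mu l :
  (A - mu%:M) *m prod_shift A l = prod_shift A l *m (A - mu%:M).
Proof.
elim: l => [|nu l IH] /=; first by rewrite mulmx1 mul1mx.
by rewrite mulmxA shift_shift_comm -mulmxA IH mulmxA.
Qed.

Lemma vector_scalar_solution (mu : C) f : cexp mu T2 != 1 -> vcont f -> periodic f T2 ->
  exists x, periodic x T2 /\ forall t, vder x t (mu *: x t + f t).
Proof.
move=> nr cf pf.
have /choice[a Ha] : forall i : 'I_n, exists a, periodic a T2 /\ forall t, cder a t (mu * a t + f t i 0).
  by move=> i; apply: scalar_periodic_solution => // t; rewrite pf.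
exists (fun t => \col_i a i t); split=> t.
  by apply/colP => i; rewrite !mxE (Ha i).1.
move=> i; rewrite (_ : (fun _ => _) = a i); first by rewrite !mxE; exact: (Ha i).2.
by apply/funext => s; rewrite mxE.
Qed.

(** If s' = mu s + f, then x = s + (A - mu) y solves x' = A x + f as soon as y' = A y + s. The
    induction solves this last system up to a defect, and one more factor A - mu then multiplies the
    defect. *)
Lemma near_solution A l f : (forall mu, mu \in l -> cexp mu T2 != 1) ->
  vcont f -> periodic f T2 ->
  exists x h, periodic x T2 /\
    forall t, vder x t (A *m x t + f t - prod_shift A l *m h t).
Proof.
elim: l f => [|mu l IH] f nr cf pf.
  exists (fun=> 0), f; split=> // t; apply: (@vder_val _ _ 0).
    by rewrite /= mulmx0 mul1mx add0r subrr.
  by move=> i; rewrite mxE; exact: cder_cst.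
have [s [ps sin_H]] := vector_scalar_solution (nr mu (mem_head _ _)) cf pf.
have nrl nu : nu \in l -> cexp nu T2 != 1 by move=> nul; apply: nr; rewrite inE nul orbT.
have [y [h [py Hy]]] := IH s nrl (vder_vcont sin_H) ps.
exists (fun t => s t + (A - mu%:M) *m y t), h; split=> t; first by rewrite ps py.
apply: vder_val (vder_add (sin_H t) (vder_mulmx (A - mu%:M) (Hy t))).
rewrite /= -/(prod_shift A l) !mulmxDr mulmxN !mulmxA shift_comm.
rewrite (_ : A *m s t = (A - mu%:M) *m s t + mu *: s t); last first.
  by rewrite mulmxBl mul_scalar_mx subrK.
set a := mu *: s t; set b := f t; set c := _ *m y t; set d := _ *m s t; set e := _ *m h t.
by move: a b c d e => a b c d e; apply/colP => i; rewrite !mxE; ring.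
Qed.

Lemma periodic_mulmx A x : periodic x T2 -> periodic (fun t => A *m x t) T2.
Proof. by move=> px t; rewrite px. Qed.

(** Here y = (A - mu) x satisfies the same system with forcing (A - mu) f and one factor less, while
    x solves the scalar equations x' = mu x + (y + f). The bound assumed on the full product applied
    to [x] is the base of this induction. *)
Lemma vector_bound A l : (forall mu, mu \in l -> cexp mu T2 != 1) ->
  exists2 K, 0 <= K & forall x f B, periodic x T2 ->
    (forall t, vder x t (A *m x t + f t)) -> 0 <= B -> vbound f B ->
    vbound (fun t => prod_shift A l *m x t) B -> vbound x (K * B).
Proof.
elim: l => [|mu l IH] nr.
  exists 1 => // x f B _ _ _ _ + t i => /(_ t i).
  by rewrite /= mul1mx mul1r.
have [|K K0 HK] := IH; first by move=> nu nul; apply: nr; rewrite inE nul orbT.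
have [k k0 Hk] := scalar_periodic_bound (nr mu (mem_head _ _)).
pose S := mxsum (A - mu%:M); have S0 : 0 <= S := mxsum_ge0 _.
exists (k * (K * (S + 1) + 1)); first by rewrite mulr_ge0 ?addr_ge0 ?mulr_ge0 ?addr_ge0.
move=> x f B px Hx B0 Hf Hp.
pose y t := (A - mu%:M) *m x t.
have Hy : vbound y (K * ((S + 1) * B)).
  apply: (HK y (fun t => (A - mu%:M) *m f t)).
  - exact: periodic_mulmx.
  - move=> t; apply: vder_val (vder_mulmx (A - mu%:M) (Hx t)).
    by rewrite mulmxDr !mulmxA shift_comm.
  - by rewrite mulr_ge0 ?addr_ge0.
  - move=> t i; apply: le_trans (vbound_mulmx _ B0 Hf t i) _.
    by rewrite ler_wpM2r // lerDl.
  - move=> t i; rewrite /y mulmxA -prod_shift_comm; apply: le_trans (Hp t i) _.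
    by rewrite -[leLHS]mul1r ler_wpM2r // lerDr.
move=> t i; rewrite -[leRHS]mulrA.
apply: (Hk (fun s => x s i 0) (fun s => y s i 0 + f s i 0)).
- by move=> s; rewrite px.
- move=> s; apply: cder_val (Hx s i).
  rewrite /y mulmxBl mul_scalar_mx; move: (A *m x s) => z; rewrite !mxE; ring.
- move=> s; apply: le_trans (cnormD _ _) _; rewrite mulrDl mul1r -mulrA.
  by apply: lerD; [exact: Hy|exact: Hf].
Qed.

End Dim.

Section Nonresonant.
Context {n : nat}.
Implicit Types A : 'M[C]_n.+1.

Definition nonresonant A := forall mu, eigenvalue A mu -> cexp mu T2 != 1.

(* Cayley-Hamilton: peeling the factors A - mu off the vanishing product one at a
   time reduces a linear system to scalar equations. *)
Lemma prod_shift_eigen0 A : exists2 l : seq C,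
  (forall mu, mu \in l -> eigenvalue A mu) & prod_shift A l = 0.
Proof.
have [l lE] := closed_field_poly_normal (char_poly A).
rewrite (monicP (char_poly_monic A)) scale1r in lE.
exists l => [mu mul|]; first by rewrite eigenvalue_root_char lE root_prod_XsubC.
rewrite -(Cayley_Hamilton A) lE rmorph_prod /=.
elim: {lE} l => [|mu l IH]; first by rewrite big_nil.
rewrite big_cons /= -/(prod_shift A l) IH rmorphB /= horner_mx_X horner_mx_C.
by [].
Qed.

Theorem nonresonant_solution A (f : R -> 'cV[C]_n.+1) :
  nonresonant A -> vcont f -> periodic f T2 ->
  exists x, periodic x T2 /\ forall t, vder x t (A *m x t + f t).
Proof.
move=> nr cf pf; have [l lA l0] := prod_shift_eigen0 A.
have [x [h [px Hx]]] := @near_solution _ A l f (fun mu ml => nr mu (lA mu ml)) cf pf.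
exists x; split=> // t; apply: vder_val (Hx t).
by rewrite l0 mul0mx subr0.
Qed.

Theorem nonresonant_bound A : nonresonant A ->
  exists2 K, 0 <= K & forall x f B, periodic x T2 ->
    (forall t, vder x t (A *m x t + f t)) -> vbound f B -> vbound x (K * B).
Proof.
move=> nr; have [l lA l0] := prod_shift_eigen0 A.
have [K K0 HK] := @vector_bound _ A l (fun mu ml => nr mu (lA mu ml)).
exists K => // x f B px Hx Hf.
have B0 : 0 <= B by apply: le_trans (Hf 0 0); exact: cnorm_ge0.
apply: (HK x f B) => // t i; rewrite l0 mul0mx mxE cnorm0; exact: B0.
Qed.

End Nonresonant.
End ComplexVectorODE.

(** * The linear system of one Fourier mode *)

Section ModeSystem.
Context {R : realType} {m : nat}.
Local Notation C := R[i].
Local Notation n := (2 + m)%N.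
Local Notation T2 := ((pi : R) *+ 2).
Local Notation rC := (real_complex R).
Local Notation iC := ('i%C : C).
Local Notation e1 := (@e1 R m).
Local Notation e2 := (@e2 R m).
Implicit Types (a b f g : 'cV[R]_n) (k : nat).

Definition j1 : 'I_n := lshift m 0.
Definition j2 : 'I_n := lshift m 1.

Lemma e1E i : e1 i 0 = (i == j1)%:R.
Proof. by rewrite mxE eqxx andbT. Qed.

Lemma e2E i : e2 i 0 = (i == j2)%:R.
Proof. by rewrite mxE eqxx andbT. Qed.

Lemma block_mul_u (K : comNzRingType) (A : 'M[K]_2) (D : 'M[K]_m) (v : 'cV[K]_n) (i : 'I_2) :
  (block_mx A 0 0 D *m v) (lshift m i) 0 = A i 0 * v j1 0 + A i 1 * v j2 0.
Proof.
rewrite -[v in LHS]vsubmxK mul_block_col mul0mx addr0 col_mxEu mxE !big_ord_recl big_ord0 addr0.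
have -> : lift ord0 ord0 = 1 :> 'I_2 by apply: val_inj.
by rewrite !mxE.
Qed.

Lemma block_mul_d (K : comNzRingType) (A : 'M[K]_2) (D : 'M[K]_m) (v : 'cV[K]_n) (i : 'I_m) :
  (block_mx A 0 0 D *m v) (rshift 2 i) 0 = (D *m dsubmx v) i 0.
Proof. by rewrite -[v in LHS]vsubmxK mul_block_col !mul0mx add0r col_mxEd. Qed.

Lemma exponent_mul_1 (x y : R) Et a :
  (exponent_mx x y Et *m a) j1 0 = x * a j1 0 - y * a j2 0.
Proof. by rewrite block_mul_u !mxE /= mulNr. Qed.

Lemma exponent_mul_2 (x y : R) Et a :
  (exponent_mx x y Et *m a) j2 0 = y * a j1 0 + x * a j2 0.
Proof. by rewrite block_mul_u !mxE /=. Qed.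

Lemma ord2P (j : 'I_2) : j = 0 \/ j = 1.
Proof. by case: j => [[|[|//]] ?]; [left|right]; apply: val_inj. Qed.

Lemma ord_splitP (i : 'I_n) : [\/ i = j1, i = j2 | exists l, i = rshift 2 l].
Proof.
rewrite -(splitK i); case: fintype.split => j /=; last by apply: Or33; exists j.
by case: (ord2P j) => ->; [apply: Or31|apply: Or32].
Qed.

Lemma colP_split (K : Type) (u v : 'cV[K]_n) : u j1 0 = v j1 0 -> u j2 0 = v j2 0 ->
  (forall i : 'I_m, u (rshift 2 i) 0 = v (rshift 2 i) 0) -> u = v.
Proof. by move=> h1 h2 h3; apply/colP => i; case: (ord_splitP i) => [->|->|[l ->]]. Qed.

Variables (oms : R) (Ets : 'M[R]_m).
Local Notation Es := (exponent_mx 0 oms Ets).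

(* p1 + 'i p2 is the coordinate of a - 'i b on the eigenvector (1, -'i, 0) of Es. *)
Definition p1 a b : R := a j1 0 + b j2 0.
Definition p2 a b : R := a j2 0 - b j1 0.

(** Without the last term, [La] and [Lb] are the cosine and sine coefficients of Es z - oms dz/dphi
    for z = a cos k phi + b sin k phi. The last term moves the critical eigenvalue and is switched
    on by [dl]. *)
Definition La (dl : R) k a b : 'cV[R]_n :=
  Es *m a - (k%:R * oms) *: b - (dl / 2) *: (p1 a b *: e1 + p2 a b *: e2).
Definition Lb (dl : R) k a b : 'cV[R]_n :=
  Es *m b + (k%:R * oms) *: a - (dl / 2) *: (p1 a b *: e2 - p2 a b *: e1).

Definition rder a (t : R) (x : R -> 'cV[R]_n) := forall i, der (fun s => x s i 0) t (a i 0).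

Section Complexify.
Variables (K : fieldType) (rK : {rmorphism R -> K}) (iK : K).
Hypothesis iK2 : iK * iK = - 1.

(** The complex amplitude: a cos k phi + b sin k phi is the real part of (a - 'i b) exp('i k phi).
    In particular [evp] is the amplitude of [astar] at k = 1, and [evq] its conjugate. *)
Definition cplx a b : 'cV[K]_n := map_mx rK a - iK *: map_mx rK b.
Definition evp : 'cV[K]_n := cplx e1 e2.
Definition evq : 'cV[K]_n := cplx e1 (- e2).
(** The left eigenvector of [Es] for the eigenvalue [iK * oms]; pairing with it gives the critical
    coordinate p1 + 'i p2. *)
Definition prow : 'rV[K]_n := (map_mx rK e1)^T + iK *: (map_mx rK e2)^T.
(* At k = 1 (dl = 1) the rank-one term moves the critical eigenvalue 0 to -1. *)
Definition mode_mx (dl : R) k : 'M[K]_n :=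
  map_mx rK Es - (rK (k%:R * oms) * iK)%:M - rK (dl / 2) *: (evp *m prow).

Lemma cplxE a b i : cplx a b i 0 = rK (a i 0) - iK * rK (b i 0).
Proof. by rewrite !mxE. Qed.

Lemma cplxD a b a' b' : cplx a b + cplx a' b' = cplx (a + a') (b + b').
Proof. by apply/colP => i; rewrite !mxE !rmorphD /=; ring. Qed.

Lemma delta_row_mul (c : 'cV[K]_n) (j : 'I_n) :
  (map_mx rK (delta_mx j 0 : 'cV[R]_n))^T *m c = (c j 0)%:M.
Proof.
by rewrite map_delta_mx trmx_delta -rowE; apply/matrixP => i l; rewrite !ord1 !mxE eqxx.
Qed.

Lemma prow_mul (c : 'cV[K]_n) : prow *m c = (c j1 0 + iK * c j2 0)%:M.
Proof.
rewrite /prow mulmxDl -scalemxAl !delta_row_mul.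
by apply/matrixP => i j; rewrite !ord1 !mxE eqxx.
Qed.

Lemma prow_cplx a b : prow *m cplx a b = (rK (p1 a b) + iK * rK (p2 a b))%:M.
Proof.
rewrite prow_mul !cplxE /p1 /p2; congr (_%:M).
rewrite rmorphD rmorphB mulrBr mulrBr !mulrA iK2; ring.
Qed.

Lemma Mk_cplx dl k a b : mode_mx dl k *m cplx a b = cplx (La dl k a b) (Lb dl k a b).
Proof.
rewrite /mode_mx mulmxBl mulmxBl -scalemxAl -mulmxA prow_cplx mul_scalar_mx mul_mx_scalar.
have -> : map_mx rK Es *m cplx a b = cplx (Es *m a) (Es *m b).
  by rewrite /cplx mulmxBr -scalemxAr !map_mxM.
rewrite /La /Lb; move: (Es *m a) (Es *m b) => Ea Eb; apply/colP => i.
rewrite /evp; move: (dl / 2) (p1 a b) (p2 a b) e1 e2 (k%:R * oms) => d q1 q2 u v w.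
rewrite !mxE !(rmorphB, rmorphD, rmorphM) /=.
move: (rK _) (rK _) (rK _) (rK _) (rK _) (rK _) (rK _) (rK _) (rK _) (rK _).
move=> s s0 s1 s2 s3 s4 s5 s6 s7 s8.
transitivity (s8 + iK * iK * (s6 * s4) - s3 * (s2 * s0 - iK * iK * (s1 * s)) -
  iK * (s7 + s6 * s5 - s3 * (s2 * s - s1 * s0))); first by ring.
by rewrite iK2; ring.
Qed.

Lemma exponent_e1 : Es *m e1 = oms *: e2.
Proof.
apply: colP_split => [||i].
- by rewrite exponent_mul_1 !mxE /=; ring.
- by rewrite exponent_mul_2 !mxE /=; ring.
by rewrite block_mul_d (_ : dsubmx e1 = 0) ?mulmx0 ?mxE ?mulr0//; apply/colP => l; rewrite !mxE.
Qed.

Lemma exponent_e2 : Es *m e2 = - oms *: e1.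
Proof.
apply: colP_split => [||i].
- by rewrite exponent_mul_1 !mxE /=; ring.
- by rewrite exponent_mul_2 !mxE /=; ring.
by rewrite block_mul_d (_ : dsubmx e2 = 0) ?mulmx0 ?mxE ?mulr0//; apply/colP => l; rewrite !mxE.
Qed.

Lemma p_e12 : p1 e1 e2 = 2 /\ p2 e1 e2 = 0.
Proof. by rewrite /p1 /p2 !mxE /=; split; ring. Qed.

Lemma p_e1N2 : p1 e1 (- e2) = 0 /\ p2 e1 (- e2) = 0.
Proof. by rewrite /p1 /p2 !mxE /=; split; ring. Qed.

(** The eigenvalues 'i oms and -'i oms of [Es], translated by - 'i k oms. For k up to 3 the
    multiples of oms are 1 - k and - (1 + k), hence at most 4 in absolute value. *)
Definition eigp (dl : R) k : K := rK (- dl) + iK * rK ((1 - k%:R) * oms).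
Definition eigq k : K := iK * rK (- (1 + k%:R) * oms).

Lemma Mk_evp dl k : mode_mx dl k *m evp = eigp dl k *: evp.
Proof.
rewrite Mk_cplx /La /Lb p_e12.1 p_e12.2 exponent_e1 exponent_e2 /eigp /evp.
move: e1 e2 k%:R => u v x; apply/colP => i; rewrite !mxE.
have -> : dl / 2 * (2 * u i 0 + 0 * v i 0) = dl * u i 0 by field.
have -> : dl / 2 * (2 * v i 0 - 0 * u i 0) = dl * v i 0 by field.
rewrite !(rmorphB, rmorphD, rmorphM, rmorphN, rmorph1) /=.
move: (rK _) (rK _) (rK _) (rK _) (rK _) => s1 s2 s3 s4 s5.
transitivity ((- s1 + iK * ((1 - s2) * s5)) * s4 + iK * s1 * s3 -
  iK * iK * ((1 - s2) * s5 * s3)); last by ring.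
by rewrite iK2; ring.
Qed.

Lemma Mk_evq dl k : mode_mx dl k *m evq = eigq k *: evq.
Proof.
rewrite Mk_cplx /La /Lb p_e1N2.1 p_e1N2.2 mulmxN exponent_e1 exponent_e2 /eigq /evq.
move: e1 e2 k%:R => u v x; apply/colP => i; rewrite !mxE !mul0r addr0 subrr !mulr0 !subr0.
rewrite !(rmorphB, rmorphD, rmorphM, rmorphN, rmorph1) /=.
move: (rK _) (rK _) (rK _) (rK _) => s1 s2 s3 s4.
transitivity (iK * (- (1 + s4) * s3) * s2 + iK * iK * (- (1 + s4) * s3 * s1)); last by ring.
by rewrite iK2; ring.
Qed.

(** A left eigenvector annihilates every right eigenvector with a different eigenvalue. If [mu] is
    neither critical value, it annihilates [evp] and [evq], so its first two entries vanish; the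
    rank-one term then drops out and the block structure leaves an eigenvector of [Ets]. *)
Lemma eigenvalue_Mk dl k mu : eigenvalue (mode_mx dl k) mu ->
  [\/ mu = eigp dl k, mu = eigq k
    | eigenvalue (map_mx rK Ets) (mu + rK (k%:R * oms) * iK)].
Proof.
move=> /eigenvalueP[v vM v0].
have H (u : 'cV[K]_n) lam : mode_mx dl k *m u = lam *: u -> mu = lam \/ v *m u = 0.
  move=> Hu; have [->|ml] := eqVneq mu lam; [by left|right].
  have : (mu - lam) *: (v *m u) = 0.
    by rewrite scalerBl (scalemxAr lam) -Hu mulmxA vM -scalemxAl subrr.
  by move/eqP; rewrite scaler_eq0 subr_eq0 (negPf ml) /= => /eqP.
have [->|vp] := H _ _ (Mk_evp dl k); first exact: Or31.
have [->|vq] := H _ _ (Mk_evq dl k); first exact: Or32.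
apply: Or33.
have vE (j : 'I_n) : v *m map_mx rK (delta_mx j 0 : 'cV[R]_n) = (v 0 j)%:M.
  rewrite map_delta_mx -colE; apply/matrixP => i l; rewrite !ord1 !mxE eqxx.
  by [].
have [v1 v2] : v 0 j1 = 0 /\ v 0 j2 = 0.
  move: vp vq; rewrite /evp /evq /cplx map_mxN scalerN opprK mulmxBr mulmxDr -!scalemxAr !vE.
  move=> /matrixP/(_ 0 0); rewrite !mxE eqxx /= !mulr1n => h1.
  move=> /matrixP/(_ 0 0); rewrite !mxE eqxx /= !mulr1n => h2.
  have two : rK 2^-1 * (1 + 1) = 1.
    by rewrite -(rmorph1 rK) -rmorphD -rmorphM; congr (rK _); field.
  have a1 : v 0 j1 = 0.
    rewrite -[LHS]mul1r -two; transitivity (rK 2^-1 * ((v 0 j1 - iK * v 0 j2) + (v 0 j1 + iK * v 0 j2))).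
      by ring.
    by rewrite h1 h2 addr0 mulr0.
  split=> //; move: h2; rewrite a1 add0r => h2.
  transitivity (- (iK * (iK * v 0 j2))); first by rewrite mulrA iK2 mulN1r opprK.
  by rewrite [iK * v 0 j2]h2 mulr0 oppr0.
have vr : v = row_mx 0 (rsubmx v).
  rewrite -[LHS]hsubmxK; congr row_mx; apply/rowP => i; rewrite !mxE.
  by case: (ord2P i) => ->.
apply/eigenvalueP; exists (rsubmx v); last first.
  by apply: contraNneq v0 => v30; rewrite vr v30 row_mx0.
have : v *m map_mx rK Es = (mu + rK (k%:R * oms) * iK) *: v.
  move: vM; rewrite /mode_mx mulmxBr mulmxBr mul_mx_scalar -scalemxAr mulmxA vp mul0mx scaler0 subr0.
  by move/eqP; rewrite subr_eq => /eqP ->; rewrite scalerDl.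
rewrite [in X in X -> _]vr /exponent_mx map_block_mx !map_mx0 mul_row_block !mul0mx !mulmx0 !add0r.
rewrite scale_row_mx => /eq_row_mx[_ h].
by [].
Qed.

End Complexify.
End ModeSystem.

(** * Non-resonance of the modes 0 to 3, and the degenerate mode 1 *)

Section ModeSolutions.
Context {R : realType} {m : nat}.
Local Notation C := R[i].
Local Notation n := (2 + m)%N.
Local Notation T2 := ((pi : R) *+ 2).
Local Notation rC := (real_complex R : {rmorphism R -> C}).
Local Notation iC := ('i%C : C).
Local Notation e1 := (@e1 R m).
Local Notation e2 := (@e2 R m).

(** A vanishing sine makes the cosine 1 or -1, so the modulus of the exponential would have to be 1,
    which forces the real part to vanish. *)
Lemma cexp_neq1_Re (mu : C) : complex.Re mu != 0 -> cexp mu T2 != 1.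
Proof.
move=> re0; apply/eqP => -[hc hs].
have s0 : sin (complex.Im mu * T2) = 0.
  by move/eqP: hs; rewrite mulf_eq0 gt_eqF ?expR_gt0//= => /eqP.
have := sin0cos1 s0; move: (congr1 Num.norm hc).
rewrite normrM normr1 (gtr0_norm (expR_gt0 _)) => + h; rewrite h mulr1 => /eqP.
rewrite -expR0 (inj_eq (@expR_inj R)) mulf_eq0 (negPf re0) /= => /eqP h0.
by have := twopi_gt0 (R := R); rewrite h0 ltxx.
Qed.

Lemma cos_twopi_neq1 (y : R) : 0 < y < 2 -> y != 1 -> cos (y * T2) != 1.
Proof.
move=> /andP[y0 y2] y1; have p0 := pi_gt0 R.
rewrite (_ : y * T2 = (y * pi) *+ 2); last by rewrite mulrnAr.
rewrite cos_mulr2n cos2sin2; apply/eqP => h.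
have {h} : sin (y * pi) = 0 by apply/eqP; rewrite -sqrf_eq0; apply/eqP; lra.
case: (ltgtP y 1) y1 => // h _ s0.
  by have := @sin_gt0_pi R (y * pi); rewrite s0 ltxx mulr_gt0// gtr_pMl// h => /(_ isT).
have := @sin_gt0_pi R (y * pi - pi).
have -> : y * pi - pi = (y - 1) * pi by ring.
have -> : sin ((y - 1) * pi) = 0.
  have := sinDpi ((y - 1) * pi); rewrite (_ : _ + pi = y * pi); last by ring.
  by rewrite s0 => /esym/eqP; rewrite oppr_eq0 => /eqP.
have -> : 0 < (y - 1) * pi < pi.
  by rewrite mulr_gt0 ?subr_gt0//= gtr_pMl// ltrBlDl.
by rewrite ltxx => /(_ isT).
Qed.

Lemma cexp_neq1_Im (y : R) : 0 < `|y| < 2 -> `|y| != 1 -> cexp (Complex 0 y) T2 != 1.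
Proof.
move=> h1 h2; apply/eqP => -[]; rewrite mul0r expR0 mul1r => hc _.
have := cos_twopi_neq1 h1 h2; rewrite (_ : `|y| * T2 = `|y * T2|) ?cos_norm ?hc ?eqxx//.
by rewrite normrM (gtr0_norm (x := T2)) ?twopi_gt0.
Qed.

Variables (oms : R) (Ets : 'M[R]_m).
Hypothesis oms_gt0 : 0 < oms.
Hypothesis oms_lt : oms < 2^-1.
Hypothesis oms3 : oms != 3^-1.
Hypothesis oms4 : oms != 4^-1.
Hypothesis Ets_hyp : forall mu, complex_eigenvalue Ets mu -> complex.Re mu != 0.
Local Notation Es := (exponent_mx 0 oms Ets).
Local Notation dl k := ((k == 1%N)%:R : R).
Local Notation M k := (mode_mx oms Ets rC iC (dl k) k).
Local Notation La k := (La oms Ets (dl k) k).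
Local Notation Lb k := (Lb oms Ets (dl k) k).

Lemma iC2 : iC * iC = -1.
Proof. by apply: complex_eq; rewrite ?reM ?imM /= ?oppr0; ring. Qed.

(** Since 4 oms < 2, the value 1 is the only one that could give multiplier 1. For j = 1, 2 it is
    excluded by oms < 1/2, for j = 3 and 4 by the two excluded frequencies. *)
Lemma omsj (j : nat) : (0 < j <= 4)%N -> 0 < `|j%:R * oms| < 2 /\ `|j%:R * oms| != 1.
Proof.
move=> /andP[j0 j4].
rewrite normrM (gtr0_norm oms_gt0) normr_nat; split.
  rewrite mulr_gt0 ?ltr0n//=; apply: le_lt_trans (_ : 4 * oms < _).
    by rewrite ler_wpM2r ?ler_nat// ltW.
  by move: oms_lt; lra.
case: j j0 j4 => [//|[|[|[|[|//]]]]] _ _; apply/eqP.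
- by move=> h; move: oms_lt; lra.
- by move=> h; move: oms_lt; lra.
- by move=> h; move/eqP: oms3; apply; lra.
- by move=> h; move/eqP: oms4; apply; lra.
Qed.

Lemma cexp_resonance (x : R) (j : nat) : `|x| = j%:R -> (0 < j <= 4)%N ->
  cexp (iC * rC (x * oms)) T2 != 1.
Proof.
move=> xj jr; have [h1 h2] := omsj jr.
rewrite (_ : iC * _ = Complex 0 (x * oms)).
  by apply: cexp_neq1_Im; rewrite normrM xj -[j%:R]normr_nat -normrM.
by apply: complex_eq; rewrite ?reM ?imM /=; ring.
Qed.

(** The value 1/3 is excluded for the sake of k = 2 (multiple -3) and 1/4 for the sake of k = 3
    (multiple -4). At k = 1 the shifted critical eigenvalue is -1. An eigenvalue coming from [Ets]
    keeps its nonzero real part. *)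
Lemma M_nonresonant k : (k < 4)%N -> nonresonant (n := 1 + m) (M k).
Proof.
move=> k4 mu /(eigenvalue_Mk iC2)[->|->|/Ets_hyp].
- rewrite /eigp; have [->|k1] := eqVneq k 1%N.
    by apply: cexp_neq1_Re; rewrite subrr mul0r rmorph0 mulr0 addr0 /= oppr_eq0 oner_eq0.
  rewrite oppr0 rmorph0 add0r.
  case: k k4 k1 => [|[//|[|[|//]]]] _ _.
  + by apply: (@cexp_resonance _ 1) => //; rewrite subr0 normr1.
  + by apply: (@cexp_resonance _ 1) => //; rewrite -normrN -(normr_nat R 1); congr Num.norm; ring.
  + by apply: (@cexp_resonance _ 2) => //; rewrite -normrN -(normr_nat R 2); congr Num.norm; ring.
- apply: (@cexp_resonance _ k.+1); last by [].
  by rewrite normrN -natr1 addrC ger0_norm// addr_ge0.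
- move=> h; apply: cexp_neq1_Re; move: h; rewrite reD reM /=.
  by rewrite !mulr0 mul0r subrr addr0.
Qed.

Definition rcont (f : R -> 'cV[R]_n) := forall i, continuous (fun t => f t i 0).
Definition rbound (f : R -> 'cV[R]_n) (B : R) := forall t i, `|f t i 0| <= B.

Implicit Types a b f g : R -> 'cV[R]_n.

Lemma M_solution k (h : R -> 'cV[C]_n) : (k < 4)%N -> vcont h -> periodic h T2 ->
  exists c : R -> 'cV[C]_n, periodic c T2 /\ forall t, vder c t (M k *m c t + h t).
Proof. by move=> k4; exact: (nonresonant_solution (M_nonresonant k4)). Qed.

Lemma M_bound k : (k < 4)%N -> exists2 K, 0 <= K & forall (x h : R -> 'cV[C]_n) B,
  periodic x T2 -> (forall t, vder x t (M k *m x t + h t)) -> vbound h B ->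
  vbound x (K * B).
Proof. by move=> k4; exact: (nonresonant_bound (M_nonresonant k4)). Qed.

Lemma cplxCE (a b : 'cV[R]_n) i : cplx rC iC a b i 0 = Complex (a i 0) (- b i 0).
Proof. by rewrite cplxE; apply: complex_eq; rewrite ?reD ?imD ?reN ?imN ?reM ?imM /=; ring. Qed.

Lemma regular_solution k f g : (k < 4)%N -> rcont f -> rcont g ->
  periodic f T2 -> periodic g T2 -> exists a b, [/\ periodic a T2, periodic b T2,
    forall t, rder (La k (a t) (b t) + f t) t a &
    forall t, rder (Lb k (a t) (b t) + g t) t b].
Proof.
move=> k4 cf cg pf pg.
have [||c [pc cos_H]] := @M_solution k (fun t => cplx rC iC (f t) (g t)) k4.
- move=> i; split.
    rewrite (_ : (fun _ => _) = (fun t => f t i 0)); first exact: cf.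
    by apply/funext => t; rewrite cplxCE.
  rewrite (_ : (fun _ => _) = (fun t => - g t i 0)).
    by move=> t; apply: cvgN; exact: cg.
  by apply/funext => t; rewrite cplxCE.
- by move=> t; rewrite pf pg.
pose a t := (\col_i complex.Re (c t i 0)) : 'cV[R]_n.
pose b t := (\col_i - complex.Im (c t i 0)) : 'cV[R]_n.
have cE t : c t = cplx rC iC (a t) (b t).
  apply/colP => i; rewrite cplxCE !mxE opprK; exact: complex_eq.
have eqn t : M k *m c t + cplx rC iC (f t) (g t) =
    cplx rC iC (La k (a t) (b t) + f t) (Lb k (a t) (b t) + g t).
  rewrite [c t]cE.
  have h := @Mk_cplx R m oms Ets C rC iC iC2 (dl k) k (a t) (b t).
  rewrite -cplxD.
  exact: (congr1 (fun z => z + cplx rC iC (f t) (g t)) h).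
have aE t i : a t i 0 = complex.Re (c t i 0) by rewrite mxE.
have bE t i : b t i 0 = - complex.Im (c t i 0) by rewrite mxE.
exists a, b; split => [t|t|t i|t i].
- by apply/colP => i; rewrite !mxE pc.
- by apply/colP => i; rewrite !mxE pc.
- have [h _] := cos_H t i; apply: der_ext (fun s => esym (aE s i)) _.
  by apply: der_val h; rewrite eqn cplxCE.
- have [_ h] := cos_H t i; apply: der_ext (fun s => esym (bE s i)) _.
  by apply: der_val (der_opp h); rewrite eqn cplxCE /= opprK.
Qed.

Lemma regular_bound k : (k < 4)%N -> exists2 K, 0 <= K & forall a b f g B,
  periodic a T2 -> periodic b T2 -> rbound f B -> rbound g B ->
  (forall t, rder (La k (a t) (b t) + f t) t a) ->
  (forall t, rder (Lb k (a t) (b t) + g t) t b) ->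
  rbound a (K * B) /\ rbound b (K * B).
Proof.
move=> k4; have [K K0 HK] := M_bound k4.
exists (K * 2); first by rewrite mulr_ge0.
move=> a b f g B pa pb Bf Bg Ha Hb.
have H : vbound (fun t => cplx rC iC (a t) (b t)) (K * (2 * B)).
  apply: (HK _ (fun t => cplx rC iC (f t) (g t))).
  - by move=> t; rewrite pa pb.
  - move=> t i.
    have eqn : M k *m cplx rC iC (a t) (b t) + cplx rC iC (f t) (g t) =
        cplx rC iC (La k (a t) (b t) + f t) (Lb k (a t) (b t) + g t).
      rewrite -cplxD.
      exact: (congr1 (fun z => z + cplx rC iC (f t) (g t)) (@Mk_cplx R m oms Ets C rC iC iC2 (dl k) k (a t) (b t))).
    apply: cder_val (_ : Complex ((La k (a t) (b t) + f t) i 0) (- (Lb k (a t) (b t) + g t) i 0) = _) _.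
      by rewrite eqn cplxCE.
    split.
      by apply: der_ext (Ha t i) => s; rewrite cplxCE.
    by apply: der_ext (der_opp (Hb t i)) => s; rewrite cplxCE.
  - move=> t i; rewrite cplxCE /cnorm /= normrN mulr_natl mulr2n.
    by apply: lerD; [exact: Bf|exact: Bg].
by split=> t i; have := H t i; rewrite cplxCE /cnorm /= normrN -mulrA; apply: le_trans;
  rewrite ?lerDl ?lerDr.
Qed.

Definition Aa k (a b : 'cV[R]_n) : 'cV[R]_n := Es *m a - (k%:R * oms) *: b.
Definition Ab k (a b : 'cV[R]_n) : 'cV[R]_n := Es *m b + (k%:R * oms) *: a.

Lemma LaE k a b t : La k (a t) (b t) =
  Aa k (a t) (b t) - ((k == 1%N)%:R / 2) *: (p1 (a t) (b t) *: e1 + p2 (a t) (b t) *: e2).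
Proof. by []. Qed.

Lemma LbE k a b t : Lb k (a t) (b t) =
  Ab k (a t) (b t) - ((k == 1%N)%:R / 2) *: (p1 (a t) (b t) *: e2 - p2 (a t) (b t) *: e1).
Proof. by []. Qed.

(** At k = 1 the pairing p1 + 'i p2 is a left null vector of the mode operator, so the derivative of
    the critical coordinate is the critical coordinate of the forcing alone. *)
Lemma p1A (a b : 'cV[R]_n) : p1 (Aa 1 a b) (Ab 1 a b) = 0.
Proof.
have h1 := exponent_mul_1 0 oms Ets a; have h2 := exponent_mul_2 0 oms Ets b.
rewrite /p1 /Aa /Ab; move: (Es *m a) (Es *m b) h1 h2 => x y h1 h2.
by rewrite !mxE [x _ _]h1 [y _ _]h2 !mul1r; ring.
Qed.

Lemma p2A (a b : 'cV[R]_n) : p2 (Aa 1 a b) (Ab 1 a b) = 0.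
Proof.
have h1 := exponent_mul_2 0 oms Ets a; have h2 := exponent_mul_1 0 oms Ets b.
rewrite /p2 /Aa /Ab; move: (Es *m a) (Es *m b) h1 h2 => x y h1 h2.
by rewrite !mxE [x _ _]h1 [y _ _]h2 !mul1r; ring.
Qed.

Lemma p1D (a b a' b' : 'cV[R]_n) : p1 (a + a') (b + b') = p1 a b + p1 a' b'.
Proof. by rewrite /p1 !mxE; ring. Qed.

Lemma p2D (a b a' b' : 'cV[R]_n) : p2 (a + a') (b + b') = p2 a b + p2 a' b'.
Proof. by rewrite /p2 !mxE; ring. Qed.

Lemma p1B (a b a' b' : 'cV[R]_n) : p1 (a - a') (b - b') = p1 a b - p1 a' b'.
Proof. by rewrite /p1 !mxE; ring. Qed.

Lemma p2B (a b a' b' : 'cV[R]_n) : p2 (a - a') (b - b') = p2 a b - p2 a' b'.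
Proof. by rewrite /p2 !mxE; ring. Qed.

(** [va x y] and [vb x y] are the coefficients of the critical vector with coordinate x + 'i y: a
    right inverse of the pair [p1], [p2]. *)
Definition va (x y : R) : 'cV[R]_n := 2^-1 *: (x *: e1 + y *: e2).
Definition vb (x y : R) : 'cV[R]_n := 2^-1 *: (x *: e2 - y *: e1).

Lemma p1v x y : p1 (va x y) (vb x y) = x.
Proof. by rewrite /p1 !mxE /=; field. Qed.

Lemma p2v x y : p2 (va x y) (vb x y) = y.
Proof. by rewrite /p2 !mxE /=; field. Qed.

Lemma der_p1 a b t da db : rder da t a -> rder db t b ->
  der (fun s => p1 (a s) (b s)) t (p1 da db).
Proof. by move=> ha hb; exact: (der_add (ha j1) (hb j2)). Qed.

Lemma der_p2 a b t da db : rder da t a -> rder db t b ->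
  der (fun s => p2 (a s) (b s)) t (p2 da db).
Proof. by move=> ha hb; exact: (der_sub (ha j2) (hb j1)). Qed.

Lemma rder_val (x y : 'cV[R]_n) t a : x = y -> rder x t a -> rder y t a.
Proof. by move=> ->. Qed.

Lemma rder_rcont a (da : R -> 'cV[R]_n) : (forall t, rder (da t) t a) -> rcont a.
Proof. by move=> H i t; exact: der_continuous (H t i). Qed.

Lemma periodic_p1 a b : periodic a T2 -> periodic b T2 ->
  periodic (fun t => p1 (a t) (b t)) T2.
Proof. by move=> pa pb t; rewrite pa pb. Qed.

Lemma periodic_p2 a b : periodic a T2 -> periodic b T2 ->
  periodic (fun t => p2 (a t) (b t)) T2.
Proof. by move=> pa pb t; rewrite pa pb. Qed.

Lemma continuous_p1 a b : rcont a -> rcont b -> continuous (fun t => p1 (a t) (b t)).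
Proof. by move=> ca cb; apply: continuous_add; [exact: ca|exact: cb]. Qed.

Lemma continuous_p2 a b : rcont a -> rcont b -> continuous (fun t => p2 (a t) (b t)).
Proof. by move=> ca cb; apply: continuous_sub; [exact: ca|exact: cb]. Qed.

(** The primitive is normalised to mean zero so that the critical coordinate built from it meets the
    amplitude and phase conditions. *)
Lemma mean_zero_primitive (w : R -> R) : continuous w -> periodic w T2 ->
  integral_2pi w = 0 ->
  exists q : R -> R, [/\ periodic q T2, forall t : R, der q t (w t) & integral_2pi q = 0].
Proof.
move=> cw pw iw; have [U HU] := antiderivative cw.
have cU : continuous U by move=> x; exact: der_continuous (HU x).
exists (fun t => U t - T2^-1 * integral_2pi U); split.
- move=> t; congr (_ - _); apply/eqP; rewrite -subr_eq0; apply/eqP.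
  have := @der0_const _ (fun s => U (s + T2) - U s) _ t 0.
  rewrite add0r -(integral_2piE HU cw) iw; apply => x.
  by apply: der_val (der_sub (der_shift (HU (x + T2))) (HU x)); rewrite pw subrr.
- by move=> t; apply: der_val (der_sub (HU t) (der_cst _ t)); rewrite subr0.
- rewrite int2B ?int2_cst //; last exact: continuous_cst.
  by rewrite mulrA mulfV ?twopi_neq0// mul1r subrr.
Qed.

(** The exponent -1 is non-resonant and the forcing is 0, so the periodic bound is 0. *)
Lemma periodic_decay (w : R -> R) : periodic w T2 -> (forall t : R, der w t (- w t)) ->
  forall t, w t = 0.
Proof.
move=> pw dw t.
have [|K K0 HK] := @scalar_periodic_bound R (-1).
  by apply: cexp_neq1_Re; rewrite /= oppr_eq0 oner_eq0.
suff : cnorm (Complex (w t) 0) <= K * 0.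
  by rewrite mulr0 /cnorm /= normr0 addr0 normr_le0 => /eqP.
apply: (HK (fun s => Complex (w s) 0) (fun=> 0)).
- by move=> s; rewrite pw.
- move=> s; rewrite addr0; split.
    by apply: der_val (dw s); rewrite reM /=; ring.
  by apply: der_val (der_cst 0 s); rewrite imM /=; ring.
- by move=> s; rewrite cnorm0.
Qed.

(** At k = 1 the shifted, non-resonant system is solved with the critical primitive [q] added to the
    forcing. The critical coordinate w then satisfies (w - q)' = - (w - q), hence w = q: the added
    term cancels the shift and the original equation remains. *)
Theorem mode_solution k f g : (k < 4)%N -> rcont f -> rcont g ->
  periodic f T2 -> periodic g T2 ->
  (k = 1%N -> integral_2pi (fun t => p1 (f t) (g t)) = 0 /\
              integral_2pi (fun t => p2 (f t) (g t)) = 0) ->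
  exists a b, [/\ periodic a T2, periodic b T2,
    forall t, rder (Aa k (a t) (b t) + f t) t a,
    forall t, rder (Ab k (a t) (b t) + g t) t b &
    k = 1%N -> integral_2pi (fun t => p1 (a t) (b t)) = 0 /\
               integral_2pi (fun t => p2 (a t) (b t)) = 0].
Proof.
move=> k4 cf cg pf pg H1; have [k1|k1] := eqVneq k 1%N; last first.
  have [a [b [pa pb da db]]] := regular_solution k4 cf cg pf pg.
  exists a, b; split => [//|//|t|t|/eqP]; last by rewrite (negPf k1).
    by apply: rder_val (da t); rewrite LaE (negPf k1) mul0r scale0r subr0.
  by apply: rder_val (db t); rewrite LbE (negPf k1) mul0r scale0r subr0.
have [i1 i2] := H1 k1.
have [q1 [pq1 dq1 iq1]] := mean_zero_primitive (continuous_p1 cf cg) (periodic_p1 pf pg) i1.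
have [q2 [pq2 dq2 iq2]] := mean_zero_primitive (continuous_p2 cf cg) (periodic_p2 pf pg) i2.
have cq1 : continuous q1 by move=> x; exact: der_continuous (dq1 x).
have cq2 : continuous q2 by move=> x; exact: der_continuous (dq2 x).
have [||||a [b [pa pb da db]]] := @regular_solution k (fun t => f t + va (q1 t) (q2 t))
    (fun t => g t + vb (q1 t) (q2 t)) k4.
- move=> i; rewrite (_ : (fun _ => _) = (fun t => f t i 0 + 2^-1 * (q1 t * e1 i 0 + q2 t * e2 i 0))).
    by apply: continuous_add; [exact: cf|apply: continuous_mul; [exact: continuous_cst|
     apply: continuous_add; apply: continuous_mul => //; exact: continuous_cst]].
  by apply/funext => t; rewrite !mxE.
- move=> i; rewrite (_ : (fun _ => _) = (fun t => g t i 0 + 2^-1 * (q1 t * e2 i 0 - q2 t * e1 i 0))).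
    by apply: continuous_add; [exact: cg|apply: continuous_mul; [exact: continuous_cst|
     apply: continuous_sub; apply: continuous_mul => //; exact: continuous_cst]].
  by apply/funext => t; rewrite !mxE.
- by move=> t; rewrite pf pq1 pq2.
- by move=> t; rewrite pg pq1 pq2.
have eqLa t : La k (a t) (b t) = Aa k (a t) (b t) - va (p1 (a t) (b t)) (p2 (a t) (b t)).
  by rewrite LaE k1 eqxx div1r.
have eqLb t : Lb k (a t) (b t) = Ab k (a t) (b t) - vb (p1 (a t) (b t)) (p2 (a t) (b t)).
  by rewrite LbE k1 eqxx div1r.
have w1 t : p1 (a t) (b t) = q1 t.
  apply/eqP; rewrite -subr_eq0; apply/eqP.
  apply: (@periodic_decay (fun t => p1 (a t) (b t) - q1 t)) => s; first by rewrite pa pb pq1.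
  apply: der_val (der_sub (der_p1 (da s) (db s)) (dq1 s)).
  rewrite eqLa eqLb p1D p1B [p1 (f s + _) _]p1D !p1v k1 p1A; ring.
have w2 t : p2 (a t) (b t) = q2 t.
  apply/eqP; rewrite -subr_eq0; apply/eqP.
  apply: (@periodic_decay (fun t => p2 (a t) (b t) - q2 t)) => s; first by rewrite pa pb pq2.
  apply: der_val (der_sub (der_p2 (da s) (db s)) (dq2 s)).
  rewrite eqLa eqLb p2D p2B [p2 (f s + _) _]p2D !p2v k1 p2A; ring.
exists a, b; split => [//|//|t|t|_].
- apply: rder_val (da t); rewrite eqLa w1 w2.
  by move: (Aa _ _ _) (va _ _) (f t) => x y z; rewrite addrA addrAC subrK.
- apply: rder_val (db t); rewrite eqLb w1 w2.
  by move: (Ab _ _ _) (vb _ _) (g t) => x y z; rewrite addrA addrAC subrK.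
- split; [rewrite -iq1|rewrite -iq2]; congr integral_2pi; apply/funext => t; [exact: w1|exact: w2].
Qed.

Lemma periodic_oscillation (w dw : R -> R) B : periodic w T2 ->
  (forall t : R, der w t (dw t)) -> (forall t, `|dw t| <= B) ->
  forall s t, `|w s - w t| <= B * T2.
Proof.
move=> pw Hw HB.
have red x : exists2 y, 0 <= y <= T2 & w x = w y.
  have [n0 [y [yI [->|yE]]]] := periodic_repr x.
    by exists y => //; rewrite periodicn.
  by exists y => //; rewrite yE periodicn.
move=> s t; have [s' sI ->] := red s; have [t' tI ->] := red t.
apply: le_trans (mvt_bound_dist (fun x _ => Hw x) (fun x _ => HB x)) _.
have B0 : 0 <= B by apply: le_trans (HB 0).
by apply: ler_wpM2l => //; rewrite ler_norml; move: sI tI => /andP[? ?] /andP[? ?]; apply/andP; split; lra.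
Qed.

Lemma mean_zero_bound (w : R -> R) B : continuous w -> integral_2pi w = 0 ->
  (forall s t, `|w s - w t| <= B) -> forall t, `|w t| <= B.
Proof.
move=> cw iw HB t; have T0 := twopi_gt0 (R := R).
have := @int2_bound R (fun s => w s - w t) B _ (fun s => HB s t).
rewrite int2B ?int2_cst //; last exact: continuous_cst.
rewrite iw sub0r normrN normrM (gtr0_norm T0) ler_pM2l//; apply.
by apply: continuous_sub => //; exact: continuous_cst.
Qed.

(** At k = 1 the critical coordinates have mean zero, so they are bounded by their oscillation, that
    is by the forcing integrated over one period. Moved to the right-hand side, they turn the
    equation into the shifted one, whose bound is known; this explains the factor 1 + 2 T. *)
Theorem mode_bound k : (k < 4)%N -> exists2 K, 0 <= K & forall a b f g B,
  periodic a T2 -> periodic b T2 -> rbound f B -> rbound g B ->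
  (forall t, rder (Aa k (a t) (b t) + f t) t a) ->
  (forall t, rder (Ab k (a t) (b t) + g t) t b) ->
  (k = 1%N -> integral_2pi (fun t => p1 (a t) (b t)) = 0 /\
              integral_2pi (fun t => p2 (a t) (b t)) = 0) ->
  rbound a (K * B) /\ rbound b (K * B).
Proof.
move=> k4; have [K K0 HK] := regular_bound k4; have T0 := twopi_gt0 (R := R).
exists (K * (1 + 2 * T2)); first by rewrite mulr_ge0// addr_ge0// mulr_ge0// ltW.
move=> a b f g B pa pb Bf Bg Ha Hb H1; rewrite -mulrA.
have B0 : 0 <= B by apply: le_trans (Bf 0 j1).
have BT : 0 <= 2 * T2 * B by rewrite mulr_ge0// mulr_ge0// ltW.
have le1 : B <= (1 + 2 * T2) * B by rewrite mulrDl mul1r lerDl.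
have [k1|k1] := eqVneq k 1%N; last first.
  apply: (HK a b f g) => // [t i|t i|t|t].
  - exact: le_trans (Bf t i) _.
  - exact: le_trans (Bg t i) _.
  - by apply: rder_val (Ha t); rewrite LaE (negPf k1) mul0r scale0r subr0.
  - by apply: rder_val (Hb t); rewrite LbE (negPf k1) mul0r scale0r subr0.
have [i1 i2] := H1 k1.
have ca : rcont a by exact: rder_rcont Ha.
have cb : rcont b by exact: rder_rcont Hb.
have b1 t : `|p1 (a t) (b t)| <= 2 * T2 * B.
  apply: (@mean_zero_bound (fun t => p1 (a t) (b t))) => // [|s s'].
    exact: continuous_p1.
  rewrite mulrAC; apply: (periodic_oscillation (periodic_p1 pa pb) (fun x => der_p1 (Ha x) (Hb x))).
  move=> x; rewrite k1 p1D p1A add0r; apply: le_trans (ler_normD _ _) _.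
  by have := Bf x j1; have := Bg x j2; lra.
have b2 t : `|p2 (a t) (b t)| <= 2 * T2 * B.
  apply: (@mean_zero_bound (fun t => p2 (a t) (b t))) => // [|s s'].
    exact: continuous_p2.
  rewrite mulrAC; apply: (periodic_oscillation (periodic_p2 pa pb) (fun x => der_p2 (Ha x) (Hb x))).
  move=> x; rewrite k1 p2D p2A add0r; apply: le_trans (ler_normB _ _) _.
  by have := Bf x j2; have := Bg x j1; lra.
have e01 i : `|e1 i 0| <= 1 by rewrite !mxE; case: (_ && _); rewrite ?normr0 ?normr1.
have e02 i : `|e2 i 0| <= 1 by rewrite !mxE; case: (_ && _); rewrite ?normr0 ?normr1.
have comb (x y u v : R) : `|x| <= 2 * T2 * B -> `|y| <= 2 * T2 * B -> `|u| <= 1 -> `|v| <= 1 ->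
    `|2^-1 * (x * u + y * v)| <= 2 * T2 * B.
  move=> hx hy hu hv; rewrite normrM ger0_norm ?invr_ge0// ler_pdivrMl//.
  apply: le_trans (ler_normD _ _) _; rewrite !normrM.
  have -> : 2 * (2 * T2 * B) = 2 * T2 * B * 1 + 2 * T2 * B * 1 by ring.
  by apply: lerD; apply: ler_pM.
apply: (HK a b (fun t => f t + va (p1 (a t) (b t)) (p2 (a t) (b t)))
  (fun t => g t + vb (p1 (a t) (b t)) (p2 (a t) (b t)))) => // [t i|t i|t|t].
- rewrite mxE mulrDl mul1r; apply: le_trans (ler_normD _ _) _; apply: lerD; first exact: Bf.
  have -> : va (p1 (a t) (b t)) (p2 (a t) (b t)) i 0 =
    2^-1 * (p1 (a t) (b t) * e1 i 0 + p2 (a t) (b t) * e2 i 0) by rewrite /va; move: e1 e2 => u v; rewrite !mxE.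
  exact: comb.
- rewrite mxE mulrDl mul1r; apply: le_trans (ler_normD _ _) _; apply: lerD; first exact: Bg.
  have -> : vb (p1 (a t) (b t)) (p2 (a t) (b t)) i 0 =
    2^-1 * (p1 (a t) (b t) * e2 i 0 + - p2 (a t) (b t) * e1 i 0).
    by rewrite /vb; move: e1 e2 => u v; rewrite !mxE mulNr.
  by apply: comb; rewrite ?normrN.
- apply: rder_val (Ha t); rewrite LaE k1 eqxx div1r -/(va _ _).
  by move: (Aa _ _ _) (va _ _) (f t) => x y z; rewrite [z + y]addrC addrA subrK.
- apply: rder_val (Hb t); rewrite LbE k1 eqxx div1r -/(vb _ _).
  by move: (Ab _ _ _) (vb _ _) (g t) => x y z; rewrite [z + y]addrC addrA subrK.
Qed.

End ModeSolutions.

(** * Uniformly smooth families *)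

Section ChainRule.
Context {R : realType} {V : normedModType R}.
Implicit Types (f : V -> R) (A : set V) (Y b : V).

Lemma der_small (phi : R -> R) (e0 : R) :
  (forall eta, 0 < eta -> \forall e \near e0, `|phi e - phi e0| <= eta * `|e - e0|) ->
  der phi e0 0.
Proof.
move=> H.
have H0 : (fun h => h^-1 *: (phi (h *: 1 + e0) - phi e0)) @ 0^' --> (0 : R).
  apply/cvgrPdist_le => eta eta0; near=> h.
  rewrite sub0r normrN normrZ normfV.
  have h0 : h != 0 by near: h; exact: nbhs_dnbhs_neq.
  rewrite ler_pdivrMl ?normr_gt0// mulrC.
  rewrite [X in _ <= _ * `|X|](_ : h = (h *: 1 + e0) - e0); last by rewrite addrK /GRing.scale /= mulr1.
  near: h; apply: nbhs_dnbhs.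
  have : (fun h : R => h *: (1 : R) + e0) @ 0 --> e0.
    rewrite -[X in _ --> X]add0r -[X in _ --> X + _](scale0r (1 : R)).
    by apply: cvgD; [apply: cvgZl; exact: cvg_id|exact: cvg_cst].
  by move=> cvh; exact: (cvh _ (H _ eta0)).
split; first by apply/cvg_ex; exists 0.
exact: cvg_lim.
Unshelve. all: by end_near. Qed.

Lemma der_lip (x : R -> R) (e0 d : R) : der x e0 d ->
  \forall e \near e0, `|x e - x e0| <= (`|d| + 1) * `|e - e0|.
Proof.
move=> [dx dE].
have /cvgrPdist_le /(_ 1 ltr01) H : (fun h => h^-1 *: (x (h *: 1 + e0) - x e0)) @ 0^' --> d.
  by rewrite -dE; exact: dx.
have {H} [r /= r0 Hr] : \forall h \near (0 : R)^', `|d - h^-1 *: (x (h *: 1 + e0) - x e0)| <= 1 by exact: H.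
apply/nbhs_ballP; exists r => //= e; rewrite /ball /= => er.
have [->|ee] := eqVneq e e0; first by rewrite !subrr normr0 mulr0.
have := Hr (e - e0); rewrite /= sub0r normrN distrC subr_eq0 => /(_ er ee).
rewrite /GRing.scale /= mulr1 subrK => h.
have ee' : e - e0 != 0 by rewrite subr_eq0.
have {}h : `|(e - e0)^-1 * (x e - x e0)| <= `|d| + 1.
  rewrite -[_ * _](subrK d) addrC; apply: le_trans (ler_normD _ _) _.
  by rewrite lerD2l distrC.
by move: h; rewrite [`|e0 - e|]distrC normrM normfV ler_pdivrMl ?normr_gt0// mulrC.
Qed.

Lemma der_line f Y b (s : R) : derivable f (Y + s *: b) b ->
  der (fun t => f (Y + t *: b)) s ('D_b f (Y + s *: b)).
Proof.
move=> H.
have E : (fun h : R => h^-1 *: (f (Y + (h *: 1 + s) *: b) - f (Y + s *: b))) =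
         (fun h : R => h^-1 *: (f (h *: b + (Y + s *: b)) - f (Y + s *: b))).
  apply/funext => h; congr (_ *: (f _ - _)).
  by rewrite [h *: 1]mulr1 scalerDl addrCA.
by split; [rewrite /derivable E|rewrite /derive E].
Qed.

(** Strict differentiability: the derivative is frozen at [Y0] while the base point [Y] moves. This
    is what allows increments in several directions to be added one after the other. *)
Lemma strict_direction f A Y0 b eta : open A -> A Y0 -> 0 < eta ->
  (forall Y, A Y -> derivable f Y b) -> {for Y0, continuous ('D_b f)} ->
  exists2 dl, 0 < dl & forall Y (h : R), `|Y - Y0| < dl -> `|h| < dl ->
    `|f (Y + h *: b) - f Y - h * 'D_b f Y0| <= eta * `|h|.
Proof.
move=> oA AY0 eta0 dA cD.
have /nbhs_ballP[r r0 Hr] : nbhs Y0 A by exact: open_nbhs_nbhs.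
have /cvgrPdist_le /(_ _ eta0) /nbhs_ballP[r' r'0 Hr'] := cD.
pose rho := Num.min r r'.
have rho0 : 0 < rho by rewrite lt_min; apply/andP.
have b1 : 0 < 1 + `|b| by rewrite ltr_pwDl.
exists (rho / (1 + `|b|)); first by rewrite divr_gt0.
move=> Y h HY Hh.
have inb s : `|s| <= `|h| -> `|Y + s *: b - Y0| < rho.
  move=> sh; rewrite addrAC; apply: le_lt_trans (ler_normD _ _) _.
  have -> : rho = rho / (1 + `|b|) + rho / (1 + `|b|) * `|b|.
    by rewrite -[X in X + _]mulr1 -mulrDr divfK// gt_eqF.
  apply: ltr_leD => //; rewrite normrZ ler_wpM2r//.
  exact: le_trans sh (ltW Hh).
have inA s : `|s| <= `|h| -> A (Y + s *: b).
  move=> /inb h1; apply: Hr; rewrite -ball_normE /ball_ /= distrC.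
  by apply: lt_le_trans h1 _; rewrite ge_min lexx.
have dphi (s : R) : `|s - 0| <= `|h - 0| ->
    der (fun t => f (Y + t *: b) - t * 'D_b f Y0) s ('D_b f (Y + s *: b) - 'D_b f Y0).
  rewrite !subr0 => sh; apply: der_sub; first exact/der_line/dA/inA.
  by apply: der_val (der_mul (der_id s) (der_cst _ s)); rewrite mulr0 add0r mulr1.
have bphi s : `|s - 0| <= `|h - 0| -> `|'D_b f (Y + s *: b) - 'D_b f Y0| <= eta.
  rewrite !subr0 => sh; rewrite distrC; apply: Hr'; rewrite -ball_normE /ball_ /= distrC.
  by apply: lt_le_trans (inb _ sh) _; rewrite ge_min lexx orbT.
have := mvt_bound_dist dphi bphi.
by rewrite scale0r addr0 mul0r !subr0 addrAC.
Qed.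

Lemma strict_directions (I : eqType) (bs : I -> V) (l : seq I) f A Y0 eta : open A -> A Y0 -> 0 < eta ->
  (forall i Y, A Y -> derivable f Y (bs i)) ->
  (forall i, {for Y0, continuous ('D_(bs i) f)}) ->
  exists2 dl, 0 < dl & forall Y (h : I -> R), `|Y - Y0| < dl -> (forall i, `|h i| < dl) ->
    `|f (Y + \sum_(i <- l) h i *: bs i) - f Y - \sum_(i <- l) h i * 'D_(bs i) f Y0|
      <= eta * \sum_(i <- l) `|h i|.
Proof.
move=> oA AY0 eta0 dA cD; elim: l => [|i l [dl dl0 IH]].
  by exists 1 => // Y h _ _; rewrite !big_nil addr0 subrr subr0 normr0 mulr0.
have [dl' dl'0 sin_H] := strict_direction oA AY0 eta0 (dA i) (cD i).
have b1 : 0 < 1 + `|bs i| by rewrite ltr_pwDl.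
exists (Num.min (dl / (1 + `|bs i|)) dl'); first by rewrite lt_min dl'0 divr_gt0.
move=> Y h; rewrite !lt_min => /andP[HY HY'] Hh; rewrite !big_cons.
have h1 j : `|h j| < dl / (1 + `|bs i|) by have := Hh j; rewrite lt_min => /andP[].
have h2 j : `|h j| < dl' by have := Hh j; rewrite lt_min => /andP[].
have dle : dl / (1 + `|bs i|) <= dl.
  by rewrite ler_pdivrMr// ler_peMr ?(ltW dl0)// lerDl.
have hY : `|Y + h i *: bs i - Y0| < dl.
  rewrite addrAC; apply: le_lt_trans (ler_normD _ _) _.
  have -> : dl = dl / (1 + `|bs i|) + dl / (1 + `|bs i|) * `|bs i|.
    by rewrite -[X in X + _]mulr1 -mulrDr divfK// gt_eqF.
  by apply: ltr_leD => //; rewrite normrZ ler_wpM2r// ltW.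
have A1 := IH (Y + h i *: bs i) h hY (fun j => lt_le_trans (h1 j) dle).
have A2 := sin_H Y (h i) HY' (h2 i).
rewrite addrA mulrDr.
move: A1 A2; set S := \sum_(_ <- _) _ *: _; set SD := \sum_(_ <- _) _ * _.
set SN := \sum_(_ <- _) `|_|; move=> A1 A2.
have -> : f (Y + h i *: bs i + S) - f Y - (h i * 'D_(bs i) f Y0 + SD) =
  (f (Y + h i *: bs i + S) - f (Y + h i *: bs i) - SD) +
  (f (Y + h i *: bs i) - f Y - h i * 'D_(bs i) f Y0) by ring.
by apply: le_trans (ler_normD _ _) _; rewrite addrC lerD.
Qed.

(** Only directional derivatives are available, so the increment along the curve is split into
    increments along the directions [bs], each controlled strictly; continuity of the partial
    derivatives makes the remainder o(|e - e0|). *)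
Lemma chain_rule N (bs : 'I_N -> V) (x : 'I_N -> R -> R) (d : 'I_N -> R) f A (e0 : R) : open A ->
  A (\sum_i x i e0 *: bs i) ->
  (forall i Y, A Y -> derivable f Y (bs i)) ->
  (forall i Y, A Y -> {for Y, continuous ('D_(bs i) f)}) ->
  (forall i, der (x i) e0 (d i)) ->
  der (fun e => f (\sum_i x i e *: bs i)) e0
    (\sum_i d i * 'D_(bs i) f (\sum_i x i e0 *: bs i)).
Proof.
move=> oA AX dA cD dx; set base_state := \sum_i x i e0 *: bs i.
pose lin e := \sum_i (x i e - x i e0) * 'D_(bs i) f base_state.
have dlin : der lin e0 (\sum_i d i * 'D_(bs i) f base_state).
  apply: der_sum => i.
  apply: der_val (der_mul (der_sub (dx i) (der_cst _ _)) (der_cst ('D_(bs i) f base_state) _)).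
  by rewrite mulr0 add0r subr0 mulrC.
pose phi e := f (\sum_i x i e *: bs i) - lin e.
suff dphi : der phi e0 0.
  rewrite -[X in is_derive _ _ _ X]add0r.
  apply: der_ext (der_add dphi dlin) => e.
  by rewrite /phi subrK.
apply: der_small => eta eta0.
pose S := \sum_i (`|d i| + 1).
have S0 : 0 <= S by apply: sumr_ge0 => i _; rewrite addr_ge0.
have eta'0 : 0 < eta / (S + 1) by rewrite divr_gt0// ltr_wpDl.
have [dl dl0 Hdl] := strict_directions (index_enum _) oA AX eta'0 dA (fun i => cD i _ AX).
have lin0 : lin e0 = 0 by rewrite /lin big1// => i _; rewrite subrr mul0r.
near=> e.
have hx i : `|x i e - x i e0| < dl.
  move: i; near: e; apply: filter_forall => i.
  have := der_continuous (dx i); move/cvgrPdist_lt => /(_ _ dl0).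
  by apply: filterS => e; rewrite distrC.
have hl i : `|x i e - x i e0| <= (`|d i| + 1) * `|e - e0|.
  by move: i; near: e; apply: filter_forall => i; exact: der_lip.
have := Hdl base_state (fun i => x i e - x i e0); rewrite subrr normr0 => /(_ dl0 hx).
have -> : base_state + \sum_i (x i e - x i e0) *: bs i = \sum_i x i e *: bs i.
  by rewrite -big_split /=; apply: eq_bigr => i _; rewrite -scalerDl addrC subrK.
rewrite /phi lin0 subr0 -/base_state -/(lin e) addrAC => H; apply: le_trans H _.
apply: le_trans (_ : eta / (S + 1) * (S * `|e - e0|) <= _).
  by rewrite ler_pM2l// mulr_suml; apply: ler_sum => i _; exact: hl.
rewrite mulrA ler_wpM2r// -mulrA ger_pMr// mulrC ler_pdivrMr ?ltr_wpDl//.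
by rewrite mul1r lerDl.
Unshelve. all: by end_near. Qed.

End ChainRule.

Section SmoothEntries.
Context {R : realType} {V : normedModType R}.

Lemma smooth_on_iter (W : normedModType R) (A : set V) (f : V -> W) vs :
  smooth_on A f -> smooth_on A (iter_derive f vs).
Proof.
move=> sf ws x Ax; have := sf (ws ++ vs) x Ax.
suff -> : iter_derive (iter_derive f vs) ws = iter_derive f (ws ++ vs) by [].
by elim: ws => //= w ws ->.
Qed.

Lemma iter_derive_entry p q (A : set V) (f : V -> 'M[R]_(p, q)) i j vs : open A -> smooth_on A f ->
  forall x, A x -> iter_derive (fun x => f x i j : R) vs x = iter_derive f vs x i j.
Proof.
move=> oA sf; elim: vs => [//|v vs IH] x Ax /=.
have [_ /(_ v) dx] := sf vs x Ax.
rewrite (@near_eq_derive _ _ _ _ (fun x => iter_derive f vs x i j)).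
  by rewrite [in RHS]derive_mx// mxE.
by apply: filterS (open_nbhs_nbhs (conj oA Ax)) => y Ay; exact: IH.
Qed.

Lemma smooth_on_entry p q (A : set V) (f : V -> 'M[R]_(p, q)) i j : open A -> smooth_on A f ->
  smooth_on A (fun x => f x i j : R).
Proof.
move=> oA sf vs x Ax; have [cx dx] := sf vs x Ax.
have nE : \near x, iter_derive f vs x i j = iter_derive (fun x => f x i j : R) vs x.
  by apply: filterS (open_nbhs_nbhs (conj oA Ax)) => y Ay; rewrite (iter_derive_entry _ _ _ oA sf).
split; last first.
  by move=> v; exact: (near_eq_derivable nE ((derivable_mxP _ _ _).1 (dx v) i j)).
rewrite /prop_for /continuous_at (iter_derive_entry i j vs oA sf Ax).
apply: cvg_trans (near_eq_cvg nE) _.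
exact: (continuous_comp cx (@coord_continuous _ _ _ i j _)).
Qed.

End SmoothEntries.

(** * Families of functions with uniformly bounded derivatives *)

Section Families.
Context {R : realType} {T : Type}.
Variable D : R -> R -> T -> Prop.
Implicit Types f g : R -> R -> T -> R.

Definition fam_bounded f := exists B, forall e s t, D e s t -> `|f e s t| <= B.

(* Functions of (e, s) with a parameter t : T; all bounds are uniform in t, which
   is how uniformity in theta, phi and the state is obtained. *)
Definition fam_der f fe fs := forall e s t, D e s t ->
  der (fun x => f x s t) e (fe e s t) /\ der (fun x => f e x t) s (fs e s t).

Fixpoint famC (k : nat) f : Prop := fam_bounded f /\
  if k is k'.+1 then exists fe fs, [/\ famC k' fe, famC k' fs & fam_der f fe fs] else True.

Lemma famC_bounded k f : famC k f -> fam_bounded f.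
Proof. by case: k => [|k] []. Qed.

Lemma famC_S k f : famC k.+1 f -> famC k f.
Proof.
elim: k f => [|k IH] f; first by move=> [].
move=> [bf [fe [fs [h1 h2 h3]]]]; split=> //; exists fe, fs; split=> //; exact: IH.
Qed.

Lemma famC_param k (c : T -> R) B : (forall e s t, D e s t -> `|c t| <= B) ->
  famC k (fun _ _ => c).
Proof.
move=> H; have b : forall k, famC k (fun _ _ _ => 0).
  elim=> [|k' IH]; first by split=> //; exists 0 => *; rewrite normr0.
  split; first by exists 0 => *; rewrite normr0.
  exists (fun _ _ _ => 0), (fun _ _ _ => 0); split=> //.
  by move=> e s t _; split; exact: der_cst.
case: k => [|k]; split=> //; try by exists B.
exists (fun _ _ _ => 0), (fun _ _ _ => 0); split=> //.
by move=> e s t _; split; exact: der_cst.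
Qed.

Lemma famC_cst k (c : R) : famC k (fun _ _ _ => c).
Proof. exact: (@famC_param k (fun=> c) `|c|). Qed.

Lemma fam_bounded_add f g : fam_bounded f -> fam_bounded g ->
  fam_bounded (fun e s t => f e s t + g e s t).
Proof.
move=> [B HB] [C HC]; exists (B + C) => e s t Dt.
by apply: le_trans (ler_normD _ _) _; apply: lerD; [exact: HB|exact: HC].
Qed.

Lemma fam_bounded_mul f g : fam_bounded f -> fam_bounded g ->
  fam_bounded (fun e s t => f e s t * g e s t).
Proof.
move=> [B HB] [C HC]; exists (B * C) => e s t Dt.
by rewrite normrM; apply: ler_pM => //; [exact: HB|exact: HC].
Qed.

Lemma famC_add k f g : famC k f -> famC k g -> famC k (fun e s t => f e s t + g e s t).
Proof.
elim: k f g => [|k IH] f g [bf hf] [bg hg]; split=> //; try exact: fam_bounded_add.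
move: hf hg => [fe [fs [h1 h2 h3]]] [ge [gs [g1 g2 g3]]].
exists (fun e s t => fe e s t + ge e s t), (fun e s t => fs e s t + gs e s t); split.
- exact: IH.
- exact: IH.
- move=> e s t Dt; have [a1 a2] := h3 e s t Dt; have [c1 c2] := g3 e s t Dt.
  by split; exact: der_add.
Qed.

Lemma famC_mul k f g : famC k f -> famC k g -> famC k (fun e s t => f e s t * g e s t).
Proof.
elim: k f g => [|k IH] f g Hf Hg; have [bf hf] := Hf; have [bg hg] := Hg;
  split=> //; try exact: fam_bounded_mul.
have Hf' := famC_S Hf; have Hg' := famC_S Hg.
move: hf hg => [fe [fs [h1 h2 h3]]] [ge [gs [g1 g2 g3]]].
exists (fun e s t => f e s t * ge e s t + g e s t * fe e s t),
  (fun e s t => f e s t * gs e s t + g e s t * fs e s t); split.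
- by apply: famC_add; exact: IH.
- by apply: famC_add; exact: IH.
- move=> e s t Dt; have [a1 a2] := h3 e s t Dt; have [c1 c2] := g3 e s t Dt.
  by split; exact: der_mul.
Qed.

Lemma famC_ext k f g : (forall e s t, f e s t = g e s t) -> famC k f -> famC k g.
Proof. by move=> h; rewrite (_ : f = g)//; do 3!apply/funext => ?; exact: h. Qed.

Lemma famC_opp k f : famC k f -> famC k (fun e s t => - f e s t).
Proof.
move=> h; apply: famC_ext (famC_mul (famC_cst k (-1)) h) => e s t.
by rewrite mulN1r.
Qed.

Lemma famC_sub k f g : famC k f -> famC k g -> famC k (fun e s t => f e s t - g e s t).
Proof. by move=> h1 h2; apply: famC_add => //; exact: famC_opp. Qed.

Lemma famC_sum k (I : Type) (l : seq I) (P : pred I) (f : I -> R -> R -> T -> R) :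
  (forall i, famC k (f i)) -> famC k (fun e s t => \sum_(i <- l | P i) f i e s t).
Proof.
move=> H; elim: l => [|i l IH].
  by apply: famC_ext (famC_cst k 0) => e s t; rewrite big_nil.
case Pi : (P i); last by apply: famC_ext IH => e s t; rewrite big_cons Pi.
by apply: famC_ext (famC_add (H i) IH) => e s t; rewrite big_cons Pi.
Qed.

Lemma famC_prod k (I : Type) (l : seq I) (f : I -> R -> R -> T -> R) :
  (forall i, famC k (f i)) -> famC k (fun e s t => \prod_(i <- l) f i e s t).
Proof.
move=> H; elim: l => [|i l IH].
  by apply: famC_ext (famC_cst k 1) => e s t; rewrite big_nil.
by apply: famC_ext (famC_mul (H i) IH) => e s t; rewrite big_cons.
Qed.

Lemma famC_eps k B : (forall e s t, D e s t -> `|e| <= B) -> famC k (fun e _ _ => e).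
Proof.
move=> H; case: k => [|k]; split=> //; try by exists B.
exists (fun _ _ _ => 1), (fun _ _ _ => 0); split; try exact: famC_cst.
by move=> e s t _; split; [exact: der_id|exact: der_cst].
Qed.

Lemma famC_s k B : (forall e s t, D e s t -> `|s| <= B) -> famC k (fun _ s _ => s).
Proof.
move=> H; case: k => [|k]; split=> //; try by exists B.
exists (fun _ _ _ => 0), (fun _ _ _ => 1); split; try exact: famC_cst.
by move=> e s t _; split; [exact: der_cst|exact: der_id].
Qed.

Lemma famC_inv k f B : (forall e s t, D e s t -> f e s t != 0 /\ `|(f e s t)^-1| <= B) ->
  famC k f -> famC k (fun e s t => (f e s t)^-1).
Proof.
move=> H; elim: k => [|k IH] hf; first by split=> //; exists B => e s t /H[].
have Hi := IH (famC_S hf); move: hf => [_ [fe [fs [h1 h2 h3]]]].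
split; first by exists B => e s t /H[].
exists (fun e s t => - (f e s t)^-1 * (f e s t)^-1 * fe e s t),
  (fun e s t => - (f e s t)^-1 * (f e s t)^-1 * fs e s t); split.
- by do 2!apply: famC_mul => //; exact: famC_opp.
- by do 2!apply: famC_mul => //; exact: famC_opp.
- move=> e s t Dt; have [f0 _] := H e s t Dt; have [a1 a2] := h3 e s t Dt.
  by split; [exact: (der_inv f0 a1)|exact: (@der_inv _ (fun x => f e x t) _ _ f0 a2)].
Qed.

(** By the chain rule a derivative of the composite is a finite sum of a derivative of [x i] times
    the composite with a directional derivative of [f], which is smooth again; the induction
    therefore runs over all smooth [f]. Bounds come from continuity on the compact [K], uniformly in
    the parameter. *)
Lemma famC_comp (V : normedModType R) N (bs : 'I_N -> V) (x : 'I_N -> R -> R -> T -> R)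
    (A K : set V) (f : V -> R) k : open A -> smooth_on A f -> compact K -> K `<=` A ->
  (forall e s t, D e s t -> K (\sum_i x i e s t *: bs i)) ->
  (forall i, famC k (x i)) -> famC k (fun e s t => f (\sum_i x i e s t *: bs i)).
Proof.
move=> oA + cK KA XK.
have bdd (g : V -> R) : smooth_on A g -> fam_bounded (fun e s t => g (\sum_i x i e s t *: bs i)).
  move=> sg; have cg : {within K, continuous g}.
    by apply: continuous_in_subspaceT => y /set_mem Ky; have [] := sg [::] y (KA y Ky).
  have [M [_ HM]] := compact_bounded (continuous_compact cg cK).
  exists (M + 1) => e s t Dt; apply: (HM (M + 1)); first by rewrite ltrDl.
  by exists (\sum_i x i e s t *: bs i) => //; exact: XK.
elim: k f => [|k IH] f sf hx; split=> //; try exact: bdd.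
have /choice[xe Hxe] : forall i, exists xe, exists xs,
    [/\ famC k xe, famC k xs & fam_der (x i) xe xs] by move=> i; case: (hx i).
have /choice[xs H] := Hxe.
have hx' i : famC k (x i) by exact: famC_S.
exists (fun e s t => \sum_i xe i e s t * 'D_(bs i) f (\sum_i x i e s t *: bs i)),
  (fun e s t => \sum_i xs i e s t * 'D_(bs i) f (\sum_i x i e s t *: bs i)); split.
- apply: famC_sum => i; apply: famC_mul; first by case: (H i).
  exact: (IH ('D_(bs i) f) (smooth_on_iter [:: bs i] sf) hx').
- apply: famC_sum => i; apply: famC_mul; first by case: (H i).
  exact: (IH ('D_(bs i) f) (smooth_on_iter [:: bs i] sf) hx').
- move=> e s t Dt; have AX := KA _ (XK e s t Dt).
  have dA i Y : A Y -> derivable f Y (bs i) by move=> /(sf [::])[].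
  have cD i Y : A Y -> {for Y, continuous ('D_(bs i) f)} by move=> /(sf [:: bs i])[].
  split.
    apply: (@chain_rule _ _ N bs (fun i e => x i e s t) _ f A) => // i.
    by case: (H i) => _ _ /(_ e s t Dt)[].
  apply: (@chain_rule _ _ N bs (fun i s => x i e s t) _ f A) => // i.
  by case: (H i) => _ _ /(_ e s t Dt)[].
Qed.

End Families.

Section BoxComposition.
Context {R : realType} {T : Type}.
Variable D : R -> R -> T -> Prop.

(** The compact set is the image of a product of segments under the linear map with columns [bs], so
    bounds on the coordinates suffice. *)
Lemma famC_comp_box (V : normedModType R) N (bs : 'I_N -> V) (x : 'I_N -> R -> R -> T -> R)
    (A : set V) (f : V -> R) (c B : 'I_N -> R) k : open A -> smooth_on A f ->
  (forall y : 'I_N -> R, (forall i, `|y i - c i| <= B i) -> A (\sum_i y i *: bs i)) ->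
  (forall e s t i, D e s t -> `|x i e s t - c i| <= B i) ->
  (forall i, famC D k (x i)) -> famC D k (fun e s t => f (\sum_i x i e s t *: bs i)).
Proof.
move=> oA sf AB xB hx.
pose box := [set y : 'rV[R]_N | forall i, `[c i - B i, c i + B i]%classic (y 0 i)].
have cbox : compact box by apply: (@rV_compact R N (fun i => `[c i - B i, c i + B i]%classic)) => i; exact: segment_compact.
pose L (y : 'rV[R]_N) := \sum_i y 0 i *: bs i.
have cL : continuous L.
  have H (l : seq 'I_N) : continuous (fun y : 'rV[R]_N => \sum_(i <- l) y 0 i *: bs i).
    elim: l => [|i l IH] y.
      have -> : (fun y : 'rV[R]_N => \sum_(i <- [::]) y 0 i *: bs i) = (fun=> 0).
        by apply/funext => z; rewrite big_nil.
      exact: cst_continuous.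
    have -> : (fun y : 'rV[R]_N => \sum_(i <- i :: l) y 0 i *: bs i) =
        (fun y : 'rV[R]_N => y 0 i *: bs i + \sum_(i <- l) y 0 i *: bs i).
      by apply/funext => z; rewrite big_cons.
    have c1 : {for y, continuous (fun y : 'rV[R]_N => y 0 i *: bs i)}.
      apply: (continuous_comp (g := fun a : R => a *: bs i)); first exact: coord_continuous.
      exact: scalel_continuous.
    exact: (@cvgD _ _ _ _ _ _ _ _ _ c1 (IH y)).
  exact: H.
have inbox (y : 'I_N -> R) : (forall i, `|y i - c i| <= B i) -> (L @` box) (\sum_i y i *: bs i).
  move=> Hy; exists (\row_i y i); last by apply: eq_bigr => i _; rewrite mxE.
  move=> i /=; rewrite mxE in_itv /=; have := Hy i; rewrite ler_norml => /andP[? ?].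
  by apply/andP; split; lra.
apply: (famC_comp (A := A) (K := L @` box)) => //.
- apply: continuous_compact => //; exact: continuous_subspaceT.
- move=> _ [y yb <-]; apply: AB => i; have := yb i; rewrite /= in_itv /= => /andP[? ?].
  by rewrite ler_norml; apply/andP; split; lra.
- by move=> e s t Dt; apply: inbox => i; exact: xB.
Qed.

End BoxComposition.

Section DetContinuity.
Context {R : realType} {V : normedModType R}.

Lemma cvg_sum_seq (I : Type) (l : seq I) (f : I -> V -> R) (a : I -> R) (x : V) :
  (forall i, f i @ x --> a i) -> (fun y => \sum_(i <- l) f i y) @ x --> \sum_(i <- l) a i.
Proof.
move=> H; elim: l => [|i l IH].
  rewrite big_nil (_ : (fun _ => _) = (fun=> 0)); first exact: cvg_cst.
  by apply/funext => z; rewrite big_nil.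
rewrite big_cons (_ : (fun _ => _) = (fun y => f i y + \sum_(i <- l) f i y)); first exact: cvgD.
by apply/funext => z; rewrite big_cons.
Qed.

Lemma cvg_prod_seq (I : Type) (l : seq I) (f : I -> V -> R) (a : I -> R) (x : V) :
  (forall i, f i @ x --> a i) -> (fun y => \prod_(i <- l) f i y) @ x --> \prod_(i <- l) a i.
Proof.
move=> H; elim: l => [|i l IH].
  rewrite big_nil (_ : (fun _ => _) = (fun=> 1)); first exact: cvg_cst.
  by apply/funext => z; rewrite big_nil.
rewrite big_cons (_ : (fun _ => _) = (fun y => f i y * \prod_(i <- l) f i y)); first exact: cvgM.
by apply/funext => z; rewrite big_cons.
Qed.

Lemma cvg_det n (M : V -> 'M[R]_n) (x : V) : (forall i j, (fun y => M y i j) @ x --> M x i j) ->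
  (fun y => \det (M y)) @ x --> \det (M x).
Proof.
move=> H; apply: cvg_sum_seq => s; apply: cvgM; first exact: cvg_cst.
exact: cvg_prod_seq.
Qed.

End DetContinuity.

Section FamilyDet.
Context {R : realType} {T : Type}.
Variable D : R -> R -> T -> Prop.

Lemma famC_det n k (M : R -> R -> T -> 'M[R]_n) :
  (forall i j, famC D k (fun e s t => M e s t i j)) -> famC D k (fun e s t => \det (M e s t)).
Proof.
move=> H; apply: famC_sum => p; apply: famC_mul; first exact: famC_cst.
by apply: famC_prod => i; exact: H.
Qed.

Lemma famC_adj n k (M : R -> R -> T -> 'M[R]_n) :
  (forall i j, famC D k (fun e s t => M e s t i j)) ->
  forall i j, famC D k (fun e s t => \adj (M e s t) i j).
Proof.
move=> H i j.
have : famC D k (fun e s t => (-1) ^+ (j + i) * \det (row' j (col' i (M e s t)))).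
  apply: famC_mul; first exact: famC_cst.
  apply: famC_det => a b.
  by apply: famC_ext (H (lift j a) (lift i b)) => e s t; rewrite !mxE.
by apply: famC_ext => e s t; rewrite mxE.
Qed.

Lemma famC_mulmx n p q k (M : R -> R -> T -> 'M[R]_(n, p)) (N : R -> R -> T -> 'M[R]_(p, q)) :
  (forall i j, famC D k (fun e s t => M e s t i j)) ->
  (forall i j, famC D k (fun e s t => N e s t i j)) ->
  forall i j, famC D k (fun e s t => (M e s t *m N e s t) i j).
Proof.
move=> HM HN i j.
have : famC D k (fun e s t => \sum_l M e s t i l * N e s t l j).
  by apply: famC_sum => l; exact: famC_mul.
by apply: famC_ext => e s t; rewrite mxE.
Qed.

End FamilyDet.

(** * The nonlinear part of the vector field *)

Section VectorFieldFamily.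
Context {R : realType} {n : nat}.
Local Notation vec := 'cV[R]_n.
Local Notation mat := 'M[R]_n.
Variables (F : vec -> R -> R -> vec) (lams r : R) (v : R -> R -> vec) (P : R -> R -> mat).
Let Fhat := fun x : vec * R * R => F x.1.1 x.1.2 x.2.
Hypothesis r_gt0 : 0 < r.
Hypothesis F_smooth : smooth_on setT Fhat.
Let AR := [set x : R * R | `|x.2 - lams| < r].
Hypothesis v_smooth : smooth_on AR (fun x => v x.1 x.2).
Hypothesis P_smooth : smooth_on AR (fun x => P x.1 x.2).
Hypothesis P_unit : forall th lam, `|lam - lams| < r -> P th lam \in unitmx.

(** Cramer's formula writes the entries of the inverse as quotients of polynomials in the entries of
    [P], for which regularity of families is inherited. *)
Definition Pinv th lam := (\det (P th lam))^-1 *: \adj (P th lam).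

Definition jacobian (u : vec) (th lam : R) : mat :=
  \matrix_(i, j) ('D_(delta_mx j 0) (fun u => F u th lam) u) i 0.

(** eps times the part of G beyond E z, written with the Jacobian in place of the derivative of [P]
    thanks to the Floquet identity. There is no division by eps, so smoothness at eps = 0 is
    visible, and the expression vanishes there to second order. *)
Definition gfun (z : vec) (lam th e : R) : vec :=
  Pinv th lam *m (F (v th lam + e *: (P th lam *m z)) th lam - F (v th lam) th lam
    - e *: (jacobian (v th lam) th lam *m (P th lam *m z))).

Lemma open_AR : open AR.
Proof.
rewrite openE => x /= xr; apply/nbhs_ballP; exists (r - `|x.2 - lams|) => /=; first by rewrite subr_gt0.
move=> y [_]; rewrite /ball /= => h.
rewrite distrC in h; have := ler_normD (y.2 - x.2) (x.2 - lams); rewrite addrA subrK /AR /=; lra.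
Qed.

(** A basis of the product space on which F is smooth; the chain rule needs the arguments of F as
    combinations of fixed directions, with coefficients [xF]. *)
Definition bsF (i : 'I_(n + 2)) : vec * R * R :=
  match fintype.split i with
  | inl j => (delta_mx j 0, 0, 0)
  | inr j => if j == 0 then (0, 1, 0) else (0, 0, 1)
  end.

Definition xF (u : 'I_n -> R) (th lam : R) (i : 'I_(n + 2)) : R :=
  match fintype.split i with
  | inl j => u j
  | inr j => if j == 0 then th else lam
  end.

Lemma sum_bsF u th lam : \sum_i xF u th lam i *: bsF i = (\col_j u j, th, lam).
Proof.
rewrite big_split_ord /= !big_ord_recl big_ord0 addr0.
rewrite /xF /bsF !(unsplitK (inr _)) /=.
have -> : \sum_(i < n) xF u th lam (lshift 2 i) *: bsF (lshift 2 i) = (\col_j u j, 0, 0).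
  have -> : \col_j u j = \sum_(i < n) u i *: delta_mx i 0 :> vec.
    apply/colP => i; rewrite mxE summxE (bigD1 i)//= big1 ?addr0 => [|j ji].
      by rewrite !mxE !eqxx mulr1.
    by rewrite !mxE eq_sym (negPf ji) mulr0.
  have Hl (l : seq 'I_n) : \sum_(i <- l) xF u th lam (lshift 2 i) *: bsF (lshift 2 i) =
      (\sum_(i <- l) u i *: delta_mx i 0, 0, 0).
    elim: l => [|j l IH]; first by rewrite !big_nil.
    rewrite !big_cons IH /xF /bsF (unsplitK (inl _)).
    by congr (_, _, _); rewrite /= ?scaler0 ?addr0.
  exact: Hl.
by congr (_, _, _); rewrite /= ?scaler0 ?scale0r ?addr0 ?add0r // /GRing.scale /= ?mulr1 ?mulr0 ?addr0 ?add0r.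
Qed.

Definition bs2 (i : 'I_2) : R * R := if i == 0 then (1, 0) else (0, 1).
Definition x2 (a b : R) (i : 'I_2) : R := if i == 0 then a else b.

Lemma sum_bs2 a b : \sum_i x2 a b i *: bs2 i = (a, b).
Proof.
rewrite !big_ord_recl big_ord0 addr0 /x2 /bs2 /=.
by congr (_, _); rewrite /= /GRing.scale /= ?mulr1 ?mulr0 ?addr0 ?add0r.
Qed.

Lemma det_inv_bounded Bth : exists B, forall th lam, `|th| <= Bth -> `|lam - lams| <= r / 2 ->
  `|(\det (P th lam))^-1| <= B.
Proof.
pose K := `[- Bth, Bth]%classic `*` `[lams - r / 2, lams + r / 2]%classic.
have cK : compact K by apply: compact_setX; exact: segment_compact.
have KA : K `<=` AR.
  move=> x [_]; rewrite /= in_itv /= => /andP[? ?]; rewrite /AR /= ltr_norml.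
  by move: r_gt0 => ?; apply/andP; split; lra.
pose d (x : R * R) := (\det (P x.1 x.2))^-1.
have cd : {within K, continuous d}.
  apply: continuous_in_subspaceT => x /set_mem /KA Ax; apply: cvgV.
    by have := P_unit x.1 Ax; rewrite unitmxE unitfE.
  apply: (@cvg_det _ _ _ (fun x : R * R => P x.1 x.2) x) => i j.
  by have [] := smooth_on_entry i j open_AR P_smooth [::] Ax.
have [M [_ HM]] := compact_bounded (continuous_compact cd cK).
exists (M + 1) => th lam hth hlam; apply: (HM (M + 1)); first by rewrite ltrDl.
exists (th, lam) => //; move: hth hlam; rewrite !ler_norml => /andP[? ?] /andP[? ?].
by split; rewrite /= in_itv /=; apply/andP; split; lra.
Qed.

(** Smoothness is assumed for F as a function of all its arguments; this expresses the Jacobian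
    entries as directional derivatives of that function, hence as smooth functions too. *)
Lemma jacobianE u th lam i j :
  jacobian u th lam i j = 'D_(bsF (lshift 2 j)) (fun x => Fhat x i 0) (u, th, lam).
Proof.
have dF : derivable (fun u => F u th lam) u (delta_mx j 0).
  have [_ /(_ (bsF (lshift 2 j)))] := F_smooth [::] (I : setT (u, th, lam)).
  rewrite /derivable /= /Fhat /bsF (unsplitK (inl _)) /=.
  set f1 := (fun h => _); set f2 := (fun h => _); suff -> : f2 = f1 by [].
  by apply/funext => h; rewrite /f1 /f2 !scaler0 !add0r.
rewrite mxE derive_mx// mxE /derive /Fhat /bsF (unsplitK (inl _)) /=.
set f1 := (fun h => _); set f2 := (fun h => _); suff -> : f1 = f2 by [].
by apply/funext => h; rewrite /f1 /f2 !scaler0 !add0r.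
Qed.

Section Curves.
Context {T : Type}.
Variables (D : R -> R -> T -> Prop) (k : nat) (Bz Bth : R).
Variables (z : R -> R -> T -> vec) (lam th : R -> R -> T -> R).
Hypothesis z_fam : forall i, famC D k (fun e s t => z e s t i 0).
Hypothesis lam_fam : famC D k lam.
Hypothesis th_fam : famC D k th.
Hypothesis D_bound : forall e s t, D e s t -> [/\ forall i, `|z e s t i 0| <= Bz,
  `|lam e s t - lams| <= r / 2, `|th e s t| <= Bth & `|e| <= 1].

Lemma fam_th_lam (f : R * R -> R) : smooth_on AR f ->
  famC D k (fun e s t => f (th e s t, lam e s t)).
Proof.
move=> sf.
apply: famC_ext (fun e s t => congr1 f (sum_bs2 (th e s t) (lam e s t))) _.
apply: (famC_comp_box (A := AR) (c := x2 0 lams) (B := x2 Bth (r / 2))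
  (x := fun i e s t => x2 (th e s t) (lam e s t) i)) => //.
- exact: open_AR.
- move=> y Hy; rewrite (_ : \sum_i y i *: bs2 i = (y 0, y 1)).
    by have := Hy 1; rewrite /x2 /AR /= => h; move: r_gt0 => ?; apply: le_lt_trans h _; lra.
  rewrite -sum_bs2; apply: eq_bigr => i _; congr (_ *: _).
  by have [->|->] := ord2P i.
- move=> e s t i Dt; have [_ h1 h2 _] := D_bound Dt.
  by have [->|->] := ord2P i; rewrite /x2 //= subr0.
- by move=> i; have [->|->] := ord2P i.
Qed.

Lemma fam_F (f : vec * R * R -> R) (u : R -> R -> T -> vec) Bu : smooth_on setT f ->
  (forall i, famC D k (fun e s t => u e s t i 0)) ->
  (forall e s t i, D e s t -> `|u e s t i 0| <= Bu) ->
  famC D k (fun e s t => f (u e s t, th e s t, lam e s t)).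
Proof.
move=> sf ufam uB.
have E e s t : \sum_i xF (fun j => u e s t j 0) (th e s t) (lam e s t) i *: bsF i =
    (u e s t, th e s t, lam e s t).
  by rewrite sum_bsF; congr (_, _, _); apply/colP => i; rewrite mxE.
apply: famC_ext (fun e s t => congr1 f (E e s t)) _.
apply: (famC_comp_box (A := setT) (c := xF (fun=> 0) 0 lams) (B := xF (fun=> Bu) Bth (r / 2))
  (x := fun i e s t => xF (fun j => u e s t j 0) (th e s t) (lam e s t) i)) => //.
- exact: openT.
- move=> e s t i Dt; have [_ h1 h2 _] := D_bound Dt; rewrite /xF.
  by case: (fintype.split i) => j; [rewrite subr0; exact: uB|case: (j == 0) => //; rewrite subr0].
- move=> i; rewrite /xF; case: (fintype.split i) => j; first exact: ufam.
  by case: (j == 0).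
Qed.

Lemma fam_v i : famC D k (fun e s t => v (th e s t) (lam e s t) i 0).
Proof. exact: (fam_th_lam (smooth_on_entry i 0 open_AR v_smooth)). Qed.

Lemma fam_P i j : famC D k (fun e s t => P (th e s t) (lam e s t) i j).
Proof. exact: (fam_th_lam (smooth_on_entry i j open_AR P_smooth)). Qed.

Lemma fam_Pinv i j : famC D k (fun e s t => Pinv (th e s t) (lam e s t) i j).
Proof.
have [B HB] := det_inv_bounded Bth.
have H : famC D k (fun e s t => (\det (P (th e s t) (lam e s t)))^-1 * \adj (P (th e s t) (lam e s t)) i j).
  apply: famC_mul; last by apply: famC_adj => a b; exact: fam_P.
  apply: (famC_inv (B := B)); last by apply: famC_det => a b; exact: fam_P.
  move=> e s t Dt; have [_ h1 h2 _] := D_bound Dt; split; last exact: HB.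
  have := P_unit (th e s t) (lam := lam e s t); rewrite unitmxE unitfE; apply.
  by move: r_gt0 => ?; apply: le_lt_trans h1 _; lra.
by apply: famC_ext H => e s t; rewrite /Pinv [RHS]mxE.
Qed.

Lemma fam_gfun i : famC D k (fun e s t => gfun (z e s t) (lam e s t) (th e s t) e i 0).
Proof.
have Pz : forall i j, famC D k (fun e s t => (P (th e s t) (lam e s t) *m z e s t) i j).
  apply: famC_mulmx => a b; first exact: fam_P.
  by apply: famC_ext (z_fam a) => e s t; rewrite ord1.
have he : famC D k (fun e _ _ => e) by apply: (@famC_eps R T D k 1) => e s t /D_bound[].
pose w e s t := v (th e s t) (lam e s t) + e *: (P (th e s t) (lam e s t) *m z e s t).
have wfam j : famC D k (fun e s t => w e s t j 0).
  apply: famC_ext (famC_add (fam_v j) (famC_mul he (Pz j 0))) => e s t.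
  by rewrite /w; move: (P _ _ *m _) => y; rewrite !mxE.
have bound_of (u : R -> R -> T -> vec) : (forall i, famC D k (fun e s t => u e s t i 0)) ->
    exists Bu, forall e s t i, D e s t -> `|u e s t i 0| <= Bu.
  move=> ufam; have /choice[B HB] : forall i, fam_bounded D (fun e s t => u e s t i 0).
    by move=> j; exact: famC_bounded (ufam j).
  exists (\sum_i `|B i|) => e s t j Dt; apply: le_trans (HB j e s t Dt) _.
  by rewrite (bigD1 j)//= (le_trans (ler_norm _))// lerDl sumr_ge0.
have sF j : smooth_on setT (fun x => Fhat x j 0) by exact: smooth_on_entry openT F_smooth.
have [Bw HBw] := bound_of w wfam.
have [Bv HBv] := bound_of _ fam_v.
have JPz : forall a b, famC D k (fun e s t =>
    (jacobian (v (th e s t) (lam e s t)) (th e s t) (lam e s t) *m (P (th e s t) (lam e s t) *m z e s t)) a b).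
  apply: famC_mulmx => // a b.
  apply: famC_ext (fun e s t => esym (jacobianE _ _ _ _ _)) _.
  exact: (fam_F (Bu := Bv) (f := 'D_(bsF (lshift 2 b)) (fun x => Fhat x a 0)) (smooth_on_iter [:: bsF (lshift 2 b)] (sF a)) fam_v HBv).
have inner : forall a b, famC D k (fun e s t =>
    (F (w e s t) (th e s t) (lam e s t) - F (v (th e s t) (lam e s t)) (th e s t) (lam e s t)
    - e *: (jacobian (v (th e s t) (lam e s t)) (th e s t) (lam e s t) *m (P (th e s t) (lam e s t) *m z e s t))) a b).
  move=> a b.
  have h1 : famC D k (fun e s t => F (w e s t) (th e s t) (lam e s t) a 0).
    exact: (fam_F (sF a) wfam HBw).
  have h2 : famC D k (fun e s t => F (v (th e s t) (lam e s t)) (th e s t) (lam e s t) a 0).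
    exact: (fam_F (sF a) fam_v HBv).
  apply: famC_ext (famC_sub (famC_sub h1 h2) (famC_mul he (JPz a 0))) => e s t.
  by rewrite ord1; move: (jacobian _ _ _ *m _) => y; rewrite !mxE.
exact: (famC_mulmx fam_Pinv inner i 0).
Qed.

End Curves.
End VectorFieldFamily.

(** * Taylor expansion in eps and odd parts *)

Section Taylor.
Context {R : realType}.

Lemma der_expn j (x : R) : der (fun y : R => y ^+ j.+1) x (j.+1%:R * x ^+ j).
Proof.
elim: j => [|j IH]; first by rewrite expr0 mulr1; exact: der_id.
apply: der_ext (fun y => esym (exprS _ _)) _.
apply: der_val (der_mul (der_id x) IH).
by rewrite mulrCA -exprS mulr1 -[j.+2%:R]natr1 mulrDl mul1r.
Qed.

(** Induction through the eps-derivative: its Taylor polynomial is integrated and the mean value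
    theorem bounds the rest. The coefficients may depend on [s] and [t], but the constant may not.
    The domain must contain, with a value of eps, all values of smaller modulus. *)
Lemma famC_taylor (T : Type) (D : R -> R -> T -> Prop) k f :
  (forall e x s t, D e s t -> `|x| <= `|e| -> D x s t) -> famC D k f ->
  exists2 C, 0 <= C & forall s t, exists c : nat -> R, forall e, D e s t ->
    `|f e s t - \sum_(j < k) c j * e ^+ j| <= C * `|e| ^+ k.
Proof.
move=> star; elim: k f => [|k IH] f Hf.
  have [B HB] := famC_bounded Hf; exists `|B| => // s t; exists (fun=> 0) => e Dt.
  by rewrite big_ord0 subr0 expr0 mulr1; apply: le_trans (HB e s t Dt) (ler_norm _).
have [_ [fe [fs [h1 h2 h3]]]] := Hf; have [C C0 HC] := IH fe h1.
exists C => // s t; have [c cos_H] := HC s t.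
exists (fun j => if j is j'.+1 then c j' / j'.+1%:R else f 0 s t) => e Dt.
pose p x := \sum_(j < k.+1) (if (j : nat) is j'.+1 then c j' / j'.+1%:R else f 0 s t) * x ^+ j.
have dp (x : R) : der p x (\sum_(j < k) c j * x ^+ j).
  have pE y : f 0 s t + \sum_(j < k) (c j / j.+1%:R) * y ^+ j.+1 = p y.
    by rewrite /p big_ord_recl expr0 mulr1.
  apply: der_ext pE _; rewrite -[X in is_derive _ _ _ X]add0r; apply: der_add.
  apply: der_sum => j.
  apply: der_val (der_scale (c j / j.+1%:R) (der_expn j x)).
  by rewrite mulrA divfK// pnatr_eq0.
have p0 : p 0 = f 0 s t.
  rewrite /p big_ord_recl expr0 mulr1 big1 ?addr0// => j _.
  by rewrite exprS mul0r mulr0.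
have := @mvt_bound_dist _ (fun x => f x s t - p x) (fun x => fe x s t - \sum_(j < k) c j * x ^+ j) 0 e (C * `|e| ^+ k).
rewrite p0 subrr !subr0 -mulrA -exprSr; apply => x; rewrite !subr0 => xe.
  by have [d _] := h3 x s t (star _ _ _ _ Dt xe); exact: der_sub d (dp x).
apply: le_trans (cos_H x (star _ _ _ _ Dt xe)) _.
by apply: ler_wpM2l => //; apply: lerXn2r; rewrite ?nnegrE.
Qed.

Lemma small_le0 (x K e1 : R) : 0 < e1 -> (forall e, 0 < e -> e < e1 -> x <= K * e) -> x <= 0.
Proof.
move=> e10 H; rewrite leNgt; apply/negP => x0.
have K0 : 0 < `|K| + 1 by rewrite ltr_wpDl.
pose e := Num.min (e1 / 2) (x / (2 * (`|K| + 1))).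
have e0 : 0 < e by rewrite lt_min !divr_gt0// mulr_gt0.
have ee1 : e < e1 by apply: le_lt_trans (_ : e1 / 2 < _); [rewrite ge_min lexx|lra].
have := H e e0 ee1; apply/negP; rewrite -ltNge.
apply: le_lt_trans (_ : x / 2 < _); last lra.
apply: le_trans (_ : (`|K| + 1) * e <= _).
  by apply: ler_wpM2r; [exact: ltW|have := ler_norm K; lra].
rewrite mulrC -ler_pdivlMr// -mulrA -invfM ge_min; apply/orP; right.
by rewrite [2 * _]mulrC.
Qed.

(** The constant term is itself O(e), hence 0; dividing by [e] lowers the degree and the order by
    one. *)
Lemma poly_small_coef0 k (c : nat -> R) (C e1 : R) : 0 < e1 ->
  (forall e, 0 < e -> e < e1 -> `|\sum_(j < k) c j * e ^+ j| <= C * e ^+ k) ->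
  forall j, (j < k)%N -> c j = 0.
Proof.
move=> e10; elim: k c => [//|k IH] c H.
have e1' : 0 < Num.min e1 1 by rewrite lt_min e10 ltr01.
have c0 : c 0%N = 0.
  apply/eqP; rewrite -normr_le0.
  apply: (@small_le0 _ (`|C| + \sum_(j < k) `|c j.+1|) (Num.min e1 1)) => // e e0.
  rewrite lt_min => /andP[ee1 /ltW e1le]; have := H e e0 ee1; rewrite big_ord_recl expr0 mulr1.
  set S := \sum_(i < k) _ => HS.
  have eX j : e ^+ j.+1 <= e by rewrite exprS ger_pMr// exprn_ile1// ltW.
  have bS : `|S| <= (\sum_(j < k) `|c j.+1|) * e.
    apply: le_trans (ler_norm_sum _ _ _) _; rewrite mulr_suml; apply: ler_sum => j _.
    rewrite normrM ler_wpM2l// ger0_norm; first exact: eX.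
    by rewrite exprn_ge0// ltW.
  have hC : C * e ^+ k.+1 <= `|C| * e.
    exact: le_trans (ler_wpM2r (exprn_ge0 _ (ltW e0)) (ler_norm C)) (ler_wpM2l (normr_ge0 C) (eX k)).
  rewrite mulrDl; have := ler_normB (c 0%N + S) S; rewrite addrK; lra.
case=> [//|j] jk; apply: (IH (fun j => c j.+1)) => // e e0 ee1.
have := H e e0 ee1; rewrite big_ord_recl c0 mul0r add0r.
rewrite (_ : \sum_(i < k) _ = e * \sum_(i < k) c i.+1 * e ^+ i).
  by rewrite normrM (gtr0_norm e0) exprS mulrCA ler_pM2l.
by rewrite mulr_sumr; apply: eq_bigr => i _; rewrite exprS mulrCA.
Qed.

(* The even part of the Taylor polynomial of [f] cancels in [f e - f (- e)], so an *)
(* error of order 4 is automatically of order 5. *)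
Lemma odd_gain (f : R -> R) (c q : nat -> R) (C C2 e1 : R) : 0 < e1 -> e1 <= 1 -> 0 <= C ->
  (forall e, `|e| < e1 -> `|f e - \sum_(j < 5) c j * e ^+ j| <= C * `|e| ^+ 5) ->
  (forall e, `|e| < e1 -> `|f e - f (- e) - \sum_(j < 4) q j * e ^+ j| <= C2 * `|e| ^+ 4) ->
  forall e, `|e| < e1 -> `|f e - f (- e) - \sum_(j < 4) q j * e ^+ j| <= 2 * C * `|e| ^+ 5.
Proof.
move=> e10 e1le C0 H1 H2.
(* The coefficients of the difference of the two Taylor polynomials minus the given cubic. The power
   e^4 is even and cancels, so only degrees below 4 remain, and the order-4 bound forces these
   coefficients to vanish. *)
pose b j : R := (if odd j then 2 * c j else 0) - q j.
have E e : (\sum_(j < 5) c j * e ^+ j) - (\sum_(j < 5) c j * (- e) ^+ j) - \sum_(j < 4) q j * e ^+ j =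
    \sum_(j < 4) b j * e ^+ j.
  by rewrite /b !big_ord_recl !big_ord0 /= /bump /=; ring.
have G e : `|e| < e1 -> `|f e - f (- e) - (\sum_(j < 5) c j * e ^+ j - \sum_(j < 5) c j * (- e) ^+ j)|
    <= 2 * C * `|e| ^+ 5.
  move=> he; have h1 := H1 e he; have := H1 (- e); rewrite normrN => /(_ he) h2.
  set A := \sum_(j < 5) c j * e ^+ j in h1 *; set B := \sum_(j < 5) c j * (- e) ^+ j in h2 *.
  have -> : f e - f (- e) - (A - B) = (f e - A) - (f (- e) - B) by ring.
  apply: le_trans (ler_normB _ _) _.
  by move: h1 h2; set X := _ ^+ 5; lra.
have b0 : forall j, (j < 4)%N -> b j = 0.
  apply: (@poly_small_coef0 4 b (C2 + 2 * C) e1) => // e e0 ee1.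
  have he : `|e| < e1 by rewrite gtr0_norm.
  have h1 := G e he; have h2 := H2 e he; rewrite -E; move: h1 h2.
  set A := \sum_(j < 5) c j * e ^+ j; set B := \sum_(j < 5) c j * (- e) ^+ j.
  set Q := \sum_(j < 4) _ => h1 h2.
  have -> : A - B - Q = (f e - f (- e) - Q) - (f e - f (- e) - (A - B)) by ring.
  apply: le_trans (ler_normB _ _) _; rewrite mulrDl; rewrite (gtr0_norm e0) in h1 h2.
  apply: lerD => //; apply: le_trans h1 _.
  have C20 : 0 <= 2 * C by lra.
  apply: ler_wpM2l => //; rewrite exprSr ger_pMr ?exprn_gt0//.
  by apply: le_trans (ltW ee1) _.
move=> e he; have h1 := G e he; have h := E e.
rewrite [in RHS]big1 in h => [|j _]; last by rewrite b0 ?mul0r.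
move/eqP: h; rewrite subr_eq0 => /eqP h; rewrite -h.
exact: h1.
Qed.

End Taylor.

Section UniformConstant.
Context {R : realType}.

Lemma uniform_constant (I : finType) (Q : I -> R -> Prop) :
  (forall i C C', C <= C' -> Q i C -> Q i C') -> (forall i, exists C, Q i C) ->
  exists2 C, 0 <= C & forall i, Q i C.
Proof.
move=> mono /choice[c cos_H]; exists (\sum_i `|c i|) => [|i]; first exact: sumr_ge0.
apply: mono (cos_H i); rewrite (bigD1 i)//= (le_trans (ler_norm _))// lerDl sumr_ge0//.
Qed.

End UniformConstant.

(** * Quadratic smallness in eps and Lipschitz bounds of the remainder *)

Section VectorFieldEstimates.
Context {R : realType} {n : nat}.
Local Notation vec := 'cV[R]_n.
Local Notation mat := 'M[R]_n.
Variables (F : vec -> R -> R -> vec) (lams r : R) (v : R -> R -> vec) (P : R -> R -> mat).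
Let Fhat := fun x : vec * R * R => F x.1.1 x.1.2 x.2.
Hypothesis r_gt0 : 0 < r.
Hypothesis F_smooth : smooth_on setT Fhat.
Let AR := [set x : R * R | `|x.2 - lams| < r].
Hypothesis v_smooth : smooth_on AR (fun x => v x.1 x.2).
Hypothesis P_smooth : smooth_on AR (fun x => P x.1 x.2).
Hypothesis P_unit : forall th lam, `|lam - lams| < r -> P th lam \in unitmx.
Local Notation g := (gfun F v P).

Lemma gfun0 z lam th : g z lam th 0 = 0.
Proof. by rewrite /gfun !scale0r addr0 subrr subr0 mulmx0. Qed.

Lemma gfun0E z lam th i : g z lam th 0 i 0 = 0.
Proof. by rewrite gfun0 mxE. Qed.

Lemma der_F_ray (u w : vec) th lam j :
  der (fun e : R => F (u + e *: w) th lam j 0) (0 : R) ((jacobian F u th lam *m w) j 0).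
Proof.
pose x i e := xF (fun l => u l 0 + e * w l 0) th lam i : R.
pose d i := xF (fun l => w l 0) 0 0 i : R.
have E e : \sum_i x i e *: bsF i = (u + e *: w, th, lam).
  by rewrite sum_bsF; congr (_, _, _); apply/colP => i; rewrite !mxE.
have dx i : der (x i) (0 : R) (d i).
  rewrite /x /d /xF; case: (fintype.split i) => l.
    apply: der_val (der_add (der_cst _ _) (der_mul (der_id 0) (der_cst (w l 0) _))).
    by rewrite mul0r !add0r mulr1.
  by case: (l == 0); exact: der_cst.
have sF : smooth_on setT (fun y => Fhat y j 0) by exact: smooth_on_entry openT F_smooth.
have := @chain_rule R _ _ (@bsF R n) x d (fun y => Fhat y j 0) setT 0 openT I.
have -> : (fun e => Fhat (\sum_i x i e *: bsF i) j 0) = (fun e => F (u + e *: w) th lam j 0).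
  by apply/funext => e; rewrite E.
rewrite E scale0r addr0 => H.
have {}H := H (fun i Y _ => (sF [::] Y I).2 (bsF i)) (fun i Y _ => (sF [:: bsF i] Y I).1) dx.
apply: der_val H; rewrite big_split_ord /= [X in _ + X]big1 ?addr0 => [|i _]; last first.
  by rewrite /d /xF (unsplitK (inr _)); case: (i == 0); rewrite mul0r.
rewrite mxE; apply: eq_bigr => i _.
by rewrite jacobianE // /d /xF (unsplitK (inl _)) mulrC.
Qed.

(** The subtracted Jacobian term is exactly the first-order term of F along the ray. *)
Lemma der_gfun0 z lam th i : der (fun e : R => g z lam th e i 0) (0 : R) 0.
Proof.
set u := v th lam; set w := P th lam *m z.
have H j : der (fun e : R => (F (u + e *: w) th lam - F u th lam
    - e *: (jacobian F u th lam *m w)) j 0) (0 : R) 0.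
  have h := der_sub (der_sub (der_F_ray u w th lam j) (der_cst (F u th lam j 0) 0))
    (der_mul (der_id 0) (der_cst ((jacobian F u th lam *m w) j 0) 0)).
  apply: der_ext (der_val _ h) => [e|]; last by rewrite mul0r add0r mulr1 subr0 subrr.
  by move: (jacobian F u th lam *m w) => y; rewrite !mxE.
have : der (fun e : R => \sum_j Pinv P th lam i j * (F (u + e *: w) th lam - F u th lam
    - e *: (jacobian F u th lam *m w)) j 0) (0 : R) (\sum_j Pinv P th lam i j * 0).
  by apply: der_sum => j; apply: der_scale.
rewrite [X in is_derive _ _ _ X]big1 => [|j _]; last by rewrite mulr0.
by apply: der_ext => e; rewrite /gfun [RHS]mxE.
Qed.

Lemma segment_norm_le (a u w s B : R) : 0 <= s <= w -> `|a| <= B -> `|a + w * u| <= B ->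
  `|a + s * u| <= B.
Proof.
move=> /andP[s0 sw]; rewrite !ler_norml => /andP[h1 h2] /andP[h3 h4].
case: (leP 0 u) => u0.
  have l1 : 0 <= s * u by rewrite mulr_ge0.
  have l2 : s * u <= w * u by rewrite ler_wpM2r.
  by apply/andP; split; lra.
have l1 : s * u <= 0 by rewrite mulr_ge0_le0// ltW.
have l2 : w * u <= s * u by rewrite ler_wnM2r// ltW.
by apply/andP; split; lra.
Qed.

(** A segment in the space of (z, lam, th) with direction entries at most 1. Travelling along it
    with parameter [s] turns a Lipschitz bound into a bound on an s-derivative, uniform in the
    segment. *)
Record segment_data := SegmentData {
  sd_z : vec; sd_uz : vec; sd_lam : R; sd_ulam : R; sd_th : R; sd_uth : R }.

Definition segment_dom (Bz Bth S : R) (e s : R) (t : segment_data) :=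
  [/\ `|e| <= 1, `|s| <= S,
      [/\ forall i, `|sd_z t i 0| <= Bz, `|sd_lam t - lams| <= r / 2 & `|sd_th t| <= Bth],
      [/\ forall i, `|sd_uz t i 0| <= 1, `|sd_ulam t| <= 1 & `|sd_uth t| <= 1] &
      [/\ forall i, `|sd_z t i 0 + s * sd_uz t i 0| <= Bz,
          `|sd_lam t + s * sd_ulam t - lams| <= r / 2 &
          `|sd_th t + s * sd_uth t| <= Bth]].

Lemma gfun_segment Bz Bth S k i :
  famC (segment_dom Bz Bth S) k (fun e s t =>
    g (sd_z t + s *: sd_uz t) (sd_lam t + s * sd_ulam t) (sd_th t + s * sd_uth t) e i 0).
Proof.
have hs : famC (segment_dom Bz Bth S) k (fun _ s _ => s).
  by apply: (@famC_s _ _ _ _ S) => e s t [].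
apply: (fam_gfun r_gt0 F_smooth v_smooth P_smooth P_unit (Bz := Bz) (Bth := Bth)
  (z := fun e s t => sd_z t + s *: sd_uz t) (lam := fun e s t => sd_lam t + s * sd_ulam t)
  (th := fun e s t => sd_th t + s * sd_uth t)).
- move=> j; have h1 : famC (segment_dom Bz Bth S) k (fun _ _ t => sd_z t j 0).
    by apply: (@famC_param _ _ _ _ _ Bz) => e s t [_ _ [h _ _] _ _]; exact: h.
  have h2 : famC (segment_dom Bz Bth S) k (fun _ _ t => sd_uz t j 0).
    by apply: (@famC_param _ _ _ _ _ 1) => e s t [_ _ _ [h _ _] _]; exact: h.
  by apply: famC_ext (famC_add h1 (famC_mul hs h2)) => e s t; rewrite !mxE.
- apply: famC_add; last apply: famC_mul => //.
    apply: (@famC_param _ _ _ _ _ (`|lams| + r / 2)) => e s t [_ _ [_ h _] _ _].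
    rewrite -[sd_lam t](subrK lams) addrC; apply: le_trans (ler_normD _ _) _.
    by rewrite lerD2l.
  by apply: (@famC_param _ _ _ _ _ 1) => e s t [_ _ _ [_ h _] _].
- apply: famC_add; last apply: famC_mul => //.
    by apply: (@famC_param _ _ _ _ _ Bth) => e s t [_ _ [_ _ h] _ _].
  by apply: (@famC_param _ _ _ _ _ 1) => e s t [_ _ _ [_ _ h] _].
- move=> e s t [h1 _ _ _ [h2 h3 h4]]; split=> // j.
  by move: (h2 j); rewrite !mxE.
Qed.

(** The remainder and its eps-derivative vanish at eps = 0, so a bound on the second eps-derivative
    gives O(eps^2). The Lipschitz bound with the same factor eps^2 needs the mixed derivative taken
    twice in eps and once in s, hence a family with three derivatives. *)
Lemma gfun_entry_estimates Bz Bth S i : exists C : R, 0 <= C /\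
  (forall e s t, segment_dom Bz Bth S e s t ->
     `|g (sd_z t + s *: sd_uz t) (sd_lam t + s * sd_ulam t) (sd_th t + s * sd_uth t) e i 0|
       <= C * `|e| ^+ 2) /\
  (forall e w t, 0 <= w -> segment_dom Bz Bth S e w t ->
     `|g (sd_z t + w *: sd_uz t) (sd_lam t + w * sd_ulam t) (sd_th t + w * sd_uth t) e i 0
       - g (sd_z t) (sd_lam t) (sd_th t) e i 0| <= C * w * `|e| ^+ 2).
Proof.
pose D := segment_dom Bz Bth S.
have Dseg e w s t : 0 <= s <= w -> D e w t -> D e s t.
  move=> sw [h1 h2 [a1 a2 a3] h4 [b1 b2 b3]]; have /andP[s0 sw'] := sw.
  split=> //; first by apply: le_trans h2; rewrite !ger0_norm// (le_trans s0).
  split; first by move=> j; exact: (segment_norm_le sw).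
    by rewrite addrAC; apply: (segment_norm_le sw) => //; rewrite addrAC.
  exact: (segment_norm_le sw).
have Deps e x s t : D e s t -> `|x| <= `|e| -> D x s t.
  by move=> [h1 h2 h3 h4 h5] xe; split=> //; exact: le_trans xe h1.
have [_ [fe [fs [H1 _ H3]]]] := gfun_segment Bz Bth S 3 i.
have [_ [fee [fes [K1 _ K3]]]] := H1.
have [[C2 HC2] [feee [fees [_ [[C HC] _] L3]]]] := K1.
have fe0 e s t : D e s t -> fe 0 s t = 0.
  move=> Dt; have D0 : D 0 s t by apply: Deps Dt _; rewrite normr0.
  by have [d _] := H3 0 s t D0; exact: der_uniq d (der_gfun0 _ _ _ _).
exists (`|C| + `|C2|); split; first by rewrite addr_ge0.
split=> [e s t Dt|e w t w0 Dt].
  have b1 x : `|x| <= `|e| -> `|fe x s t| <= `|C2| * `|x|.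
    move=> xe; have Dx := Deps _ _ _ _ Dt xe.
    have := @mvt_bound_dist _ (fun y => fe y s t) (fun y => fee y s t) 0 x `|C2|.
    rewrite !subr0 (fe0 _ _ _ Dt) subr0; apply => y; rewrite subr0 => yx.
      by have [d _] := K3 y s t (Deps _ _ _ _ Dx yx).
    by apply: le_trans (HC2 y s t (Deps _ _ _ _ Dx yx)) (ler_norm _).
  pose p1 y := g (sd_z t + s *: sd_uz t) (sd_lam t + s * sd_ulam t) (sd_th t + s * sd_uth t) y i 0.
  have h1 (y : R) : `|y| <= `|e| -> der p1 y (fe y s t).
    by move=> ye; have [] := H3 y s t (Deps _ _ _ _ Dt ye).
  have p10 : p1 0 = 0 by exact: gfun0E.
  rewrite -/(p1 e); clearbody p1.
  have := @mvt_bound_dist _ p1 (fun y => fe y s t) 0 e ((`|C| + `|C2|) * `|e|).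
  rewrite p10 !subr0 -mulrA -expr2; apply => y; rewrite subr0 => ye; first exact: h1.
  apply: le_trans (b1 y ye) _; apply: ler_pM => //.
  by rewrite lerDr.
have D0 : D e 0 t by apply: Dseg Dt; rewrite lexx.
(* From here the increment along the segment is integrated: [d1] bounds it for the second
   eps-derivative, [d2] for the first, and the last use of the mean value theorem bounds it for the
   remainder itself. *)
have d1 x : `|x| <= `|e| -> `|fee x w t - fee x 0 t| <= `|C| * w.
  move=> xe; have := @mvt_bound _ (fun y => fee x y t) (fun y => fees x y t) 0 w `|C| w0.
  rewrite subr0; apply => y yw; have Dy := Deps _ _ _ _ (Dseg _ _ _ _ yw Dt) xe.
    by have [_ d] := L3 x y t Dy.
  exact: le_trans (HC x y t Dy) (ler_norm _).
have d2 x : `|x| <= `|e| -> `|fe x w t - fe x 0 t| <= `|C| * w * `|x|.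
  move=> xe; have := @mvt_bound_dist _ (fun y => fe y w t - fe y 0 t) (fun y => fee y w t - fee y 0 t) 0 x (`|C| * w).
  rewrite (fe0 _ _ _ Dt) (fe0 _ _ _ D0) subrr !subr0; apply => y; rewrite subr0 => yx.
    have ye := le_trans yx xe.
    have [a1 _] := K3 y w t (Deps _ _ _ _ Dt ye); have [a2 _] := K3 y 0 t (Deps _ _ _ _ D0 ye).
    exact: der_sub.
  by apply: d1; exact: le_trans xe.
pose p1 y := g (sd_z t + w *: sd_uz t) (sd_lam t + w * sd_ulam t) (sd_th t + w * sd_uth t) y i 0.
pose p2 y := g (sd_z t) (sd_lam t) (sd_th t) y i 0.
have h1 (y : R) : `|y| <= `|e| -> der p1 y (fe y w t).
  by move=> ye; have [] := H3 y w t (Deps _ _ _ _ Dt ye).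
have h2 (y : R) : `|y| <= `|e| -> der p2 y (fe y 0 t).
  move=> ye; have [+ _] := H3 y 0 t (Deps _ _ _ _ D0 ye); apply: der_ext => x.
  by rewrite /p2 scale0r !mul0r !addr0.
have p10 : p1 0 = 0 by exact: gfun0E.
have p20 : p2 0 = 0 by exact: gfun0E.
rewrite -/(p1 e) -/(p2 e); clearbody p1 p2.
have := @mvt_bound_dist _ (fun y => p1 y - p2 y) (fun y => fe y w t - fe y 0 t) 0 e
  ((`|C| + `|C2|) * w * `|e|).
rewrite p10 p20 !subr0; set K := (`|C| + `|C2|) * w; rewrite -[K * _ * _]mulrA -expr2; apply => y; rewrite subr0 => ye.
  by apply: der_sub; [exact: h1|exact: h2].
apply: le_trans (d2 y ye) _; rewrite /K; apply: ler_pM => //; first by rewrite mulr_ge0.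
by apply: ler_wpM2r => //; rewrite lerDl.
Qed.

Theorem gfun_estimates Bz Bth : exists2 C, 0 <= C &
  forall (e : R) (z : vec) (lam th : R), `|e| <= 1 -> (forall i, `|z i 0| <= Bz) -> `|lam - lams| <= r / 2 ->
    `|th| <= Bth ->
    (forall i, `|g z lam th e i 0| <= C * `|e| ^+ 2) /\
    (forall (z' : vec) (lam' th' w : R), (forall i, `|z' i 0| <= Bz) -> `|lam' - lams| <= r / 2 ->
      `|th'| <= Bth -> (forall i, `|z' i 0 - z i 0| <= w) -> `|lam' - lam| <= w ->
      `|th' - th| <= w ->
      forall i, `|g z' lam' th' e i 0 - g z lam th e i 0| <= C * w * `|e| ^+ 2).
Proof.
(* An upper bound for the difference of any coordinate between two points of the box. *)
pose S := 2 * `|Bz| + r + 2 * `|Bth|.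
have [C C0 HC] := uniform_constant (I := 'I_n) (Q := fun i C => 0 <= C /\
  (forall e s t, segment_dom Bz Bth S e s t ->
     `|g (sd_z t + s *: sd_uz t) (sd_lam t + s * sd_ulam t) (sd_th t + s * sd_uth t) e i 0|
       <= C * `|e| ^+ 2) /\
  (forall e w t, 0 <= w -> segment_dom Bz Bth S e w t ->
     `|g (sd_z t + w *: sd_uz t) (sd_lam t + w * sd_ulam t) (sd_th t + w * sd_uth t) e i 0
       - g (sd_z t) (sd_lam t) (sd_th t) e i 0| <= C * w * `|e| ^+ 2))
  (fun i C1 C2 C12 H => conj (le_trans H.1 C12) (conj
    (fun e s t Dt => le_trans (H.2.1 e s t Dt) (ler_wpM2r (exprn_ge0 2 (normr_ge0 e)) C12))
    (fun e w t w0 Dt => le_trans (H.2.2 e w t w0 Dt)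
       (ler_wpM2r (exprn_ge0 2 (normr_ge0 e)) (ler_wpM2r w0 C12)))))
  (fun i => gfun_entry_estimates Bz Bth S i).
have S0 : 0 <= S by rewrite /S; have := r_gt0; have := normr_ge0 Bz; have := normr_ge0 Bth; lra.
exists C => // e z lam th he hz hlam hth; split=> [i|].
  have [_ [H _]] := HC i.
  have := H e 0 (SegmentData z 0 lam 0 th 0).
  rewrite /= !mul0r scale0r !addr0; apply; split=> //=; rewrite ?normr0 ?mulr0 ?addr0 //.
    by split=> // j; rewrite mxE normr0.
  by split=> // j; rewrite mxE mulr0 addr0.
move=> z' lam' th' w0 hz' hlam' hth' dz0 dlam0 dth0 i.
have [_ [_ H]] := HC i.
have w0ge : 0 <= w0 by apply: le_trans dlam0.
(* The given [w0] may exceed the size of the box; capping it by [S] keeps the segment parameter in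
   the domain and only improves the bound. *)
pose w := Num.min w0 S.
have wge : 0 <= w by rewrite le_min w0ge.
apply: le_trans (_ : C * w * `|e| ^+ 2 <= _); last first.
  by apply: ler_wpM2r; [exact: exprn_ge0|apply: ler_wpM2l => //; rewrite ge_min lexx].
have dz j : `|z' j 0 - z j 0| <= w.
  rewrite le_min dz0 /=; apply: le_trans (ler_normB _ _) _.
  have := hz j; have := hz' j; have := ler_norm Bz; have := normr_ge0 Bth; move: r_gt0; rewrite /S; lra.
have dlam : `|lam' - lam| <= w.
  rewrite le_min dlam0 /= (_ : lam' - lam = (lam' - lams) - (lam - lams)); last by ring.
  apply: le_trans (ler_normB _ _) _.
  have := normr_ge0 Bz; have := normr_ge0 Bth; move: r_gt0; rewrite /S; lra.
have dth : `|th' - th| <= w.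
  rewrite le_min dth0 /=; apply: le_trans (ler_normB _ _) _.
  have := ler_norm Bth; have := normr_ge0 Bz; move: r_gt0; rewrite /S; lra.
(* When w = 0 the two points coincide and division by 0 returns 0, so the direction formula remains
   correct. *)
have dirE (a b : R) : `|a - b| <= w -> w * ((a - b) / w) = a - b.
  have [->|wn] := eqVneq w 0; last by rewrite mulrC divfK.
  by rewrite normr_le0 => /eqP ->; rewrite mul0r.
have dirB (a b : R) : `|a - b| <= w -> `|(a - b) / w| <= 1.
  have [->|wn] := eqVneq w 0; first by rewrite invr0 mulr0 normr0.
  by move=> h; rewrite normrM normfV (ger0_norm wge) ler_pdivrMr ?mul1r// lt_def wn.
have zE : z + w *: (\col_j ((z' j 0 - z j 0) / w)) = z'.
  by apply/colP => j; rewrite !mxE dirE// addrC subrK.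
have lamE' : lam + w * ((lam' - lam) / w) = lam' by rewrite dirE// addrC subrK.
have thE : th + w * ((th' - th) / w) = th' by rewrite dirE// addrC subrK.
have := H e w (SegmentData z (\col_j ((z' j 0 - z j 0) / w)) lam ((lam' - lam) / w) th ((th' - th) / w)) wge.
rewrite /= zE lamE' thE; apply; split=> //=.
- by rewrite ger0_norm// ge_min lexx orbT.
- by split; [move=> j; rewrite mxE; exact: dirB|exact: dirB|exact: dirB].
- split; [move=> j|by rewrite lamE'|by rewrite thE].
  by rewrite mxE dirE// addrC subrK.
Qed.

End VectorFieldEstimates.

(** * Fourier modes in phi *)

Section ScalarModes.
Context {R : realType}.
Local Notation I2 := (@integral_2pi R).
Local Notation T2 := ((pi : R) *+ 2).
Local Notation fac := (@phi_mode_factor R).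
Implicit Types (f g : R -> R) (k : nat).

Definition cmode k f : R := fac k * I2 (fun x => f x * cos (k%:R * x)).
Definition smode k f : R := fac k * I2 (fun x => f x * sin (k%:R * x)).

Lemma fac_ge0 k : 0 <= fac k.
Proof. by rewrite /phi_mode_factor; case: ifP => _; rewrite invr_ge0 ltW ?twopi_gt0 ?pi_gt0. Qed.

Lemma fac_bound k : fac k * T2 <= 2.
Proof.
have p0 := pi_gt0 R; rewrite /phi_mode_factor; case: ifP => _.
  by rewrite mulVf ?twopi_neq0// ler1n.
by rewrite mulrnAr mulVf ?gt_eqF.
Qed.

Lemma mode_bound_gen k f h M : continuous f -> continuous h -> (forall x, `|h x| <= 1) ->
  (forall x, `|f x| <= M) -> `|fac k * I2 (fun x => f x * h x)| <= 2 * M.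
Proof.
move=> cf ch h1 fM; rewrite normrM (ger0_norm (fac_ge0 k)).
have M0 : 0 <= M by apply: le_trans (fM 0).
apply: le_trans (_ : fac k * (T2 * M) <= _).
  apply: ler_wpM2l; first exact: fac_ge0.
  apply: int2_bound; first exact: continuous_mul.
  by move=> x; rewrite normrM -[leRHS]mulr1; apply: ler_pM.
by rewrite mulrA; apply: ler_wpM2r => //; exact: fac_bound.
Qed.

Lemma cmode_bound k f M : continuous f -> (forall x, `|f x| <= M) -> `|cmode k f| <= 2 * M.
Proof. by move=> cf fM; apply: mode_bound_gen => // [|x]; [exact: continuous_cos_mul|exact: cos_max]. Qed.

Lemma smode_bound k f M : continuous f -> (forall x, `|f x| <= M) -> `|smode k f| <= 2 * M.
Proof. by move=> cf fM; apply: mode_bound_gen => // [|x]; [exact: continuous_sin_mul|exact: sin_max]. Qed.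

Lemma cmodeD k f g : continuous f -> continuous g ->
  cmode k (fun x => f x + g x) = cmode k f + cmode k g.
Proof.
move=> cf cg; have cc := @continuous_cos_mul R k%:R.
rewrite /cmode -mulrDr -int2D; [|exact: continuous_mul|exact: continuous_mul].
by congr (_ * I2 _); apply/funext => x; rewrite mulrDl.
Qed.

Lemma smodeD k f g : continuous f -> continuous g ->
  smode k (fun x => f x + g x) = smode k f + smode k g.
Proof.
move=> cf cg; have cc := @continuous_sin_mul R k%:R.
rewrite /smode -mulrDr -int2D; [|exact: continuous_mul|exact: continuous_mul].
by congr (_ * I2 _); apply/funext => x; rewrite mulrDl.
Qed.

Lemma cmodeZ k c f : continuous f -> cmode k (fun x => c * f x) = c * cmode k f.
Proof.
move=> cf; have cc := @continuous_cos_mul R k%:R.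
have E : (fun x => c * f x * cos (k%:R * x)) = (fun x => c * (f x * cos (k%:R * x))).
  by apply/funext => x; rewrite mulrA.
by rewrite /cmode E int2Z; [exact: mulrCA|exact: continuous_mul].
Qed.

Lemma smodeZ k c f : continuous f -> smode k (fun x => c * f x) = c * smode k f.
Proof.
move=> cf; have cc := @continuous_sin_mul R k%:R.
have E : (fun x => c * f x * sin (k%:R * x)) = (fun x => c * (f x * sin (k%:R * x))).
  by apply/funext => x; rewrite mulrA.
by rewrite /smode E int2Z; [exact: mulrCA|exact: continuous_mul].
Qed.

Lemma cmodeB k f g : continuous f -> continuous g ->
  cmode k (fun x => f x - g x) = cmode k f - cmode k g.
Proof.
move=> cf cg; rewrite -[- cmode k g]mulN1r -cmodeZ// -cmodeD//; last first.
  by apply: continuous_mul => //; exact: continuous_cst.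
by congr cmode; apply/funext => x; rewrite mulN1r.
Qed.

Lemma smodeB k f g : continuous f -> continuous g ->
  smode k (fun x => f x - g x) = smode k f - smode k g.
Proof.
move=> cf cg; rewrite -[- smode k g]mulN1r -smodeZ// -smodeD//; last first.
  by apply: continuous_mul => //; exact: continuous_cst.
by congr smode; apply/funext => x; rewrite mulN1r.
Qed.

Lemma cmode_sum k (I : Type) (l : seq I) (f : I -> R -> R) : (forall i, continuous (f i)) ->
  cmode k (fun x => \sum_(i <- l) f i x) = \sum_(i <- l) cmode k (f i).
Proof.
move=> cf; have cc := @continuous_cos_mul R k%:R.
have E : (fun x => (\sum_(i <- l) f i x) * cos (k%:R * x)) = (fun x => \sum_(i <- l) f i x * cos (k%:R * x)).
  by apply/funext => x; rewrite mulr_suml.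
rewrite /cmode E int2_sum; first by rewrite mulr_sumr.
by move=> i; exact: continuous_mul.
Qed.

Lemma smode_sum k (I : Type) (l : seq I) (f : I -> R -> R) : (forall i, continuous (f i)) ->
  smode k (fun x => \sum_(i <- l) f i x) = \sum_(i <- l) smode k (f i).
Proof.
move=> cf; have cc := @continuous_sin_mul R k%:R.
have E : (fun x => (\sum_(i <- l) f i x) * sin (k%:R * x)) = (fun x => \sum_(i <- l) f i x * sin (k%:R * x)).
  by apply/funext => x; rewrite mulr_suml.
rewrite /smode E int2_sum; first by rewrite mulr_sumr.
by move=> i; exact: continuous_mul.
Qed.

Definition trig (ms : seq nat) (a b : nat -> R) x :=
  \sum_(l <- ms) (cos (l%:R * x) * a l + sin (l%:R * x) * b l).

Lemma trig_term_continuous (a b : R) l : continuous (fun x : R => cos (l%:R * x) * a + sin (l%:R * x) * b).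
Proof.
by apply: continuous_add; apply: continuous_mul; solve [exact: continuous_cst|
  exact: continuous_cos_mul|exact: continuous_sin_mul].
Qed.

Lemma continuous_trig ms a b : continuous (trig ms a b).
Proof. by apply: continuous_sum => l; exact: trig_term_continuous. Qed.

Lemma cmode_term k l (a b : R) : cmode k (fun x : R => cos (l%:R * x) * a + sin (l%:R * x) * b) =
  (k == l)%:R * a.
Proof.
rewrite /cmode; transitivity (fac k * (a * ((l == k)%:R + ((l + k)%N == 0%N)%:R) * pi)).
  congr (_ * _).
  transitivity (I2 (fun x => a * (cos (l%:R * x) * cos (k%:R * x)) + b * (sin (l%:R * x) * cos (k%:R * x)))).
    by congr I2; apply/funext => x; ring.
  have cc := @continuous_cos_mul R; have cs := @continuous_sin_mul R.
  rewrite int2D ?int2Z ?int2_cos_cos ?int2_sin_cos ?mulr0 ?addr0 ?mulrA//;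
   do ?[exact: continuous_mul|apply: continuous_mul; [exact: continuous_cst|exact: continuous_mul]].
have p0 : (pi : R) != 0 by rewrite gt_eqF ?pi_gt0.
rewrite eq_sym /phi_mode_factor; have [->|k0] := eqVneq k 0%N.
  rewrite addn0 eq_sym; case: (l == 0%N) => /=; last by rewrite addr0 mulr0 !mul0r mulr0.
  transitivity ((T2^-1 * T2) * a); first by ring.
  by rewrite mulVf ?twopi_neq0.
rewrite addn_eq0 (negPf k0) andbF addr0 mulrCA mulrA -mulrA mulVf// mulr1.
by rewrite mulrC.
Qed.

Lemma smode_term k l (a b : R) : smode k (fun x : R => cos (l%:R * x) * a + sin (l%:R * x) * b) =
  ((k == l) && (k != 0))%:R * b.
Proof.
rewrite /smode; transitivity (fac k * (b * ((l == k)%:R - ((l + k)%N == 0%N)%:R) * pi)).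
  congr (_ * _).
  transitivity (I2 (fun x => a * (cos (l%:R * x) * sin (k%:R * x)) + b * (sin (l%:R * x) * sin (k%:R * x)))).
    by congr I2; apply/funext => x; ring.
  have cc := @continuous_cos_mul R; have cs := @continuous_sin_mul R.
  rewrite int2D ?int2Z ?int2_cos_sin ?int2_sin_sin ?mulr0 ?add0r ?mulrA//;
   do ?[exact: continuous_mul|apply: continuous_mul; [exact: continuous_cst|exact: continuous_mul]].
have p0 : (pi : R) != 0 by rewrite gt_eqF ?pi_gt0.
rewrite eq_sym /phi_mode_factor; have [->|k0] := eqVneq k 0%N.
  by rewrite addn0 eq_sym subrr mulr0 !mul0r mulr0 andbF mul0r.
rewrite addn_eq0 (negPf k0) !andbF andbT subr0 mulrCA mulrA -mulrA mulVf// mulr1.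
by rewrite mulrC.
Qed.

Lemma cmode_trig ms a b k : uniq ms -> cmode k (trig ms a b) = (k \in ms)%:R * a k.
Proof.
move=> ums; rewrite /trig cmode_sum => [|l]; last exact: trig_term_continuous.
under eq_bigr do rewrite cmode_term.
elim: ms ums => [|l ms IH] /=; first by rewrite big_nil mul0r.
move=> /andP[lms ums]; rewrite big_cons IH// inE; have [->|kl] := eqVneq k l.
  by rewrite (negPf lms) mul0r addr0.
by rewrite mul0r add0r.
Qed.

Lemma smode_trig ms a b k : uniq ms -> smode k (trig ms a b) = ((k \in ms) && (k != 0))%:R * b k.
Proof.
move=> ums; rewrite /trig smode_sum => [|l]; last exact: trig_term_continuous.
under eq_bigr do rewrite smode_term.
elim: ms ums => [|l ms IH] /=; first by rewrite big_nil mul0r.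
move=> /andP[lms ums]; rewrite big_cons IH// inE; have [->|kl] := eqVneq k l.
  by rewrite (negPf lms) mul0r addr0.
by rewrite mul0r add0r.
Qed.

Lemma cos_odd_pi k (x : R) : odd k -> cos (k%:R * (x + pi)) = - cos (k%:R * x).
Proof.
move=> ko; rewrite -(odd_double_half k) ko natrD mulrDl mul1r -muln2 natrM.
set j := k./2.
rewrite (_ : x + pi + j%:R * 2%:R * (x + pi) = ((1 + j%:R * 2%:R) * x + pi) + T2 *+ j); last first.
  by rewrite -[T2 *+ j]mulr_natl; ring.
by rewrite (periodicn (@cosD2pi R)) cosDpi.
Qed.

Lemma sin_odd_pi k (x : R) : odd k -> sin (k%:R * (x + pi)) = - sin (k%:R * x).
Proof.
move=> ko; rewrite -(odd_double_half k) ko natrD mulrDl mul1r -muln2 natrM.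
set j := k./2.
rewrite (_ : x + pi + j%:R * 2%:R * (x + pi) = ((1 + j%:R * 2%:R) * x + pi) + T2 *+ j); last first.
  by rewrite -[T2 *+ j]mulr_natl; ring.
by rewrite (periodicn (@sinD2pi R)) sinDpi.
Qed.

Lemma periodic_cos_nat k : periodic (fun x : R => cos (k%:R * x)) T2.
Proof.
move=> x; rewrite mulrDr [k%:R * T2]mulr_natl.
by rewrite (periodicn (@cosD2pi R)).
Qed.

Lemma periodic_sin_nat k : periodic (fun x : R => sin (k%:R * x)) T2.
Proof.
move=> x; rewrite mulrDr [k%:R * T2]mulr_natl.
by rewrite (periodicn (@sinD2pi R)).
Qed.

(** A shift by pi changes the sign of [h], so the integral of f h is half the integral of (f(x) -
    f(x + pi)) h(x): an odd mode sees only the part of [f] that is odd under the half-period shift.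
    The half compensates the factor 2 of the general mode bound. *)
Lemma odd_mode_half k f h M : odd k -> continuous f -> periodic f T2 -> continuous h ->
  periodic h T2 -> (forall x, `|h x| <= 1) -> (forall x, h (x + pi) = - h x) ->
  (forall x, `|f x - f (x + pi)| <= M) ->
  `|fac k * I2 (fun x => f x * h x)| <= M.
Proof.
move=> ko cf pf ch ph h1 hpi fM.
have cfs : continuous (fun x => f (x + pi)).
  by move=> x; apply: (continuous_comp (f := fun x => x + pi)); [apply: cvgD; [exact: cvg_id|exact: cvg_cst]|exact: cf].
have E : I2 (fun x => (f x - f (x + pi)) * h x) = 2 * I2 (fun x => f x * h x).
  transitivity (I2 (fun x => f x * h x - f (x + pi) * h x)).
    by congr I2; apply/funext => x; rewrite mulrBl.
  rewrite int2B; [|exact: continuous_mul|exact: continuous_mul].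
  have -> : I2 (fun x => f (x + pi) * h x) = - I2 (fun x => f x * h x).
    rewrite -(@int2_shift _ (fun x => f x * h x) pi); last 2 first.
    - exact: continuous_mul.
    - by move=> x; rewrite pf ph.
    have cs : continuous (fun x => f (x + pi) * h x) by exact: continuous_mul.
    apply: oppr_inj; rewrite opprK -int2N//; congr I2; apply/funext => x.
    by rewrite hpi mulrN.
  by ring.
have -> : I2 (fun x => f x * h x) = I2 (fun x => (f x - f (x + pi)) * h x) / 2.
  by rewrite E mulrAC divff ?mul1r// pnatr_eq0.
rewrite mulrA normrM (ger0_norm (x := 2^-1))// ler_pdivrMr// [M * 2]mulrC; apply: mode_bound_gen => //; exact: continuous_sub.
Qed.

Lemma odd_cmode_bound k f M : odd k -> continuous f -> periodic f T2 ->
  (forall x, `|f x - f (x + pi)| <= M) -> `|cmode k f| <= M.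
Proof.
move=> ko cf pf; apply: odd_mode_half => // [||x|x].
- exact: continuous_cos_mul.
- exact: periodic_cos_nat.
- exact: cos_max.
- exact: cos_odd_pi.
Qed.

Lemma odd_smode_bound k f M : odd k -> continuous f -> periodic f T2 ->
  (forall x, `|f x - f (x + pi)| <= M) -> `|smode k f| <= M.
Proof.
move=> ko cf pf; apply: odd_mode_half => // [||x|x].
- exact: continuous_sin_mul.
- exact: periodic_sin_nat.
- exact: sin_max.
- exact: sin_odd_pi.
Qed.

End ScalarModes.

(** * Fourier coefficients as combinations of point values *)

Section Sampling.
Context {R : realType}.
Local Notation T2 := ((pi : R) *+ 2).
Local Notation trig4 := (@trig R [:: 0; 1; 2; 3]%N).

(* A Fourier coefficient of a trigonometric polynomial is a combination of finitely
   many point values, so it inherits the theta-differentiability of the function. *)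
Definition sampled (L : (R -> R) -> R) := exists l : seq (R * R),
  forall f, L f = \sum_(p <- l) p.1 * f p.2.

Lemma sampled_eval x : sampled (fun f => f x).
Proof. by exists [:: (1, x)] => f; rewrite big_seq1 mul1r. Qed.

Lemma sampled_lin c1 c2 L1 L2 : sampled L1 -> sampled L2 ->
  sampled (fun f => c1 * L1 f + c2 * L2 f).
Proof.
move=> [l1 H1] [l2 H2]; exists ([seq (c1 * p.1, p.2) | p <- l1] ++ [seq (c2 * p.1, p.2) | p <- l2]) => f.
rewrite big_cat !big_map H1 H2 !mulr_sumr.
by congr (_ + _); apply: eq_bigr => p _; rewrite mulrA.
Qed.

Definition odd_part (f : R -> R) x := 2^-1 * f x + - 2^-1 * f (x + pi).
Definition even_part (f : R -> R) x := 2^-1 * f x + 2^-1 * f (x + pi).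

Lemma sampled_odd x : sampled (fun f => odd_part f x).
Proof. exact: sampled_lin (sampled_eval _) (sampled_eval _). Qed.

Lemma sampled_even x : sampled (fun f => even_part f x).
Proof. exact: sampled_lin (sampled_eval _) (sampled_eval _). Qed.

Lemma trig4E a b x : trig4 a b x = a 0%N + (cos x * a 1%N + sin x * b 1%N) +
  (cos (2 * x) * a 2%N + sin (2 * x) * b 2%N) + (cos (3 * x) * a 3%N + sin (3 * x) * b 3%N).
Proof. by rewrite /trig !big_cons big_nil mul0r cos0 sin0 !mul1r mul0r !addr0 !addrA. Qed.

Lemma odd_trig4 a b x : odd_part (trig4 a b) x =
  cos x * a 1%N + sin x * b 1%N + (cos (3 * x) * a 3%N + sin (3 * x) * b 3%N).
Proof.
rewrite /odd_part !trig4E cosDpi sinDpi (cos_odd_pi (k := 3)) // (sin_odd_pi (k := 3)) //.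
rewrite (_ : 2 * (x + pi) = 2 * x + T2); last by rewrite mulrDr -[pi *+ 2]mulr_natl.
by rewrite cosD2pi sinD2pi; field.
Qed.

Lemma even_trig4 a b x : even_part (trig4 a b) x =
  a 0%N + (cos (2 * x) * a 2%N + sin (2 * x) * b 2%N).
Proof.
rewrite /even_part !trig4E cosDpi sinDpi (cos_odd_pi (k := 3)) // (sin_odd_pi (k := 3)) //.
rewrite (_ : 2 * (x + pi) = 2 * x + T2); last by rewrite mulrDr -[pi *+ 2]mulr_natl.
by rewrite cosD2pi sinD2pi; field.
Qed.

Let c6 := cos ((pi : R) / 6).

Lemma c6_neq0 : c6 != 0.
Proof. by rewrite gt_eqF// cos_gt0_pihalf//; have := pi_gt0 R; lra. Qed.

(* Shifts by pi / 6 in both directions make the third harmonics cancel. *)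
Lemma third_harmonic_filter a b y :
  (2 * c6)^-1 * odd_part (trig4 a b) (y + pi / 6) + (2 * c6)^-1 * odd_part (trig4 a b) (y - pi / 6) =
  cos y * a 1%N + sin y * b 1%N.
Proof.
rewrite !odd_trig4.
rewrite (_ : 3 * (y + pi / 6) = 3 * y + pi / 2); last by field.
rewrite (_ : 3 * (y - pi / 6) = 3 * y - pi / 2); last by field.
rewrite cosDpihalf cosBpihalf sinDpihalf sinBpihalf cosD cosB sinD sinB -/c6.
by have := c6_neq0 => h; field.
Qed.

Definition third_filter y (f : R -> R) :=
  (2 * c6)^-1 * odd_part f (y + pi / 6) + (2 * c6)^-1 * odd_part f (y - pi / 6).

Lemma sampled_fil y : sampled (third_filter y).
Proof. exact: sampled_lin (sampled_odd _) (sampled_odd _). Qed.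

(** The half-period shift separates the harmonics 0, 2 from 1, 3. Values at 0, pi / 2 and pi / 4
    then determine the even ones, the filter isolates the first harmonic, and subtracting it leaves
    the third. The sine coefficient at k = 0 is not determined by the function, hence the condition
    0 < k. *)
Lemma trig4_coef_sampled k : (k < 4)%N -> exists La Lb, [/\ sampled La, sampled Lb,
  forall a b, La (trig4 a b) = a k & forall a b, (0 < k)%N -> Lb (trig4 a b) = b k].
Proof.
have cp : cos (2 * ((pi : R) / 2)) = -1 by rewrite mulrC divfK ?pnatr_eq0// cospi.
have sp : sin (2 * ((pi : R) / 2)) = 0 by rewrite mulrC divfK ?pnatr_eq0// sinpi.
have c4 : cos (2 * ((pi : R) / 4)) = 0 by rewrite (_ : _ * _ = pi / 2) ?cos_pihalf//; field.
have s4 : sin (2 * ((pi : R) / 4)) = 1 by rewrite (_ : _ * _ = pi / 2) ?sin_pihalf//; field.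
have c3 : cos (3 * ((pi : R) / 2)) = 0.
  by rewrite (_ : _ * _ = pi / 2 + pi) ?cosDpi ?cos_pihalf ?oppr0//; field.
have s3 : sin (3 * ((pi : R) / 2)) = -1.
  by rewrite (_ : _ * _ = pi / 2 + pi) ?sinDpi ?sin_pihalf//; field.
have A0 : sampled (fun f => 2^-1 * even_part f 0 + 2^-1 * even_part f (pi / 2)).
  exact: sampled_lin (sampled_even _) (sampled_even _).
case: k => [|[|[|[|//]]]] _.
- exists (fun f => 2^-1 * even_part f 0 + 2^-1 * even_part f (pi / 2)), (fun f => f 0).
  split=> // [|a b]; first exact: sampled_eval.
  by rewrite !even_trig4 mulr0 cos0 sin0 cp sp; field.
- exists (third_filter 0), (third_filter (pi / 2)); split; try exact: sampled_fil.
    by move=> a b; rewrite /third_filter third_harmonic_filter cos0 sin0; ring.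
  by move=> a b _; rewrite /third_filter third_harmonic_filter cos_pihalf sin_pihalf; ring.
- exists (fun f => 2^-1 * even_part f 0 + (- 2^-1) * even_part f (pi / 2)),
    (fun f => 1 * even_part f (pi / 4) + (-1) * (2^-1 * even_part f 0 + 2^-1 * even_part f (pi / 2))).
  split=> [||a b|a b _].
  + exact: sampled_lin (sampled_even _) (sampled_even _).
  + exact: sampled_lin (sampled_even _) A0.
  + by rewrite !even_trig4 mulr0 cos0 sin0 cp sp; field.
  + by rewrite !even_trig4 mulr0 cos0 sin0 cp sp c4 s4; field.
- exists (fun f => 1 * odd_part f 0 + (-1) * third_filter 0 f),
    (fun f => 1 * third_filter (pi / 2) f + (-1) * odd_part f (pi / 2)).
  split=> [||a b|a b _].
  + exact: sampled_lin (sampled_odd _) (sampled_fil _).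
  + exact: sampled_lin (sampled_fil _) (sampled_odd _).
  + by rewrite /third_filter third_harmonic_filter odd_trig4 mulr0 cos0 sin0; ring.
  + by rewrite /third_filter third_harmonic_filter odd_trig4 c3 s3 cos_pihalf sin_pihalf; ring.
Qed.

Lemma sampled_derivable L (f : R -> R -> R) t : sampled L ->
  (forall x, derivable (fun s => f s x) t 1) -> derivable (fun s => L (f s)) t 1.
Proof.
move=> [l Hl] df.
have -> : (fun s => L (f s)) = (fun s => \sum_(p <- l) p.1 * f s p.2) by apply/funext => s; exact: Hl.
have H (p : R * R) : der (fun s => p.1 * f s p.2) t (p.1 * 'D_1 (fun s => f s p.2) t).
  by apply: der_scale; exact/derivableP/df.
by have [] := @der_sum _ _ l (fun p s => p.1 * f s p.2) _ t H.
Qed.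

End Sampling.

(** * Fourier modes of vector-valued functions on the torus *)

Section VectorModes.
Context {R : realType} {m : nat}.
Local Notation n := (2 + m)%N.
Local Notation vec := 'cV[R]_n.
Local Notation T2 := ((pi : R) *+ 2).
Local Notation ks := [:: 0; 1; 2; 3]%N.
Implicit Types (c d : modes R n) (w g : R -> R -> vec).

Lemma phi_cosE w k t i : cos_mode (phi_modes w) k t i 0 = cmode k (fun x => w t x i 0).
Proof. by rewrite mxE. Qed.

Lemma phi_sinE w k t i : sin_mode (phi_modes w) k t i 0 = smode k (fun x => w t x i 0).
Proof. by rewrite mxE. Qed.

Lemma synthE ms c t x i : synth ms c t x i 0 =
  trig ms (fun l => cos_mode c l t i 0) (fun l => sin_mode c l t i 0) x.
Proof. by rewrite /synth /trig summxE; apply: eq_bigr => l _; rewrite !mxE. Qed.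

Lemma phi_cos_synth ms c k t : uniq ms -> cos_mode (phi_modes (synth ms c)) k t =
  (k \in ms)%:R *: cos_mode c k t.
Proof.
move=> ums; apply/colP => i; rewrite phi_cosE.
transitivity (cmode k (trig ms (fun l => cos_mode c l t i 0) (fun l => sin_mode c l t i 0))).
  by congr cmode; apply/funext => x; exact: synthE.
by rewrite cmode_trig//; move: (cos_mode c k t) => y; rewrite mxE.
Qed.

Lemma phi_sin_synth ms c k t : uniq ms -> sin_mode (phi_modes (synth ms c)) k t =
  ((k \in ms) && (k != 0%N))%:R *: sin_mode c k t.
Proof.
move=> ums; apply/colP => i; rewrite phi_sinE.
transitivity (smode k (trig ms (fun l => cos_mode c l t i 0) (fun l => sin_mode c l t i 0))).
  by congr smode; apply/funext => x; exact: synthE.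
by rewrite smode_trig//; move: (sin_mode c k t) => y; rewrite mxE.
Qed.

Lemma mem_ks k : (k \in ks) = (k < 4)%N.
Proof. by case: k => [|[|[|[|[|k]]]]]. Qed.

Lemma rder_derivable (f : R -> vec) t (d : vec) : rder d t f -> derivable f t 1.
Proof. by move=> H; apply/derivable_mxP => i j; rewrite ord1; case: (H i). Qed.

Lemma derive1_rder (f : R -> vec) t (d : vec) : rder d t f -> derive1 f t = d.
Proof.
move=> H; rewrite derive1E derive_mx; last exact: rder_derivable H.
by apply/colP => i; rewrite mxE; case: (H i).
Qed.

Lemma derivable_rder (f : R -> vec) t : derivable f t 1 -> rder (derive1 f t) t f.
Proof.
move=> df i; have := (derivable_mxP _ _ _).1 df i 0 => /derivableP h.
apply: der_val h; rewrite derive1E derive_mx//; by rewrite mxE.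
Qed.

Lemma synth_modes_derivable c k t : (k < 4)%N ->
  (forall x, derivable (fun s => synth ks c s x) t 1) ->
  derivable (cos_mode c k) t 1 /\ ((0 < k)%N -> derivable (sin_mode c k) t 1).
Proof.
move=> k4 dz; have [La [Lb [sLa sLb HLa HLb]]] := trig4_coef_sampled (R := R) k4.
have dzi i x : derivable (fun s => synth ks c s x i 0) t 1 by exact: ((derivable_mxP _ _ _).1 (dz x)).
have E i s : (fun x => synth ks c s x i 0) =
    trig ks (fun l => cos_mode c l s i 0) (fun l => sin_mode c l s i 0).
  by apply/funext => x; exact: synthE.
split=> [|k0]; apply/derivable_mxP => i j; rewrite ord1.
  have := sampled_derivable sLa (dzi i).
  by under eq_fun do rewrite E HLa.
have := sampled_derivable sLb (dzi i).
by under eq_fun do rewrite E HLb//.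
Qed.

(** The derivative with respect to phi, acting on modes. *)
Definition rot c : modes R n := Modes (fun k t => k%:R *: sin_mode c k t)
  (fun k t => - (k%:R *: cos_mode c k t)).

Lemma rot_cosE c k t i : cos_mode (rot c) k t i 0 = k%:R * sin_mode c k t i 0.
Proof. by rewrite mxE. Qed.

Lemma rot_sinE c k t i : sin_mode (rot c) k t i 0 = - (k%:R * cos_mode c k t i 0).
Proof. by rewrite !mxE. Qed.

Lemma rder_synth_theta c d t x : (forall k, (k < 4)%N ->
    rder (cos_mode d k t) t (cos_mode c k) /\ rder (sin_mode d k t) t (sin_mode c k)) ->
  rder (synth ks d t x) t (fun s => synth ks c s x).
Proof.
move=> H i; rewrite synthE; apply: der_ext (fun s => esym (synthE _ _ _ _ _)) _.
rewrite /trig !big_cons !big_nil.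
have h k : (k < 4)%N -> der (fun s => cos (k%:R * x) * cos_mode c k s i 0 + sin (k%:R * x) * sin_mode c k s i 0) t
    (cos (k%:R * x) * cos_mode d k t i 0 + sin (k%:R * x) * sin_mode d k t i 0).
  by move=> /H[h1 h2]; apply: der_add; apply: der_scale; [exact: h1|exact: h2].
have E s : cos (0%:R * x) * cos_mode c 0 s i 0 + sin (0%:R * x) * sin_mode c 0 s i 0 +
    (cos (1%:R * x) * cos_mode c 1 s i 0 + sin (1%:R * x) * sin_mode c 1 s i 0 +
    (cos (2%:R * x) * cos_mode c 2 s i 0 + sin (2%:R * x) * sin_mode c 2 s i 0 +
    (cos (3%:R * x) * cos_mode c 3 s i 0 + sin (3%:R * x) * sin_mode c 3 s i 0 + 0))) =
    trig ks (fun l => cos_mode c l s i 0) (fun l => sin_mode c l s i 0) x.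
  by rewrite /trig !big_cons big_nil.
apply: der_ext E _.
exact: (der_add (h 0%N isT) (der_add (h 1%N isT) (der_add (h 2%N isT) (der_add (h 3%N isT) (der_cst 0 t))))).
Qed.

Lemma rder_synth_phi ms c t x : rder (synth ms (rot c) t x) x (synth ms c t).
Proof.
move=> i; rewrite synthE; apply: der_ext (fun s => esym (synthE _ _ _ _ _)) _.
apply: der_sum => k.
apply: der_val (der_add (der_mul (der_cos_mul k%:R x) (der_cst (cos_mode c k t i 0) x))
  (der_mul (der_sin_mul k%:R x) (der_cst (sin_mode c k t i 0) x))).
by rewrite /= !mxE; ring.
Qed.

Lemma pde_residualE g om z c d t x : (forall t x, z t x = synth ks c t x) ->
  (forall k, (k < 4)%N ->
    rder (cos_mode d k t) t (cos_mode c k) /\ rder (sin_mode d k t) t (sin_mode c k)) ->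
  pde_residual g om z t x = g t x - synth ks d t x - om *: synth ks (rot c) t x.
Proof.
move=> zE H; have -> : z = synth ks c by do 2!apply/funext => ?; exact: zE.
by rewrite /pde_residual (derive1_rder (rder_synth_theta x H)) (derive1_rder (rder_synth_phi _ _ _ _)).
Qed.

Lemma residual_modes g om c d t k : (k < 4)%N ->
  (forall i, continuous (fun x => g t x i 0)) ->
  let w := fun t x => g t x - synth ks d t x - om *: synth ks (rot c) t x in
  cos_mode (phi_modes w) k t =
    cos_mode (phi_modes g) k t - cos_mode d k t - (om * k%:R) *: sin_mode c k t /\
  ((0 < k)%N -> sin_mode (phi_modes w) k t =
    sin_mode (phi_modes g) k t - sin_mode d k t + (om * k%:R) *: cos_mode c k t).
Proof.
move=> k4 cg w.
have E i : (fun x => w t x i 0) = (fun x => g t x i 0 -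
    trig ks (fun l => cos_mode d l t i 0) (fun l => sin_mode d l t i 0) x -
    om * trig ks (fun l => cos_mode (rot c) l t i 0) (fun l => sin_mode (rot c) l t i 0) x).
  by apply/funext => x; rewrite /w -!synthE; move: (synth _ _ _ _) (synth _ _ _ _) => u v; rewrite !mxE.
have ct a b : continuous (trig (R := R) ks a b) by exact: continuous_trig.
have cot a b : continuous (fun x => om * trig (R := R) ks a b x).
  by apply: continuous_mul => //; exact: continuous_cst.
split=> [|k0]; apply/colP => i.
  rewrite phi_cosE E cmodeB//; last by apply: continuous_sub.
  rewrite cmodeB// cmodeZ// !cmode_trig// mem_ks k4 !mul1r -phi_cosE rot_cosE.
  by move: (cos_mode _ _ _) (cos_mode _ _ _) (sin_mode _ _ _) => u y z; rewrite !mxE; ring.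
rewrite phi_sinE E smodeB//; last by apply: continuous_sub.
rewrite smodeB// smodeZ// !smode_trig// mem_ks k4 -lt0n k0 !mul1r -phi_sinE rot_sinE.
by move: (sin_mode _ _ _) (sin_mode _ _ _) (cos_mode _ _ _) => u y z; rewrite !mxE; ring.
Qed.

Lemma phi_sin0 w t : sin_mode (phi_modes w) 0 t = 0.
Proof.
apply/colP => i; rewrite phi_sinE mxE /smode (_ : (fun _ => _) = (fun=> 0)) ?int2_cst ?mulr0//.
by apply/funext => x; rewrite mul0r sin0 mulr0.
Qed.

End VectorModes.

(** * The fixed-point problem *)

Section FixedPoint.
Context {R : realType}.

Lemma geometric_small (X e : R) : 0 < e -> exists n, X * (3 / 4) ^+ n <= e.
Proof.
move=> e0; have h : `|3 / 4 : R| < 1 by rewrite ger0_norm; lra.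
have /cvgrPdist_le/(_ e e0)[N _ H] := @cvg_geometric _ X _ h.
exists N; have := H N (leqnn N); rewrite sub0r normrN => h2.
exact: le_trans (ler_norm _) h2.
Qed.

Lemma geometric_squeeze (x D X : R) : (forall n, x <= D + X * (3 / 4) ^+ n) -> x <= D.
Proof.
move=> H; apply/ler_addgt0Pr => e e0; have [n hn] := geometric_small X e0.
by apply: le_trans (H n) _; rewrite lerD2l.
Qed.

Context {S J : Type}.
Variables (coord_val : S -> J -> R) (coord_ok : J -> Prop).

Definition codist x y D := forall j, coord_ok j -> `|coord_val x j - coord_val y j| <= D.

(** The contraction principle for a relation, with points compared through admissible coordinates
    only. Images are chosen once, the iterates converge coordinatewise, and the limit is related to
    some [y]; since no equality of points is available, the conclusion is that [x] and [y] have the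
    same coordinates. *)
Lemma fixed_point (B : S -> Prop) (rel : S -> S -> Prop) x0 D0 :
  (forall f : J -> R, exists x, forall j, coord_ok j -> coord_val x j = f j) -> B x0 ->
  (forall x, B x -> exists y, rel x y /\ B y) ->
  (forall x x' y y' D, B x -> B x' -> B y -> B y' -> rel x y -> rel x' y' ->
    codist x x' D -> codist y y' (3 / 4 * D)) ->
  (forall x y, B x -> B y -> codist x y D0) ->
  (forall u x, (forall n : nat, B (u n)) -> (forall e, 0 < e -> exists n, codist (u n) x e) -> B x) ->
  exists x y, [/\ B x, B y, rel x y & forall j, coord_ok j -> coord_val y j = coord_val x j].
Proof.
move=> complete B0 step contr diam closedB.
have /choice[T HT] : forall x, exists y, B x -> rel x y /\ B y.
  move=> x; have [Bx|nB] := pselect (B x); last by exists x => /nB.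
  by have [y Hy] := step x Bx; exists y.
pose u n := iter n T x0.
have Bu n : B (u n) by elim: n => [//|n IH]; exact: (HT _ IH).2.
have du n : codist (u n) (u n.+1) (D0 * (3 / 4) ^+ n).
  elim: n => [|n IH]; first by rewrite expr0 mulr1; exact: diam.
  rewrite exprS mulrCA; exact: contr (Bu n) (Bu n.+1) (Bu n.+1) (Bu n.+2)
    (HT _ (Bu n)).1 (HT _ (Bu n.+1)).1 IH.
(* The partial geometric sum from n to n + p with ratio 3/4; the factor 4 is 1 / (1 - 3/4). *)
have dup n p : codist (u n) (u (n + p)%N) (4 * D0 * (3 / 4) ^+ n * (1 - (3 / 4) ^+ p)).
  elim: p => [|p IH] j oj; first by rewrite addn0 subrr normr0 expr0 subrr mulr0.
  have h1 := IH j oj; have h2 := du (n + p)%N j oj.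
  rewrite -[coord_val (u n) j](subrK (coord_val (u (n + p)%N) j)) -addrA addnS.
  apply: le_trans (ler_normD _ _) _; apply: le_trans (lerD h1 h2) _.
  rewrite exprD exprS; move: ((3 / 4) ^+ n) ((3 / 4) ^+ p) => a b.
  by rewrite le_eqVlt; apply/orP; left; apply/eqP; field.
have D0ge j : coord_ok j -> 0 <= D0 by move=> oj; apply: le_trans (diam _ _ B0 B0 j oj).
have dum n m j : coord_ok j -> (n <= m)%N -> `|coord_val (u n) j - coord_val (u m) j| <= 4 * D0 * (3 / 4) ^+ n.
  move=> oj nm; rewrite -(subnKC nm); apply: le_trans (dup n _ j oj) _.
  have q0 p : 0 <= ((3 / 4) ^+ p : R) by apply: exprn_ge0; lra.
  by apply: ler_piMr; [rewrite !mulr_ge0// (D0ge j)|rewrite gerBl].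
have cv j : coord_ok j -> cvg ((fun n => coord_val (u n) j) @ \oo).
  move=> oj; apply/cauchy_cvgP; apply: cauchy_exP => e e0.
  have [N HN] := geometric_small (4 * D0) (divr_gt0 e0 (ltr0Sn R 1)).
  exists (coord_val (u N) j); exists N => // m /= Nm; rewrite /ball /=.
  by apply: le_lt_trans (dum N m j oj Nm) _; apply: le_lt_trans HN _; lra.
have [x Hx] := complete (fun j => lim ((fun n => coord_val (u n) j) @ \oo)).
have dx n : codist (u n) x (4 * D0 * (3 / 4) ^+ n).
  move=> j oj; rewrite (Hx j oj); apply/ler_addgt0Pr => e e0.
  have /cvgrPdist_lt/(_ e e0)[N _ HN] := cv j oj.
  have h1 := dum n (maxn n N) j oj (leq_maxl _ _); have h2 := HN (maxn n N) (leq_maxr _ _).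
  rewrite -[coord_val (u n) j](subrK (coord_val (u (maxn n N)) j)) -addrA.
  apply: le_trans (ler_normD _ _) _; apply: lerD => //.
  by rewrite distrC ltW.
have Bx : B x.
  apply: (closedB u) => // e e0; have [n hn] := geometric_small (4 * D0) e0.
  by exists n => j oj; exact: le_trans (dx n j oj) hn.
have [y [xy By]] := step x Bx; exists x, y; split=> // j oj.
apply/eqP; rewrite -subr_eq0 -normr_le0; apply: (@geometric_squeeze _ _ (8 * D0)) => n.
have h1 := contr (u n) x (u n.+1) y _ (Bu n) Bx (Bu n.+1) By (HT _ (Bu n)).1 xy (dx n) j oj.
have h2 := dx n.+1 j oj.
rewrite distrC in h1.
rewrite -[coord_val y j](subrK (coord_val (u n.+1) j)) -addrA add0r; apply: le_trans (ler_normD _ _) _.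
apply: le_trans (lerD h1 h2) _; rewrite exprS; have := D0ge j oj.
have : 0 <= ((3 / 4) ^+ n : R) by apply: exprn_ge0; lra.
move: ((3 / 4) ^+ n) => a a0 D00; rewrite (_ : _ + _ = 6 * (D0 * a)); last by field.
by rewrite -mulrA; apply: ler_wpM2r; [exact: mulr_ge0|lra].
Qed.

End FixedPoint.

Section PeriodicMean.
Context {R : realType}.
Local Notation T2 := ((pi : R) *+ 2).

(** The derivative of a periodic function has mean zero, so [c] is the mean of [rho]. *)
Lemma periodic_const_bound (w rho : R -> R) c M : periodic w T2 ->
  (forall t : R, der w t (c - rho t)) -> (forall t, `|rho t| <= M) -> `|c| <= M.
Proof.
move=> pw dw HM; have T0 := twopi_gt0 (R := R).
have := @mvt_bound _ (fun t => c * t - w t) (fun t => rho t) 0 T2 M (ltW T0).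
rewrite mulr0 -[X in w X]add0r pw !subr0 sub0r opprK subrK normrM (gtr0_norm T0) ler_pM2r//.
apply=> t _; last exact: HM.
apply: der_val (der_sub (der_scale c (der_id t)) (dw t)).
by rewrite mulr1 opprB addrC subrK.
Qed.

End PeriodicMean.

Section CriticalMode.
Context {R : realType} {m : nat}.

Lemma delta_bound (p q : nat) (a j : 'I_p) (b l : 'I_q) : `|(delta_mx a b : 'M[R]_(p, q)) j l| <= 1.
Proof. by rewrite mxE; case: (_ && _); rewrite ?normr0 ?normr1. Qed.

Lemma comb2_bound (u w x y : R) : `|u| <= 1 -> `|w| <= 1 -> `|x| <= 1 -> `|y| <= 1 -> `|u * x + w * y| <= 2.
Proof.
move=> hu hw hx hy; apply: le_trans (ler_normD _ _) _; rewrite !normrM [leRHS](_ : 2 = 1 * 1 + 1 * 1).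
  by apply: lerD; apply: ler_pM.
by rewrite mulr1.
Qed.

Lemma astar_bound (x : R) i : `|astar (m := m) x i 0| <= 2.
Proof.
rewrite /astar mxE [X in X + _]mxE [X in _ + X]mxE.
by apply: comb2_bound; [exact: cos_max|exact: sin_max|exact: delta_bound|exact: delta_bound].
Qed.

Lemma dastar_bound (x : R) i : `|dastar (m := m) x i 0| <= 2.
Proof.
rewrite /dastar mxE [X in X + _]mxE [X in _ + X]mxE.
by apply: comb2_bound; rewrite ?normrN; [exact: sin_max|exact: cos_max|exact: delta_bound|exact: delta_bound].
Qed.

End CriticalMode.

Section PointwiseBounds.
Context {R : realType}.

Lemma continuous_dominated (f w : R -> R) (C : R) (t0 : R) : {for t0, continuous w} -> w t0 = 0 ->
  (forall t, `|t - t0| <= 1 -> `|f t - f t0| <= C * w t) -> {for t0, continuous f}.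
Proof.
move=> cw w0 H; apply/cvgrPdist_le => e e0.
have d0 : 0 < e / (`|C| + 1) by rewrite divr_gt0// ltr_wpDl.
have /cvgrPdist_le/(_ _ d0) := cw; rewrite w0 => nw.
have n1 : \forall t \near t0, `|t0 - t| <= 1.
  by exists 1 => //= t; exact: ltW.
near=> t; rewrite distrC; apply: le_trans (H t _) _.
  by rewrite distrC; near: t.
have hw : `|0 - w t| <= e / (`|C| + 1) by near: t.
rewrite sub0r normrN ler_pdivlMr ?ltr_wpDl// in hw.
apply: le_trans hw; apply: le_trans (ler_norm _) _; rewrite normrM mulrC.
by apply: ler_wpM2l => //; rewrite lerDl.
Unshelve. all: by end_near. Qed.

Lemma continuous_normB (f : R -> R) c : continuous f -> continuous (fun t => `|f t - c|).
Proof.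
move=> cf x; apply: (@cvg_norm _ _ _ _ _ (fun t => f t - c) (f x - c)).
exact: (continuous_sub cf (continuous_cst (c := c))).
Qed.

Lemma mulmx_entry_bound p q (M : 'M[R]_(p, q)) (u : 'cV[R]_q) A B : 0 <= A ->
  (forall i j, `|M i j| <= A) -> (forall j, `|u j 0| <= B) ->
  forall i, `|(M *m u) i 0| <= q%:R * (A * B).
Proof.
move=> A0 HM Hu i; rewrite mxE; apply: le_trans (ler_norm_sum _ _ _) _.
apply: le_trans (_ : \sum_(j < q) A * B <= _).
  by apply: ler_sum => j _; rewrite normrM; apply: ler_pM.
by rewrite sumr_const card_ord mulr_natl.
Qed.

End PointwiseBounds.

(** * States and their weighted distance *)

Section States.
Context {R : realType} {m : nat}.
Local Notation n := (2 + m)%N.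
Local Notation vec := 'cV[R]_n.
Local Notation T2 := ((pi : R) *+ 2).
Local Notation ks := [:: 0; 1; 2; 3]%N.
Local Notation e1 := (@e1 R m).
Local Notation e2 := (@e2 R m).

Definition add_astar (c : modes R n) : modes R n := Modes
  (fun k t => cos_mode c k t + (k == 1%N)%:R *: e1) (fun k t => sin_mode c k t + (k == 1%N)%:R *: e2).

Definition with_astar (c : modes R n) (t x : R) : vec := astar x + synth ks c t x.

Lemma with_astar_synth c t x : with_astar c t x = synth ks (add_astar c) t x.
Proof.
rewrite /with_astar /synth /astar !big_cons !big_nil /= !scale0r !addr0 !scale1r !mul1r.
rewrite !scalerDr; set u := cos x *: e1; set w := sin x *: e2.
move: (cos _ *: _) (sin _ *: _) (cos _ *: _) (sin _ *: _) (cos _ *: _) (sin _ *: _) (cos _ *: _) (sin _ *: _).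
move=> y1 y2 y3 y4 y5 y6 y7 y8.
by apply/colP => i; rewrite !mxE; ring.
Qed.

(** Each value of theta gives its own coordinates, so a bound on all coordinates is a bound uniform
    in theta and the sup norm needs no separate definition. *)
Inductive coord := CLam | COm | CCos of nat & R & 'I_n | CSin of nat & R & 'I_n.

Record state := State { s_lam : R; s_om : R; s_modes : modes R n }.

Definition coord_val (X : state) (j : coord) : R :=
  match j with
  | CLam => s_lam X
  | COm => s_om X
  | CCos k t i => cos_mode (s_modes X) k t i 0
  | CSin k t i => sin_mode (s_modes X) k t i 0
  end.

Definition coord_ok j : Prop := match j with CCos k _ _ | CSin k _ _ => (k < 4)%N | _ => True end.

(* DO bounds lam, om and the odd modes, DE the even modes. *)
Definition coord_bound (DO DE : R) j : R :=
  match j with CCos k _ _ | CSin k _ _ => if odd k then DO else DE | _ => DO end.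

Definition wdist X Y DO DE := forall j, coord_ok j -> `|coord_val X j - coord_val Y j| <= coord_bound DO DE j.

Lemma state_complete (f : coord -> R) : exists X, forall j, coord_ok j -> coord_val X j = f j.
Proof.
exists (State (f CLam) (f COm) (Modes (fun k t => \col_i f (CCos k t i)) (fun k t => \col_i f (CSin k t i)))).
by move=> [||k t i|k t i] _ //=; rewrite mxE.
Qed.

Lemma synth_diff (c c' : modes R n) t t' x i (A : nat -> R) :
  (forall k, (k < 4)%N -> `|cos_mode c k t i 0 - cos_mode c' k t' i 0| +
    `|sin_mode c k t i 0 - sin_mode c' k t' i 0| <= A k) ->
  `|synth ks c t x i 0 - synth ks c' t' x i 0| <= A 0%N + A 1%N + A 2%N + A 3%N.
Proof.
move=> H; rewrite !synthE /trig -sumrB.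
have T k : (k < 4)%N -> `|cos (k%:R * x) * cos_mode c k t i 0 + sin (k%:R * x) * sin_mode c k t i 0 -
    (cos (k%:R * x) * cos_mode c' k t' i 0 + sin (k%:R * x) * sin_mode c' k t' i 0)| <= A k.
  move=> /H; apply: le_trans.
  rewrite opprD addrACA -!mulrBr; apply: le_trans (ler_normD _ _) _.
  by rewrite !normrM; apply: lerD; apply: ler_piMl => //; [exact: cos_max|exact: sin_max].
have -> : A 0%N + A 1%N + A 2%N + A 3%N = \sum_(k <- ks) A k by rewrite !big_cons big_nil addr0 !addrA.
apply: le_trans (ler_norm_sum _ _ _) _; rewrite big_seq [leRHS]big_seq.
by apply: ler_sum => k; rewrite mem_ks; exact: T.
Qed.

Lemma with_astar_diff (X Y : state) DO DE t x i : wdist X Y DO DE ->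
  `|with_astar (s_modes X) t x i 0 - with_astar (s_modes Y) t x i 0| <= 4 * (DO + DE).
Proof.
move=> H; rewrite /with_astar; move: (astar x) => u.
have -> : (u + synth ks (s_modes X) t x) i 0 - (u + synth ks (s_modes Y) t x) i 0 =
    synth ks (s_modes X) t x i 0 - synth ks (s_modes Y) t x i 0.
  by move: (synth _ _ _ _) (synth _ _ _ _) => a b; rewrite !mxE; ring.
apply: le_trans (@synth_diff _ _ t t x i (fun k => 2 * if odd k then DO else DE) _) _.
  move=> k k4; have h1 := H (CCos k t i) k4; have h2 := H (CSin k t i) k4.
  by move: h1 h2 => /= h1 h2; lra.
by rewrite /=; lra.
Qed.

End States.

(** * From functions on the torus to modes, and the amplitude and phase conditions *)

Section ModeConversions.
Context {R : realType} {m : nat}.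
Local Notation n := (2 + m)%N.
Local Notation vec := 'cV[R]_n.
Local Notation T2 := ((pi : R) *+ 2).
Local Notation I2 := (@integral_2pi R).
Local Notation ks := [:: 0; 1; 2; 3]%N.
Local Notation e1 := (@e1 R m).
Local Notation e2 := (@e2 R m).
Implicit Types c : modes R n.

Lemma entry_le_enorm (u : vec) i : `|u i 0| <= enorm u.
Proof.
rewrite -sqrtr_sqr /enorm ler_wsqrtr// /dotv (bigD1 i)//= -expr2 lerDl.
by apply: sumr_ge0 => j _; rewrite -expr2 sqr_ge0.
Qed.

Lemma enorm_le_entries (u : vec) B : (forall i, `|u i 0| <= B) -> enorm u <= n%:R * B.
Proof.
move=> hu; have B0 : 0 <= B by apply: le_trans (hu j1).
rewrite -[leRHS]ger0_norm ?mulr_ge0 ?ler0n// -sqrtr_sqr /enorm ler_wsqrtr// /dotv.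
apply: le_trans (_ : \sum_(i < n) B ^+ 2 <= _).
  by apply: ler_sum => i _; rewrite -expr2 -real_normK ?num_real// lerXn2r ?nnegrE.
rewrite sumr_const card_ord exprMn -[leLHS]mulr_natl; apply: ler_wpM2r; first exact: sqr_ge0.
by rewrite expr2 -natrM ler_nat leq_pmulr.
Qed.

(** The sine mode of index 0 is not determined by the function; setting it to 0 makes the passage
    from functions to modes unique. *)
Definition drop_sin0 c : modes R n := Modes (cos_mode c) (fun k t => if k == 0%N then 0 else sin_mode c k t).
Definition deviation c : modes R n := Modes (fun k t => cos_mode c k t - (k == 1%N)%:R *: e1)
  (fun k t => sin_mode c k t - (k == 1%N)%:R *: e2).

Lemma synth_eq ms c c' t x : (forall k, k \in ms -> cos_mode c k t = cos_mode c' k t) ->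
  (forall k, k \in ms -> (0 < k)%N -> sin_mode c k t = sin_mode c' k t) -> synth ms c t x = synth ms c' t x.
Proof.
move=> h1 h2; rewrite /synth big_seq [RHS]big_seq; apply: eq_bigr => k km; rewrite h1//.
by case: k km => [|k] km; [rewrite mul0r sin0 !scale0r|rewrite h2].
Qed.

Lemma synth_drop_sin0 ms c t x : synth ms (drop_sin0 c) t x = synth ms c t x.
Proof. by apply: synth_eq => // -[]. Qed.

Lemma add_astar_deviation c k t : cos_mode (add_astar (deviation c)) k t = cos_mode c k t /\ sin_mode (add_astar (deviation c)) k t = sin_mode c k t.
Proof. by rewrite /= !subrK. Qed.

Lemma with_astar_deviation c t x : with_astar (deviation c) t x = synth ks c t x.
Proof. by rewrite with_astar_synth; apply: synth_eq => k *; have [] := add_astar_deviation c k t. Qed.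

(** Periodicity passes to the modes through their integral formula. Differentiability in theta is
    known only pointwise in phi, which does not permit differentiating under the integral; it is
    obtained from the sampling formulas. *)
Lemma torus_modes c : torus_function (synth ks c) -> forall k, (k < 4)%N ->
  [/\ periodic (cos_mode (drop_sin0 c) k) T2, periodic (sin_mode (drop_sin0 c) k) T2,
    forall t, rder (derive1 (cos_mode (drop_sin0 c) k) t) t (cos_mode (drop_sin0 c) k) &
    forall t, rder (derive1 (sin_mode (drop_sin0 c) k) t) t (sin_mode (drop_sin0 c) k)].
Proof.
move=> [pz _ dz _] k k4.
have mk : k \in ks by rewrite mem_ks.
have pE t x : synth ks c (t + T2) x = synth ks c t x by exact: pz.
split=> [t|t|t|t].
- have h s := @phi_cos_synth _ _ ks c k s isT; rewrite mk in h.
  have {}h s : cos_mode c k s = cos_mode (phi_modes (synth ks c)) k s by rewrite h scale1r.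
  rewrite /= !h; apply/colP => i; rewrite !phi_cosE; congr cmode; apply/funext => x; by rewrite pE.
- rewrite /=; case: eqP => [//|/eqP k0].
  have h s := @phi_sin_synth _ _ ks c k s isT; rewrite mk k0 in h.
  have {}h s : sin_mode c k s = sin_mode (phi_modes (synth ks c)) k s by rewrite h scale1r.
  rewrite !h; apply/colP => i; rewrite !phi_sinE; congr smode; apply/funext => x; by rewrite pE.
- by apply: derivable_rder; have [] := @synth_modes_derivable _ _ c k t k4 (fun x => dz t x).
- apply: derivable_rder; rewrite /=; case: eqP => [_|/eqP k0]; first exact: derivable_cst.
  have [_ h] := @synth_modes_derivable _ _ c k t k4 (fun x => dz t x).
  by apply: h; rewrite lt0n.
Qed.

Lemma rder_deviation c k t (x y : vec) : rder x t (cos_mode c k) -> rder y t (sin_mode c k) ->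
  rder x t (cos_mode (deviation c) k) /\ rder y t (sin_mode (deviation c) k).
Proof.
have h (f : R -> vec) (u w : vec) : rder w t f -> rder w t (fun s => f s - u).
  move=> Hw i; apply: der_ext (der_val _ (der_sub (Hw i) (der_cst (u i 0) t))) => [s|].
    by move: (f s) => g; rewrite !mxE.
  by rewrite subr0.
by move=> h1 h2; split; apply: h.
Qed.

Lemma dotv_astar (u : vec) (x : R) : dotv u (astar x) = cos x * u j1 0 + sin x * u j2 0.
Proof.
rewrite /dotv (bigD1 j1)//= (bigD1 j2)//= big1 ?addr0 => [|i /andP[h1 h2]].
  by rewrite /astar ![(_ + _ : vec) _ 0]mxE ![(_ *: _ : vec) _ 0]mxE !e1E !e2E /=; ring.
rewrite /astar ![(_ + _ : vec) _ 0]mxE ![(_ *: _ : vec) _ 0]mxE !e1E !e2E.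
by rewrite (negPf h1) (negPf h2) !mulr0 addr0 mulr0.
Qed.

Lemma dotv_dastar (u : vec) (x : R) : dotv u (dastar x) = cos x * u j2 0 - sin x * u j1 0.
Proof.
rewrite /dotv (bigD1 j1)//= (bigD1 j2)//= big1 ?addr0 => [|i /andP[h1 h2]].
  by rewrite /dastar ![(_ + _ : vec) _ 0]mxE ![(_ *: _ : vec) _ 0]mxE !e1E !e2E /=; ring.
rewrite /dastar ![(_ + _ : vec) _ 0]mxE ![(_ *: _ : vec) _ 0]mxE !e1E !e2E.
by rewrite (negPf h1) (negPf h2) !mulr0 addr0 mulr0.
Qed.

Lemma continuous_synth_theta ms c x j :
  (forall k, k \in ms -> rcont (cos_mode c k) /\ rcont (sin_mode c k)) ->
  continuous (fun t => synth ms c t x j 0).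
Proof.
move=> hcs; have cs (a : R) (f : R -> R) : continuous f -> continuous (fun t : R => a * f t).
  by move=> cf; apply: continuous_mul => //; exact: continuous_cst.
rewrite (_ : (fun _ => _) = (fun t => \sum_(k <- ms)
  (cos (k%:R * x) * cos_mode c k t j 0 + sin (k%:R * x) * sin_mode c k t j 0))); last first.
  by apply/funext => t; exact: synthE.
elim: ms hcs => [|l ms IH] hcs.
  by rewrite (_ : (fun _ => _) = (fun=> 0)); [exact: continuous_cst|apply/funext => t; rewrite big_nil].
rewrite (_ : (fun _ => _) = (fun t => (cos (l%:R * x) * cos_mode c l t j 0 + sin (l%:R * x) * sin_mode c l t j 0) +
  \sum_(k <- ms) (cos (k%:R * x) * cos_mode c k t j 0 + sin (k%:R * x) * sin_mode c k t j 0))); last first.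
  by apply/funext => t; rewrite big_cons.
have [cla clb] := hcs l (mem_head l ms).
apply: continuous_add; last by apply: IH => q qm; apply: hcs; rewrite inE qm orbT.
by apply: continuous_add; apply: cs; [exact: cla|exact: clb].
Qed.

Lemma int2_trig ms c x j : (forall k, k \in ms -> rcont (cos_mode c k) /\ rcont (sin_mode c k)) ->
  I2 (fun t => synth ms c t x j 0) =
  trig ms (fun k => I2 (fun t => cos_mode c k t j 0)) (fun k => I2 (fun t => sin_mode c k t j 0)) x.
Proof.
move=> hc; rewrite (_ : (fun _ => _) = (fun t => \sum_(k <- ms)
  (cos (k%:R * x) * cos_mode c k t j 0 + sin (k%:R * x) * sin_mode c k t j 0))); last first.
  by apply/funext => t; exact: synthE.
elim: ms hc => [|k ms IH] hc.
  by rewrite /trig big_nil (_ : (fun _ => _) = (fun=> 0)) ?int2_cst ?mulr0//; apply/funext => t; rewrite big_nil.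
have [ca cb] := hc k (mem_head k ms).
have hcs l : l \in ms -> rcont (cos_mode c l) /\ rcont (sin_mode c l).
  by move=> lm; apply: hc; rewrite inE lm orbT.
have cs (a : R) (f : R -> R) : continuous f -> continuous (fun t : R => a * f t).
  by move=> cf; apply: continuous_mul => //; exact: continuous_cst.
have cS : continuous (fun t => \sum_(k <- ms) (cos (k%:R * x) * cos_mode c k t j 0 + sin (k%:R * x) * sin_mode c k t j 0)).
  rewrite (_ : (fun _ => _) = (fun t => synth ms c t x j 0)); first exact: continuous_synth_theta.
  by apply/funext => t; rewrite synthE.
rewrite /trig big_cons -/(trig _ _ _ _) -IH//.
rewrite (_ : (fun _ => _) = (fun t => (cos (k%:R * x) * cos_mode c k t j 0 + sin (k%:R * x) * sin_mode c k t j 0) +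
    \sum_(k <- ms) (cos (k%:R * x) * cos_mode c k t j 0 + sin (k%:R * x) * sin_mode c k t j 0))); last first.
  by apply/funext => t; rewrite big_cons.
rewrite int2D//; last by apply: continuous_add; apply: cs; [exact: ca|exact: cb].
by congr (_ + _); rewrite int2D ?int2Z//; try (apply: cs); by [exact: ca|exact: cb].
Qed.

Lemma I2_cmode1 (f : R -> R) : I2 (fun x => f x * cos x) = pi * cmode 1 f.
Proof.
rewrite /cmode /phi_mode_factor /= mulrA mulfV ?gt_eqF ?pi_gt0// mul1r.
by congr I2; apply/funext => x; rewrite mul1r.
Qed.

Lemma I2_smode1 (f : R -> R) : I2 (fun x => f x * sin x) = pi * smode 1 f.
Proof.
rewrite /smode /phi_mode_factor /= mulrA mulfV ?gt_eqF ?pi_gt0// mul1r.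
by congr I2; apply/funext => x; rewrite mul1r.
Qed.

(** By orthogonality [astar] and [dastar] pair only with mode 1, and the two pairings are the mean
    values of the critical coordinates. *)
Lemma gamma_synth ms c : uniq ms -> 1%N \in ms ->
  (forall k, k \in ms -> rcont (cos_mode c k) /\ rcont (sin_mode c k)) ->
  gamma (synth ms c) 0 0 = T2 ^- 2 * pi * I2 (fun t => p1 (cos_mode c 1 t) (sin_mode c 1 t)) /\
  gamma (synth ms c) 1 0 = T2 ^- 2 * pi * I2 (fun t => p2 (cos_mode c 1 t) (sin_mode c 1 t)).
Proof.
move=> ums mean1 hc; have [ca cb] := hc 1%N mean1.
have cth x j := @continuous_synth_theta ms c x j hc.
pose Ij j x := I2 (fun t => synth ms c t x j 0).
have IE j : Ij j = trig ms (fun k => I2 (fun t => cos_mode c k t j 0)) (fun k => I2 (fun t => sin_mode c k t j 0)).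
  by apply/funext => x; exact: int2_trig.
have cI j : continuous (Ij j) by rewrite IE; exact: continuous_trig.
have cosc : continuous (@cos R) by move=> x; exact: continuous_cos.
have sinc : continuous (@sin R) by move=> x; exact: continuous_sin.
have mc j : cmode 1 (Ij j) = I2 (fun t => cos_mode c 1 t j 0) by rewrite IE cmode_trig// mean1 mul1r.
have msn j : smode 1 (Ij j) = I2 (fun t => sin_mode c 1 t j 0) by rewrite IE smode_trig// mean1 mul1r.
have cs (a : R) (f : R -> R) : continuous f -> continuous (fun t : R => a * f t).
  by move=> cf; apply: continuous_mul => //; exact: continuous_cst.
split; rewrite mxE /= /ip2 -mulrA; congr (_ * _).
- transitivity (I2 (fun x => Ij j1 x * cos x + Ij j2 x * sin x)).
    congr I2; apply/funext => x; rewrite (_ : (fun _ => _) = (fun t => cos x * synth ms c t x j1 0 + sin x * synth ms c t x j2 0)).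
      by rewrite int2D ?int2Z// ?[_ * cos x]mulrC ?[_ * sin x]mulrC//; exact: cs.
    by apply/funext => t; rewrite dotv_astar.
  rewrite int2D; [|exact: continuous_mul|exact: continuous_mul].
  rewrite I2_cmode1 I2_smode1 mc msn -mulrDr -int2D//.
- transitivity (I2 (fun x => Ij j2 x * cos x - Ij j1 x * sin x)).
    congr I2; apply/funext => x; rewrite (_ : (fun _ => _) = (fun t => cos x * synth ms c t x j2 0 - sin x * synth ms c t x j1 0)).
      by rewrite int2B ?int2Z// ?[_ * cos x]mulrC ?[_ * sin x]mulrC//; exact: cs.
    by apply/funext => t; rewrite dotv_dastar.
  rewrite int2B; [|exact: continuous_mul|exact: continuous_mul].
  rewrite I2_cmode1 I2_smode1 mc msn -mulrBr -int2B//.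
Qed.

Lemma gamma_with_astar c : (forall k, (k < 4)%N -> rcont (cos_mode c k) /\ rcont (sin_mode c k)) ->
  gamma (with_astar c) 0 0 = 1 + T2 ^- 2 * pi * I2 (fun t => p1 (cos_mode c 1 t) (sin_mode c 1 t)) /\
  gamma (with_astar c) 1 0 = T2 ^- 2 * pi * I2 (fun t => p2 (cos_mode c 1 t) (sin_mode c 1 t)).
Proof.
move=> hc; have [ca cb] := hc 1%N isT.
have -> : with_astar c = synth ks (add_astar c) by do 2!apply/funext => ?; exact: with_astar_synth.
have hf k : k \in ks -> rcont (cos_mode (add_astar c) k) /\ rcont (sin_mode (add_astar c) k).
  rewrite mem_ks => /hc[h1 h2].
  have add (f : R -> vec) u : rcont f -> rcont (fun t => f t + u).
    move=> cf i; rewrite (_ : (fun _ => _) = (fun t => f t i 0 + u i 0)).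
      by apply: continuous_add; [exact: cf|exact: continuous_cst].
    by apply/funext => t; move: (f t) => g; rewrite mxE.
  by split; apply: add.
have [-> ->] := @gamma_synth ks (add_astar c) isT isT hf.
have E1 : (fun t => p1 (cos_mode (add_astar c) 1 t) (sin_mode (add_astar c) 1 t)) =
    (fun t => p1 (cos_mode c 1 t) (sin_mode c 1 t) + 2).
  apply/funext => t; rewrite /= !scale1r p1D; congr (_ + _).
  by rewrite /p1 e1E e2E eqxx.
have E2 : (fun t => p2 (cos_mode (add_astar c) 1 t) (sin_mode (add_astar c) 1 t)) =
    (fun t => p2 (cos_mode c 1 t) (sin_mode c 1 t)).
  apply/funext => t; rewrite /= !scale1r p2D -[RHS]addr0; congr (_ + _).
  by rewrite /p2 e1E e2E /= subrr.
rewrite E1 E2 int2D ?int2_cst; [|exact: continuous_p1|exact: continuous_cst]; split=> //.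
have p0 : (pi : R) != 0 by rewrite gt_eqF ?pi_gt0.
have alg (p w : R) : p != 0 -> (2 * p) ^- 2 * p * (w + 2 * p * 2) = 1 + (2 * p) ^- 2 * p * w.
  by move=> p0'; field.
by have := alg pi (I2 (fun t => p1 (cos_mode c 1 t) (sin_mode c 1 t))) p0; rewrite mulr_natl.
Qed.

(** [astar] alone contributes exactly [ehat1], and the remaining factor is nonzero; the conditions
    on z become mean-zero conditions on the critical coordinate of the deviation. *)
Lemma gamma_condition c : (forall k, (k < 4)%N -> rcont (cos_mode c k) /\ rcont (sin_mode c k)) ->
  gamma (with_astar c) - ehat1 = 0 <->
  I2 (fun t => p1 (cos_mode c 1 t) (sin_mode c 1 t)) = 0 /\
  I2 (fun t => p2 (cos_mode c 1 t) (sin_mode c 1 t)) = 0.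
Proof.
move=> /gamma_with_astar[g0 g1]; have p0 : T2 ^- 2 * pi != 0 :> R.
  by rewrite mulf_neq0 ?gt_eqF ?invr_gt0 ?exprn_gt0 ?twopi_gt0 ?pi_gt0.
split=> [Hg|[h1 h2]].
  have := congr1 (fun M : 'cV[R]_2 => M 0 0) Hg; have := congr1 (fun M : 'cV[R]_2 => M 1 0) Hg.
  move: (gamma _) g0 g1 => G g0 g1; rewrite !mxE g0 g1 /= subr0 addrC addKr.
  by move=> /eqP; rewrite mulf_eq0 (negPf p0) /= => /eqP -> /eqP; rewrite mulf_eq0 (negPf p0) /= => /eqP ->.
apply/colP => i; rewrite h1 mulr0 addr0 in g0; rewrite h2 mulr0 in g1.
move: (gamma _) g0 g1 => G g0 g1; rewrite !mxE.
by have [->|->] := ord2P i; rewrite ?g0 ?g1 /= ?subrr ?subr0.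
Qed.

(** A mode is an average against a bounded function, normalised so that the sup norm grows by a
    factor of at most 2. *)
Lemma near_modes c (dl : R) : (forall t x, enorm (with_astar c t x - astar x) < dl) ->
  (forall t, sin_mode c 0 t = 0) -> 0 <= dl ->
  forall k t i, (k < 4)%N -> `|cos_mode c k t i 0| <= 2 * dl /\ `|sin_mode c k t i 0| <= 2 * dl.
Proof.
move=> hz s0 dl0 k t i k4; have mk : k \in ks by rewrite mem_ks.
have E1 t' x : with_astar c t' x - astar x = synth ks c t' x by rewrite /with_astar addrC addKr.
have b x : `|synth ks c t x i 0| <= dl.
  by rewrite -E1; apply: le_trans (entry_le_enorm _ _) (ltW (hz t x)).
have cx : continuous (fun x => synth ks c t x i 0).
  rewrite (_ : (fun _ => _) = trig ks (fun l => cos_mode c l t i 0) (fun l => sin_mode c l t i 0)).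
    exact: continuous_trig.
  by apply/funext => x; exact: synthE.
split.
  have h := @phi_cos_synth _ _ ks c k t isT; rewrite mk scale1r in h.
  by rewrite -h phi_cosE; exact: cmode_bound.
have [->|k0] := eqVneq k 0%N; first by rewrite s0 mxE normr0 mulr_ge0.
have h := @phi_sin_synth _ _ ks c k t isT; rewrite mk k0 scale1r in h.
by rewrite -h phi_sinE; exact: smode_bound.
Qed.

End ModeConversions.

(** * The iteration on states *)

Section Iteration.
Context {R : realType} {m : nat}.
Local Notation n := (2 + m)%N.
Local Notation vec := 'cV[R]_n.
Local Notation mat := 'M[R]_n.
Local Notation T2 := ((pi : R) *+ 2).
Local Notation I2 := (@integral_2pi R).
Local Notation ks := [:: 0; 1; 2; 3]%N.
Local Notation e1 := (@e1 R m).
Local Notation e2 := (@e2 R m).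
Local Notation state := (@state R m).
Variables (lams r oms : R) (Ets : 'M[R]_m) (alphaR alphaI : R -> R) (Et : R -> 'M[R]_m).
(** The nonlinearity in G = E z + e H. Its local Lipschitz bound includes theta and serves
    continuity of the modes in theta; the other bound is at fixed theta with a constant valid for
    all theta and drives the contraction. *)
Variable H : vec -> R -> R -> R -> vec.
Local Notation E := (fun lam => exponent_mx (alphaR lam) (alphaI lam) (Et lam)).
Local Notation Es := (exponent_mx 0 oms Ets).
Hypothesis r_gt0 : 0 < r.
Hypothesis base : [/\ alphaR lams = 0, alphaI lams = oms & Et lams = Ets].
Hypothesis H_lipschitz_local : forall Bz Bth, exists2 C, 0 <= C &
  forall (e : R) (z : vec) (lam th : R), `|e| <= 1 -> (forall i, `|z i 0| <= Bz) ->
    `|lam - lams| <= r / 2 -> `|th| <= Bth ->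
    (forall i, `|H z lam th e i 0| <= C) /\
    (forall (z' : vec) (lam' th' w : R), (forall i, `|z' i 0| <= Bz) -> `|lam' - lams| <= r / 2 ->
      `|th'| <= Bth -> (forall i, `|z' i 0 - z i 0| <= w) -> `|lam' - lam| <= w ->
      `|th' - th| <= w ->
      forall i, `|H z' lam' th' e i 0 - H z lam th e i 0| <= C * w).
Hypothesis H_lipschitz : forall Bz, exists2 C, 0 <= C &
  forall (e : R) (z : vec) (lam th : R), `|e| <= 1 -> (forall i, `|z i 0| <= Bz) ->
    `|lam - lams| <= r / 2 ->
    (forall i, `|H z lam th e i 0| <= C) /\
    (forall (z' : vec) (lam' w : R), (forall i, `|z' i 0| <= Bz) -> `|lam' - lams| <= r / 2 ->
      (forall i, `|z' i 0 - z i 0| <= w) -> `|lam' - lam| <= w ->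
      forall i, `|H z' lam' th e i 0 - H z lam th e i 0| <= C * w).
Hypothesis H_periodic : forall z lam e, `|lam - lams| < r -> periodic (fun th => H z lam th e) T2.

(** The last condition is the amplitude and phase condition; it is also what makes the k = 1
    equation solvable at the next step. *)
Definition regular (X : state) := [/\
  forall k, (k < 4)%N -> rcont (cos_mode (s_modes X) k) /\ rcont (sin_mode (s_modes X) k),
  forall k, (k < 4)%N -> periodic (cos_mode (s_modes X) k) T2 /\ periodic (sin_mode (s_modes X) k) T2 &
  I2 (fun t => p1 (cos_mode (s_modes X) 1 t) (sin_mode (s_modes X) 1 t)) = 0 /\
  I2 (fun t => p2 (cos_mode (s_modes X) 1 t) (sin_mode (s_modes X) 1 t)) = 0].

Definition base_state : state := State lams oms (Modes (fun _ _ => 0) (fun _ _ => 0)).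

Definition ball_of d X := regular X /\ wdist X base_state d d.

Definition Wfun e X t x : vec := H (with_astar (s_modes X) t x) (s_lam X) t e.
Definition cos_H e X k t := cos_mode (phi_modes (Wfun e X)) k t.
Definition sin_H e X k t := sin_mode (phi_modes (Wfun e X)) k t.
Definition mean1 e X := T2^-1 * I2 (fun t => p1 (cos_H e X 1 t) (sin_H e X 1 t)).
Definition mean2 e X := T2^-1 * I2 (fun t => p2 (cos_H e X 1 t) (sin_H e X 1 t)).

(* For k = 1 the critical mean of the nonlinearity is subtracted; it is balanced by
   the choice of lam and om in [step]. *)
Definition cos_forcing e X k t : vec := (E (s_lam X) - Es) *m cos_mode (s_modes X) k t
  - (k%:R * (s_om X - oms)) *: sin_mode (s_modes X) k t
  + e *: (cos_H e X k t - (k == 1%N)%:R *: va (mean1 e X) (mean2 e X)).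
Definition sin_forcing e X k t : vec := (E (s_lam X) - Es) *m sin_mode (s_modes X) k t
  + (k%:R * (s_om X - oms)) *: cos_mode (s_modes X) k t
  + e *: (sin_H e X k t - (k == 1%N)%:R *: vb (mean1 e X) (mean2 e X)).

Lemma ball_lam d X : ball_of d X -> `|s_lam X - lams| <= d.
Proof. by case=> _ /(_ CLam I). Qed.

Lemma ball_om d X : ball_of d X -> `|s_om X - oms| <= d.
Proof. by case=> _ /(_ COm I). Qed.

Lemma ball_cos d X k t i : ball_of d X -> (k < 4)%N -> `|cos_mode (s_modes X) k t i 0| <= d.
Proof. by move=> [_ h] k4; have := h (CCos k t i) k4; rewrite /= mxE subr0; case: odd. Qed.

Lemma ball_sin d X k t i : ball_of d X -> (k < 4)%N -> `|sin_mode (s_modes X) k t i 0| <= d.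
Proof. by move=> [_ h] k4; have := h (CSin k t i) k4; rewrite /= mxE subr0; case: odd. Qed.

Lemma with_astar_base t x : with_astar (m := m) (s_modes base_state) t x = astar x.
Proof.
rewrite /with_astar /synth !big_cons big_nil /=.
by rewrite !scaler0 !addr0.
Qed.

(** The constant 10 is 2 for [astar] plus 4 (d + d) for the deviation, with d at most 1. *)
Lemma ball_with_astar d X t x i : d <= 1 -> ball_of d X -> `|with_astar (s_modes X) t x i 0| <= 10.
Proof.
move=> d1 [_ h]; have := with_astar_diff t x i h; rewrite with_astar_base => h1.
have := astar_bound x i.
have := ler_normD (with_astar (s_modes X) t x i 0 - astar x i 0) (astar x i 0).
rewrite subrK; lra.
Qed.

Section Radius.
Variable d : R.
Hypothesis d_le1 : d <= 1.
Hypothesis d_ler : d <= r / 2.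

Let lam_half X : ball_of d X -> `|s_lam X - lams| <= r / 2.
Proof. by move=> /ball_lam h; exact: le_trans h d_ler. Qed.

Let lam_in X : ball_of d X -> `|s_lam X - lams| < r.
Proof. by move=> /lam_half h; apply: le_lt_trans h _; move: r_gt0; lra. Qed.

Lemma continuous_synth (c : modes R n) t i : continuous (fun x => synth ks c t x i 0).
Proof.
have -> : (fun x => synth ks c t x i 0) = trig ks (fun l => cos_mode c l t i 0) (fun l => sin_mode c l t i 0).
  by apply/funext => x; exact: synthE.
exact: continuous_trig.
Qed.

Lemma with_astar_continuous (c : modes R n) t i : continuous (fun x => with_astar c t x i 0).
Proof.
by rewrite (_ : (fun _ => _) = (fun x => synth ks (add_astar c) t x i 0)); [exact: continuous_synth|
  apply/funext => x; rewrite with_astar_synth].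
Qed.

Lemma W_continuous_phi e X t i : `|e| <= 1 -> ball_of d X -> continuous (fun x => Wfun e X t x i 0).
Proof.
move=> he BX x0; have [C C0 HC] := H_lipschitz 10.
pose w x := \sum_j `|with_astar (s_modes X) t x j 0 - with_astar (s_modes X) t x0 j 0|.
apply: (@continuous_dominated _ _ w C).
- apply: continuous_sum => j.
  exact: (@continuous_normB _ (fun x => with_astar (s_modes X) t x j 0) _ (with_astar_continuous (c := s_modes X) (t := t) (i := j))).
- by rewrite /w big1// => j _; rewrite subrr normr0.
- move=> x _; rewrite /Wfun.
  have [_ h] := HC e _ _ t he (fun j => ball_with_astar t x0 j d_le1 BX) (lam_half BX).
  apply: h; [by move=> j; exact: ball_with_astar BX|exact: lam_half| |].
    by move=> j; rewrite /w (bigD1 j)//= lerDl sumr_ge0.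
  by rewrite subrr normr0 /w sumr_ge0.
Qed.

Lemma W_bound : exists2 C, 0 <= C & forall e X t x i, `|e| <= 1 -> ball_of d X ->
  `|Wfun e X t x i 0| <= C.
Proof.
have [C C0 HC] := H_lipschitz 10; exists C => // e X t x i he BX.
by have [h _] := HC e _ _ t he (fun j => ball_with_astar t x j d_le1 BX) (lam_half BX); exact: h.
Qed.

Lemma H_modes_bound : exists2 C, 0 <= C & forall e X k t i, `|e| <= 1 -> ball_of d X ->
  `|cos_H e X k t i 0| <= C /\ `|sin_H e X k t i 0| <= C.
Proof.
have [C C0 HC] := W_bound; exists (2 * C) => [|e X k t i he BX]; first by rewrite mulr_ge0.
rewrite /cos_H /sin_H phi_cosE phi_sinE; split; [apply: cmode_bound|apply: smode_bound] => [|x||x];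
  by [exact: W_continuous_phi|exact: HC].
Qed.

Lemma H_modes_diff : exists2 C, 0 <= C & forall e X Y k t i DO DE, `|e| <= 1 -> ball_of d X ->
  ball_of d Y -> wdist X Y DO DE ->
  `|cos_H e X k t i 0 - cos_H e Y k t i 0| <= C * (DO + DE) /\ `|sin_H e X k t i 0 - sin_H e Y k t i 0| <= C * (DO + DE).
Proof.
have [C C0 HC] := H_lipschitz 10; exists (2 * (C * 4)) => [|e X Y k t i DO DE he BX BY XY].
  by rewrite !mulr_ge0.
have DO0 : 0 <= DO by apply: le_trans (XY CLam I).
have DE0 : 0 <= DE by apply: le_trans (XY (CCos 0 0 j1) isT).
have W x : `|Wfun e X t x i 0 - Wfun e Y t x i 0| <= C * 4 * (DO + DE).
  have [_ h] := HC e _ _ t he (fun j => ball_with_astar t x j d_le1 BY) (lam_half BY).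
  rewrite -mulrA; apply: h; [by move=> j; exact: ball_with_astar BX|exact: lam_half| |].
    by move=> j; exact: with_astar_diff.
  by have := XY CLam I => /= h; apply: le_trans h _; lra.
have cX := @W_continuous_phi e X t i he BX; have cY := @W_continuous_phi e Y t i he BY.
rewrite /cos_H /sin_H !phi_cosE !phi_sinE -cmodeB// -smodeB// -[2 * (C * 4) * _]mulrA.
by split; [apply: cmode_bound|apply: smode_bound] => //; exact: continuous_sub.
Qed.

(** The local Lipschitz bound dominates the variation in theta by [w], the sum of the variation of
    theta and of all modes of [X], independently of phi. It is therefore preserved by the average
    over phi, and [w] is continuous with value 0 at [t0]. *)
Lemma H_modes_continuous e X k : `|e| <= 1 -> ball_of d X -> rcont (cos_H e X k) /\ rcont (sin_H e X k).
Proof.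
move=> he BX; have [[rX _ _] _] := BX.
pose w t0 t := `|t - t0| + \sum_(j < n) (
  (`|cos_mode (s_modes X) 0 t j 0 - cos_mode (s_modes X) 0 t0 j 0| +
   `|sin_mode (s_modes X) 0 t j 0 - sin_mode (s_modes X) 0 t0 j 0|) +
  (`|cos_mode (s_modes X) 1 t j 0 - cos_mode (s_modes X) 1 t0 j 0| +
   `|sin_mode (s_modes X) 1 t j 0 - sin_mode (s_modes X) 1 t0 j 0|) +
  (`|cos_mode (s_modes X) 2 t j 0 - cos_mode (s_modes X) 2 t0 j 0| +
   `|sin_mode (s_modes X) 2 t j 0 - sin_mode (s_modes X) 2 t0 j 0|) +
  (`|cos_mode (s_modes X) 3 t j 0 - cos_mode (s_modes X) 3 t0 j 0| +
   `|sin_mode (s_modes X) 3 t j 0 - sin_mode (s_modes X) 3 t0 j 0|)).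
have cw t0 : continuous (w t0).
  have cn := @continuous_normB R.
  apply: continuous_add; first by apply: cn => x; exact: cvg_id.
  have c2 k' j : (k' < 4)%N -> continuous (fun t =>
      `|cos_mode (s_modes X) k' t j 0 - cos_mode (s_modes X) k' t0 j 0| +
      `|sin_mode (s_modes X) k' t j 0 - sin_mode (s_modes X) k' t0 j 0|).
    by move=> /rX[h1 h2]; apply: continuous_add; apply: cn; [exact: h1|exact: h2].
  apply: continuous_sum => j.
  exact: (continuous_add (continuous_add (continuous_add (c2 0%N j isT) (c2 1%N j isT)) (c2 2%N j isT)) (c2 3%N j isT)).
have w0 t0 : w t0 t0 = 0.
  by rewrite /w subrr normr0 add0r big1// => j _; rewrite !subrr !normr0 !addr0.
have main t0 i : exists2 C, 0 <= C & forall t, `|t - t0| <= 1 -> forall x,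
    `|Wfun e X t x i 0 - Wfun e X t0 x i 0| <= C * w t0 t.
  have [C C0 HC] := H_lipschitz_local 10 (`|t0| + 1); exists C => // t tt0 x.
  have ht0 : `|t0| <= `|t0| + 1 by rewrite lerDl.
  have [_ h] := HC e _ _ t0 he (fun j => ball_with_astar t0 x j d_le1 BX) (lam_half BX) ht0.
  have S0 : 0 <= \sum_(j < n) (
  (`|cos_mode (s_modes X) 0 t j 0 - cos_mode (s_modes X) 0 t0 j 0| +
   `|sin_mode (s_modes X) 0 t j 0 - sin_mode (s_modes X) 0 t0 j 0|) +
  (`|cos_mode (s_modes X) 1 t j 0 - cos_mode (s_modes X) 1 t0 j 0| +
   `|sin_mode (s_modes X) 1 t j 0 - sin_mode (s_modes X) 1 t0 j 0|) +
  (`|cos_mode (s_modes X) 2 t j 0 - cos_mode (s_modes X) 2 t0 j 0| +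
   `|sin_mode (s_modes X) 2 t j 0 - sin_mode (s_modes X) 2 t0 j 0|) +
  (`|cos_mode (s_modes X) 3 t j 0 - cos_mode (s_modes X) 3 t0 j 0| +
   `|sin_mode (s_modes X) 3 t j 0 - sin_mode (s_modes X) 3 t0 j 0|)).
    by apply: sumr_ge0 => j _; rewrite !addr_ge0.
  apply: h; [by move=> j; exact: ball_with_astar BX|exact: lam_half| | | |].
  - by have := ler_normD (t - t0) t0; rewrite subrK; move: tt0; lra.
  - move=> j; rewrite /w; apply: ler_wpDl => //.
    rewrite /with_astar; move: (astar x) => u.
    have -> : (u + synth ks (s_modes X) t x) j 0 - (u + synth ks (s_modes X) t0 x) j 0 =
        synth ks (s_modes X) t x j 0 - synth ks (s_modes X) t0 x j 0.
      by move: (synth _ _ _ _) (synth _ _ _ _) => a b; rewrite !mxE; ring.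
    apply: le_trans (synth_diff x (A := fun k => _) (fun k k4 => lexx _)) _.
    by rewrite (bigD1 j)//= lerDl sumr_ge0// => l _; rewrite !addr_ge0.
  - by rewrite subrr normr0 addr_ge0.
  - by rewrite /w lerDl.
have gen (md : (R -> R) -> R) (f : R -> R -> R) t0 C : (forall t, continuous (f t)) ->
    (forall u M, continuous u -> (forall x, `|u x| <= M) -> `|md u| <= 2 * M) ->
    (forall u u', continuous u -> continuous u' -> md (fun x => u x - u' x) = md u - md u') ->
    (forall t, `|t - t0| <= 1 -> forall x, `|f t x - f t0 x| <= C * w t0 t) ->
    {for t0, continuous (fun t => md (f t))}.
  move=> cf mb mB hC; apply: (@continuous_dominated _ _ (w t0) (2 * C)) => [||t tt0].
  - exact: cw.
  - exact: w0.
  rewrite -mB// -mulrA; apply: mb; first exact: continuous_sub.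
  by move=> x; exact: hC.
split=> i t0; have [C C0 HC] := main t0 i.
  rewrite (_ : (fun _ => _) = (fun t => cmode k (fun x => Wfun e X t x i 0))); last first.
    by apply/funext => t; rewrite /cos_H phi_cosE.
  apply: (gen (cmode k) (fun t x => Wfun e X t x i 0) t0 C) => //.
  + by move=> t; exact: W_continuous_phi.
  + by move=> *; exact: cmode_bound.
  + by move=> *; exact: cmodeB.
rewrite (_ : (fun _ => _) = (fun t => smode k (fun x => Wfun e X t x i 0))); last first.
  by apply/funext => t; rewrite /sin_H phi_sinE.
apply: (gen (smode k) (fun t x => Wfun e X t x i 0) t0 C) => //.
+ by move=> t; exact: W_continuous_phi.
+ by move=> *; exact: smode_bound.
+ by move=> *; exact: smodeB.
Qed.

Lemma H_modes_periodic e X k : ball_of d X -> periodic (cos_H e X k) T2 /\ periodic (sin_H e X k) T2.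
Proof.
move=> BX; have [[_ pX _] _] := BX.
have E1 t x : Wfun e X (t + T2) x = Wfun e X t x.
  rewrite /Wfun H_periodic; last exact: lam_in.
  congr (H _ _ _ _); rewrite /with_astar; congr (_ + _); rewrite /synth big_seq [RHS]big_seq.
  by apply: eq_bigr => l; rewrite mem_ks => /pX[p q]; rewrite p q.
by split=> t; apply/colP => i; rewrite /cos_H /sin_H ?phi_cosE ?phi_sinE;
  congr (_ _ _); apply/funext => x; rewrite E1.
Qed.

(** * Dependence on lam, and Lipschitz estimates for the forcing *)

Hypothesis E_taylor : exists2 L, 0 <= L & forall i j, exists dE : R -> R,
  (forall lam, `|lam - lams| <= r / 2 -> der (fun l => E l i j) lam (dE lam)) /\
  (forall lam, `|lam - lams| <= r / 2 -> `|dE lam| <= L /\ `|dE lam - dE lams| <= L * `|lam - lams|).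
Variable kappa : R.
Hypothesis kappa_der : der alphaR lams kappa.
Hypothesis kappa_neq0 : kappa != 0.

Lemma mvt_lip_ball (f df : R -> R) (c0 rad M : R) : (forall x : R, `|x - c0| <= rad -> der f x (df x)) ->
  (forall x, `|x - c0| <= rad -> `|df x| <= M) ->
  forall x y, `|x - c0| <= rad -> `|y - c0| <= rad -> `|f x - f y| <= M * `|x - y|.
Proof.
move=> h1 h2 x y; wlog xy : x y / y <= x => [W hx hy|].
  case: (leP y x) => [|/ltW] h; first exact: W.
  by rewrite distrC [`|x - y|]distrC; exact: W.
rewrite (ger0_norm (x := x - y)) ?subr_ge0//.
rewrite ![`|_ - c0| <= _]ler_norml => /andP[x1 x2] /andP[y1 y2].
have hI z : y <= z <= x -> `|z - c0| <= rad.
  by move=> /andP[? ?]; rewrite ler_norml; apply/andP; split; lra.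
by have := @mvt_bound _ f df y x M xy (fun z hz => h1 z (hI z hz)) (fun z hz => h2 z (hI z hz)).
Qed.

Lemma E_lipschitz : exists2 L, 0 <= L & forall lam lam' i j, `|lam - lams| <= r / 2 ->
  `|lam' - lams| <= r / 2 -> `|E lam i j - E lam' i j| <= L * `|lam - lam'|.
Proof.
have [L L0 HL] := E_taylor; exists L => // lam lam' i j h h'.
have [dE [d1 d2]] := HL i j.
by apply: (@mvt_lip_ball (fun l => E l i j) dE lams (r / 2)) => // x hx; have [] := d2 x hx.
Qed.

Lemma exponent_j1 x y (A : 'M[R]_m) : exponent_mx x y A j1 j1 = x.
Proof. by rewrite /exponent_mx block_mxEul mxE eqxx. Qed.

Lemma exponent_j2 x y (A : 'M[R]_m) : exponent_mx x y A j2 j1 = y.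
Proof. by rewrite /exponent_mx block_mxEul mxE. Qed.

Lemma E_base : E lams = Es.
Proof. by have [-> -> ->] := base. Qed.

(** A Newton step for the zero of [alphaR] with the slope frozen at its value for [lams]. Its
    derivative 1 - alphaR' / kappa is O(|lam - lams|), so its Lipschitz constant is proportional to
    the radius of the ball; transversality is what allows division by [kappa]. *)
Definition lam_step lam := lam - alphaR lam / kappa.

Lemma lam_step_lipschitz : exists2 L, 0 <= L & forall dl lam lam', dl <= r / 2 ->
  `|lam - lams| <= dl -> `|lam' - lams| <= dl ->
  `|lam_step lam - lam_step lam'| <= L * dl * `|lam - lam'|.
Proof.
have [L L0 HL] := E_taylor; exists (L / `|kappa|) => [|dl lam lam' hd h h'].
  by rewrite divr_ge0.
have [dE [d1 d2]] := HL j1 j1.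
have dR x : `|x - lams| <= dl -> der alphaR x (dE x).
  by move=> hx; apply: der_ext (d1 x (le_trans hx hd)) => l; rewrite exponent_j1.
have h0 : `|lams - lams| <= dl by rewrite subrr normr0 (le_trans _ h).
have kE : kappa = dE lams by exact: der_uniq kappa_der (dR _ h0).
apply: (@mvt_lip_ball lam_step (fun x => 1 - dE x / kappa) lams dl) => // x hx.
  apply: der_ext (der_val _ (der_sub (der_id x) (der_mul (dR x hx) (der_cst kappa^-1 x)))) => //.
  by rewrite mulr0 add0r mulrC.
rewrite (_ : 1 - dE x / kappa = - (kappa^-1 * (dE x - dE lams))); last first.
  by rewrite -kE; field.
rewrite normrN normrM normfV mulrC mulrAC -[leLHS]mulrC mulrC; apply: ler_wpM2r; first by rewrite invr_ge0.
have [_ h2] := d2 x (le_trans hx hd); apply: le_trans h2 _; exact: ler_wpM2l.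
Qed.

Lemma ball_mono dl X : dl <= d -> ball_of dl X -> ball_of d X.
Proof.
move=> h [h1 h2]; split=> // j oj; apply: le_trans (h2 j oj) _.
by case: j oj => [||k t i|k t i] _ //=; case: odd.
Qed.

Lemma va_diff (x y x' y' : R) i : `|va x y i 0 - va (m := m) x' y' i 0| <= `|x - x'| + `|y - y'|.
Proof.
have b1 : `|e1 i 0| <= 1 by rewrite !mxE; case: (_ && _); rewrite ?normr0 ?normr1.
have b2 : `|e2 i 0| <= 1 by rewrite !mxE; case: (_ && _); rewrite ?normr0 ?normr1.
have -> : va x y i 0 - va x' y' i 0 = 2^-1 * ((x - x') * e1 i 0 + (y - y') * e2 i 0).
  by rewrite /va; move: e1 e2 => u w; rewrite !mxE; ring.
rewrite normrM ger0_norm ?invr_ge0//.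
have h1 : `|(x - x') * e1 i 0| <= `|x - x'| by rewrite normrM ler_piMr.
have h2 : `|(y - y') * e2 i 0| <= `|y - y'| by rewrite normrM ler_piMr.
by have := ler_normD ((x - x') * e1 i 0) ((y - y') * e2 i 0); have := normr_ge0 (x - x'); have := normr_ge0 (y - y'); lra.
Qed.

Lemma vb_diff (x y x' y' : R) i : `|vb x y i 0 - vb (m := m) x' y' i 0| <= `|x - x'| + `|y - y'|.
Proof.
have b1 : `|e1 i 0| <= 1 by rewrite !mxE; case: (_ && _); rewrite ?normr0 ?normr1.
have b2 : `|e2 i 0| <= 1 by rewrite !mxE; case: (_ && _); rewrite ?normr0 ?normr1.
have -> : vb x y i 0 - vb x' y' i 0 = 2^-1 * ((x - x') * e2 i 0 - (y - y') * e1 i 0).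
  by rewrite /vb; move: e1 e2 => u w; rewrite !mxE; ring.
rewrite normrM ger0_norm ?invr_ge0//.
have h1 : `|(x - x') * e2 i 0| <= `|x - x'| by rewrite normrM ler_piMr.
have h2 : `|(y - y') * e1 i 0| <= `|y - y'| by rewrite normrM ler_piMr.
by have := ler_normB ((x - x') * e2 i 0) ((y - y') * e1 i 0); have := normr_ge0 (x - x'); have := normr_ge0 (y - y'); lra.
Qed.

Lemma va0 : va (m := m) (0 : R) 0 = 0.
Proof. by rewrite /va !scale0r addr0 scaler0. Qed.

Lemma vb0 : vb (m := m) (0 : R) 0 = 0.
Proof. by rewrite /vb !scale0r subr0 scaler0. Qed.

Lemma mean_p_diff (a b a' b' : R -> vec) M : rcont a -> rcont b -> rcont a' -> rcont b' ->
  (forall t i, `|a t i 0 - a' t i 0| <= M) -> (forall t i, `|b t i 0 - b' t i 0| <= M) ->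
  `|T2^-1 * I2 (fun t => p1 (a t) (b t)) - T2^-1 * I2 (fun t => p1 (a' t) (b' t))| <= 2 * M /\
  `|T2^-1 * I2 (fun t => p2 (a t) (b t)) - T2^-1 * I2 (fun t => p2 (a' t) (b' t))| <= 2 * M.
Proof.
move=> ca cb ca' cb' ha hb; have T0 := twopi_gt0 (R := R).
have c1 := continuous_p1 ca cb; have c1' := continuous_p1 ca' cb'.
have c2 := continuous_p2 ca cb; have c2' := continuous_p2 ca' cb'.
split; rewrite -mulrBr -int2B// normrM normfV (gtr0_norm T0) ler_pdivrMl//;
  apply: int2_bound => [|t]; try exact: continuous_sub.
  rewrite /p1 opprD addrACA; apply: le_trans (ler_normD _ _) _.
  by have := ha t j1; have := hb t j2; lra.
rewrite /p2 (_ : _ - _ = (a t j2 0 - a' t j2 0) - (b t j1 0 - b' t j1 0)); last by ring.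
apply: le_trans (ler_normB _ _) _; have := ha t j2; have := hb t j1; lra.
Qed.

Lemma m_diff : exists2 C, 0 <= C & forall e X Y DO DE, `|e| <= 1 -> ball_of d X ->
  ball_of d Y -> wdist X Y DO DE ->
  `|mean1 e X - mean1 e Y| <= C * (DO + DE) /\ `|mean2 e X - mean2 e Y| <= C * (DO + DE).
Proof.
have [C C0 HC] := H_modes_diff; exists (2 * C) => [|e X Y DO DE he BX BY XY].
  by rewrite mulr_ge0.
have [cX sX] := H_modes_continuous 1 he BX; have [cY sY] := H_modes_continuous 1 he BY.
rewrite -mulrA; apply: mean_p_diff => // t i; by have [] := HC e X Y 1%N t i DO DE he BX BY XY.
Qed.

Lemma m_bound : exists2 C, 0 <= C & forall e X, `|e| <= 1 -> ball_of d X ->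
  `|mean1 e X| <= C /\ `|mean2 e X| <= C.
Proof.
have [C C0 HC] := H_modes_bound; exists (2 * C) => [|e X he BX]; first by rewrite mulr_ge0.
have [cX sX] := H_modes_continuous 1 he BX.
have c0 : rcont (fun=> 0 : vec) by move=> i; exact: continuous_cst.
have z1 : I2 (fun _ : R => p1 (0 : vec) 0) = 0 by rewrite int2_cst /p1 !mxE addr0 mulr0.
have z2 : I2 (fun _ : R => p2 (0 : vec) 0) = 0 by rewrite int2_cst /p2 !mxE subr0 mulr0.
have := @mean_p_diff _ _ _ _ C cX sX c0 c0; rewrite z1 z2 mulr0 !subr0; apply=> t i.
  by rewrite [(0 : vec) i 0]mxE subr0; have [] := HC e X 1%N t i he BX.
by rewrite [(0 : vec) i 0]mxE subr0; have [] := HC e X 1%N t i he BX.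
Qed.

(** The linear part of the forcing is a sum of products of two quantities that are O(dl) in the
    ball, so the difference of two such products carries a factor [dl]. The coefficient 3 is the
    largest mode index. *)
Lemma linear_part_diff (A A' : mat) (a b h a' b' h' : vec) (c c' e dl DO Dk Lp Ch : R) :
  0 <= Lp -> 0 <= dl -> 0 <= DO ->
  (forall i j, `|A i j| <= Lp * dl) -> (forall i j, `|A i j - A' i j| <= Lp * DO) ->
  (forall i, `|a i 0 - a' i 0| <= Dk) -> (forall i, `|a' i 0| <= dl) ->
  (forall i, `|b i 0 - b' i 0| <= Dk) -> (forall i, `|b' i 0| <= dl) ->
  `|c| <= 3 * dl -> `|c - c'| <= 3 * DO -> (forall i, `|h i 0 - h' i 0| <= Ch) ->
  forall i, `|(A *m a + c *: b + e *: h) i 0 - (A' *m a' + c' *: b' + e *: h') i 0| <=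
    (n%:R * Lp + 3) * (dl * (DO + Dk)) + `|e| * Ch.
Proof.
move=> L0 dl0 DO0 hA hAA ha ha' hb hb' hc hcc hh i.
have Dk0 : 0 <= Dk by apply: le_trans (ha j1).
have E1 : (A *m a + c *: b + e *: h) i 0 - (A' *m a' + c' *: b' + e *: h') i 0 =
    ((A *m (a - a')) i 0 + ((A - A') *m a') i 0) +
    (c * (b i 0 - b' i 0) + (c - c') * b' i 0) + e * (h i 0 - h' i 0).
  rewrite mulmxBr mulmxBl; move: (A *m a) (A *m a') (A' *m a') => u1 u2 u3.
  by rewrite !mxE; ring.
rewrite E1 {E1}.
have t1 : `|(A *m (a - a')) i 0| <= n%:R * (Lp * dl * Dk).
  apply: mulmx_entry_bound => //; first exact: mulr_ge0.
  by move=> j; rewrite !mxE; exact: ha.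
have t2 : `|((A - A') *m a') i 0| <= n%:R * (Lp * DO * dl).
  apply: mulmx_entry_bound => //; first exact: mulr_ge0.
  by move=> k l; rewrite !mxE; exact: hAA.
have t3 : `|c * (b i 0 - b' i 0)| <= 3 * dl * Dk by rewrite normrM; apply: ler_pM.
have t4 : `|(c - c') * b' i 0| <= 3 * DO * dl by rewrite normrM; apply: ler_pM.
have t5 : `|e * (h i 0 - h' i 0)| <= `|e| * Ch by rewrite normrM; apply: ler_wpM2l.
apply: le_trans (ler_normD _ _) _; apply: lerD => //.
apply: le_trans (ler_normD _ _) _.
apply: le_trans (lerD (le_trans (ler_normD _ _) (lerD t1 t2)) (le_trans (ler_normD _ _) (lerD t3 t4))) _.
by rewrite le_eqVlt; apply/orP; left; apply/eqP; ring.
Qed.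

(** The term with [dl] contains only the distance of the mode's own parity besides [DO], because the
    linear part is diagonal in k; the other parity enters only through the nonlinearity and its
    factor |e|. This asymmetry produces the two different orders of the final estimate. *)
Lemma forcing_diff : exists2 C, 0 <= C & forall dl e X Y k t i DO DE, `|e| <= 1 -> dl <= d ->
  ball_of dl X -> ball_of dl Y -> wdist X Y DO DE -> (k < 4)%N ->
  `|cos_forcing e X k t i 0 - cos_forcing e Y k t i 0| <= C * (dl * (DO + if odd k then DO else DE) + `|e| * (DO + DE)) /\
  `|sin_forcing e X k t i 0 - sin_forcing e Y k t i 0| <= C * (dl * (DO + if odd k then DO else DE) + `|e| * (DO + DE)).
Proof.
have [L L0 HL] := E_lipschitz; have [C1 C10 HC1] := H_modes_diff; have [C2 C20 HC2] := m_diff.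
exists ((n%:R * L + 3) + (C1 + 2 * C2)) => [|dl e X Y k t i DO DE he hd BX BY XY k4].
  by rewrite !addr_ge0// mulr_ge0// ler0n.
have BX' := ball_mono hd BX; have BY' := ball_mono hd BY.
have DO0 : 0 <= DO by apply: le_trans (XY CLam I).
have DE0 : 0 <= DE by apply: le_trans (XY (CCos 0 0 j1) isT).
have dl0 : 0 <= dl by apply: le_trans (ball_lam BX).
set Dk := if odd k then DO else DE.
have Dk0 : 0 <= Dk by rewrite /Dk; case: odd.
have hlX := le_trans (ball_lam BX') d_ler; have hlY := le_trans (ball_lam BY') d_ler.
have h00 : `|lams - lams| <= r / 2 by rewrite subrr normr0 (le_trans _ hlX).
have hA a b : `|(E (s_lam X) - Es) a b| <= L * dl.
  rewrite -E_base; have := HL _ _ a b hlX h00; move: (E _) (E _) => M M'; rewrite !mxE => h.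
  apply: le_trans h _; apply: ler_wpM2l => //; exact: ball_lam.
have hAA a b : `|(E (s_lam X) - Es) a b - (E (s_lam Y) - Es) a b| <= L * DO.
  have := HL _ _ a b hlX hlY; move: (E _) (E _) (Es) => M M' M''; rewrite !mxE => h.
  rewrite opprB addrA subrK; apply: le_trans h _; apply: ler_wpM2l => //; exact: (XY CLam I).
have k3 : (k%:R : R) <= 3 by rewrite ler_nat.
have hc (X' : state) : ball_of dl X' -> `|k%:R * (s_om X' - oms)| <= 3 * dl.
  by move=> h; rewrite normrM normr_nat; apply: ler_pM => //; exact: ball_om.
have hcc : `|k%:R * (s_om X - oms) - k%:R * (s_om Y - oms)| <= 3 * DO.
  rewrite -mulrBr opprB addrA subrK normrM normr_nat; apply: ler_pM => //; exact: (XY COm I).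
have [hm1 hm2] := HC2 e X Y DO DE he BX' BY' XY.
have hv (u w u' w' : vec) : (forall j, `|u j 0 - w j 0| <= C1 * (DO + DE)) ->
    (forall j, `|u' j 0 - w' j 0| <= 2 * C2 * (DO + DE)) -> forall j,
    `|(u - (k == 1%N)%:R *: u') j 0 - (w - (k == 1%N)%:R *: w') j 0| <= (C1 + 2 * C2) * (DO + DE).
  move=> h1 h2 j; rewrite mulrDl.
  have -> : (u - (k == 1%N)%:R *: u') j 0 - (w - (k == 1%N)%:R *: w') j 0 =
     (u j 0 - w j 0) - (k == 1%N)%:R * (u' j 0 - w' j 0) by rewrite !mxE; ring.
  apply: le_trans (ler_normB _ _) _; apply: lerD => //.
  apply: le_trans (h2 j); case: (k == 1%N); rewrite ?mul1r// mul0r normr0//.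
have m2C : `|mean1 e X - mean1 e Y| + `|mean2 e X - mean2 e Y| <= 2 * C2 * (DO + DE) by move: hm1 hm2; lra.
have fin x : x <= (n%:R * L + 3) * (dl * (DO + Dk)) + `|e| * ((C1 + 2 * C2) * (DO + DE)) ->
    x <= (n%:R * L + 3 + (C1 + 2 * C2)) * (dl * (DO + Dk) + `|e| * (DO + DE)).
  move=> /le_trans; apply.
  have gen (A B U V w : R) : 0 <= A -> 0 <= B -> 0 <= U -> 0 <= V -> 0 <= w ->
      A * U + w * (B * V) <= (A + B) * (U + w * V).
    move=> A0 B0 U0 V0 w0; rewrite (_ : (A + B) * _ = A * U + w * (B * V) + (A * (w * V) + B * U)); last by ring.
    by rewrite lerDl addr_ge0// !mulr_ge0.
  by apply: gen => //; rewrite ?addr_ge0// ?mulr_ge0// ?addr_ge0// ler0n.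
split; apply: fin.
- have ffE Z : cos_forcing e Z k t = (E (s_lam Z) - Es) *m cos_mode (s_modes Z) k t +
      (- (k%:R * (s_om Z - oms))) *: sin_mode (s_modes Z) k t +
      e *: (cos_H e Z k t - (k == 1%N)%:R *: va (mean1 e Z) (mean2 e Z)) by rewrite /cos_forcing scaleNr.
  rewrite !ffE {ffE}; apply: (@linear_part_diff _ _ _ _ _ _ _ _ _ _ e dl DO Dk L) => //.
  + by move=> j; exact: (XY (CCos k t j) k4).
  + by move=> j; exact: ball_cos BY k4.
  + by move=> j; exact: (XY (CSin k t j) k4).
  + by move=> j; exact: ball_sin BY k4.
  + by rewrite normrN; exact: hc.
  + by rewrite -opprD normrN.
  + apply: hv => l; first by have [] := HC1 e X Y k t l DO DE he BX' BY' XY.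
    by apply: le_trans (va_diff _ _ _ _ _) m2C.
- apply: (@linear_part_diff _ _ _ _ _ _ _ _ _ _ e dl DO Dk L) => //.
  + by move=> j; exact: (XY (CSin k t j) k4).
  + by move=> j; exact: ball_sin BY k4.
  + by move=> j; exact: (XY (CCos k t j) k4).
  + by move=> j; exact: ball_cos BY k4.
  + exact: hc.
  + apply: hv => l; first by have [] := HC1 e X Y k t l DO DE he BX' BY' XY.
    by apply: le_trans (vb_diff _ _ _ _ _) m2C.
Qed.

(** * Solvability, contraction and self-map of the iteration *)

Hypothesis oms_gt0 : 0 < oms.
Hypothesis oms_lt : oms < 2^-1.
Hypothesis oms3 : oms != 3^-1.
Hypothesis oms4 : oms != 4^-1.
Hypothesis Ets_hyp : forall mu, complex_eigenvalue Ets mu -> complex.Re mu != 0.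

Lemma forcing_continuous e X k : `|e| <= 1 -> ball_of d X -> (k < 4)%N ->
  rcont (cos_forcing e X k) /\ rcont (sin_forcing e X k).
Proof.
move=> he BX k4; have [[rX _ _] _] := BX; have [ca cb] := rX k k4.
have [cH sH] := H_modes_continuous k he BX.
have gen (A : mat) (c : R) (a b h : R -> vec) (u : vec) : rcont a -> rcont b -> rcont h ->
    rcont (fun t => A *m a t + c *: b t + e *: (h t - u)).
  move=> ha hb hh i.
  rewrite (_ : (fun _ => _) = (fun t => \sum_j A i j * a t j 0 + c * b t i 0 + e * (h t i 0 - u i 0))).
    have cc := @continuous_cst R.
    apply: continuous_add; first apply: continuous_add.
    - by apply: continuous_sum => j; apply: continuous_mul; [exact: cc|exact: ha].
    - by apply: continuous_mul; [exact: cc|exact: hb].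
    - by apply: continuous_mul; [exact: cc|apply: continuous_sub; [exact: hh|exact: cc]].
  apply/funext => t; have : (A *m a t) i 0 = \sum_j A i j * a t j 0 by rewrite mxE.
  by move: (A *m a t) => w hw; rewrite !mxE hw.
split; last exact: gen.
rewrite (_ : cos_forcing e X k = (fun t => (E (s_lam X) - Es) *m cos_mode (s_modes X) k t +
  (- (k%:R * (s_om X - oms))) *: sin_mode (s_modes X) k t +
  e *: (cos_H e X k t - (k == 1%N)%:R *: va (mean1 e X) (mean2 e X)))); first exact: gen.
by apply/funext => t; rewrite /cos_forcing scaleNr.
Qed.

Lemma forcing_periodic e X k : ball_of d X -> (k < 4)%N ->
  periodic (cos_forcing e X k) T2 /\ periodic (sin_forcing e X k) T2.
Proof.
move=> BX k4; have [[_ pX _] _] := BX; have [pa pb] := pX k k4.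
have [pH qH] := H_modes_periodic e k BX.
by split=> t; rewrite /cos_forcing /sin_forcing pa pb ?pH ?qH.
Qed.

(** On the critical coordinate p1 + 'i p2 the matrix acts as multiplication by alphaR + 'i (alphaI -
    oms). *)
Lemma exponent_diff_p (a b : vec) lam :
  p1 ((E lam - Es) *m a) ((E lam - Es) *m b) = alphaR lam * p1 a b - (alphaI lam - oms) * p2 a b /\
  p2 ((E lam - Es) *m a) ((E lam - Es) *m b) = alphaR lam * p2 a b + (alphaI lam - oms) * p1 a b.
Proof.
have x1 (u : vec) : ((E lam - Es) *m u) j1 0 = alphaR lam * u j1 0 - (alphaI lam - oms) * u j2 0.
  have := exponent_mul_1 (alphaR lam) (alphaI lam) (Et lam) u; have := exponent_mul_1 0 oms Ets u.
  by rewrite mulmxBl; move: (_ *m u) (_ *m u) => y y' h h'; rewrite !mxE h h'; ring.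
have x2 (u : vec) : ((E lam - Es) *m u) j2 0 = (alphaI lam - oms) * u j1 0 + alphaR lam * u j2 0.
  have := exponent_mul_2 (alphaR lam) (alphaI lam) (Et lam) u; have := exponent_mul_2 0 oms Ets u.
  by rewrite mulmxBl; move: (_ *m u) (_ *m u) => y y' h h'; rewrite !mxE h h'; ring.
by rewrite /p1 /p2 !x1 !x2; split; ring.
Qed.

Lemma forcing_p e X t (k := 1%N) (a := cos_mode (s_modes X) 1 t) (b := sin_mode (s_modes X) 1 t) :
  p1 (cos_forcing e X k t) (sin_forcing e X k t) = alphaR (s_lam X) * p1 a b + (s_om X - alphaI (s_lam X)) * p2 a b
    + e * (p1 (cos_H e X k t) (sin_H e X k t) - mean1 e X) /\
  p2 (cos_forcing e X k t) (sin_forcing e X k t) = alphaR (s_lam X) * p2 a b - (s_om X - alphaI (s_lam X)) * p1 a b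
    + e * (p2 (cos_H e X k t) (sin_H e X k t) - mean2 e X).
Proof.
have [h1 h2] := exponent_diff_p a b (s_lam X).
rewrite /cos_forcing /sin_forcing eqxx !scale1r mul1r -/a -/b.
have g1 := p1v (m := m) (mean1 e X) (mean2 e X); have g2 := p2v (m := m) (mean1 e X) (mean2 e X).
move: h1 h2 g1 g2; rewrite /p1 /p2.
move: ((E (s_lam X) - Es) *m a) ((E (s_lam X) - Es) *m b) (cos_H e X k t) (sin_H e X k t)
  (va _ _) (vb _ _) => u w hc hs va' vb' h1 h2 g1 g2.
split; rewrite !mxE.
  transitivity ((u j1 0 + w j2 0) + (s_om X - oms) * (a j2 0 - b j1 0) +
    e * ((hc j1 0 + hs j2 0) - (va' j1 0 + vb' j2 0))); first by ring.
  by rewrite h1 g1; ring.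
transitivity ((u j2 0 - w j1 0) - (s_om X - oms) * (a j1 0 + b j2 0) +
    e * ((hc j2 0 - hs j1 0) - (va' j2 0 - vb' j1 0))); first by ring.
by rewrite h2 g2; ring.
Qed.

(** The linear terms of the critical forcing are multiples of critical coordinates of [X], which
    have mean zero, and the mean of the nonlinear term has been subtracted. Hence every regular
    state in the ball has an image. *)
Lemma forcing_mean e X : `|e| <= 1 -> ball_of d X ->
  I2 (fun t => p1 (cos_forcing e X 1 t) (sin_forcing e X 1 t)) = 0 /\ I2 (fun t => p2 (cos_forcing e X 1 t) (sin_forcing e X 1 t)) = 0.
Proof.
move=> he BX; have [[rX _ [z1 z2]] _] := BX; have [ca cb] := rX 1%N isT.
have [cH sH] := H_modes_continuous 1 he BX.
have c1 := continuous_p1 ca cb; have c2 := continuous_p2 ca cb.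
have k1 := continuous_p1 cH sH; have k2 := continuous_p2 cH sH.
have gen (w1 w2 h : R -> R) x y : continuous w1 -> continuous w2 -> continuous h -> I2 w1 = 0 -> I2 w2 = 0 ->
    I2 (fun t => x * w1 t + y * w2 t + e * (h t - T2^-1 * I2 h)) = 0.
  move=> cw1 cw2 ch i1 i2.
  have cs c (f : R -> R) : continuous f -> continuous (fun t : R => c * f t).
    by move=> cf; apply: continuous_mul => //; exact: continuous_cst.
  have ch' : continuous (fun t => h t - T2^-1 * I2 h) by apply: continuous_sub => //; exact: continuous_cst.
  rewrite int2D; [|by apply: continuous_add; exact: cs|exact: cs].
  rewrite int2D; [|exact: cs|exact: cs].
  rewrite !int2Z// int2B//; last exact: continuous_cst.
  by rewrite i1 i2 int2_cst mulrA mulfV ?twopi_neq0// mul1r subrr !mulr0 !addr0.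
split.
  rewrite -(gen _ _ _ (alphaR (s_lam X)) (s_om X - alphaI (s_lam X)) c1 c2 k1 z1 z2).
  by congr I2; apply/funext => t; have [-> _] := forcing_p e X t.
rewrite -(gen _ _ _ (alphaR (s_lam X)) (- (s_om X - alphaI (s_lam X))) c2 c1 k2 z2 z1).
by congr I2; apply/funext => t; have [_ ->] := forcing_p e X t; rewrite mulNr.
Qed.

(* [step e ro re X Y]: Y is the image of X under the iteration, up to errors ro in
   lam, om and the odd modes and re in the even modes.  An exact solution is an
   exact step from X to X, an approximate one an approximate step. *)
Definition step e ro re X Y := [/\
  `|s_lam Y - (lam_step (s_lam X) - e * mean1 e X / (2 * kappa))| <= ro,
  `|s_om Y - (alphaI (s_lam Y) + e * mean2 e X / 2)| <= ro &
  forall k, (k < 4)%N -> exists f g,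
    [/\ forall t, rder (Aa oms Ets k (cos_mode (s_modes Y) k t) (sin_mode (s_modes Y) k t) + f t) t
          (cos_mode (s_modes Y) k),
        forall t, rder (Ab oms Ets k (cos_mode (s_modes Y) k t) (sin_mode (s_modes Y) k t) + g t) t
          (sin_mode (s_modes Y) k) &
        forall t i, `|f t i 0 - cos_forcing e X k t i 0| <= (if odd k then ro else re) /\
                    `|g t i 0 - sin_forcing e X k t i 0| <= (if odd k then ro else re)]].

Lemma lam_estimate : exists2 C, 0 <= C & forall dl e X X' Y Y' ro re DO DE, `|e| <= 1 -> dl <= d ->
  ball_of dl X -> ball_of dl X' -> step e ro re X Y -> step e 0 0 X' Y' -> wdist X X' DO DE ->
  `|s_lam Y - s_lam Y'| <= C * (dl * DO + `|e| * (DO + DE)) + ro.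
Proof.
have [L L0 HL] := lam_step_lipschitz; have [C C0 HC] := m_diff.
exists (L + C / `|2 * kappa|) => [|dl e X X' Y Y' ro re DO DE he hd BX BX' [sl _ _] [sl' _ _] XX'].
  by rewrite addr_ge0// divr_ge0.
have [hm _] := HC e X X' DO DE he (ball_mono hd BX) (ball_mono hd BX') XX'.
have hl := HL dl _ _ (le_trans hd d_ler) (ball_lam BX) (ball_lam BX').
have DO0 : 0 <= DO by apply: le_trans (XX' CLam I).
have DE0 : 0 <= DE by apply: le_trans (XX' (CCos 0 0 j1) isT).
have dl0 : 0 <= dl by apply: le_trans (ball_lam BX).
have hl2 : `|lam_step (s_lam X) - lam_step (s_lam X')| <= L * (dl * DO).
  by apply: le_trans hl _; rewrite -mulrA; do 2!apply: ler_wpM2l => //; exact: (XX' CLam I).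
move: sl'; rewrite normr_le0 subr_eq0 => /eqP ->.
have alg (y a b u w : R) : y - (b - w) = (y - (a - u)) + ((a - b) - (u - w)) by ring.
rewrite (alg _ (lam_step (s_lam X)) _ (e * mean1 e X / (2 * kappa))) {alg}.
have hm2 : `|e * mean1 e X / (2 * kappa) - e * mean1 e X' / (2 * kappa)| <= C / `|2 * kappa| * (`|e| * (DO + DE)).
  rewrite -mulrBl -mulrBr (mulrC C) -[leRHS]mulrA normrM normfV [leLHS]mulrC; apply: ler_wpM2l; first by rewrite invr_ge0.
  by rewrite normrM mulrCA; apply: ler_wpM2l.
apply: le_trans (ler_normD _ _) _; rewrite addrC; apply: lerD => //.
apply: le_trans (ler_normB _ _) _.
apply: le_trans (lerD hl2 hm2) _.
have c0 : 0 <= C / `|2 * kappa| by rewrite divr_ge0.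
have V1 : 0 <= dl * DO by exact: mulr_ge0.
have V2 : 0 <= `|e| * (DO + DE) by apply: mulr_ge0 => //; exact: addr_ge0.
move: (C / _) (dl * DO) (`|e| * _) c0 V1 V2 => c x y c0 x0 y0.
rewrite (_ : (L + c) * (x + y) = L * x + c * y + (L * y + c * x)); last by ring.
by rewrite lerDl addr_ge0// mulr_ge0.
Qed.

(** The difference of two images solves the linear mode equations with the difference of the
    forcings, so the linear bound applies. The even distance reaches the odd quantities only with
    factor |e|; in the even modes the factor [dl] also carries [DO], because changes of [lam] and
    [om] multiply the even modes. *)
Lemma step_estimate : exists2 C, 0 <= C & forall dl e X X' Y Y' ro re DO DE, `|e| <= 1 -> dl <= d ->
  ball_of dl X -> ball_of dl X' -> regular Y -> regular Y' ->
  `|s_lam Y - lams| <= r / 2 -> `|s_lam Y' - lams| <= r / 2 ->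
  step e ro re X Y -> step e 0 0 X' Y' -> wdist X X' DO DE ->
  wdist Y Y' (C * (dl * DO + `|e| * (DO + DE) + ro)) (C * (dl * (DO + DE) + `|e| * (DO + DE) + re)).
Proof.
have [C1 C10 H1] := lam_estimate; have [C2 C20 H2] := forcing_diff; have [C3 C30 H3] := m_diff.
have [L L0 HL] := E_lipschitz.
have [||K K0 HK] := @uniform_constant R 'I_4 (fun k K => 0 <= K /\ forall a b f g B,
  periodic a T2 -> periodic b T2 -> rbound f B -> rbound g B ->
  (forall t, rder (Aa oms Ets k (a t) (b t) + f t) t a) ->
  (forall t, rder (Ab oms Ets k (a t) (b t) + g t) t b) ->
  (k = 1%N :> nat -> I2 (fun t => p1 (a t) (b t)) = 0 /\ I2 (fun t => p2 (a t) (b t)) = 0) ->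
  rbound a (K * B) /\ rbound b (K * B)).
- move=> k K K' KK' [K0 h]; split; first exact: le_trans KK'.
  move=> a b f g B pa pb hf hg da db hm; have [h3 h4] := h a b f g B pa pb hf hg da db hm.
  have B0 : 0 <= B by apply: le_trans (hf 0 j1).
  by split=> t i; [apply: le_trans (h3 t i) _|apply: le_trans (h4 t i) _]; exact: ler_wpM2r.
- move=> k; have [K K0 h] := mode_bound oms_gt0 oms_lt oms3 oms4 Ets_hyp (ltn_ord k).
  by exists K.
pose C := C1 + 1 + (L * (C1 + 1) + C3 + 1) + K * (2 * C2 + 1).
exists C => [|dl e X X' Y Y' ro re DO DE he hd BX BX' rY rY' hY hY' sXY sXY' XX'].
  by rewrite !addr_ge0// !mulr_ge0// !addr_ge0// ?mulr_ge0// ?addr_ge0.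
have DO0 : 0 <= DO by apply: le_trans (XX' CLam I).
have DE0 : 0 <= DE by apply: le_trans (XX' (CCos 0 0 j1) isT).
have dl0 : 0 <= dl by apply: le_trans (ball_lam BX).
have ro0 : 0 <= ro by case: sXY => h _ _; apply: le_trans h.
have re0 : 0 <= re by case: sXY => _ _ /(_ 0%N isT)[f [g [_ _ h]]]; have [h' _] := h 0 j1; apply: le_trans h'.
have hlam := H1 dl e X X' Y Y' ro re DO DE he hd BX BX' sXY sXY' XX'.
set U := dl * DO + `|e| * (DO + DE) in hlam *.
have U0 : 0 <= U by rewrite addr_ge0// mulr_ge0// addr_ge0.
have hlam2 : `|s_lam Y - s_lam Y'| <= (C1 + 1) * (U + ro).
  by apply: le_trans hlam _; rewrite mulrDl mul1r !mulrDr; have : 0 <= C1 * ro by [exact: mulr_ge0]; lra.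
have Uro : 0 <= U + ro by exact: addr_ge0.
have part c : 0 <= c -> c <= C -> forall x, x <= c * (U + ro) -> x <= C * (U + ro).
  by move=> c0 cC x hx; apply: le_trans hx _; exact: ler_wpM2r.
have q1 : 0 <= L * (C1 + 1) by rewrite mulr_ge0// addr_ge0.
have q2 : 0 <= K * (2 * C2 + 1) by rewrite mulr_ge0// addr_ge0// mulr_ge0.
(* The new [om] is computed from the new [lam], so its estimate uses the one just obtained for
   [lam]. *)
have hom : `|s_om Y - s_om Y'| <= (L * (C1 + 1) + C3 + 1) * (U + ro).
  case: sXY sXY' => [_ so _] [_ so' _]; move: so'; rewrite normr_le0 subr_eq0 => /eqP ->.
  have [_ hm] := H3 e X X' DO DE he (ball_mono hd BX) (ball_mono hd BX') XX'.
  have hI := HL _ _ j2 j1 hY hY'; rewrite !exponent_j2 in hI.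
  have hI2 : `|alphaI (s_lam Y) - alphaI (s_lam Y')| <= L * (C1 + 1) * (U + ro).
    by apply: le_trans hI _; rewrite -mulrA; exact: ler_wpM2l.
  have hm2 : `|e * mean2 e X / 2 - e * mean2 e X' / 2| <= C3 * (U + ro).
    rewrite -mulrBl -mulrBr !normrM (ger0_norm (x := 2^-1)) ?invr_ge0// ler_pdivrMr//.
    have h : `|e| * `|mean2 e X - mean2 e X'| <= C3 * (`|e| * (DO + DE)) by rewrite mulrCA; exact: ler_wpM2l.
    apply: le_trans h _; rewrite -mulrA; apply: ler_wpM2l => //.
    have : 0 <= dl * DO by exact: mulr_ge0.
    have : 0 <= `|e| * (DO + DE) by apply: mulr_ge0 => //; exact: addr_ge0.
    by rewrite /U; lra.
  have alg (y a b u w : R) : y - (b + w) = (y - (a + u)) + ((a - b) + (u - w)) by ring.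
  rewrite (alg _ (alphaI (s_lam Y)) _ (e * mean2 e X / 2)) {alg}.
  apply: le_trans (ler_normD _ _) _; apply: le_trans (lerD so (ler_normD _ _)) _.
  apply: le_trans (lerD (lexx _) (lerD hI2 hm2)) _.
  by rewrite !mulrDl mul1r; move: U0; lra.
have hmodes k t i : (k < 4)%N ->
    `|cos_mode (s_modes Y) k t i 0 - cos_mode (s_modes Y') k t i 0| <=
      K * (C2 * (dl * (DO + if odd k then DO else DE) + `|e| * (DO + DE)) + if odd k then ro else re) /\
    `|sin_mode (s_modes Y) k t i 0 - sin_mode (s_modes Y') k t i 0| <=
      K * (C2 * (dl * (DO + if odd k then DO else DE) + `|e| * (DO + DE)) + if odd k then ro else re).
  move=> k4; case: sXY sXY' => [_ _ sm] [_ _ sm'].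
  have [f [g [da db hfg]]] := sm k k4; have [f' [g' [da' db' hfg']]] := sm' k k4.
  have [rY1 rY2 rY3] := rY; have [rY1' rY2' rY3'] := rY'.
  have [ca cb] := rY1 k k4; have [ca' cb'] := rY1' k k4.
  have [pa pb] := rY2 k k4; have [pa' pb'] := rY2' k k4.
  have := (HK (Ordinal k4)).2 (fun t => cos_mode (s_modes Y) k t - cos_mode (s_modes Y') k t)
    (fun t => sin_mode (s_modes Y) k t - sin_mode (s_modes Y') k t)
    (fun t => f t - f' t) (fun t => g t - g' t)
    (C2 * (dl * (DO + if odd k then DO else DE) + `|e| * (DO + DE)) + if odd k then ro else re).
  have sub (x y x' y' : R) B B' : `|x - x'| <= B -> `|y - y'| <= (if odd k then 0 else 0) ->
      `|x' - y'| <= B' -> `|x - y| <= B' + B.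
    rewrite if_same normr_le0 subr_eq0 => h1 /eqP -> h2.
    by rewrite -[x](subrK x') -addrA addrC; apply: le_trans (ler_normD _ _) (lerD h2 h1).
  case=> [||t' i'|t' i'|t'|t'|k1|h1 h2].
  - by move=> t'; rewrite pa pa'.
  - by move=> t'; rewrite pb pb'.
  - have [h1 _] := hfg t' i'; have [h1' _] := hfg' t' i'.
    have [h _] := H2 dl e X X' k t' i' DO DE he hd BX BX' XX' k4.
    by rewrite mxE [(- f' t') i' 0]mxE; exact: sub h1 h1' h.
  - have [_ h1] := hfg t' i'; have [_ h1'] := hfg' t' i'.
    have [_ h] := H2 dl e X X' k t' i' DO DE he hd BX BX' XX' k4.
    by rewrite mxE [(- g' t') i' 0]mxE; exact: sub h1 h1' h.
  - move=> j; apply: der_ext (der_val _ (der_sub (da t' j) (da' t' j))) => [s|].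
      by move: (cos_mode _ _ _) (cos_mode _ _ _) => u w; rewrite !mxE.
    rewrite /Aa mulmxBr scalerBr /=; move: (_ *m _) (_ *m _) (_ *: _) (_ *: _) => x1 x2 x3 x4.
    by rewrite !mxE; ring.
  - move=> j; apply: der_ext (der_val _ (der_sub (db t' j) (db' t' j))) => [s|].
      by move: (sin_mode _ _ _) (sin_mode _ _ _) => u w; rewrite !mxE.
    rewrite /Ab mulmxBr scalerBr /=; move: (_ *m _) (_ *m _) (_ *: _) (_ *: _) => x1 x2 x3 x4.
    by rewrite !mxE; ring.
  - have {}k1 : k = 1%N := k1; subst k.
    have diff0 (w w' u : R -> R) : continuous w -> continuous w' -> I2 w = 0 -> I2 w' = 0 ->
        (forall s, u s = w s - w' s) -> I2 u = 0.
      move=> cw cw' w0 w0' uE; have -> : u = (fun s => w s - w' s) by apply/funext.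
      by rewrite int2B// w0 w0' subrr.
    split.
    + apply: diff0 rY3.1 rY3'.1 _; [exact: continuous_p1|exact: continuous_p1|].
      by move=> s; exact: p1B.
    + apply: diff0 rY3.2 rY3'.2 _; [exact: continuous_p2|exact: continuous_p2|].
      by move=> s; exact: p2B.
  - have := h1 t i; have := h2 t i.
    move: (cos_mode _ _ _) (cos_mode _ _ _) (sin_mode _ _ _) (sin_mode _ _ _) => u1 u2 u3 u4.
    by rewrite !mxE.
have modd x k : (k < 4)%N -> x <= K * (C2 * (dl * (DO + if odd k then DO else DE) + `|e| * (DO + DE)) + if odd k then ro else re) ->
    x <= if odd k then C * (U + ro) else C * (dl * (DO + DE) + `|e| * (DO + DE) + re).
  move=> k4 /le_trans; apply.
  have e1C : 0 <= `|e| * (DO + DE) by apply: mulr_ge0 => //; exact: addr_ge0.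
  have q3 : 0 <= L * (C1 + 1) + C3 + 1 by rewrite !addr_ge0.
  case: odd.
    apply: (part (K * (2 * C2 + 1))) => //; first by rewrite /C; lra.
    rewrite -mulrA; apply: ler_wpM2l => //; rewrite /U.
    have : 0 <= C2 * (`|e| * (DO + DE)) by exact: mulr_ge0.
    have : 0 <= C2 * ro by exact: mulr_ge0.
    have : 0 <= dl * DO by exact: mulr_ge0.
    by rewrite !mulrDl !mul1r !mulrDr; lra.
  set V := dl * (DO + DE) + `|e| * (DO + DE).
  have V0 : 0 <= V by rewrite addr_ge0// mulr_ge0// addr_ge0.
  apply: le_trans (_ : K * (2 * C2 + 1) * (V + re) <= _); last first.
    by apply: ler_wpM2r; [exact: addr_ge0|rewrite /C; lra].
  rewrite -mulrA; apply: ler_wpM2l => //.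
  have : 0 <= C2 * V by exact: mulr_ge0.
  have : 0 <= C2 * re by exact: mulr_ge0.
  by rewrite mulrDl mul1r !mulrDr; lra.
case=> [||k t i|k t i] /= ok_.
- by apply: (part (C1 + 1)) => //; [rewrite addr_ge0|rewrite /C; lra].
- by apply: (part (L * (C1 + 1) + C3 + 1)) => //; [rewrite !addr_ge0|rewrite /C; lra].
- by apply: modd => //; have [] := hmodes k t i ok_.
- by apply: modd => //; have [] := hmodes k t i ok_.
Qed.

Lemma coord_bound_same (D : R) j : coord_bound (m := m) D D j = D.
Proof. by case: j => //= k _ _; case: odd. Qed.

Lemma wdist_codist (X Y : state) D : wdist X Y D D <-> codist (@coord_val R m) (@coord_ok R m) X Y D.
Proof. by split=> h j oj; have := h j oj; rewrite coord_bound_same. Qed.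

Lemma wdist_sym (X Y : state) DO DE : wdist X Y DO DE -> wdist Y X DO DE.
Proof. by move=> h j oj; rewrite distrC; exact: h. Qed.

Lemma wdist_mono (X Y : state) DO DE DO' DE' : DO <= DO' -> DE <= DE' -> wdist X Y DO DE -> wdist X Y DO' DE'.
Proof.
move=> h1 h2 h j oj; apply: le_trans (h j oj) _.
by case: j oj => [||k t i|k t i] //= _; case: odd.
Qed.

Lemma uniform_limit_continuous (f : R -> R) :
  (forall eps : R, 0 < eps -> exists2 g : R -> R, continuous g & forall t, `|g t - f t| <= eps) -> continuous f.
Proof.
move=> Hf t0; apply/cvgrPdist_le => eps eps0.
have e3 : 0 < eps / 3 by rewrite divr_gt0.
have [g cg gf] := Hf _ e3.
have /cvgrPdist_le/(_ _ e3) ng := cg t0.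
near=> t.
have h : `|g t0 - g t| <= eps / 3 by near: t.
have h1 := gf t; have h2 := gf t0; rewrite distrC in h2.
rewrite (_ : f t0 - f t = (f t0 - g t0) + ((g t0 - g t) + (g t - f t))); last by ring.
apply: le_trans (ler_normD _ _) _; apply: le_trans (lerD h2 (le_trans (ler_normD _ _) (lerD h h1))) _.
by lra.
Unshelve. all: by end_near. Qed.

Lemma regular_base : regular base_state.
Proof.
split=> [k k4|k k4|]; first by split=> i; exact: continuous_cst.
  by [].
by split; rewrite /= int2_cst /p1 /p2 !mxE ?addr0 ?subr0 mulr0.
Qed.

Lemma ball_base dl : 0 <= dl -> ball_of dl base_state.
Proof.
move=> h; split; first exact: regular_base.
by move=> j _; rewrite subrr normr0 coord_bound_same.
Qed.

Lemma lam_step_base : lam_step lams = lams.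
Proof. by have [h _ _] := base; rewrite /lam_step h mul0r subr0. Qed.

(** The base state solves the equations up to the nonlinear term, which has size |e|. As an
    approximate step it can be compared with true steps, which gives the self-map property. *)
Lemma step_base : exists2 C, 0 <= C & forall e, `|e| <= 1 -> 0 <= d ->
  step e (C * `|e|) (C * `|e|) base_state base_state.
Proof.
have [C1 C10 H1] := H_modes_bound; have [C2 C20 H2] := m_bound.
pose C := C2 / `|2 * kappa| + C2 + (C1 + 2 * C2).
have c0 : 0 <= C2 / `|2 * kappa| by rewrite divr_ge0.
exists C => [|e he d0]; first by rewrite /C !addr_ge0// mulr_ge0.
have [hm1 hm2] := H2 e base_state he (ball_base d0).
have [h0 h00 _] := base.
have le_C (c x : R) : c <= C -> x <= c * `|e| -> x <= C * `|e|.
  by move=> cC /le_trans; apply; exact: ler_wpM2r.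
have C22 : 0 <= 2 * C2 by rewrite mulr_ge0.
split=> [||k k4].
- apply: (le_C (C2 / `|2 * kappa|)); first by move: c0 C10 C20; rewrite /C; lra.
  rewrite lam_step_base /= opprB addrC subrK normrM normfV normrM.
  rewrite [leRHS]mulrAC; apply: ler_wpM2r; first by rewrite invr_ge0.
  by rewrite mulrC; apply: ler_wpM2r.
- apply: (le_C C2); first by move: c0 C10 C20; rewrite /C; lra.
  rewrite /= h00 opprD addrA subrr add0r normrN normrM (normrM e) (ger0_norm (x := 2^-1)) ?invr_ge0//.
  rewrite ler_pdivrMr//; apply: le_trans (ler_wpM2l (normr_ge0 e) hm2) _.
  by rewrite mulrC; move: (mulr_ge0 C20 (normr_ge0 e)); lra.
- exists (fun=> 0), (fun=> 0); split=> [t j|t j|t j].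
  + apply: der_val (der_cst _ t); rewrite /Aa /= !(mulmx0, scaler0) subr0 addr0.
    by rewrite [RHS]mxE.
  + apply: der_val (der_cst _ t); rewrite /Ab /= !(mulmx0, scaler0) !addr0.
    by rewrite [RHS]mxE.
  + have fE : cos_forcing e base_state k t = e *: (cos_H e base_state k t - (k == 1%N)%:R *: va (mean1 e base_state) (mean2 e base_state)).
      by rewrite /cos_forcing /= mulmx0 scaler0 subr0 add0r.
    have gE : sin_forcing e base_state k t = e *: (sin_H e base_state k t - (k == 1%N)%:R *: vb (mean1 e base_state) (mean2 e base_state)).
      by rewrite /sin_forcing /= mulmx0 scaler0 addr0 add0r.
    have [hc hs] := H1 e base_state k t j he (ball_base d0).
    rewrite if_same fE gE.
    have gen (h w : vec) : `|h j 0| <= C1 -> `|w j 0| <= 2 * C2 ->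
        `|(0 : vec) j 0 - (e *: (h - (k == 1%N)%:R *: w)) j 0| <= C * `|e|.
      move=> hh hw; apply: (le_C (C1 + 2 * C2)); first by move: c0 C10 C20; rewrite /C; lra.
      rewrite !mxE sub0r normrN normrM mulrC; apply: ler_wpM2r => //.
      apply: le_trans (ler_normB _ _) _; apply: lerD => //.
      by apply: le_trans hw; case: (k == 1%N); rewrite ?mul1r// mul0r normr0.
    have b2 : `|mean1 e base_state - 0| + `|mean2 e base_state - 0| <= 2 * C2 by rewrite !subr0; move: hm1 hm2; lra.
    have hva := le_trans (va_diff (mean1 e base_state) (mean2 e base_state) 0 0 j) b2.
    have hvb := le_trans (vb_diff (mean1 e base_state) (mean2 e base_state) 0 0 j) b2.
    rewrite va0 [(0 : vec) j 0]mxE subr0 in hva; rewrite vb0 [(0 : vec) j 0]mxE subr0 in hvb.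
    by split; apply: gen.
Qed.

Lemma step_exists e X : `|e| <= 1 -> ball_of d X -> exists Y, regular Y /\ step e 0 0 X Y.
Proof.
move=> he BX; pose lamY := lam_step (s_lam X) - e * mean1 e X / (2 * kappa).
have sol k : exists ab : (R -> vec) * (R -> vec), (k < 4)%N -> [/\ periodic ab.1 T2, periodic ab.2 T2,
    forall t, rder (Aa oms Ets k (ab.1 t) (ab.2 t) + cos_forcing e X k t) t ab.1,
    forall t, rder (Ab oms Ets k (ab.1 t) (ab.2 t) + sin_forcing e X k t) t ab.2 &
    k = 1%N -> I2 (fun t => p1 (ab.1 t) (ab.2 t)) = 0 /\ I2 (fun t => p2 (ab.1 t) (ab.2 t)) = 0].
  case: (ltnP k 4) => [k4|_]; last by exists (fun=> 0, fun=> 0).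
  have [cf cg] := forcing_continuous he BX k4; have [pf pg] := forcing_periodic e BX k4.
  have [|a [b H']] := mode_solution oms_gt0 oms_lt oms3 oms4 Ets_hyp k4 cf cg pf pg.
    by move=> k1; subst k; exact: forcing_mean.
  by exists (a, b).
have [ab Hab] := choice sol.
exists (State lamY (alphaI lamY + e * mean2 e X / 2) (Modes (fun k => (ab k).1) (fun k => (ab k).2))).
split.
  split=> [k k4|k k4|] /=.
  - by have [_ _ da db _] := Hab k k4; split; [exact: rder_rcont da|exact: rder_rcont db].
  - by have [pa pb _ _ _] := Hab k k4.
  - by have [_ _ _ _ /(_ erefl)] := Hab 1%N isT.
split=> [||k k4] /=; rewrite ?subrr ?normr0//.
exists (cos_forcing e X k), (sin_forcing e X k); have [_ _ da db _] := Hab k k4; split=> // t i.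
by rewrite !subrr !normr0 if_same.
Qed.

(** Convergence in coordinates is uniform in theta, so continuity, periodicity and the mean-zero
    conditions pass to the limit. *)
Lemma ball_closed dl u x : (forall j : nat, ball_of dl (u j)) ->
  (forall eps : R, 0 < eps -> exists j, codist (@coord_val R m) (@coord_ok R m) (u j) x eps) -> ball_of dl x.
Proof.
move=> Bu ux; have Hco j : coord_ok j -> forall eps : R, 0 < eps -> exists l, `|coord_val (u l) j - coord_val x j| <= eps.
  by move=> oj eps /ux[l hl]; exists l; exact: hl.
have cx k : (k < 4)%N -> rcont (cos_mode (s_modes x) k) /\ rcont (sin_mode (s_modes x) k).
  move=> k4; split=> i; apply: uniform_limit_continuous => eps /ux[l hl].
    exists (fun t => cos_mode (s_modes (u l)) k t i 0); last by move=> t; exact: (hl (CCos k t i) k4).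
    by have [[/(_ k k4)[h _] _ _] _] := Bu l; exact: h.
  exists (fun t => sin_mode (s_modes (u l)) k t i 0); last by move=> t; exact: (hl (CSin k t i) k4).
  by have [[/(_ k k4)[_ h] _ _] _] := Bu l; exact: h.
have small (y c : R) : 0 <= c -> (forall eps : R, 0 < eps -> `|y| <= c * eps) -> y = 0.
  move=> c0 hy; apply/eqP; rewrite -normr_le0; apply/ler_addgt0Pr => eps eps0; rewrite add0r.
  have c1 : 0 < c + 1 by rewrite ltr_wpDl.
  apply: le_trans (hy _ (divr_gt0 eps0 c1)) _; rewrite mulrA ler_pdivrMr// mulrC.
  by apply: ler_wpM2l; [exact: ltW|rewrite lerDl].
split; first split=> //.
- move=> k k4; split=> t; apply/colP => i; apply/eqP; rewrite -subr_eq0; apply/eqP;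
    apply: (small _ 2) => // eps /ux[l hl]; have [[_ /(_ k k4)[pa pb] _] _] := Bu l.
    have h1 := hl (CCos k (t + T2) i) k4; have h2 := hl (CCos k t i) k4.
    rewrite /= pa in h1; rewrite distrC in h1; rewrite /= in h2.
    by apply: le_trans (ler_distD _ _ _) (le_trans (lerD h1 h2) _); rewrite mulr_natl mulr2n.
  have h1 := hl (CSin k (t + T2) i) k4; have h2 := hl (CSin k t i) k4.
  rewrite /= pb in h1; rewrite distrC in h1; rewrite /= in h2.
  by apply: le_trans (ler_distD _ _ _) (le_trans (lerD h1 h2) _); rewrite mulr_natl mulr2n.
- have [ca cb] := cx 1%N isT; have T0 := twopi_gt0 (R := R).
  have diff (w w' : R -> R) c : continuous w -> continuous w' -> I2 w = 0 ->
      (forall t, `|w t - w' t| <= c) -> `|I2 w'| <= T2 * c.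
    move=> cw cw' w0 hc; have := int2_bound (continuous_sub cw cw') hc.
    by rewrite int2B// w0 sub0r normrN.
  split; apply: (small _ (T2 * 2)); rewrite ?mulr_ge0 ?(ltW T0)// => eps /ux[l hl];
    have [[/(_ 1%N isT)[cua cub] _ [z1 z2]] _] := Bu l; rewrite -mulrA.
    apply: diff z1 _; [exact: continuous_p1|exact: continuous_p1|move=> t].
    rewrite /p1 opprD addrACA; apply: le_trans (ler_normD _ _) _.
    have := hl (CCos 1 t j1) isT; have := hl (CSin 1 t j2) isT => /= h h'.
    by apply: le_trans (lerD h' h) _; rewrite mulr_natl mulr2n.
  apply: diff z2 _; [exact: continuous_p2|exact: continuous_p2|move=> t].
  have alg (p q s w : R) : p - q - (s - w) = (p - s) - (q - w) by ring.
  rewrite /p2 alg {alg}.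
  apply: le_trans (ler_normB _ _) _.
  have := hl (CCos 1 t j2) isT; have := hl (CSin 1 t j1) isT => /= h h'.
  by apply: le_trans (lerD h' h) _; rewrite mulr_natl mulr2n.
- move=> j oj; rewrite coord_bound_same; apply/ler_addgt0Pr => eps /(Hco j oj)[l hl].
  have [_ /(_ j oj)] := Bu l; rewrite coord_bound_same => h.
  rewrite -[coord_val x j](subrK (coord_val (u l) j)) -addrA; apply: le_trans (ler_normD _ _) _.
  by rewrite [leRHS]addrC; apply: lerD => //; rewrite distrC.
Qed.

(** The radius makes both C dl and C |e| at most 1/8, so at most four such terms give a factor below
    3/4. *)
Lemma step_contraction : exists2 d0, 0 < d0 & forall dl e X X' Y Y' D, dl <= d0 -> dl <= d -> `|e| <= d0 ->
  ball_of dl X -> ball_of dl X' -> ball_of d Y -> ball_of d Y' -> step e 0 0 X Y -> step e 0 0 X' Y' ->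
  wdist X X' D D -> wdist Y Y' (3 / 4 * D) (3 / 4 * D).
Proof.
have [C C0 HC] := step_estimate; have C1 : 0 < 8 * C + 1 by rewrite ltr_wpDl// mulr_ge0.
exists (8 * C + 1)^-1 => [|dl e X X' Y Y' D hdl hd he BX BX' BY BY' XY XY' XX']; first by rewrite invr_gt0.
have e1 : `|e| <= 1 by apply: le_trans he _; rewrite invf_le1// lerDr mulr_ge0.
have dl0 : 0 <= dl by apply: le_trans (ball_lam BX).
have D0 : 0 <= D by apply: le_trans (XX' CLam I).
have := HC dl e X X' Y Y' 0 0 D D e1 hd BX BX' BY.1 BY'.1
  (le_trans (ball_lam BY) d_ler) (le_trans (ball_lam BY') d_ler) XY XY' XX'.
have h1 : C * dl <= 8^-1.
  have : (8 * C + 1) * dl <= 1 by rewrite mulrC -ler_pdivlMr// div1r.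
  by move: dl0; lra.
have h2 : C * `|e| <= 8^-1.
  have : (8 * C + 1) * `|e| <= 1 by rewrite mulrC -ler_pdivlMr// div1r.
  by have := normr_ge0 e; lra.
have k1 := ler_wpM2r D0 h1; have k2 := ler_wpM2r D0 h2.
have Cd : 0 <= C * dl * D by rewrite !mulr_ge0.
apply: wdist_mono.
  rewrite addr0 (_ : C * _ = C * dl * D + 2 * (C * `|e| * D)); last by ring.
  by move: k1 k2 Cd; lra.
rewrite addr0 (_ : C * _ = 2 * (C * dl * D) + 2 * (C * `|e| * D)); last by ring.
by move: k1 k2; lra.
Qed.

(** The image is compared with the base state: the quadratic term dl^2 is small against [dl] for a
    small radius, and the error of the base state is small once eps is chosen after the radius,
    below a multiple of [dl]. *)
Lemma step_self_map : exists2 d0, 0 < d0 & forall dl, 0 < dl -> dl <= d0 -> dl <= d ->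
  exists2 e0, 0 < e0 & forall e X Y, `|e| <= e0 -> ball_of dl X -> regular Y -> step e 0 0 X Y -> ball_of dl Y.
Proof.
have [C C0 HC] := step_estimate; have [C1 C10 HC1] := lam_estimate; have [C2 C20 HC2] := step_base.
pose K := C + C1 + C2 + 1.
have K0 : 0 < K by rewrite /K ltr_wpDl// !addr_ge0.
exists (8 * K)^-1 => [|dl dl0 hdl hd]; first by rewrite invr_gt0 mulr_gt0.
exists (Num.min 1 (dl / (8 * K * K))) => [|e X Y].
  by rewrite lt_min ltr01 divr_gt0// !mulr_gt0.
rewrite le_min => /andP[e1 he] BX rY XY.
have Kd : K * dl <= 8^-1.
  have K8 : 0 < 8 * K by rewrite mulr_gt0.
  have : (8 * K) * dl <= 1 by rewrite mulrC -ler_pdivlMr// div1r.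
  by lra.
have KKe : 8 * K * K * `|e| <= dl by rewrite mulrC -ler_pdivlMr// !mulr_gt0.
have K1 : 1 <= K by rewrite /K lerDr !addr_ge0.
have Ke : K * `|e| <= dl / 8.
  have : K * `|e| <= K * (K * `|e|) by apply: ler_wpM2l; [exact: ltW|rewrite ler_peMl].
  by move: KKe; rewrite -!mulrA; lra.
have dK : dl <= 8^-1 by apply: le_trans Kd; rewrite ler_peMl// ltW.
have B0 := ball_base (ltW dl0).
have d0 : 0 <= d by apply: le_trans hd; exact: ltW.
have s0 := HC2 e e1 d0.
have X0X : wdist base_state X dl dl by apply: wdist_sym; exact: BX.2.
have small c : 0 <= c -> c <= K -> c * (dl * (dl + dl) + `|e| * (dl + dl) + C2 * `|e|) <= dl.
  move=> c0 cK; have P : 0 <= dl * (dl + dl) + `|e| * (dl + dl) + C2 * `|e|.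
    by rewrite !addr_ge0// !mulr_ge0// ?addr_ge0// ltW.
  apply: le_trans (ler_wpM2r P cK) _.
  have q1 : K * dl * dl <= 8^-1 * dl by apply: ler_wpM2r => //; exact: ltW.
  have q2 : K * `|e| * dl <= dl / 8 * dl by apply: ler_wpM2r => //; exact: ltW.
  have q3 : dl / 8 * dl <= dl / 8 * 8^-1 by apply: ler_wpM2l => //; rewrite divr_ge0// ltW.
  have q4 : K * C2 * `|e| <= K * K * `|e|.
    by apply: ler_wpM2r => //; apply: ler_wpM2l; [exact: ltW|rewrite /K; move: C0 C10; lra].
  have q5 : 0 <= K * K * `|e| by rewrite !mulr_ge0// ltW.
  rewrite (_ : K * _ = 2 * (K * dl * dl) + 2 * (K * `|e| * dl) + K * C2 * `|e|); last by ring.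
  have : 8 * (K * K * `|e|) <= dl by rewrite !mulrA.
  by move: q1 q2 q3 q4 q5 dl0; lra.
have pos : 0 <= dl * dl by rewrite mulr_ge0// ltW.
(* The general estimate evaluates [alphaI] at the new [lam], so it must first be known that this
   value stays in the domain of the continuation. *)
have hlam : `|s_lam Y - lams| <= r / 2.
  rewrite distrC; apply: le_trans (HC1 dl e base_state X base_state Y _ _ dl dl e1 hd B0 BX s0 XY X0X) _.
  apply: le_trans (le_trans hd d_ler).
  apply: le_trans (small (C1 + 1) _ _); rewrite ?addr_ge0//; last by rewrite /K; move: C0 C20; lra.
  rewrite mulrDl mul1r.
  have p1 : 0 <= C1 * (dl * dl) by exact: mulr_ge0.
  have p2 : 0 <= C1 * (C2 * `|e|) by rewrite !mulr_ge0.
  have p3 : 0 <= `|e| * (dl + dl) by rewrite mulr_ge0// addr_ge0// ltW.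
  by rewrite !mulrDr in p3 *; move: p1 p2 p3 pos; lra.
have lam0 : `|s_lam base_state - lams| <= r / 2 by rewrite subrr normr0 (le_trans (normr_ge0 _) hlam).
split=> //; apply: wdist_sym.
apply: wdist_mono (HC dl e base_state X base_state Y _ _ dl dl e1 hd B0 BX regular_base rY lam0 hlam s0 XY X0X).
  apply: le_trans (small C C0 _); last by rewrite /K; move: C10 C20; lra.
  by apply: ler_wpM2l => //; rewrite -!addrA lerD2r mulrDr lerDl.
by apply: small => //; rewrite /K; move: C10 C20; lra.
Qed.

Theorem branch_point : exists2 d0, 0 < d0 & forall dl, 0 < dl -> dl <= d0 -> dl <= d ->
  exists2 e0, 0 < e0 & forall e, `|e| <= e0 -> exists X Y,
    [/\ ball_of dl X, ball_of dl Y, step e 0 0 X Y & forall j, coord_ok j -> coord_val Y j = coord_val X j].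
Proof.
have [d1 d10 H1] := step_contraction; have [d2 d20 H2] := step_self_map.
exists (Num.min d1 d2) => [|dl dl0]; first by rewrite lt_min d10.
rewrite le_min => /andP[hd1 hd2] hd.
have [e0 e00 H3] := H2 dl dl0 hd2 hd.
exists (Num.min (Num.min e0 d1) 1) => [|e]; first by rewrite !lt_min e00 d10 ltr01.
rewrite !le_min => /andP[/andP[he0 he1] he].
apply: (@fixed_point _ _ _ (@coord_val R m) (@coord_ok R m) (ball_of dl) (step e 0 0) base_state (2 * dl)).
- exact: state_complete.
- exact/ball_base/ltW.
- move=> X BX; have [Y [rY XY]] := step_exists he (ball_mono hd BX).
  by exists Y; split=> //; exact: H3 XY.
- move=> X X' Y Y' D BX BX' BY BY' XY XY' /wdist_codist XX'; apply/wdist_codist.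
  exact: (H1 dl e X X' Y Y' D hd1 hd he1 BX BX' (ball_mono hd BY) (ball_mono hd BY') XY XY' XX').
- move=> X Y [_ BX] [_ BY] j oj; have := BX j oj; have := BY j oj; rewrite !coord_bound_same => h1 h2.
  rewrite -[coord_val X j](subrK (coord_val base_state j)) -addrA; apply: le_trans (ler_normD _ _) _.
  by rewrite distrC in h1; move: h1 h2; lra.
- exact: ball_closed.
Qed.

(** * Solutions of the truncated equation as fixed points *)

Variable G : vec -> R -> R -> R -> vec.
Hypothesis G_linear_part : forall z lam th e, `|lam - lams| < r ->
  G z lam th e = E lam *m z + e *: H z lam th e.

Definition Gfun e X t x : vec := G (with_astar (s_modes X) t x) (s_lam X) t e.

Lemma Gfun_entry e X t x i : ball_of d X -> Gfun e X t x i 0 =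
  \sum_j E (s_lam X) i j * with_astar (s_modes X) t x j 0 + e * Wfun e X t x i 0.
Proof.
move=> BX; rewrite /Gfun G_linear_part; last exact: lam_in.
rewrite -/(Wfun e X t x); have : (E (s_lam X) *m with_astar (s_modes X) t x) i 0 =
  \sum_j E (s_lam X) i j * with_astar (s_modes X) t x j 0 by rewrite mxE.
by move: (_ *m _) (Wfun _ _ _ _) => u w hu; rewrite !mxE hu.
Qed.

Lemma Gfun_continuous e X t i : `|e| <= 1 -> ball_of d X -> continuous (fun x => Gfun e X t x i 0).
Proof.
move=> he BX; rewrite (_ : (fun _ => _) = (fun x =>
  \sum_j E (s_lam X) i j * with_astar (s_modes X) t x j 0 + e * Wfun e X t x i 0)); last first.
  by apply/funext => x; exact: Gfun_entry.
have cc := @continuous_cst R.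
apply: continuous_add; last by apply: continuous_mul; [exact: cc|exact: W_continuous_phi].
by apply: continuous_sum => j; apply: continuous_mul; [exact: cc|exact: with_astar_continuous].
Qed.

Lemma G_modes e X k t : `|e| <= 1 -> ball_of d X -> (k < 4)%N ->
  cos_mode (phi_modes (Gfun e X)) k t = E (s_lam X) *m cos_mode (add_astar (s_modes X)) k t + e *: cos_H e X k t /\
  ((0 < k)%N -> sin_mode (phi_modes (Gfun e X)) k t =
     E (s_lam X) *m sin_mode (add_astar (s_modes X)) k t + e *: sin_H e X k t).
Proof.
move=> he BX k4; have mk : k \in ks by rewrite mem_ks.
have cc := @continuous_cst R.
have Ez i : (fun x => Gfun e X t x i 0) = (fun x =>
    \sum_j E (s_lam X) i j * with_astar (s_modes X) t x j 0 + e * Wfun e X t x i 0).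
  by apply/funext => x; exact: Gfun_entry.
have cz j := @with_astar_continuous (s_modes X) t j.
have cW i := @W_continuous_phi e X t i he BX.
have cEz i j : continuous (fun x => E (s_lam X) i j * with_astar (s_modes X) t x j 0).
  by apply: continuous_mul; [exact: cc|exact: cz].
have cS i : continuous (fun x => \sum_j E (s_lam X) i j * with_astar (s_modes X) t x j 0).
  by apply: continuous_sum => j; exact: cEz.
have ceW i : continuous (fun x => e * Wfun e X t x i 0) by apply: continuous_mul; [exact: cc|exact: cW].
have zt j : (fun x => with_astar (s_modes X) t x j 0) = trig ks (fun l => cos_mode (add_astar (s_modes X)) l t j 0)
    (fun l => sin_mode (add_astar (s_modes X)) l t j 0).
  by apply/funext => x; rewrite with_astar_synth synthE.
split=> [|k0]; apply/colP => i.
  rewrite phi_cosE Ez cmodeD// cmode_sum// cmodeZ//.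
  transitivity (\sum_j E (s_lam X) i j * cos_mode (add_astar (s_modes X)) k t j 0 + e * cos_H e X k t i 0).
    rewrite /cos_H phi_cosE; congr (_ + _); apply: eq_bigr => j _.
    by rewrite cmodeZ// zt cmode_trig// mk mul1r.
  have : (E (s_lam X) *m cos_mode (add_astar (s_modes X)) k t) i 0 =
    \sum_j E (s_lam X) i j * cos_mode (add_astar (s_modes X)) k t j 0 by rewrite mxE.
  by move: (_ *m _) (cos_H _ _ _ _) => u w <-; rewrite [RHS]mxE [(e *: w) i 0]mxE.
rewrite phi_sinE Ez smodeD// smode_sum// smodeZ//.
transitivity (\sum_j E (s_lam X) i j * sin_mode (add_astar (s_modes X)) k t j 0 + e * sin_H e X k t i 0).
  rewrite /sin_H phi_sinE; congr (_ + _); apply: eq_bigr => j _.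
  by rewrite smodeZ// zt smode_trig// mk -lt0n k0 mul1r.
have : (E (s_lam X) *m sin_mode (add_astar (s_modes X)) k t) i 0 =
  \sum_j E (s_lam X) i j * sin_mode (add_astar (s_modes X)) k t j 0 by rewrite mxE.
by move: (_ *m _) (sin_H _ _ _ _) => u w <-; rewrite [RHS]mxE [(e *: w) i 0]mxE.
Qed.

(* Twice the coefficients of the constant term of the k = 1 equation in the
   critical direction; both vanish exactly for solutions. *)
Definition defect1 e X := 2 * alphaR (s_lam X) + e * mean1 e X.
Definition defect2 e X := 2 * (alphaI (s_lam X) - s_om X) + e * mean2 e X.

Lemma exponent_e12 x y (A : 'M[R]_m) : exponent_mx x y A *m e1 = x *: e1 + y *: e2 /\
  exponent_mx x y A *m e2 = x *: e2 - y *: e1.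
Proof.
by split; (apply: colP_split => [||i]; [rewrite exponent_mul_1 !mxE /=; ring|
  rewrite exponent_mul_2 !mxE /=; ring|
  rewrite block_mul_d (_ : dsubmx _ = 0) ?mulmx0 ?mxE/= ?mxE ?mulr0 ?addr0 ?subr0//;
  apply/colP => l; rewrite !mxE]).
Qed.

(** The contribution of [astar] to mode 1 is the critical vector with coordinate alphaR + 'i (alphaI
    - om). Together with the means removed in the forcing it forms the defects, and all other terms
    agree on both sides. *)
Lemma forcing_modes e X k t :
  E (s_lam X) *m cos_mode (add_astar (s_modes X)) k t + e *: cos_H e X k t
    - (s_om X * k%:R) *: sin_mode (add_astar (s_modes X)) k t =
  Aa oms Ets k (cos_mode (s_modes X) k t) (sin_mode (s_modes X) k t) + cos_forcing e X k t
    + (k == 1%N)%:R *: va (defect1 e X) (defect2 e X) /\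
  E (s_lam X) *m sin_mode (add_astar (s_modes X)) k t + e *: sin_H e X k t
    + (s_om X * k%:R) *: cos_mode (add_astar (s_modes X)) k t =
  Ab oms Ets k (cos_mode (s_modes X) k t) (sin_mode (s_modes X) k t) + sin_forcing e X k t
    + (k == 1%N)%:R *: vb (defect1 e X) (defect2 e X).
Proof.
have [E1 E2] := exponent_e12 (alphaR (s_lam X)) (alphaI (s_lam X)) (Et (s_lam X)).
rewrite /Aa /Ab /cos_forcing /sin_forcing /= !mulmxDr !mulmxBl -!scalemxAr E1 E2 /va /vb /defect1 /defect2.
move: (cos_mode _ _ _) (sin_mode _ _ _) (cos_H _ _ _ _) (sin_H _ _ _ _) => a b hc hs.
move: (E _ *m a) (E _ *m b) (Es *m a) (Es *m b) => Ea Eb Esa Esb.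
move: e1 e2 (mean1 e X) (mean2 e X) => u w y1 y2.
have [->|k1] := eqVneq k 1%N; last first.
  by split; apply/colP => i; rewrite !mxE /= ?mulr0n; ring.
by split; apply/colP => i; rewrite !mxE /= ?mulr1n; field.
Qed.

(** At k = 1 the derivative of the critical coordinate is a mean-zero forcing plus the defect minus
    the residual. Periodicity makes the defect the mean of the residual, so each defect is at most 2
    ro. The defects are then absorbed in [f] and [g], which gives 4 + 1 = 5, and the step in [lam]
    adds 1 / |kappa|. *)
Lemma residual_step : exists2 C, 0 <= C & forall e X (dm : modes R n) ro re, `|e| <= 1 -> ball_of d X ->
  (forall k, (k < 4)%N -> forall t, rder (cos_mode dm k t) t (cos_mode (s_modes X) k) /\
    rder (sin_mode dm k t) t (sin_mode (s_modes X) k)) ->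
  (forall t, sin_mode (s_modes X) 0 t = 0) ->
  (forall k, (k < 4)%N -> forall t i,
    `|(cos_mode (phi_modes (Gfun e X)) k t - cos_mode dm k t
       - (s_om X * k%:R) *: sin_mode (add_astar (s_modes X)) k t) i 0| <= (if odd k then ro else re) /\
    ((0 < k)%N -> `|(sin_mode (phi_modes (Gfun e X)) k t - sin_mode dm k t
       + (s_om X * k%:R) *: cos_mode (add_astar (s_modes X)) k t) i 0| <= (if odd k then ro else re))) ->
  step e (C * ro) (C * re) X X.
Proof.
exists (5 + `|kappa|^-1) => [|e X dm ro re he BX hdm s0 hres]; first by rewrite addr_ge0// invr_ge0.
have k0 : 0 < `|kappa| by rewrite normr_gt0.
have [[rX pX zX] _] := BX.
pose f k t := cos_mode dm k t - Aa oms Ets k (cos_mode (s_modes X) k t) (sin_mode (s_modes X) k t).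
pose g k t := sin_mode dm k t - Ab oms Ets k (cos_mode (s_modes X) k t) (sin_mode (s_modes X) k t).
pose rc k t := cos_forcing e X k t + (k == 1%N)%:R *: va (defect1 e X) (defect2 e X) - f k t.
pose rs k t := sin_forcing e X k t + (k == 1%N)%:R *: vb (defect1 e X) (defect2 e X) - g k t.
have hrc k t i : (k < 4)%N -> `|rc k t i 0| <= (if odd k then ro else re).
  move=> k4; have [h _] := hres k k4 t i; have [hG _] := G_modes t he BX k4.
  apply: le_trans h; rewrite hG; have [hf _] := forcing_modes e X k t.
  have -> : rc k t = E (s_lam X) *m cos_mode (add_astar (s_modes X)) k t + e *: cos_H e X k t - cos_mode dm k t
      - (s_om X * k%:R) *: sin_mode (add_astar (s_modes X)) k t; last exact: lexx.
  rewrite [RHS]addrAC hf /rc /f; move: (Aa _ _ _ _ _) (cos_forcing _ _ _ _) (_ *: va _ _) (cos_mode _ _ _) => x y z w.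
  by apply/colP => j; rewrite !mxE; ring.
have hrs k t i : (k < 4)%N -> `|rs k t i 0| <= (if odd k then ro else re).
  move=> k4; case: (posnP k) => [k00|kpos].
    (* No equation is assumed for the sine mode of index 0; it vanishes together with its derivative
       and its forcing, so its residual is 0. *)
    subst k; have [h _] := hres 0%N isT t i.
    have d0' : sin_mode dm 0 t = 0.
      apply/colP => j; have [_ hd] := hdm 0%N isT t; rewrite [RHS]mxE.
      by apply: der_uniq (hd j) _; apply: der_ext (der_cst 0 t) => s; rewrite s0 mxE.
    have -> : rs 0%N t = 0.
      rewrite /rs /g /sin_forcing /Ab /= s0 d0' /sin_H phi_sin0 !(mulmx0, mulr0n, mul0r, scale0r, subr0, addr0, scaler0).
      by [].
    by rewrite mxE normr0; apply: le_trans h.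
  have [_ /(_ kpos) h] := hres k k4 t i; have [_ /(_ kpos) hG] := G_modes t he BX k4.
  apply: le_trans h; rewrite hG; have [_ hf] := forcing_modes e X k t.
  have -> : rs k t = E (s_lam X) *m sin_mode (add_astar (s_modes X)) k t + e *: sin_H e X k t - sin_mode dm k t
      + (s_om X * k%:R) *: cos_mode (add_astar (s_modes X)) k t; last exact: lexx.
  rewrite [RHS]addrAC hf /rs /g; move: (Ab _ _ _ _ _) (sin_forcing _ _ _ _) (_ *: vb _ _) (sin_mode _ _ _) => x y z w.
  by apply/colP => j; rewrite !mxE; ring.
have ro0 : 0 <= ro by have := hrc 1%N 0 j1 isT; apply: le_trans.
have re0 : 0 <= re by have := hrc 0%N 0 j1 isT; apply: le_trans.
have [cf cg] := forcing_continuous he BX (isT : (1 < 4)%N).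
have [pf pg] := forcing_periodic e BX (isT : (1 < 4)%N).
have [i1 i2] := forcing_mean he BX.
have [ca cb] := rX 1%N isT; have [pa pb] := pX 1%N isT.
have [q1 [pq1 dq1 _]] := mean_zero_primitive (continuous_p1 cf cg) (periodic_p1 pf pg) i1.
have [q2 [pq2 dq2 _]] := mean_zero_primitive (continuous_p2 cf cg) (periodic_p2 pf pg) i2.
have fE t : f 1%N t = cos_forcing e X 1 t + va (defect1 e X) (defect2 e X) - rc 1%N t.
  by rewrite /rc /= scale1r opprB addrC subrK.
have gE t : g 1%N t = sin_forcing e X 1 t + vb (defect1 e X) (defect2 e X) - rs 1%N t.
  by rewrite /rs /= scale1r opprB addrC subrK.
have dE t : cos_mode dm 1 t = Aa oms Ets 1 (cos_mode (s_modes X) 1 t) (sin_mode (s_modes X) 1 t) + f 1%N t.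
  by rewrite /f addrC subrK.
have dE' t : sin_mode dm 1 t = Ab oms Ets 1 (cos_mode (s_modes X) 1 t) (sin_mode (s_modes X) 1 t) + g 1%N t.
  by rewrite /g addrC subrK.
have b1 : `|defect1 e X| <= 2 * ro.
  apply: (@periodic_const_bound _ (fun t => p1 (cos_mode (s_modes X) 1 t) (sin_mode (s_modes X) 1 t) - q1 t)
    (fun t => p1 (rc 1%N t) (rs 1%N t))) => [t|t|t].
  - by rewrite pa pb pq1.
  - have [h1 h2] := hdm 1%N isT t; apply: der_val (der_sub (der_p1 h1 h2) (dq1 t)).
    by rewrite dE dE' fE gE p1D p1A p1B p1D p1v; ring.
  - rewrite /p1; apply: le_trans (ler_normD _ _) _.
    by have := hrc 1%N t j1 isT; have := hrs 1%N t j2 isT => /=; lra.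
have b2 : `|defect2 e X| <= 2 * ro.
  apply: (@periodic_const_bound _ (fun t => p2 (cos_mode (s_modes X) 1 t) (sin_mode (s_modes X) 1 t) - q2 t)
    (fun t => p2 (rc 1%N t) (rs 1%N t))) => [t|t|t].
  - by rewrite pa pb pq2.
  - have [h1 h2] := hdm 1%N isT t; apply: der_val (der_sub (der_p2 h1 h2) (dq2 t)).
    by rewrite dE dE' fE gE p2D p2A p2B p2D p2v; ring.
  - rewrite /p2; apply: le_trans (ler_normB _ _) _.
    by have := hrc 1%N t j2 isT; have := hrs 1%N t j1 isT => /=; lra.
have kv0 : 0 <= `|kappa|^-1 by rewrite invr_ge0.
split=> [||k k4].
- have -> : s_lam X - (lam_step (s_lam X) - e * mean1 e X / (2 * kappa)) = kappa^-1 * (defect1 e X / 2).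
    rewrite /lam_step /defect1; move: (mean1 e X) => y; move: (alphaR (s_lam X)) => z; move: (s_lam X) => w.
    by have := kappa_neq0 => h; field.
  rewrite normrM normfV [leRHS]mulrDl; apply: ler_wpDl; first by rewrite mulr_ge0.
  apply: ler_wpM2l => //; rewrite normrM (ger0_norm (x := 2^-1)) ?invr_ge0// ler_pdivrMr//.
  by rewrite mulrC.
- have -> : s_om X - (alphaI (s_lam X) + e * mean2 e X / 2) = - (defect2 e X / 2).
    by rewrite /defect2; move: (mean2 e X) => y; move: (alphaI (s_lam X)) => z; move: (s_om X) => w; field.
  rewrite normrN normrM (ger0_norm (x := 2^-1)) ?invr_ge0// ler_pdivrMr//; apply: le_trans b2 _.
  rewrite mulrC; apply: ler_wpM2r => //; have := mulr_ge0 kv0 ro0.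
  by rewrite mulrDl; lra.
exists (f k), (g k); split=> [t|t|t i].
- have [h _] := hdm k k4 t; apply: rder_val h.
  by rewrite /f addrC subrK.
- have [_ h] := hdm k k4 t; apply: rder_val h.
  by rewrite /g addrC subrK.
have rk0 : 0 <= (if odd k then ro else re) by case: odd.
have vab : `|(k == 1%N)%:R * va (m := m) (defect1 e X) (defect2 e X) i 0| <= 4 * (if odd k then ro else re) /\
    `|(k == 1%N)%:R * vb (m := m) (defect1 e X) (defect2 e X) i 0| <= 4 * (if odd k then ro else re).
  have [->|k1] := eqVneq k 1%N; last by rewrite !mul0r normr0 mulr_ge0.
  rewrite !mul1r; have := va_diff (defect1 e X) (defect2 e X) 0 0 i; have := vb_diff (defect1 e X) (defect2 e X) 0 0 i.
  by rewrite va0 vb0 ![(0 : vec) i 0]mxE !subr0 /= => h1 h2; move: b1 b2 h1 h2; lra.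
have fin x y : `|x| <= 4 * (if odd k then ro else re) -> `|y| <= (if odd k then ro else re) ->
    `|x - y| <= (if odd k then (5 + `|kappa|^-1) * ro else (5 + `|kappa|^-1) * re).
  move=> hx hy; rewrite -(fun_if (fun z => (5 + `|kappa|^-1) * z)).
  apply: le_trans (ler_normB _ _) _; move: (if odd k then ro else re) rk0 hx hy => z z0 hx hy.
  by rewrite [leRHS]mulrDl; have := mulr_ge0 kv0 z0; move: hx hy; lra.
split.
- rewrite (_ : f k t i 0 - cos_forcing e X k t i 0 = (k == 1%N)%:R * va (defect1 e X) (defect2 e X) i 0 - rc k t i 0).
    by apply: fin; [have [] := vab|exact: hrc].
  rewrite /rc; move: (f k t) (cos_forcing e X k t) (va _ _) => x y z; rewrite !mxE; ring.
- rewrite (_ : g k t i 0 - sin_forcing e X k t i 0 = (k == 1%N)%:R * vb (defect1 e X) (defect2 e X) i 0 - rs k t i 0).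
    by apply: fin; [have [] := vab|exact: hrs].
  rewrite /rs; move: (g k t) (sin_forcing e X k t) (vb _ _) => x y z; rewrite !mxE; ring.
Qed.

Lemma synth_comb ms (A B C : modes R n) om t x :
  synth ms A t x - synth ms B t x - om *: synth ms C t x =
  synth ms (Modes (fun k t => cos_mode A k t - cos_mode B k t - om *: cos_mode C k t)
    (fun k t => sin_mode A k t - sin_mode B k t - om *: sin_mode C k t)) t x.
Proof.
rewrite /synth scaler_sumr -sumrB -sumrB; apply: eq_bigr => k _ /=.
move: (cos_mode A k t) (cos_mode B k t) (cos_mode C k t) (sin_mode A k t) (sin_mode B k t) (sin_mode C k t).
by move=> a b c a' b' c'; apply/colP => i; rewrite !mxE; ring.
Qed.

Lemma synth_zero ms (c : modes R n) t x : (forall k, k \in ms -> cos_mode c k t = 0) ->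
  (forall k, k \in ms -> (0 < k)%N -> sin_mode c k t = 0) -> synth ms c t x = 0.
Proof.
move=> h1 h2; rewrite (synth_eq (c' := Modes (fun _ _ => 0) (fun _ _ => 0)))//.
by rewrite /synth big1// => k _; rewrite !scaler0 addr0.
Qed.

Lemma synth_periodic_phi ms (c : modes R n) t : periodic (synth ms c t) T2.
Proof.
move=> x; rewrite /synth; apply: eq_bigr => k _.
have := @periodic_cos_nat R k x; have := @periodic_sin_nat R k x.
by move=> /= -> ->.
Qed.

Lemma torus_with_astar (c dm : modes R n) :
  (forall k, (k < 4)%N -> periodic (cos_mode c k) T2 /\ periodic (sin_mode c k) T2) ->
  (forall k, (k < 4)%N -> forall t, rder (cos_mode dm k t) t (cos_mode c k) /\ rder (sin_mode dm k t) t (sin_mode c k)) ->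
  torus_function (with_astar c) /\ forall k, (k < 4)%N -> forall t,
    rder (cos_mode dm k t) t (cos_mode (add_astar c) k) /\ rder (sin_mode dm k t) t (sin_mode (add_astar c) k).
Proof.
move=> pc dc.
have df k : (k < 4)%N -> forall t,
    rder (cos_mode dm k t) t (cos_mode (add_astar c) k) /\ rder (sin_mode dm k t) t (sin_mode (add_astar c) k).
  move=> k4 t; have [h1 h2] := dc k k4 t.
  have gen (f : R -> vec) (u w : vec) : rder w t f -> rder w t (fun s => f s + u).
    move=> Hw i; apply: der_ext (der_val _ (der_add (Hw i) (der_cst (u i 0) t))) => [s|].
      by move: (f s) => g; rewrite !mxE.
    by rewrite addr0.
  by split; apply: gen.
split=> //; have -> : with_astar c = synth ks (add_astar c) by do 2!apply/funext => ?; exact: with_astar_synth.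
split.
- move=> x t; rewrite /synth big_seq [RHS]big_seq; apply: eq_bigr => k; rewrite mem_ks => /pc[h1 h2] /=.
  by rewrite h1 h2.
- by move=> t; exact: synth_periodic_phi.
- move=> t x; apply: (@rder_derivable _ _ _ t (synth ks dm t x)).
  by apply: rder_synth_theta => k k4; exact: df.
- by move=> t x; apply: rder_derivable; exact: rder_synth_phi.
Qed.

Lemma co_modes (X Y : state) : (forall j, coord_ok j -> coord_val Y j = coord_val X j) -> forall k, (k < 4)%N ->
  cos_mode (s_modes Y) k = cos_mode (s_modes X) k /\ sin_mode (s_modes Y) k = sin_mode (s_modes X) k.
Proof.
move=> h k k4; split; apply/funext => t; apply/colP => i; [exact: (h (CCos k t i))|exact: (h (CSin k t i))].
Qed.

(** At a fixed point the conditions on [lam] and [om] say that both defects vanish. The forcing then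
    gives precisely the modes of the truncated equation, and the mean-zero conditions give the
    amplitude and phase conditions. *)
Lemma fixed_step_truncated e X Y : `|e| <= 1 -> ball_of d X -> step e 0 0 X Y ->
  (forall j, coord_ok j -> coord_val Y j = coord_val X j) ->
  truncated_solution G e (s_lam X) (s_om X) (with_astar (s_modes X)).
Proof.
move=> he BX [sl so sm] YX; have [[rX pX zX] _] := BX.
have lamE : s_lam Y = s_lam X := YX CLam I; have omE : s_om Y = s_om X := YX COm I.
have s1 : defect1 e X = 0.
  move: sl; rewrite lamE normr_le0 /lam_step /defect1; move: (mean1 e X) => y; move: (alphaR _) => z; move: (s_lam X) => w.
  move=> /eqP h; have h0 := kappa_neq0; apply: (mulfI (invr_neq0 h0)); rewrite mulr0.
  by transitivity (2 * (w - (w - z / kappa - e * y / (2 * kappa)))); [field|rewrite h mulr0].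
have s2 : defect2 e X = 0.
  move: so; rewrite lamE omE normr_le0 /defect2; move: (mean2 e X) => y; move: (alphaI _) => z; move: (s_om X) => w.
  by move=> /eqP h; transitivity (- 2 * (w - (z + e * y / 2))); [field|rewrite h mulr0].
pose dm := Modes (fun k t => Aa oms Ets k (cos_mode (s_modes X) k t) (sin_mode (s_modes X) k t) + cos_forcing e X k t)
  (fun k t => Ab oms Ets k (cos_mode (s_modes X) k t) (sin_mode (s_modes X) k t) + sin_forcing e X k t).
have hdm k : (k < 4)%N -> forall t, rder (cos_mode dm k t) t (cos_mode (s_modes X) k) /\
    rder (sin_mode dm k t) t (sin_mode (s_modes X) k).
  move=> k4 t; have [f [g [df dg hfg]]] := sm k k4; have [ec es] := co_modes YX k4.
  have fE : f t = cos_forcing e X k t.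
    by apply/colP => i; have [h _] := hfg t i; move: h; rewrite if_same normr_le0 subr_eq0 => /eqP.
  have gE : g t = sin_forcing e X k t.
    by apply/colP => i; have [_ h] := hfg t i; move: h; rewrite if_same normr_le0 subr_eq0 => /eqP.
  by move: (df t) (dg t); rewrite ec es fE gE.
have [tz df] := torus_with_astar pX hdm.
split=> //.
- by exists (add_astar (s_modes X)) => t x; exact: with_astar_synth.
- move=> t x.
  rewrite (@pde_residualE _ _ _ _ _ (add_astar (s_modes X)) dm)//; last 2 first.
    by move=> *; exact: with_astar_synth.
    by move=> k k4; exact: df.
  rewrite /S_trunc -[iota 0 4]/ks -/(Gfun e X) synth_comb; apply: synth_zero => k; rewrite mem_ks => k4.
    change (cos_mode (phi_modes (Gfun e X)) k t - cos_mode dm k t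
      - s_om X *: (k%:R *: sin_mode (add_astar (s_modes X)) k t) = 0).
    have [-> _] := G_modes t he BX k4; have [+ _] := forcing_modes e X k t.
    by rewrite s1 s2 va0 scaler0 addr0 => hf; rewrite scalerA addrAC hf; exact: subrr.
  move=> k0.
  change (sin_mode (phi_modes (Gfun e X)) k t - sin_mode dm k t
    - s_om X *: (- (k%:R *: cos_mode (add_astar (s_modes X)) k t)) = 0).
  have [_ /(_ k0) ->] := G_modes t he BX k4; have [_ +] := forcing_modes e X k t.
  by rewrite s1 s2 vb0 scaler0 addr0 => hf; rewrite scalerN opprK scalerA addrAC hf; exact: subrr.
- by apply/gamma_condition.
Qed.

Lemma ball_near dl dd X : n%:R * (8 * dl) < dd -> dl < dd -> ball_of dl X ->
  near_bifurcation dd lams oms (s_lam X) (s_om X) (with_astar (s_modes X)).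
Proof.
move=> h1 h2 BX; split.
- exact: le_lt_trans (ball_lam BX) h2.
- exact: le_lt_trans (ball_om BX) h2.
- move=> t x; apply: le_lt_trans h1; apply: enorm_le_entries => i.
  have := with_astar_diff t x i BX.2; rewrite with_astar_base.
  move: (with_astar _ _ _) (astar x) => u w; rewrite !mxE; lra.
Qed.

(** The converse, needed for uniqueness among all nearby solutions and not only among states. The
    factor 2 in [2 * dd <= dl] is the loss in passing from the function to its modes. *)
Lemma truncated_state e lam om z dd dl : `|e| <= 1 -> dl <= d -> 0 <= dd -> 2 * dd <= dl ->
  truncated_solution G e lam om z -> near_bifurcation dd lams oms lam om z ->
  exists c, [/\ ball_of dl (State lam om c), step e 0 0 (State lam om c) (State lam om c) &
    forall t x, z t x = with_astar c t x].
Proof.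
move=> he hd dd0 hdd [tz [c0 zc0] res gz] [nl no nz_].
have zE : z = synth ks c0 by do 2!apply/funext => ?; exact: zc0.
have tm := torus_modes (c := c0); rewrite -zE in tm; have {}tm := tm tz.
pose c := deviation (drop_sin0 c0).
have zc t x : z t x = with_astar c t x by rewrite with_astar_deviation synth_drop_sin0 zc0.
have zcE : z = with_astar c by do 2!apply/funext => ?; exact: zc.
pose dm := Modes (fun k t => derive1 (cos_mode (drop_sin0 c0) k) t) (fun k t => derive1 (sin_mode (drop_sin0 c0) k) t).
have s0 t : sin_mode c 0 t = 0 by rewrite /= mulr0n scale0r subr0.
have hdm k : (k < 4)%N -> forall t, rder (cos_mode dm k t) t (cos_mode c k) /\
    rder (sin_mode dm k t) t (sin_mode c k).
  by move=> k4 t; have [_ _ h1 h2] := tm k k4; apply: rder_deviation; [exact: h1|exact: h2].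
have pc k : (k < 4)%N -> periodic (cos_mode c k) T2 /\ periodic (sin_mode c k) T2.
  move=> k4; have [h1 h2 _ _] := tm k k4.
  by split=> t; rewrite /c /deviation; cbn [cos_mode sin_mode]; rewrite ?h1 ?h2.
have rc k : (k < 4)%N -> rcont (cos_mode c k) /\ rcont (sin_mode c k).
  by move=> k4; split; [exact: rder_rcont (fun t => (hdm k k4 t).1)|exact: rder_rcont (fun t => (hdm k k4 t).2)].
have nz' t x : enorm (with_astar c t x - astar x) < dd by rewrite -zc; exact: nz_.
have bm := near_modes nz' s0 dd0.
have dl0 : dd <= dl by move: dd0 hdd; lra.
have gz' : gamma (with_astar c) - ehat1 = 0 by rewrite -zcE.
clearbody c.
have reg : regular (State lam om c) by split; [exact: rc|exact: pc|exact: ((gamma_condition rc).1 gz')].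
have BX : ball_of dl (State lam om c).
  split; first exact: reg.
  case=> [||k t i|k t i] ok_; rewrite coord_bound_same.
  - exact: le_trans (ltW nl) dl0.
  - exact: le_trans (ltW no) dl0.
  - rewrite /coord_val /base_state /s_modes /cos_mode -/(cos_mode c k t) [(0 : vec) i 0]mxE subr0.
    by have [h _] := bm k t i ok_; exact: le_trans h hdd.
  - rewrite /coord_val /base_state /s_modes /sin_mode -/(sin_mode c k t) [(0 : vec) i 0]mxE subr0.
    by have [_ h] := bm k t i ok_; exact: le_trans h hdd.
exists c; split; [exact: BX| |exact: zc].
have [C C0 HC] := residual_step.
have := HC e (State lam om c) dm 0 0 he (ball_mono hd BX) hdm s0; rewrite mulr0; apply.
move=> k k4 t i; rewrite if_same.
have [_ df] := torus_with_astar pc hdm.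
have res' x : S_trunc 3 (Gfun e (State lam om c)) t x - synth ks dm t x - om *: synth ks (rot (add_astar c)) t x = 0.
  have pe := @pde_residualE R m (S_trunc 3 (Gfun e (State lam om c))) om (with_astar c) (add_astar c) dm t x
    (fun t x => with_astar_synth c t x) (fun k k4 => df k k4 t).
  by rewrite -pe; move: (res t x); rewrite zcE.
have mk : k \in iota 0 4 by rewrite mem_iota.
have cS j : continuous (fun x => S_trunc 3 (Gfun e (State lam om c)) t x j 0).
  exact: continuous_synth.
have [h1 h2] := @residual_modes R m (S_trunc 3 (Gfun e (State lam om c))) om (add_astar c) dm t k k4 cS.
have zero_c : cos_mode (phi_modes (fun t x => S_trunc 3 (Gfun e (State lam om c)) t x - synth ks dm t x - om *: synth ks (rot (add_astar c)) t x)) k t = 0.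
  apply/colP => j; rewrite phi_cosE [RHS]mxE /cmode (_ : (fun _ => _) = (fun=> 0)) ?int2_cst ?mulr0//.
  by apply/funext => x; rewrite res' mxE mul0r.
have zero_s : sin_mode (phi_modes (fun t x => S_trunc 3 (Gfun e (State lam om c)) t x - synth ks dm t x - om *: synth ks (rot (add_astar c)) t x)) k t = 0.
  apply/colP => j; rewrite phi_sinE [RHS]mxE /smode (_ : (fun _ => _) = (fun=> 0)) ?int2_cst ?mulr0//.
  by apply/funext => x; rewrite res' mxE mul0r.
split=> [|k0].
  rewrite zero_c in h1; move: h1; rewrite phi_cos_synth// mk scale1r => <-.
  by rewrite mxE normr0.
have := h2 k0; rewrite zero_s phi_sin_synth// mk -lt0n k0 scale1r => <-.
by rewrite mxE normr0.
Qed.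

(** A fixed point is its own image, so the contraction estimate can be repeated on the same pair and
    the distance decays geometrically from the diameter of the ball. *)
Lemma step_unique : exists2 d0, 0 < d0 & forall dl e X X' Y', dl <= d0 -> dl <= d -> `|e| <= d0 ->
  ball_of dl X -> ball_of dl X' -> ball_of dl Y' -> step e 0 0 X X -> step e 0 0 X' Y' ->
  (forall j, coord_ok j -> coord_val Y' j = coord_val X' j) -> forall j, coord_ok j -> coord_val X j = coord_val X' j.
Proof.
have [d0 d00 H1] := step_contraction; exists d0 => // dl e X X' Y' h1 h2 he BX BX' BY' sX sX' YX' j oj.
have W k : wdist X X' (2 * dl * (3 / 4) ^+ k) (2 * dl * (3 / 4) ^+ k).
  elim: k => [|k IH].
    move=> l ol; rewrite expr0 mulr1 coord_bound_same; have := BX.2 l ol; have := BX'.2 l ol; rewrite !coord_bound_same => g1 g2.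
    by apply: le_trans (ler_distD (coord_val base_state l) _ _) _; rewrite distrC in g1; move: g1 g2; lra.
  have := H1 dl e X X' X Y' _ h1 h2 he BX BX' (ball_mono h2 BX) (ball_mono h2 BY') sX sX' IH.
  rewrite mulrCA -exprS => h l ol; have := h l ol; by rewrite YX'.
apply/eqP; rewrite -subr_eq0 -normr_le0; apply: (@geometric_squeeze _ _ _ (2 * dl)) => k.
by have := W k j oj; rewrite coord_bound_same add0r.
Qed.

(** The estimate is iterated on one fixed pair, starting from the diameter of the ball. The
    invariant keeps the limiting orders e^4 and e^3 apart from a geometric remainder; even modes of
    size e^3 reach the odd ones as e times e^3, which is compatible with e^4. *)
Lemma step_error : exists2 d0, 0 < d0 & forall c : R, 0 <= c -> exists2 A : R, 0 <= A & exists2 e1 : R, 0 < e1 &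
  forall dl e X X' Y', dl <= d0 -> dl <= d -> `|e| <= e1 -> ball_of dl X -> ball_of dl X' -> ball_of dl Y' ->
  step e (c * `|e| ^+ 4) (c * `|e| ^+ 3) X X -> step e 0 0 X' Y' ->
  (forall j, coord_ok j -> coord_val Y' j = coord_val X' j) -> wdist X X' (A * `|e| ^+ 4) (A * `|e| ^+ 3).
Proof.
have [C C0 HC] := step_estimate; have C1 : 0 < 8 * C + 1 by rewrite ltr_wpDl// mulr_ge0.
exists (8 * C + 1)^-1 => [|c c0]; first by rewrite invr_gt0.
(* The constants make the two inequalities close up: [A1] absorbs the even contribution C A2 e^4 and
   the odd residual; [A2] absorbs the even residual and, through its summand 1, the odd distance A1
   e^4, which is at most e^3 by the choice of the bound on e. *)
pose A2 := 1 + 2 * (C * c); pose A1 := 2 * (C * (A2 + c)).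
have Cc : 0 <= C * c by exact: mulr_ge0.
have A20 : 0 <= A2 by rewrite addr_ge0// mulr_ge0.
have A10 : 0 <= A1 by rewrite mulr_ge0// mulr_ge0// addr_ge0.
exists (A1 + A2); first exact: addr_ge0.
exists (Num.min (8 * C + 1)^-1 (A1 + 1)^-1) => [|dl e X X' Y' h1 hd].
  by rewrite lt_min !invr_gt0 C1 ltr_wpDl.
rewrite le_min => /andP[he1 he2] BX BX' BY' sX sX' YX'.
have le1 : `|e| <= 1 by apply: le_trans he1 _; rewrite invf_le1// lerDr mulr_ge0.
have dl0 : 0 <= dl by apply: le_trans (ball_lam BX).
have Cd : C * dl <= 8^-1.
  have : (8 * C + 1) * dl <= 1 by rewrite mulrC -ler_pdivlMr// div1r.
  by move: dl0; lra.
have Ce : C * `|e| <= 8^-1.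
  have : (8 * C + 1) * `|e| <= 1 by rewrite mulrC -ler_pdivlMr// div1r.
  by have := normr_ge0 e; lra.
have Ae : A1 * `|e| <= 1.
  have : (A1 + 1) * `|e| <= 1 by rewrite mulrC -ler_pdivlMr ?ltr_wpDl// div1r.
  by have := normr_ge0 e; lra.
set p4 := `|e| ^+ 4; set p3 := `|e| ^+ 3.
have p30 : 0 <= p3 by exact: exprn_ge0.
have p4E : p4 = `|e| * p3 by rewrite /p4 exprS.
have p40 : 0 <= p4 by rewrite p4E mulr_ge0.
have W k : wdist X X' (A1 * p4 + 2 * dl * (3 / 4) ^+ k) (A2 * p3 + 2 * dl * (3 / 4) ^+ k).
  elim: k => [|k IH].
    rewrite expr0 mulr1; apply: (@wdist_mono X X' (2 * dl) (2 * dl)).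
    - by rewrite lerDr; exact: mulr_ge0.
    - by rewrite lerDr; exact: mulr_ge0.
    move=> l ol; have := BX.2 l ol; have := BX'.2 l ol; rewrite !coord_bound_same => g1 g2.
    by apply: le_trans (ler_distD (coord_val base_state l) _ _) _; rewrite distrC in g1; move: g1 g2; lra.
  have hd2 := le_trans hd d_ler.
  have := HC dl e X X' X Y' _ _ _ _ le1 hd BX BX' BX.1 BY'.1 (le_trans (ball_lam BX) hd2)
    (le_trans (ball_lam BY') hd2) sX sX' IH.
  have -> : 2 * dl * (3 / 4) ^+ k.+1 = 3 / 4 * (2 * dl * (3 / 4) ^+ k) by rewrite exprS mulrCA.
  rewrite -/p3 -/p4.
  have x0 : 0 <= 2 * dl * (3 / 4) ^+ k.
    by rewrite !mulr_ge0// exprn_ge0//; lra.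
  move: (2 * dl * (3 / 4) ^+ k) x0 => x x0 h.
  have {}h : wdist X X' (C * (dl * (A1 * p4 + x) + `|e| * (A1 * p4 + x + (A2 * p3 + x)) + c * p4))
     (C * (dl * (A1 * p4 + x + (A2 * p3 + x)) + `|e| * (A1 * p4 + x + (A2 * p3 + x)) + c * p3)).
    by move=> l ol; have := h l ol; rewrite YX'.
  have q1 : 0 <= A1 * p4 by exact: mulr_ge0.
  have q2 : 0 <= A2 * p3 by exact: mulr_ge0.
  have a1 : C * dl * (A1 * p4 + x) <= 8^-1 * (A1 * p4 + x) by apply: ler_wpM2r => //; exact: addr_ge0.
  have a2 : C * dl * (A2 * p3 + x) <= 8^-1 * (A2 * p3 + x) by apply: ler_wpM2r => //; exact: addr_ge0.
  have a3 : C * `|e| * (A1 * p4 + x) <= 8^-1 * (A1 * p4 + x) by apply: ler_wpM2r => //; exact: addr_ge0.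
  have a4 : C * `|e| * (A2 * p3 + x) <= 8^-1 * (A2 * p3 + x) by apply: ler_wpM2r => //; exact: addr_ge0.
  have a5 : C * `|e| * x <= 8^-1 * x by exact: ler_wpM2r.
  have a6 : A1 * p4 <= p3 by rewrite p4E mulrA ler_piMl.
  have A1E : A1 * p4 = 2 * (C * A2 * p4) + 2 * (C * c * p4) by rewrite /A1; ring.
  have A2E : A2 * p3 = p3 + 2 * (C * c * p3) by rewrite /A2; ring.
  have q3 : 0 <= C * A2 * p4 by rewrite !mulr_ge0.
  have q4 : 0 <= C * c * p4 by rewrite mulr_ge0.
  have q5 : 0 <= C * c * p3 by rewrite mulr_ge0.
  apply: wdist_mono h.
    rewrite (_ : C * _ = C * dl * (A1 * p4 + x) + C * `|e| * (A1 * p4 + x) + C * A2 * p4 + C * `|e| * x + C * c * p4); last first.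
      by rewrite p4E; ring.
    clearbody A1 A2 p4 p3; move: a1 a3 a5 q1 q3 q4 A1E x0; lra.
  rewrite (_ : C * _ = C * dl * (A1 * p4 + x) + C * dl * (A2 * p3 + x) + C * `|e| * (A1 * p4 + x) + C * `|e| * (A2 * p3 + x) + C * c * p3); last by ring.
  clearbody A1 A2 p4 p3; move: a1 a2 a3 a4 a6 q1 q2 q5 A2E x0 p30; lra.
move=> j oj; apply: (@geometric_squeeze _ _ _ (2 * dl)) => k.
apply: le_trans (W k j oj) _; move: (2 * dl * _) => y.
have g1 : A1 * p4 + y <= (A1 + A2) * p4 + y by rewrite lerD2r ler_wpM2r// lerDl.
have g2 : A2 * p3 + y <= (A1 + A2) * p3 + y by rewrite lerD2r ler_wpM2r// lerDr.
by case: j oj => [||l t i|l t i] _; rewrite /coord_bound; try case: (odd l).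
Qed.

(** * The asymptotic solution as an approximate fixed point *)

Hypothesis d_gt0 : 0 < d.
Hypothesis parity_gain_G : forall (lam2 om2 M C0 e0 : R) (z2 z3 z2p z3p z2t z3t : R -> R -> vec), 0 < e0 -> 0 <= C0 ->
  (forall t x j, [/\ `|z2 t x j 0| <= M, `|z3 t x j 0| <= M, `|z2p t x j 0| <= M & `|z3p t x j 0| <= M]) ->
  (forall t x, [/\ z2 t (x + pi) = z2 t x, z2p t (x + pi) = z2p t x & z2t t (x + pi) = z2t t x]) ->
  (forall t x, [/\ z3 t (x + pi) = - z3 t x, z3p t (x + pi) = - z3p t x & z3t t (x + pi) = - z3t t x]) ->
  let Rf e t x := G (astar x + e *: z2 t x + e ^+ 2 *: z3 t x) (lamE lams lam2 e) t e
    - (e *: z2t t x + e ^+ 2 *: z3t t x)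
    - omE oms om2 e *: (dastar x + e *: z2p t x + e ^+ 2 *: z3p t x) in
  (forall e t x i, `|e| < e0 -> `|Rf e t x i 0| <= C0 * `|e| ^+ 3) ->
  exists2 C, 0 <= C & exists2 e1, 0 < e1 & forall e t x i, `|e| < e1 -> `|t| <= T2 ->
    `|Rf e t x i 0 - Rf e t (x + pi) i 0| <= C * `|e| ^+ 4.

Definition mode_scale k (e : R) : R := if odd k then e ^+ 2 else e.
Definition scale_modes (c : modes R n) e : modes R n := Modes (fun k t => mode_scale k e *: cos_mode c k t)
  (fun k t => mode_scale k e *: sin_mode c k t).
Definition mask_modes (ms : seq nat) (c : modes R n) : modes R n := Modes
  (fun k t => if k \in ms then cos_mode c k t else 0) (fun k t => if k \in ms then sin_mode c k t else 0).
Definition modes_derivative (c : modes R n) : modes R n := Modes (fun k t => derive1 (cos_mode c k) t)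
  (fun k t => derive1 (sin_mode c k) t).

Lemma synth_scale_modes c e t x : synth ks (scale_modes c e) t x = e *: synth [:: 0; 2]%N c t x + e ^+ 2 *: synth [:: 1; 3]%N c t x.
Proof.
rewrite /synth !big_cons !big_nil /= /mode_scale /=.
move: (cos_mode c 0 t) (cos_mode c 1 t) (cos_mode c 2 t) (cos_mode c 3 t).
move: (sin_mode c 0 t) (sin_mode c 1 t) (sin_mode c 2 t) (sin_mode c 3 t) => *.
by apply/colP => i; rewrite !mxE; ring.
Qed.

Lemma zE_with_astar c e : zE c e = with_astar (scale_modes (drop_sin0 c) e).
Proof.
apply/funext => t; apply/funext => x; rewrite /zE /with_astar synth_scale_modes /z2E /z3E !synth_drop_sin0.
by rewrite addrA.
Qed.

Lemma synth_mask02 (c : modes R n) t x : synth ks (mask_modes [:: 0; 2]%N c) t x = synth [:: 0; 2]%N c t x.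
Proof. by rewrite /synth !big_cons !big_nil /= !scaler0 !add0r !addr0. Qed.

Lemma synth_mask13 (c : modes R n) t x : synth ks (mask_modes [:: 1; 3]%N c) t x = synth [:: 1; 3]%N c t x.
Proof. by rewrite /synth !big_cons !big_nil /= !scaler0 !add0r !addr0 ?add0r. Qed.

Lemma synth_pi_odd ms (c : modes R n) t x : all odd ms -> synth ms c t (x + pi) = - synth ms c t x.
Proof.
move=> /allP om; rewrite /synth -sumrN big_seq [RHS]big_seq; apply: eq_bigr => k /om ko.
by rewrite cos_odd_pi// sin_odd_pi// !scaleNr opprD.
Qed.

Lemma synth_pi_even (c : modes R n) t x : synth [:: 0; 2]%N c t (x + pi) = synth [:: 0; 2]%N c t x.
Proof.
rewrite /synth !big_cons !big_nil !mul0r.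
have -> : 2%:R * (x + pi) = 2%:R * x + T2 by rewrite mulrDr [2 * pi]mulr_natl.
by rewrite cosD2pi sinD2pi.
Qed.

Lemma rot_add_astar (c : modes R n) t x : synth ks (rot (add_astar c)) t x = dastar x + synth ks (rot c) t x.
Proof.
rewrite /synth /dastar !big_cons !big_nil /= !mul1r; move: e1 e2 => u w.
move: (cos_mode c 0 t) (cos_mode c 1 t) (cos_mode c 2 t) (cos_mode c 3 t).
move: (sin_mode c 0 t) (sin_mode c 1 t) (sin_mode c 2 t) (sin_mode c 3 t) => *.
by apply/colP => i; rewrite !mxE; ring.
Qed.

Lemma rot_scale_modes (c : modes R n) e t x : synth ks (rot (scale_modes c e)) t x = synth ks (scale_modes (rot c) e) t x.
Proof.
apply: synth_eq => k _ => [|_] /=; first by rewrite !scalerA mulrC.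
by rewrite scalerN !scalerA mulrC.
Qed.

(** Regularity of [z2E] concerns the modes 0 and 2, that of [z3E] the modes 1 and 3. Masking the
    other modes writes each as a sum over all four indices, to which the mode extraction applies. *)
Lemma asymptotic_modes (c : modes R n) : torus_function (z2E c) -> torus_function (z3E c) ->
  forall k, (k < 4)%N -> [/\ periodic (cos_mode (drop_sin0 c) k) T2, periodic (sin_mode (drop_sin0 c) k) T2,
    forall t, rder (cos_mode (modes_derivative (drop_sin0 c)) k t) t (cos_mode (drop_sin0 c) k) &
    forall t, rder (sin_mode (modes_derivative (drop_sin0 c)) k t) t (sin_mode (drop_sin0 c) k)].
Proof.
move=> t2 t3.
have e2 : z2E c = synth ks (mask_modes [:: 0; 2]%N c) by do 2!apply/funext => ?; rewrite synth_mask02.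
have e3 : z3E c = synth ks (mask_modes [:: 1; 3]%N c) by do 2!apply/funext => ?; rewrite synth_mask13.
rewrite e2 in t2; rewrite e3 in t3.
have h2 := torus_modes t2; have h3 := torus_modes t3.
by case=> [|[|[|[|//]]]] _; [exact: (h2 0%N isT)|exact: (h3 1%N isT)|exact: (h2 2%N isT)|exact: (h3 3%N isT)].
Qed.

Lemma modes_bounded (c : modes R n) : (forall k, (k < 4)%N -> rcont (cos_mode c k) /\ rcont (sin_mode c k)) ->
  (forall k, (k < 4)%N -> periodic (cos_mode c k) T2 /\ periodic (sin_mode c k) T2) ->
  exists2 M, 0 <= M & forall k t i, (k < 4)%N -> `|cos_mode c k t i 0| <= M /\ `|sin_mode c k t i 0| <= M.
Proof.
move=> rc pc; have [||M M0 HM] := @uniform_constant R ('I_4 * 'I_n)%type (fun ki M => forall t,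
    `|cos_mode c ki.1 t ki.2 0| <= M /\ `|sin_mode c ki.1 t ki.2 0| <= M).
- move=> ki M M' MM' h t; have [h1 h2] := h t; split; [exact: le_trans h1 MM'|exact: le_trans h2 MM'].
- move=> [k i] /=; have [c1 c2] := rc k (ltn_ord k); have [p1 p2] := pc k (ltn_ord k).
  have pe (f : R -> vec) : periodic f T2 -> periodic (fun t => f t i 0) T2 by move=> pf t; rewrite pf.
  have [M1 [_ h1]] := periodic_bounded (c1 i) (pe _ p1).
  have [M2 [_ h2]] := periodic_bounded (c2 i) (pe _ p2).
  exists (Num.max M1 M2) => t.
  by split; [apply: le_trans (h1 t) _|apply: le_trans (h2 t) _]; rewrite le_max lexx ?orbT.
by exists M => // k t i k4; exact: (HM (Ordinal k4, i) t).
Qed.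

Lemma synth_bound ms (c : modes R n) M t x i : 0 <= M -> subseq ms ks ->
  (forall k, (k < 4)%N -> `|cos_mode c k t i 0| <= M /\ `|sin_mode c k t i 0| <= M) ->
  `|synth ms c t x i 0| <= (size ms)%:R * (2 * M).
Proof.
move=> M0 sm hM; rewrite synthE /trig; apply: le_trans (ler_norm_sum _ _ _) _.
apply: le_trans (_ : \sum_(k <- ms) 2 * M <= _); last first.
  by rewrite big_const_seq count_predT iter_addr_0 -[leLHS]mulr_natl.
rewrite big_seq [leRHS]big_seq; apply: ler_sum => k km.
have [|h1 h2] := hM k; first by rewrite -mem_ks; exact: (mem_subseq sm).
apply: le_trans (ler_normD _ _) _; rewrite !normrM [leRHS](_ : _ = M + M); last by ring.
by apply: lerD; [apply: le_trans (_ : `|cos_mode c k t i 0| <= _)|apply: le_trans (_ : `|sin_mode c k t i 0| <= _)] => //;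
  apply: ler_piMl => //; [exact: cos_max|exact: sin_max].
Qed.

Lemma dmode_periodic (c : modes R n) k : (k < 4)%N ->
  (forall k, (k < 4)%N -> [/\ periodic (cos_mode c k) T2, periodic (sin_mode c k) T2,
    forall t, rder (cos_mode (modes_derivative c) k t) t (cos_mode c k) &
    forall t, rder (sin_mode (modes_derivative c) k t) t (sin_mode c k)]) ->
  periodic (cos_mode (modes_derivative c) k) T2 /\ periodic (sin_mode (modes_derivative c) k) T2.
Proof.
move=> k4 h; have [p1 p2 d1 d2] := h k k4.
have gen (f df : R -> vec) : periodic f T2 -> (forall t, rder (df t) t f) -> periodic df T2.
  move=> pf hd t; apply/colP => i; apply: der_uniq (hd t i).
  by apply: der_ext (der_shift (hd (t + T2) i)) => s; rewrite pf.
by split; [exact: gen p1 d1|exact: gen p2 d2].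
Qed.

Definition asymptotic_state lam2 om2 c e := State (lamE lams lam2 e) (omE oms om2 e) (scale_modes (drop_sin0 c) e).

Lemma near0_bound (Q : R -> Prop) : (\forall e \near (0 : R), Q e) -> exists2 e0, 0 < e0 & forall e, `|e| < e0 -> Q e.
Proof.
move=> /nbhs_ballP[e0 /= e00 h]; exists e0 => // e he; apply: h.
by rewrite /ball /= sub0r normrN.
Qed.

Lemma mode_scale_le k e : `|e| <= 1 -> `|mode_scale k e| <= `|e|.
Proof. by rewrite /mode_scale; case: odd => // h; rewrite normrX expr2 ler_piMl. Qed.

(** The defect in the amplitude and phase conditions is a constant times e^2 and at the same time
    O(e^3), so the constant is 0: the asymptotic solution meets these conditions exactly. *)
Lemma asymptotic_means lam2 om2 c : asymptotic_solution G lams oms lam2 om2 c ->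
  I2 (fun t => p1 (cos_mode (drop_sin0 c) 1 t) (sin_mode (drop_sin0 c) 1 t)) = 0 /\
  I2 (fun t => p2 (cos_mode (drop_sin0 c) 1 t) (sin_mode (drop_sin0 c) 1 t)) = 0.
Proof.
move=> [t2 t3 _ [C /near0_bound[e0 e00 hg]]].
have am := asymptotic_modes t2 t3.
have rc k : (k < 4)%N -> rcont (cos_mode (drop_sin0 c) k) /\ rcont (sin_mode (drop_sin0 c) k).
  by move=> k4; have [_ _ h1 h2] := am k k4; split; [exact: rder_rcont h1|exact: rder_rcont h2].
have [ca cb] := rc 1%N isT.
have rcs e k : (k < 4)%N -> rcont (cos_mode (scale_modes (drop_sin0 c) e) k) /\ rcont (sin_mode (scale_modes (drop_sin0 c) e) k).
  move=> /rc[h1 h2]; have gen (f : R -> vec) a : rcont f -> rcont (fun t => a *: f t).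
    move=> cf i; rewrite (_ : (fun _ => _) = (fun t => a * f t i 0)).
      by apply: continuous_mul; [exact: continuous_cst|exact: cf].
    by apply/funext => t; move: (f t) => u; rewrite mxE.
  by split; apply: gen.
set J1 := I2 _; set J2 := I2 _.
have p0 : 0 < T2 ^- 2 * pi :> R by rewrite mulr_gt0 ?invr_gt0 ?exprn_gt0 ?twopi_gt0 ?pi_gt0.
have P1E e : I2 (fun t => p1 (cos_mode (scale_modes (drop_sin0 c) e) 1 t) (sin_mode (scale_modes (drop_sin0 c) e) 1 t)) = e ^+ 2 * J1.
  rewrite -int2Z; last exact: continuous_p1.
  by congr I2; apply/funext => t; rewrite /p1 [(_ *: _ : vec) _ 0]mxE [X in _ + X]mxE mulrDr.
have P2E e : I2 (fun t => p2 (cos_mode (scale_modes (drop_sin0 c) e) 1 t) (sin_mode (scale_modes (drop_sin0 c) e) 1 t)) = e ^+ 2 * J2.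
  rewrite -int2Z; last exact: continuous_p2.
  by congr I2; apply/funext => t; rewrite /p2 [(_ *: _ : vec) _ 0]mxE [X in _ - X]mxE mulrBr.
have small (J : R) : (forall e, `|e| < e0 -> `|T2 ^- 2 * pi * (e ^+ 2 * J)| <= C * `|e| ^+ 3) -> J = 0.
  move=> hJ; apply/eqP; rewrite -normr_le0 -(pmulr_rle0 _ p0).
  apply: (small_le0 (K := C) e00) => e h1 h2.
  have := hJ e; rewrite gtr0_norm// => /(_ h2).
  rewrite normrM (gtr0_norm p0) normrM (gtr0_norm (exprn_gt0 2 h1)) mulrCA.
  by rewrite [X in _ <= X](_ : _ = e ^+ 2 * (C * e)) ?ler_pM2l ?exprn_gt0// exprSr mulrCA.
split; apply: small => e he; have := hg e he tt; rewrite zE_with_astar;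
  have [g0 g1] := gamma_with_astar (rcs e); rewrite P1E in g0; rewrite P2E in g1.
- move=> h; apply: le_trans h; apply: le_trans (entry_le_enorm _ 0).
  by move: (gamma _) g0 => g g0; rewrite !mxE g0 /= addrC addKr.
- move=> h; apply: le_trans h; apply: le_trans (entry_le_enorm _ 1).
  by move: (gamma _) g1 => g g1; rewrite !mxE g1 /= subr0.
Qed.

Lemma near0_norm (Q : R -> Prop) e0 : 0 < e0 -> (forall e, `|e| < e0 -> Q e) -> \forall e \near (0 : R), Q e.
Proof.
move=> e00 h; apply/nbhs_ballP; exists e0 => //= e; rewrite /ball /= sub0r normrN; exact: h.
Qed.

Lemma ball_asymptotic_state lam2 om2 c dl : 0 < dl -> asymptotic_solution G lams oms lam2 om2 c ->
  exists2 e1, 0 < e1 & forall e, `|e| < e1 -> ball_of dl (asymptotic_state lam2 om2 c e).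
Proof.
move=> dl0 as_; have [t2 t3 _ _] := as_; have am := asymptotic_modes t2 t3.
have rc k : (k < 4)%N -> rcont (cos_mode (drop_sin0 c) k) /\ rcont (sin_mode (drop_sin0 c) k).
  by move=> k4; have [_ _ h1 h2] := am k k4; split; [exact: rder_rcont h1|exact: rder_rcont h2].
have pc k : (k < 4)%N -> periodic (cos_mode (drop_sin0 c) k) T2 /\ periodic (sin_mode (drop_sin0 c) k) T2.
  by move=> k4; have [h1 h2 _ _] := am k k4.
have [M M0 HM] := modes_bounded rc pc; have [z1 z2] := asymptotic_means as_.
have [ca cb] := rc 1%N isT.
pose K := M + `|lam2| + `|om2| + 1.
have K0 : 0 < K by rewrite /K ltr_wpDl// !addr_ge0.
exists (Num.min 1 (dl / K)) => [|e]; first by rewrite lt_min ltr01 divr_gt0.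
rewrite lt_min => /andP[/ltW e1 he].
have Ke : K * `|e| <= dl by rewrite mulrC -ler_pdivlMr// ltW.
have small x y : `|x| <= `|e| -> `|y| <= K -> `|x * y| <= dl.
  by move=> hx hy; apply: le_trans Ke; rewrite normrM mulrC; apply: ler_pM.
have e2 : `|e ^+ 2| <= `|e| by rewrite normrX expr2 ler_piMl.
split; first split.
- move=> k /rc[h1 h2]; have gen (f : R -> vec) a : rcont f -> rcont (fun t => a *: f t).
    move=> cf i; rewrite (_ : (fun _ => _) = (fun t => a * f t i 0)).
      by apply: continuous_mul; [exact: continuous_cst|exact: cf].
    by apply/funext => t; move: (f t) => u; rewrite mxE.
  by split; apply: gen.
- by move=> k /pc[h1 h2]; split=> t; rewrite /asymptotic_state /s_modes /scale_modes; cbn [cos_mode sin_mode]; rewrite ?h1 ?h2.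
- split.
    rewrite (_ : (fun _ => _) = (fun t => e ^+ 2 * p1 (cos_mode (drop_sin0 c) 1 t) (sin_mode (drop_sin0 c) 1 t))).
      by rewrite int2Z ?z1 ?mulr0//; exact: continuous_p1.
    by apply/funext => t; rewrite /p1 [(_ *: _ : vec) _ 0]mxE [X in _ + X]mxE mulrDr.
  rewrite (_ : (fun _ => _) = (fun t => e ^+ 2 * p2 (cos_mode (drop_sin0 c) 1 t) (sin_mode (drop_sin0 c) 1 t))).
    by rewrite int2Z ?z2 ?mulr0//; exact: continuous_p2.
  by apply/funext => t; rewrite /p2 [(_ *: _ : vec) _ 0]mxE [X in _ - X]mxE mulrBr.
- case=> [||k t i|k t i] ok_; rewrite coord_bound_same.
  + rewrite /= /lamE addrC addKr; apply: small => //; rewrite /K; have := normr_ge0 om2; lra.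
  + rewrite /= /omE addrC addKr; apply: small => //; rewrite /K; have := normr_ge0 lam2; lra.
  + have [h _] := HM k t i ok_.
    rewrite /coord_val /base_state /asymptotic_state /s_modes /scale_modes /cos_mode -/(cos_mode (drop_sin0 c) k t) [(0 : vec) i 0]mxE subr0.
    move: (cos_mode (drop_sin0 c) k t) h => u h; rewrite mxE; apply: small; first exact: mode_scale_le.
    by rewrite /K; have := normr_ge0 lam2; have := normr_ge0 om2; move: h; lra.
  + have [_ h] := HM k t i ok_.
    rewrite /coord_val /base_state /asymptotic_state /s_modes /scale_modes /sin_mode -/(sin_mode (drop_sin0 c) k t) [(0 : vec) i 0]mxE subr0.
    move: (sin_mode (drop_sin0 c) k t) h => u h; rewrite mxE; apply: small; first exact: mode_scale_le.
    by rewrite /K; have := normr_ge0 lam2; have := normr_ge0 om2; move: h; lra.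
Qed.

(** The residual is O(e^3) pointwise, hence in every mode. The odd modes depend only on the
    difference of its values at x and x + pi, and the parity gain makes this O(e^4). *)
Lemma asymptotic_step lam2 om2 c dl : 0 < dl -> dl <= d -> asymptotic_solution G lams oms lam2 om2 c ->
  exists2 b, 0 <= b & exists2 e1, 0 < e1 & forall e, `|e| < e1 -> ball_of dl (asymptotic_state lam2 om2 c e) /\
    step e (b * `|e| ^+ 4) (b * `|e| ^+ 3) (asymptotic_state lam2 om2 c e) (asymptotic_state lam2 om2 c e).
Proof.
move=> dl0 hd as_; have [t2 t3 [C0 /near0_bound[e0 e00 hres]] _] := as_.
have am := asymptotic_modes t2 t3.
have [ea ea0 hball] := ball_asymptotic_state dl0 as_.
have rc k : (k < 4)%N -> rcont (cos_mode (drop_sin0 c) k) /\ rcont (sin_mode (drop_sin0 c) k).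
  by move=> k4; have [_ _ h1 h2] := am k k4; split; [exact: rder_rcont h1|exact: rder_rcont h2].
have pc k : (k < 4)%N -> periodic (cos_mode (drop_sin0 c) k) T2 /\ periodic (sin_mode (drop_sin0 c) k) T2.
  by move=> k4; have [h1 h2 _ _] := am k k4.
have [M M0 HM] := modes_bounded rc pc.
pose dm e := scale_modes (modes_derivative (drop_sin0 c)) e.
have hdm e k : (k < 4)%N -> forall t, rder (cos_mode (dm e) k t) t (cos_mode (scale_modes (drop_sin0 c) e) k) /\
    rder (sin_mode (dm e) k t) t (sin_mode (scale_modes (drop_sin0 c) e) k).
  move=> k4 t; have [_ _ h1 h2] := am k k4.
  have gen (f : R -> vec) (u : vec) a : rder u t f -> rder (a *: u) t (fun s => a *: f s).
    move=> Hw i; apply: der_ext (der_val _ (der_scale a (Hw i))) => [s|]; last by rewrite mxE.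
    by move: (f s) => w; rewrite mxE.
  by split; apply: gen; [exact: h1|exact: h2].
have pscm e k : (k < 4)%N -> periodic (cos_mode (scale_modes (drop_sin0 c) e) k) T2 /\ periodic (sin_mode (scale_modes (drop_sin0 c) e) k) T2.
  by move=> /pc[h1 h2]; split=> t; rewrite /scale_modes; cbn [cos_mode sin_mode]; rewrite ?h1 ?h2.
have tz e := torus_with_astar (pscm e) (hdm e).
pose z2 := synth [:: 0; 2]%N (drop_sin0 c); pose z3 := synth [:: 1; 3]%N (drop_sin0 c).
pose z2p := synth [:: 0; 2]%N (rot (drop_sin0 c)); pose z3p := synth [:: 1; 3]%N (rot (drop_sin0 c)).
pose z2t := synth [:: 0; 2]%N (modes_derivative (drop_sin0 c)); pose z3t := synth [:: 1; 3]%N (modes_derivative (drop_sin0 c)).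
pose Rf e t x := G (astar x + e *: z2 t x + e ^+ 2 *: z3 t x) (lamE lams lam2 e) t e
    - (e *: z2t t x + e ^+ 2 *: z3t t x)
    - omE oms om2 e *: (dastar x + e *: z2p t x + e ^+ 2 *: z3p t x).
have zE e t x : astar x + e *: z2 t x + e ^+ 2 *: z3 t x = with_astar (scale_modes (drop_sin0 c) e) t x.
  by rewrite /with_astar synth_scale_modes addrA.
have RfE e t x : Rf e t x = Gfun e (asymptotic_state lam2 om2 c e) t x - synth ks (dm e) t x
    - omE oms om2 e *: synth ks (rot (add_astar (scale_modes (drop_sin0 c) e))) t x.
  rewrite /Rf zE /Gfun rot_add_astar rot_scale_modes !synth_scale_modes addrA.
  by [].
have HR e t x i : `|e| < e0 -> `|Rf e t x i 0| <= `|C0| * `|e| ^+ 3.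
  move=> he; apply: le_trans (entry_le_enorm _ _) _.
  apply: le_trans (_ : C0 * `|e| ^+ 3 <= _); last by apply: ler_wpM2r; [exact: exprn_ge0|exact: ler_norm].
  have := hres e he (t, x); rewrite zE_with_astar /=.
  have pe := @pde_residualE R m (fun t p => G (with_astar (scale_modes (drop_sin0 c) e) t p) (lamE lams lam2 e) t e)
    (omE oms om2 e) (with_astar (scale_modes (drop_sin0 c) e)) (add_astar (scale_modes (drop_sin0 c) e)) (dm e) t x
    (fun t x => with_astar_synth _ t x) (fun k k4 => (tz e).2 k k4 t).
  by rewrite pe RfE.
have MR k t i : (k < 4)%N -> `|cos_mode (rot (drop_sin0 c)) k t i 0| <= 3 * M /\ `|sin_mode (rot (drop_sin0 c)) k t i 0| <= 3 * M.
  move=> k4; have [h1 h2] := HM k t i k4; have k3 : (k%:R : R) <= 3 by rewrite ler_nat.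
  by rewrite rot_cosE rot_sinE normrN !normrM normr_nat; split; apply: ler_pM.
pose MM := 2 * (2 * M) + 2 * (2 * (3 * M)).
have M30 : 0 <= 3 * M by exact: mulr_ge0.
have bz t x j : [/\ `|z2 t x j 0| <= MM, `|z3 t x j 0| <= MM, `|z2p t x j 0| <= MM & `|z3p t x j 0| <= MM].
  have l1 : 2 * (2 * M) <= MM by rewrite lerDl !mulr_ge0.
  have l2 : 2 * (2 * (3 * M)) <= MM by rewrite lerDr !mulr_ge0.
  split; [apply: le_trans l1|apply: le_trans l1|apply: le_trans l2|apply: le_trans l2];
    by apply: (synth_bound (ms := [:: _; _])) => // k k4; (exact: HM || exact: MR).
have par2 t x : [/\ z2 t (x + pi) = z2 t x, z2p t (x + pi) = z2p t x & z2t t (x + pi) = z2t t x].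
  by split; exact: synth_pi_even.
have par3 t x : [/\ z3 t (x + pi) = - z3 t x, z3p t (x + pi) = - z3p t x & z3t t (x + pi) = - z3t t x].
  by split; exact: synth_pi_odd.
have [C1 C10 [e1 e10 hpar]] := @parity_gain_G lam2 om2 MM `|C0| e0 z2 z3 z2p z3p z2t z3t e00 (normr_ge0 C0) bz
  par2 par3 HR.
have {}hpar e t x i : `|e| < e1 -> `|t| <= T2 -> `|Rf e t x i 0 - Rf e t (x + pi) i 0| <= C1 * `|e| ^+ 4 := hpar e t x i.
clearbody Rf; clear par2 par3 bz zE; clear z2 z3 z2p z3p z2t z3t.
pose em := Num.min (Num.min (Num.min ea e0) e1) 1.
have [C2 C20 HC2] := residual_step.
pose b := C2 * (2 * `|C0| + C1).
exists b; first by rewrite mulr_ge0// addr_ge0// mulr_ge0.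
exists em => [|e]; first by rewrite !lt_min ea0 e00 e10 ltr01.
rewrite !lt_min => /andP[/andP[/andP[hea he0] he1] hele]; have le1 := ltW hele.
have BX := hball e hea; split=> //; have BX' := ball_mono hd BX.
have hlam := lam_in BX'; set X := asymptotic_state lam2 om2 c e in BX BX' hlam *.
have dper k : (k < 4)%N -> periodic (cos_mode (dm e) k) T2 /\ periodic (sin_mode (dm e) k) T2.
  move=> k4; have [h1 h2] := dmode_periodic k4 am.
  by split=> t; rewrite /dm /scale_modes; cbn [cos_mode sin_mode]; rewrite ?h1 ?h2.
have synth_per (q : modes R n) t x : (forall k, (k < 4)%N -> periodic (cos_mode q k) T2 /\ periodic (sin_mode q k) T2) ->
    synth ks q (t + T2) x = synth ks q t x.
  move=> hq; rewrite /synth big_seq [RHS]big_seq; apply: eq_bigr => k; rewrite mem_ks => /hq[q1 q2].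
  by rewrite q1 q2.
have zper t x : with_astar (s_modes X) (t + T2) x = with_astar (s_modes X) t x.
  by congr (_ + _); exact: synth_per (pscm e).
have Gper z t : G z (s_lam X) (t + T2) e = G z (s_lam X) t e.
  rewrite (@G_linear_part z (s_lam X) (t + T2) e hlam) (@G_linear_part z (s_lam X) t e hlam).
  by rewrite (@H_periodic z (s_lam X) e hlam t).
have rotper k : (k < 4)%N -> periodic (cos_mode (rot (add_astar (scale_modes (drop_sin0 c) e))) k) T2 /\
    periodic (sin_mode (rot (add_astar (scale_modes (drop_sin0 c) e))) k) T2.
  by move=> k4; have [h1 h2] := pscm e k k4; split=> s; rewrite /rot /add_astar; cbn [cos_mode sin_mode]; rewrite ?h1 ?h2.
have RfX t x : Rf e t x = Gfun e X t x - synth ks (dm e) t x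
    - omE oms om2 e *: synth ks (rot (add_astar (scale_modes (drop_sin0 c) e))) t x := RfE e t x.
have GX t x : Gfun e X (t + T2) x = Gfun e X t x by rewrite /Gfun zper Gper.
have sp1 t x := synth_per (dm e) t x dper.
have sp2 t x := synth_per (rot (add_astar (scale_modes (drop_sin0 c) e))) t x rotper.
have Rper x : periodic (fun t => Rf e t x) T2.
  by move=> t; rewrite (RfX (t + T2) x) (RfX t x) GX sp1 sp2.
(* The parity gain is stated on a compact range of theta; periodicity of the residual extends it to
   the whole line. *)
have hpar' t x i : `|Rf e t x i 0 - Rf e t (x + pi) i 0| <= C1 * `|e| ^+ 4.
  have [k [y [/andP[y0 yT] yE]]] := periodic_repr t.
  have hy : `|y| <= T2 by rewrite ger0_norm.
  have yt x' : Rf e t x' = Rf e y x'.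
    by case: yE => ->; [exact: periodicn (Rper x') k y|exact/esym/(periodicn (Rper x') k t)].
  by rewrite !yt; exact: hpar.
have step_mono ro re ro' re' : ro <= ro' -> re <= re' -> step e ro re X X -> step e ro' re' X X.
  move=> h1 h2 [s1 s2 s3]; split; [exact: le_trans s1 h1|exact: le_trans s2 h1|].
  move=> k k4; have [f [g [df dg hfg]]] := s3 k k4; exists f, g; split=> // t i.
  have hh : (if odd k then ro else re) <= (if odd k then ro' else re') by case: odd.
  by have [q1 q2] := hfg t i; split; [exact: le_trans q1 hh|exact: le_trans q2 hh].
have p30 : 0 <= `|e| ^+ 3 by exact: exprn_ge0.
have p40 : 0 <= `|e| ^+ 4 by exact: exprn_ge0.
apply: (step_mono (C2 * (C1 * `|e| ^+ 4)) (C2 * (2 * (`|C0| * `|e| ^+ 3)))).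
- rewrite /b -mulrA; apply: ler_wpM2l => //; apply: ler_wpM2r => //; rewrite lerDr; exact: mulr_ge0.
- rewrite /b -mulrA; apply: ler_wpM2l => //; rewrite mulrA; apply: ler_wpM2r => //; by rewrite lerDl.
apply: (HC2 e X (dm e)) => //; first exact: hdm.
  by move=> t; rewrite /= scaler0.
move=> k k4 t i.
have cG j : continuous (fun x => Gfun e X t x j 0) by exact: Gfun_continuous.
have [r1 r2] := @residual_modes R m (Gfun e X) (omE oms om2 e) (add_astar (scale_modes (drop_sin0 c) e)) (dm e) t k k4 cG.
have wE : (fun t x => Gfun e X t x - synth ks (dm e) t x - omE oms om2 e *: synth ks (rot (add_astar (scale_modes (drop_sin0 c) e))) t x)
    = Rf e by do 2!apply/funext => ?; rewrite RfE.
cbv zeta in r1, r2; rewrite wE in r1 r2.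
have cR : continuous (fun x => Rf e t x i 0).
  rewrite (_ : (fun _ => _) = (fun x => Gfun e X t x i 0 - synth ks (dm e) t x i 0 -
    omE oms om2 e * synth ks (rot (add_astar (scale_modes (drop_sin0 c) e))) t x i 0)).
    apply: continuous_sub; first by apply: continuous_sub; [exact: cG|exact: continuous_synth].
    by apply: continuous_mul; [exact: continuous_cst|exact: continuous_synth].
  by apply/funext => x; rewrite RfE; move: (Gfun _ _ _ _) (synth _ _ _ _) (synth _ _ _ _) => u1 u2 u3; rewrite !mxE.
have pR : periodic (fun x => Rf e t x i 0) T2.
  move=> x; have GXp : Gfun e X t (x + T2) = Gfun e X t x.
    by rewrite /Gfun !with_astar_synth (@synth_periodic_phi ks (add_astar (s_modes X)) t x).
  by rewrite (RfX t (x + T2)) (RfX t x) GXp (@synth_periodic_phi ks (dm e) t x)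
    (@synth_periodic_phi ks (rot (add_astar (scale_modes (drop_sin0 c) e))) t x).
have bR x : `|Rf e t x i 0| <= `|C0| * `|e| ^+ 3 by exact: HR.
have bP x : `|Rf e t x i 0 - Rf e t (x + pi) i 0| <= C1 * `|e| ^+ 4 by exact: hpar'.
split=> [|k0].
  rewrite -[cos_mode (phi_modes _) k t - _ - _]r1 phi_cosE; case: (boolP (odd k)) => ko.
    exact: odd_cmode_bound.
  exact: cmode_bound.
rewrite -[sin_mode (phi_modes _) k t - _ + _](r2 k0) phi_sinE; case: (boolP (odd k)) => ko.
  exact: odd_smode_bound.
exact: smode_bound.
Qed.

Theorem branch_theorem : exists (eps0 d : R) (lamF omF : R -> R) (cF : R -> modes R n),
    let aF k eps := cos_mode (cF eps) k in
    let bF k eps := sin_mode (cF eps) k in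
    [/\ 0 < eps0, 0 < d,
        forall eps, `|eps| < eps0 ->
          [/\ truncated_solution G eps (lamF eps) (omF eps) (zF cF eps),
              near_bifurcation d lams oms (lamF eps) (omF eps) (zF cF eps),
              forall lam om z,
                truncated_solution G eps lam om z ->
                near_bifurcation d lams oms lam om z ->
                [/\ lam = lamF eps, om = omF eps
                  & forall theta phi, z theta phi = zF cF eps theta phi],
              ip (aF 1%N eps) (fun=> e1) + ip (bF 1%N eps) (fun=> e2) = 0
            & ip (aF 1%N eps) (fun=> e2) - ip (bF 1%N eps) (fun=> e1) = 0]
      & forall (lam2 om2 : R) (cE : modes R n),
          asymptotic_solution G lams oms lam2 om2 cE ->
          [/\ (fun eps => lamE lams lam2 eps - lamF eps)
                =O_ (0 : R) (fun eps : R => eps ^+ 4),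
              (fun eps => omE oms om2 eps - omF eps)
                =O_ (0 : R) (fun eps : R => eps ^+ 4),
              (forall k, k \in [:: 0; 2]%N ->
                 unif_bigO (fun eps theta =>
                   aE cE k eps theta - aF k eps theta) 3) /\
              unif_bigO (fun eps theta => bE cE 2 eps theta - bF 2%N eps theta) 3
            & forall k, k \in [:: 1; 3]%N ->
                unif_bigO (fun eps theta =>
                  aE cE k eps theta - aF k eps theta) 4 /\
                unif_bigO (fun eps theta =>
                  bE cE k eps theta - bF k eps theta) 4]].
Proof.
have [da da0 Ha] := branch_point; have [db db0 Hb] := step_unique; have [dc dc0 cos_H] := step_error.
pose dU := Num.min d (Num.min da (Num.min db dc)).
have dU0 : 0 < dU by rewrite !lt_min d_gt0 da0 db0 dc0.
have dUd : dU <= d by rewrite ge_min lexx.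
have dUa : dU <= da by rewrite /dU !ge_min lexx !orbT.
have dUb : dU <= db by rewrite /dU !ge_min lexx !orbT.
have dUc : dU <= dc by rewrite /dU !ge_min lexx !orbT.
(* A solution within [dd] of [astar] has modes of size at most 2 dd, so it lies in the ball of
   radius [dU] on which uniqueness holds. *)
pose dd := dU / 2; have dd0 : 0 < dd by rewrite divr_gt0.
have n0 : 0 < (n%:R : R) by rewrite ltr0n.
(* A state in the ball of radius [dl] deviates from [astar] by at most 8 dl in each entry, hence by
   at most n 8 dl = dd / 2 in the Euclidean norm: the constructed branch lies inside the region of
   uniqueness. *)
pose dl := dd / (16 * n%:R); have dl0 : 0 < dl by rewrite divr_gt0// mulr_gt0.
have n1 : 1 <= (n%:R : R) by rewrite ler1n.
have dln : n%:R * (8 * dl) = dd / 2 by rewrite /dl; field; rewrite gt_eqF.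
have dldd : dl < dd.
  have : 1 * (8 * dl) <= n%:R * (8 * dl) by apply: ler_wpM2r => //; rewrite mulr_ge0// ltW.
  by rewrite dln; move: dd0 dl0; lra.
have dlU : dl <= dU by apply: le_trans (ltW dldd) _; rewrite /dd; move: dU0; lra.
have [e0 e00 He] := Ha dl dl0 (le_trans dlU dUa) (le_trans dlU dUd).
pose eps0 := Num.min e0 (Num.min db 1).
have eps00 : 0 < eps0 by rewrite !lt_min e00 db0 ltr01.
have /choice[Xf HX] : forall e, exists X : state, `|e| < eps0 -> exists Y,
    [/\ ball_of dl X, ball_of dl Y, step e 0 0 X Y & forall j, coord_ok j -> coord_val Y j = coord_val X j].
  move=> e; case: (ltP `|e| eps0) => [he|_]; last by exists base_state.
  have [|X [Y HXY]] := He e; first by apply: le_trans (ltW he) _; rewrite ge_min lexx.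
  by exists X => _; exists Y.
have grow X : ball_of dl X -> ball_of dU X.
  by move=> [h1 h2]; split=> //; exact: (wdist_mono dlU dlU h2).
exists eps0, dd, (fun e => s_lam (Xf e)), (fun e => s_om (Xf e)), (fun e => s_modes (Xf e)) => aF bF.
split=> // [e he|lam2 om2 cE as_].
  have [Y [BX BY XY YX]] := HX e he.
  have le1 : `|e| <= 1 by apply: le_trans (ltW he) _; rewrite /eps0 !ge_min lexx !orbT.
  have leb : `|e| <= db by apply: le_trans (ltW he) _; rewrite /eps0 !ge_min lexx !orbT.
  have zFE : zF (fun e => s_modes (Xf e)) e = with_astar (s_modes (Xf e)) by [].
  have [[rX pX [z1 z2]] _] := BX; have [ca cb] := rX 1%N isT.
  have dot1 (u : vec) : dotv u e1 = u j1 0.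
    rewrite /dotv (bigD1 j1)//= e1E eqxx mulr1 big1 ?addr0// => i hi.
    by rewrite e1E (negPf hi) mulr0.
  have dot2 (u : vec) : dotv u e2 = u j2 0.
    rewrite /dotv (bigD1 j2)//= e2E eqxx mulr1 big1 ?addr0// => i hi.
    by rewrite e2E (negPf hi) mulr0.
  have ipE (f : R -> vec) : ip f (fun=> e1) = T2^-1 * I2 (fun t => f t j1 0) /\
      ip f (fun=> e2) = T2^-1 * I2 (fun t => f t j2 0).
    by rewrite /ip; split; congr (_ * I2 _); apply/funext => t; [exact: dot1|exact: dot2].
  split.
  - rewrite zFE; apply: (@fixed_step_truncated e (Xf e) Y le1) => //; exact: ball_mono (le_trans dlU dUd) BX.
  - rewrite zFE; apply: (ball_near (dl := dl)) => //; rewrite dln; move: dd0; lra.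
  - have hdd : 2 * dd <= dU by rewrite /dd mulrC divfK.
    move=> lam om z tz nz_; have [c' [Bc sc zc]] := truncated_state le1 dUd (ltW dd0) hdd tz nz_.
    have eqc := Hb dU e _ _ _ dUb dUd leb Bc (grow _ BX) (grow _ BY) sc XY YX.
    split; [exact: (eqc CLam I)|exact: (eqc COm I)|].
    move=> t x; rewrite zc /zF /with_astar; congr (_ + _); apply: synth_eq => k; rewrite mem_ks => k4.
      by apply/colP => i; exact: (eqc (CCos k t i) k4).
    by move=> _; apply/colP => i; exact: (eqc (CSin k t i) k4).
  - have [-> _] := ipE (aF 1%N e); have [_ ->] := ipE (bF 1%N e).
    by rewrite -mulrDr -int2D ?[I2 _]z1 ?mulr0//.
  - have [_ ->] := ipE (aF 1%N e); have [-> _] := ipE (bF 1%N e).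
    by rewrite -mulrBr -int2B ?[I2 _]z2 ?mulr0//.
clearbody eps0.
have [b b0 [e1 e10 hst]] := asymptotic_step dU0 dUd as_.
have [A A0 [e2' e20 herr]] := cos_H b b0.
pose em := Num.min (Num.min eps0 e1) e2'.
have em0 : 0 < em by rewrite !lt_min eps00 e10 e20.
have err e : `|e| < em -> wdist (asymptotic_state lam2 om2 cE e) (Xf e) (A * `|e| ^+ 4) (A * `|e| ^+ 3).
  rewrite !lt_min => /andP[/andP[he he1] he2].
  have [Y [BX BY XY YX]] := HX e he; have [BE sE] := hst e he1.
  exact: (herr dU e _ _ Y dUc dUd (ltW he2) BE (grow _ BX) (grow _ BY) sE XY YX).
have bigO (f : R -> R) : (forall e, `|e| < em -> `|f e| <= A * `|e| ^+ 4) ->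
    f =O_ (0 : R) (fun eps : R => eps ^+ 4).
  move=> hf; apply/eqO_exP; exists (A + 1); first by rewrite ltr_wpDl.
  apply: (near0_norm em0) => e he; apply: le_trans (hf e he) _.
  by rewrite normrX; apply: ler_wpM2r; [exact: exprn_ge0|rewrite lerDl].
have ubig (f : R -> R -> vec) p : (forall e t i, `|e| < em -> `|f e t i 0| <= A * `|e| ^+ p) -> unif_bigO f p.
  move=> hf; exists (n%:R * A); apply: (near0_norm em0) => e he t; rewrite -mulrA.
  by apply: enorm_le_entries => i; exact: hf.
have sub (u w : vec) i : (u - w) i 0 = u i 0 - w i 0 by rewrite !mxE.
have hcos k e t i : (k < 4)%N -> `|e| < em ->
    `|(aE cE k e t - aF k e t) i 0| <= (if odd k then A * `|e| ^+ 4 else A * `|e| ^+ 3).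
  by move=> k4 he; rewrite sub; exact: (err e he (CCos k t i) k4).
have hsin k e t i : (k < 4)%N -> (0 < k)%N -> `|e| < em ->
    `|(bE cE k e t - bF k e t) i 0| <= (if odd k then A * `|e| ^+ 4 else A * `|e| ^+ 3).
  by case: k => // k k4 _ he; rewrite sub; exact: (err e he (CSin k.+1 t i) k4).
split.
- by apply: bigO => e he; exact: (err e he CLam I).
- by apply: bigO => e he; exact: (err e he COm I).
- split; last by apply: ubig => e t i he; exact: (hsin 2%N e t i isT isT he).
  move=> k; rewrite !inE => /orP[/eqP ->|/eqP ->]; apply: ubig => e t i he.
    exact: (hcos 0%N e t i isT he).
  exact: (hcos 2%N e t i isT he).
- move=> k; rewrite !inE => /orP[/eqP ->|/eqP ->]; split; apply: ubig => e t i he.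
  + exact: (hcos 1%N e t i isT he).
  + exact: (hsin 1%N e t i isT isT he).
  + exact: (hcos 3%N e t i isT he).
  + exact: (hsin 3%N e t i isT isT he).
Qed.

End Radius.
End Iteration.

(** * Estimates for the forced system *)

Section NonlinearTerm.
Context {R : realType} {m : nat}.
Local Notation n := (2 + m)%N.
Local Notation vec := 'cV[R]_n.
Local Notation mat := 'M[R]_n.
Local Notation T2 := ((pi : R) *+ 2).
Variables (F : vec -> R -> R -> vec) (lams r : R) (v : R -> R -> vec) (P : R -> R -> mat).
Variables (alphaR alphaI : R -> R) (Et : R -> 'M[R]_m).
Local Notation E := (fun lam => exponent_mx (alphaR lam) (alphaI lam) (Et lam)).
Local Notation AR := [set x : R * R | `|x.2 - lams| < r].
Local Notation A1 := [set lam : R | `|lam - lams| < r].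
Hypothesis r_gt0 : 0 < r.
Hypothesis F_forcing : forcing F.
Hypothesis v_smooth : smooth_on AR (fun x => v x.1 x.2).
Hypothesis P_smooth : smooth_on AR (fun x => P x.1 x.2).
Hypothesis alphaR_smooth : smooth_on A1 alphaR.
Hypothesis alphaI_smooth : smooth_on A1 alphaI.
Hypothesis Et_smooth : smooth_on A1 Et.
Hypothesis floquet : forall lam, `|lam - lams| < r ->
  periodic_orbit F lam (v ^~ lam) /\ floquet_form F lam (v ^~ lam) (P ^~ lam) (E lam).
Local Notation G := (G_fun F v P E).
Local Notation g := (gfun F v P).

Let P_unit th lam : `|lam - lams| < r -> P th lam \in unitmx.
Proof. by move=> /floquet[_ []]. Qed.

(* G z = E z + e H z, where H extends continuously to e = 0. *)
Definition Hfun (z : vec) (lam th e : R) : vec := e ^- 2 *: g z lam th e.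

Lemma Pinv_invmx th lam : `|lam - lams| < r -> Pinv P th lam = invmx (P th lam).
Proof. by move=> /(P_unit th) h; rewrite /invmx h. Qed.

(** The Floquet identity replaces the derivative of [P] by J P - P E: the term J P z completes the
    remainder and P E z becomes E z. Multiplication by [e] includes the case e = 0. *)
Lemma G_gfun z lam th e : `|lam - lams| < r ->
  e *: G z lam th e = e *: (E lam *m z) + g z lam th e.
Proof.
move=> hlam; rewrite /G_fun; have [->|e0] := eqVneq e 0; first by rewrite gfun0 !scale0r addr0.
rewrite scalerA mulfV// scale1r /gfun Pinv_invmx//.
have [_ [_ _ _ /(_ th) fl]] := floquet hlam.
have -> : derive1 (P ^~ lam) th = jac F (v th lam) th lam *m P th lam - P th lam *m E lam.
  by rewrite -fl opprB addrC subrK.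
have -> : jacobian F (v th lam) th lam *m (P th lam *m z) = jac F (v th lam) th lam *m P th lam *m z.
  by rewrite mulmxA.
move: (jac F (v th lam) th lam *m P th lam) => W; set a := F _ _ _; set b := F _ _ _.
have -> : a - b - e *: ((W - P th lam *m E lam) *m z) =
    P th lam *m (e *: (E lam *m z)) + (a - b - e *: (W *m z)).
  rewrite mulmxBl scalerBr opprB -scalemxAr mulmxA.
  by rewrite [LHS]addrA [LHS]addrAC [RHS]addrC.
by rewrite mulmxDr mulmxA mulVmx ?mul1mx// P_unit.
Qed.

Lemma G_H z lam th e : `|lam - lams| < r ->
  G z lam th e = E lam *m z + e *: Hfun z lam th e.
Proof.
move=> hlam; have [->|e0] := eqVneq e 0; first by rewrite /G_fun eqxx scale0r addr0.
apply: (scalerI e0); rewrite G_gfun// scalerDr /Hfun !scalerA.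
by rewrite (_ : e * e / e ^+ 2 = 1) ?scale1r//; field.
Qed.

Lemma gfun_periodic z lam e : `|lam - lams| < r -> periodic (fun th => g z lam th e) T2.
Proof.
move=> hlam th; have [[pv _] [pP _ _ _]] := floquet hlam.
have [_ pF] := F_forcing.
have eF u : F u (th + T2) lam = F u th lam by exact: pF.
have ev : v (th + T2) lam = v th lam by exact: pv.
have eP : P (th + T2) lam = P th lam by exact: pP.
have eJ u : jacobian F u (th + T2) lam = jacobian F u th lam.
  by rewrite /jacobian (_ : (fun u => F u (th + T2) lam) = (fun u => F u th lam))//; apply/funext.
by rewrite /gfun /Pinv ev eP !eF eJ.
Qed.

Lemma Hfun_periodic z lam e : `|lam - lams| < r -> periodic (fun th => Hfun z lam th e) T2.
Proof. by move=> hlam th; rewrite /Hfun gfun_periodic. Qed.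

(** At e = 0 the inverse of 0 is 0, so the left-hand side vanishes and the bound holds there as
    well. *)
Lemma inv_sq_bound (e x C : R) : 0 <= C -> `|x| <= C * `|e| ^+ 2 -> `|e ^- 2 * x| <= C.
Proof.
move=> C0; have [->|e0] := eqVneq e 0; first by rewrite expr0n invr0 mul0r normr0.
by rewrite normrM normfV normrX ler_pdivrMl ?exprn_gt0 ?normr_gt0 1?mulrC.
Qed.

Lemma Hfun_lipschitz_local Bz Bth : exists2 C, 0 <= C &
  forall (e : R) (z : vec) (lam th : R), `|e| <= 1 -> (forall i, `|z i 0| <= Bz) ->
    `|lam - lams| <= r / 2 -> `|th| <= Bth ->
    (forall i, `|Hfun z lam th e i 0| <= C) /\
    (forall (z' : vec) (lam' th' w : R), (forall i, `|z' i 0| <= Bz) -> `|lam' - lams| <= r / 2 ->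
      `|th'| <= Bth -> (forall i, `|z' i 0 - z i 0| <= w) -> `|lam' - lam| <= w ->
      `|th' - th| <= w ->
      forall i, `|Hfun z' lam' th' e i 0 - Hfun z lam th e i 0| <= C * w).
Proof.
have [C C0 HC] := gfun_estimates r_gt0 F_forcing.1 v_smooth P_smooth P_unit Bz Bth.
exists C => // e z lam th he hz hlam hth; have [h1 h2] := HC e z lam th he hz hlam hth.
split=> [i|z' lam' th' w hz' hlam' hth' dz dlam dth i].
  by rewrite mxE; apply: inv_sq_bound.
have w0 : 0 <= w by apply: le_trans dlam.
rewrite /Hfun; have := h2 z' lam' th' w hz' hlam' hth' dz dlam dth i.
move: (g _ _ _ _) (g _ _ _ _) => y y' hy; rewrite !mxE -mulrBr; apply: inv_sq_bound => //.
exact: mulr_ge0.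
Qed.

(** Theta is reduced to one period, on which the local constant applies. *)
Lemma Hfun_lipschitz Bz : exists2 C, 0 <= C &
  forall (e : R) (z : vec) (lam th : R), `|e| <= 1 -> (forall i, `|z i 0| <= Bz) ->
    `|lam - lams| <= r / 2 ->
    (forall i, `|Hfun z lam th e i 0| <= C) /\
    (forall (z' : vec) (lam' w : R), (forall i, `|z' i 0| <= Bz) -> `|lam' - lams| <= r / 2 ->
      (forall i, `|z' i 0 - z i 0| <= w) -> `|lam' - lam| <= w ->
      forall i, `|Hfun z' lam' th e i 0 - Hfun z lam th e i 0| <= C * w).
Proof.
have [C C0 HC] := Hfun_lipschitz_local Bz T2.
have small x : `|x| <= r / 2 -> `|x| < r by move=> h; apply: le_lt_trans h _; move: r_gt0; lra.
have red th : exists2 y : R, `|y| <= T2 & forall z lam e, `|lam - lams| <= r / 2 ->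
    Hfun z lam th e = Hfun z lam y e.
  have [k [y [/andP[y0 yT] yE]]] := periodic_repr th.
  exists y; first by rewrite ger0_norm.
  move=> z lam e /small hlam; have pH := periodicn (Hfun_periodic z e hlam).
  by case: yE => ->; rewrite pH.
exists C => // e z lam th he hz hlam; have [y yT yE] := red th.
have [h1 h2] := HC e z lam y he hz hlam yT; split=> [i|z' lam' w hz' hlam' dz dlam i].
  by rewrite yE.
rewrite !yE//; apply: (h2 z' lam' y w) => //.
by rewrite subrr normr0; apply: le_trans dlam.
Qed.

Lemma fam_exponent T (D : R -> R -> T -> Prop) k (lam : R -> R -> T -> R) :
  famC D k lam -> (forall e s t, D e s t -> `|lam e s t - lams| <= r / 2) ->
  forall i j, famC D k (fun e s t => E (lam e s t) i j).
Proof.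
move=> flam Dlam.
have oA : open A1.
  rewrite openE => x /= xr; apply/nbhs_ballP; exists (r - `|x - lams|) => /=; first by rewrite subr_gt0.
  move=> y; rewrite /ball /= distrC => h.
  by have := ler_normD (y - x) (x - lams); rewrite addrA subrK; lra.
have fam f : smooth_on A1 f -> famC D k (fun e s t => f (lam e s t)).
  move=> sf; have Ex (x : R) : \sum_(i < 1) x *: (1 : R^o) = x by rewrite big_ord1 /GRing.scale /= mulr1.
  have := @famC_comp_box R T D _ 1 (fun=> (1 : R^o)) (fun=> lam) A1 f (fun=> lams) (fun=> r / 2) k oA sf.
  have -> : (fun e s t => f (\sum_(i < 1) lam e s t *: (1 : R^o))) = (fun e s t => f (lam e s t)).
    by do 3!apply/funext => ?; rewrite Ex.
  apply=> // [y Hy|e s t i]; last exact: Dlam.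
  rewrite big_ord1 /GRing.scale /= mulr1; move: (Hy ord0) r_gt0; lra.
have fR := fam _ alphaR_smooth; have fI := fam _ alphaI_smooth.
move=> i j; have [i'|i'] : (exists a : 'I_2, i = lshift m a) + (exists a : 'I_m, i = rshift 2 a).
- by rewrite -(splitK i); case: fintype.split => a /=; [left|right]; exists a.
- have [j'|j'] : (exists a : 'I_2, j = lshift m a) + (exists a : 'I_m, j = rshift 2 a).
  + by rewrite -(splitK j); case: fintype.split => a /=; [left|right]; exists a.
  + move: i' j' => [a ->] [b ->]; apply: famC_ext (fun e s t => esym (block_mxEul _ _ _ _ a b)) _.
    apply: famC_ext (fun e s t => esym (mxE _ _ a b)) _.
    by case: (a == b) => //; case: (a == 0) => //; exact: famC_opp.
  move: i' j' => [a ->] [b ->]; apply: famC_ext (fun e s t => esym (block_mxEur _ _ _ _ a b)) _.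
  by apply: famC_ext (famC_cst _ _ 0) => *; rewrite mxE.
have [j'|j'] : (exists a : 'I_2, j = lshift m a) + (exists a : 'I_m, j = rshift 2 a).
+ by rewrite -(splitK j); case: fintype.split => a /=; [left|right]; exists a.
+ move: i' j' => [a ->] [b ->]; apply: famC_ext (fun e s t => esym (block_mxEdl _ _ _ _ a b)) _.
  by apply: famC_ext (famC_cst _ _ 0) => *; rewrite mxE.
move: i' j' => [a ->] [b ->]; apply: famC_ext (fun e s t => esym (block_mxEdr _ _ _ _ a b)) _.
exact: (fam _ (smooth_on_entry a b oA Et_smooth)).
Qed.

Let DE := fun (e s : R) (_ : unit) => `|s| <= r / 2.

(** The variable lam - lams is the second variable of a family constant in the first, so two bounded
    derivatives give a derivative that is bounded and Lipschitz. *)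
Lemma exponent_taylor : exists2 L, 0 <= L & forall i j, exists dE : R -> R,
  (forall lam, `|lam - lams| <= r / 2 -> der (fun l => E l i j) lam (dE lam)) /\
  (forall lam, `|lam - lams| <= r / 2 -> `|dE lam| <= L /\ `|dE lam - dE lams| <= L * `|lam - lams|).
Proof.
pose Q (ij : 'I_n * 'I_n) (L : R) := exists dE : R -> R,
  (forall lam, `|lam - lams| <= r / 2 -> der (fun l => E l ij.1 ij.2) lam (dE lam)) /\
  (forall lam, `|lam - lams| <= r / 2 -> `|dE lam| <= L /\ `|dE lam - dE lams| <= L * `|lam - lams|).
have [||L L0 HL] := @uniform_constant _ _ Q.
- move=> ij L L' LL' [dE [h1 h2]]; exists dE; split=> // lam hlam; have [h3 h4] := h2 lam hlam.
  by split; [exact: le_trans h3 LL'|apply: le_trans h4 _; exact: ler_wpM2r].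
- move=> [i j].
  have fs : famC DE 2 (fun _ s _ => lams + s).
    by apply: famC_add; [exact: famC_cst|exact: (@famC_s _ _ _ _ (r / 2))].
  have [|_ [fe [fs' [_ [[B1 HB1] [g1 [g2 [_ [[B2 HB2] _] K]]]] H]]]] := @fam_exponent _ _ 2 _ fs _ i j.
    by move=> e s t; rewrite /DE addrC addKr.
  pose dE lam := fs' 0 (lam - lams) tt.
  have d1 (lam : R) : `|lam - lams| <= r / 2 -> der (fun l => E l i j) lam (dE lam).
    move=> hl; have [_ h] := H 0 (lam - lams) tt hl.
    have := der_shift (c := - lams) h.
    by apply: der_ext => s; rewrite addrC subrK.
  have d2 (lam : R) : `|lam - lams| <= r / 2 -> der dE lam (g2 0 (lam - lams) tt).
    move=> hl; have [_ h] := K 0 (lam - lams) tt hl.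
    exact: (der_shift (c := - lams) h).
  exists (`|B1| + `|B2|), dE; split=> // lam hl; split.
    by apply: le_trans (HB1 0 _ tt hl) _; apply: le_trans (ler_norm _) _; rewrite lerDl.
  apply: (@mvt_bound_dist _ dE (fun x => g2 0 (x - lams) tt)) => x hx.
    by apply: d2; exact: le_trans hx hl.
  by apply: le_trans (HB2 0 _ tt (le_trans hx hl)) _; apply: le_trans (ler_norm _) _; rewrite lerDr.
by exists L => // i j; exact: (HL (i, j)).
Qed.

(** The source of the symmetry: the remainder depends on [z] and [e] only through their product. *)
Lemma gfun_opp z lam th e : g (- z) lam th e = g z lam th (- e).
Proof. by rewrite /gfun !mulmxN !scalerN !scaleNr. Qed.

Lemma astar_pi (x : R) : astar (m := m) (x + pi) = - astar x.
Proof. by rewrite /astar cosDpi sinDpi !scaleNr opprD. Qed.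

Lemma dastar_pi (x : R) : dastar (m := m) (x + pi) = - dastar x.
Proof. by rewrite /dastar cosDpi sinDpi !scaleNr opprD. Qed.

(** Here [f] is eps times the residual without its theta-derivatives. Order five is needed because a
    factor eps is divided out later to reach eps^4. The parameter of the family is the pair (theta,
    phi), so the constant is uniform in both. *)
Lemma taylor_odd_gain (oms lam2 om2 M e1 : R) (z2 z3 z2p z3p : R -> R -> vec) i : 0 < e1 -> e1 <= 1 ->
  e1 * `|lam2| <= r / 2 ->
  (forall t x j, [/\ `|z2 t x j 0| <= M, `|z3 t x j 0| <= M, `|z2p t x j 0| <= M & `|z3p t x j 0| <= M]) ->
  let zz e t x := astar x + e *: z2 t x + e ^+ 2 *: z3 t x in
  let zp e t x := dastar x + e *: z2p t x + e ^+ 2 *: z3p t x in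
  let f e t x := g (zz e t x) (lamE lams lam2 e) t e i 0 +
    e * (E (lamE lams lam2 e) *m zz e t x) i 0 - e * (omE oms om2 e * zp e t x i 0) in
  exists2 C, 0 <= C & forall t x, `|t| <= T2 -> exists c : nat -> R, forall e, `|e| <= e1 ->
    `|f e t x - \sum_(j < 5) c j * e ^+ j| <= C * `|e| ^+ 5.
Proof.
move=> e10 e1le hlam bz zz zp f.
pose D (e s : R) (tx : R * R) := `|e| <= e1 /\ `|tx.1| <= T2.
have he k : famC D k (fun e _ _ => e) by apply: (@famC_eps _ _ _ _ e1) => e s tx [].
have par k (w : R -> R -> vec) B j : (forall t x j, `|w t x j 0| <= B) -> famC D k (fun _ _ tx => w tx.1 tx.2 j 0).
  by move=> hw; apply: (@famC_param _ _ _ _ _ B) => e s tx _; exact: hw.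
have comb k (u : R -> vec) (w2 w3 : R -> R -> vec) B j : (forall x j, `|u x j 0| <= B) ->
    (forall t x j, `|w2 t x j 0| <= M) -> (forall t x j, `|w3 t x j 0| <= M) ->
    famC D k (fun e _ tx => (u tx.2 + e *: w2 tx.1 tx.2 + e ^+ 2 *: w3 tx.1 tx.2) j 0).
  move=> hu h2 h3.
  apply: famC_ext (famC_add (famC_add (par k (fun _ x => u x) B j (fun _ => hu)) (famC_mul (he k) (par k w2 M j h2)))
    (famC_mul (famC_mul (he k) (he k)) (par k w3 M j h3))) => e s tx.
  by move: (w2 _ _) (w3 _ _) (u _) => a b c; rewrite !mxE expr2.
have ab (x : R) (j : 'I_n) : `|astar x j 0| <= 2 := astar_bound x j.
have db (x : R) (j : 'I_n) : `|dastar x j 0| <= 2 := dastar_bound x j.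
have M0 : 0 <= M by have [h _ _ _] := bz 0 0 j1; apply: le_trans h.
have fz k j : famC D k (fun e _ tx => zz e tx.1 tx.2 j 0).
  by apply: comb ab _ _ => t x l; have [] := bz t x l.
have fp k j : famC D k (fun e _ tx => zp e tx.1 tx.2 j 0).
  by apply: comb db _ _ => t x l; have [] := bz t x l.
have flam k : famC D k (fun e _ _ => lamE lams lam2 e).
  apply: famC_ext (famC_add (famC_cst D k lams) (famC_mul (famC_mul (he k) (he k)) (famC_cst D k lam2))) => e s tx.
  by rewrite /lamE expr2.
have fom k : famC D k (fun e _ _ => omE oms om2 e).
  apply: famC_ext (famC_add (famC_cst D k oms) (famC_mul (famC_mul (he k) (he k)) (famC_cst D k om2))) => e s tx.
  by rewrite /omE expr2.
have Dlam e s tx : D e s tx -> `|lamE lams lam2 e - lams| <= r / 2.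
  move=> [h _]; rewrite /lamE addrC addKr normrM normrX; apply: le_trans hlam; apply: ler_wpM2r => //.
  rewrite expr2 -[leRHS]mul1r; apply: ler_pM => //; exact: le_trans h e1le.
have [Bz HBz] : exists Bz, forall e s tx j, D e s tx -> `|zz e tx.1 tx.2 j 0| <= Bz.
  exists (2 + M + M) => e s tx j [h _]; have le1 := le_trans h e1le.
  have [h2 h3 _ _] := bz tx.1 tx.2 j; have ha := ab tx.2 j.
  rewrite /zz; move: (z2 _ _) (z3 _ _) (astar _) h2 h3 ha => a b c h2 h3 ha; rewrite !mxE.
  apply: le_trans (ler_normD _ _) _; apply: lerD; last first.
    rewrite normrM normrX expr2 -[leRHS]mul1r; apply: ler_pM => //; rewrite ?mulr_ge0//.
    by rewrite -[leRHS]mul1r; apply: ler_pM.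
  apply: le_trans (ler_normD _ _) _; apply: lerD => //.
  by rewrite normrM -[leRHS]mul1r; apply: ler_pM.
have ffam : famC D 5 (fun e _ tx => f e tx.1 tx.2).
  have h1 : famC D 5 (fun e _ tx => g (zz e tx.1 tx.2) (lamE lams lam2 e) tx.1 e i 0).
    apply: (fam_gfun r_gt0 F_forcing.1 v_smooth P_smooth P_unit (Bz := Bz) (Bth := T2)
      (z := fun e _ tx => zz e tx.1 tx.2) (lam := fun e _ _ => lamE lams lam2 e) (th := fun _ _ tx => tx.1)).
    - by move=> j; exact: fz.
    - exact: flam.
    - by apply: (@famC_param _ _ _ _ _ T2) => e s tx [].
    - move=> e s tx Dt; have [h h'] := Dt; split=> //; [by move=> j; exact: HBz Dt|exact: Dlam Dt|].
      exact: le_trans h e1le.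
  have hE : forall a b, famC D 5 (fun e _ tx => (E (lamE lams lam2 e) *m zz e tx.1 tx.2) a b).
    apply: famC_mulmx => a b; first exact: (fam_exponent (flam 5) Dlam).
    by apply: famC_ext (fz 5 a) => e s tx; rewrite ord1.
  exact: (famC_sub (famC_add h1 (famC_mul (he 5) (hE i 0))) (famC_mul (he 5) (famC_mul (fom 5) (fp 5 i)))).
have [C C0 HC] := famC_taylor (D := D) (fun e x s tx Dt xe => conj (le_trans xe Dt.1) Dt.2) ffam.
exists C => // t x ht; have [c cos_H] := HC 0 (t, x); exists c => e h.
exact: (cos_H e (conj h ht)).
Qed.

(* With Q e = e R(e, t, x), the symmetry gives Q (- e) = e R(e, t, x + pi), so that
   e times the left-hand side is Q e - Q (- e) and [odd_gain] applies.  No bound on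
   the theta-derivatives z2t, z3t is available; they only enter the polynomial q. *)
Lemma parity_gain (oms lam2 om2 M C0 e0 : R) (z2 z3 z2p z3p z2t z3t : R -> R -> vec) : 0 < e0 -> 0 <= C0 ->
  (forall t x j, [/\ `|z2 t x j 0| <= M, `|z3 t x j 0| <= M, `|z2p t x j 0| <= M & `|z3p t x j 0| <= M]) ->
  (forall t x, [/\ z2 t (x + pi) = z2 t x, z2p t (x + pi) = z2p t x & z2t t (x + pi) = z2t t x]) ->
  (forall t x, [/\ z3 t (x + pi) = - z3 t x, z3p t (x + pi) = - z3p t x & z3t t (x + pi) = - z3t t x]) ->
  let Rf e t x := G (astar x + e *: z2 t x + e ^+ 2 *: z3 t x) (lamE lams lam2 e) t e
    - (e *: z2t t x + e ^+ 2 *: z3t t x)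
    - omE oms om2 e *: (dastar x + e *: z2p t x + e ^+ 2 *: z3p t x) in
  (forall e t x i, `|e| < e0 -> `|Rf e t x i 0| <= C0 * `|e| ^+ 3) ->
  exists2 C, 0 <= C & exists2 e1, 0 < e1 & forall e t x i, `|e| < e1 -> `|t| <= T2 ->
    `|Rf e t x i 0 - Rf e t (x + pi) i 0| <= C * `|e| ^+ 4.
Proof.
move=> e00 C00 bz par2 par3 Rf HR.
pose e1 := Num.min (Num.min 1 e0) (r / (2 * (`|lam2| + 1))).
have l20 : 0 < `|lam2| + 1 by rewrite ltr_wpDl.
have e10 : 0 < e1 by rewrite !lt_min ltr01 e00 divr_gt0// mulr_gt0.
have e1le : e1 <= 1 by rewrite /e1 !ge_min lexx.
have e1e0 : e1 <= e0 by rewrite /e1 !ge_min lexx orbT.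
have hlam : e1 * `|lam2| <= r / 2.
  apply: le_trans (_ : e1 * (`|lam2| + 1) <= _); first by apply: ler_wpM2l; [exact: ltW|rewrite lerDl].
  rewrite -ler_pdivlMr// -mulrA -invfM; rewrite /e1 ge_min; apply/orP; right.
  by [].
pose zz e t x := astar x + e *: z2 t x + e ^+ 2 *: z3 t x.
pose zp e t x := dastar x + e *: z2p t x + e ^+ 2 *: z3p t x.
pose f i e t x := g (zz e t x) (lamE lams lam2 e) t e i 0 +
    e * (E (lamE lams lam2 e) *m zz e t x) i 0 - e * (omE oms om2 e * zp e t x i 0).
have [||C C1 HC] := @uniform_constant _ _ (fun (i : 'I_n) C => 0 <= C /\ forall t x, `|t| <= T2 ->
    exists c : nat -> R, forall e, `|e| <= e1 -> `|f i e t x - \sum_(j < 5) c j * e ^+ j| <= C * `|e| ^+ 5).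
- move=> i C C' CC' [C1 h]; split; first exact: le_trans CC'.
  move=> t x ht; have [c hc] := h t x ht; exists c => e he; apply: le_trans (hc e he) _.
  by apply: ler_wpM2r => //; exact: exprn_ge0.
- move=> i; have [C C1 h] := taylor_odd_gain oms om2 i e10 e1le hlam bz.
  by exists C.
exists (2 * C); first by rewrite mulr_ge0.
exists e1 => // e t x i he ht.
have lam_in e' : `|e'| < e1 -> `|lamE lams lam2 e' - lams| < r.
  move=> he'; rewrite /lamE addrC addKr normrM normrX.
  apply: le_lt_trans (_ : e1 * `|lam2| < _); last by apply: le_lt_trans hlam _; move: r_gt0; lra.
  apply: ler_wpM2r => //; apply: le_trans (ltW he'); rewrite expr2 -[leRHS]mul1r.
  by apply: ler_pM => //; exact: le_trans (ltW he') e1le.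
have Q e' : `|e'| < e1 -> e' * Rf e' t x i 0 = f i e' t x - (e' ^+ 2 * z2t t x i 0 + e' ^+ 3 * z3t t x i 0).
  move=> he'; have h := G_gfun (zz e' t x) t e' (lam_in e' he').
  rewrite /Rf /f -/(zz e' t x) -/(zp e' t x).
  have {}h : e' * G (zz e' t x) (lamE lams lam2 e') t e' i 0 =
      e' * (E (lamE lams lam2 e') *m zz e' t x) i 0 + g (zz e' t x) (lamE lams lam2 e') t e' i 0.
    have := congr1 (fun w : vec => w i 0) h; move: (G _ _ _ _) (g _ _ _ _) (_ *m _) => a b c.
    by rewrite !mxE.
  move: (G _ _ _ _) (g _ _ _ _) (_ *m _) (zp _ _ _) (z2t _ _) (z3t _ _) h => a b c w u1 u2 h.
  transitivity (e' * a i 0 - e' * (e' * u1 i 0 + e' ^+ 2 * u2 i 0) - e' * (omE oms om2 e' * w i 0)).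
    by rewrite !mxE; ring.
  by rewrite h; ring.
have Qpi : e * Rf e t (x + pi) i 0 = - e * Rf (- e) t x i 0.
  have hz : astar (x + pi) + e *: z2 t (x + pi) + e ^+ 2 *: z3 t (x + pi) = - zz (- e) t x.
    have [-> _ _] := par2 t x; have [-> _ _] := par3 t x; rewrite astar_pi /zz.
    by move: (z2 _ _) (z3 _ _) (astar _) => a b c; apply/colP => j; rewrite !mxE; ring.
  have hp : dastar (x + pi) + e *: z2p t (x + pi) + e ^+ 2 *: z3p t (x + pi) = - zp (- e) t x.
    have [_ -> _] := par2 t x; have [_ -> _] := par3 t x; rewrite dastar_pi /zp.
    by move: (z2p _ _) (z3p _ _) (dastar _) => a b c; apply/colP => j; rewrite !mxE; ring.
  have ht2 : e *: z2t t (x + pi) + e ^+ 2 *: z3t t (x + pi) = - (- e *: z2t t x + (- e) ^+ 2 *: z3t t x).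
    have [_ _ ->] := par2 t x; have [_ _ ->] := par3 t x.
    by move: (z2t _ _) (z3t _ _) => a b; apply/colP => j; rewrite !mxE; ring.
  have lamN : lamE lams lam2 (- e) = lamE lams lam2 e by rewrite /lamE sqrrN.
  have omN : omE oms om2 (- e) = omE oms om2 e by rewrite /omE sqrrN.
  rewrite /Rf hz hp ht2 -/(zz (- e) t x) -/(zp (- e) t x) lamN omN.
  have h1 := G_gfun (- zz (- e) t x) t e (lam_in e he).
  have he' : `|- e| < e1 by rewrite normrN.
  have h2 := G_gfun (zz (- e) t x) t (- e) (lam_in e he).
  rewrite gfun_opp mulmxN in h1.
  have := congr1 (fun w : vec => w i 0) h1; have := congr1 (fun w : vec => w i 0) h2.
  move: (G (- _) _ _ _) (G _ _ _ _) (g _ _ _ _) (_ *m _) (zp _ _ _) (z2t _ _) (z3t _ _) => a b c w u1 u2 u3.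
  move=> k2 k1.
  have {}k1 : e * a i 0 = - (e * w i 0) + c i 0 by move: k1; rewrite !mxE mulrN.
  have {}k2 : - e * b i 0 = - e * w i 0 + c i 0 by move: k2; rewrite !mxE.
  transitivity (e * a i 0 + e * (- e * u2 i 0 + (- e) ^+ 2 * u3 i 0) + e * (omE oms om2 e * u1 i 0)).
    by rewrite !mxE; ring.
  rewrite k1; transitivity (- e * b i 0 + e * (- e * u2 i 0 + (- e) ^+ 2 * u3 i 0) + e * (omE oms om2 e * u1 i 0)).
    by rewrite k2 -mulNr.
  by rewrite !mxE; ring.
(* The remaining argument divides by |e|; at e = 0 the residual vanishes by its own bound. *)
have [->|en0] := eqVneq e 0.
  have h0 x' : Rf 0 t x' i 0 = 0.
    by apply/eqP; rewrite -normr_le0; have := HR 0 t x' i; rewrite normr0 expr0n mulr0; apply.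
  by rewrite !h0 subrr normr0 expr0n mulr0.
have [C2 h] := HC i; have [c hc] := h t x ht.
(* In the odd part in e the term e^2 z2t cancels and the term e^3 z3t is doubled. *)
pose q j : R := if (j == 3)%N then 2 * z3t t x i 0 else 0.
have qE e' : \sum_(j < 4) q j * e' ^+ j = 2 * (e' ^+ 3 * z3t t x i 0).
  by rewrite !big_ord_recl big_ord0 /q /=; ring.
have key := @odd_gain _ (fun e => f i e t x) c q C (2 * C0) e1 e10 e1le C1 (fun e' he' => hc e' (ltW he')) _ e he.
rewrite -(ler_pM2l (x := `|e|)) ?normr_gt0// -normrM mulrBr Qpi.
have he' : `|- e| < e1 by rewrite normrN.
have diff e' : `|e'| < e1 -> f i e' t x - f i (- e') t x - \sum_(j < 4) q j * e' ^+ j =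
    e' * Rf e' t x i 0 - (- e') * Rf (- e') t x i 0.
  move=> h1; have h2 : `|- e'| < e1 by rewrite normrN.
  by rewrite Q// Q// qE; ring.
rewrite -diff// (_ : `|e| * (2 * C * `|e| ^+ 4) = 2 * C * `|e| ^+ 5); last by rewrite exprS; ring.
apply: key => e' h1; rewrite diff//; apply: le_trans (ler_normB _ _) _.
rewrite !normrM !normrN.
have b1 := HR e' t x i (lt_le_trans h1 e1e0).
have b2 := HR (- e') t x i; rewrite normrN in b2; have {}b2 := b2 (lt_le_trans h1 e1e0).
have p1 := ler_wpM2l (normr_ge0 e') b1; have p2 := ler_wpM2l (normr_ge0 e') b2.
apply: le_trans (lerD p1 p2) _; rewrite [in leRHS]exprS.
by rewrite le_eqVlt; apply/orP; left; apply/eqP; ring.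
Qed.

End NonlinearTerm.

Section CriticalEigenvalue.
Context {R : realType} {m : nat}.
Variables (K : fieldType) (rK : {rmorphism R -> K}) (iK : K) (oms : R) (Ets : 'M[R]_m).
Hypothesis iK2 : iK * iK = - 1.
Local Notation Es := (exponent_mx 0 oms Ets).

Lemma exponent_eigenvalue : eigenvalue (map_mx rK Es) (iK * rK oms).
Proof.
apply/eigenvalueP; exists (prow rK iK); last first.
  apply/eqP => /matrixP/(_ 0 j1)/eqP; apply/negP; rewrite /prow !mxE /=.
  by rewrite rmorph1 rmorph0 mulr0 addr0 oner_eq0.
apply/rowP => j; rewrite /prow mulmxDl -scalemxAl !map_delta_mx !trmx_delta -!rowE.
have lhs (A : 'M[R]_(2 + m)) : (row j1 (map_mx rK A) + iK *: row j2 (map_mx rK A)) 0 j =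
    rK (A j1 j) + iK * rK (A j2 j) by rewrite !mxE.
have e1j : Es j1 j = - oms * (j == j2)%:R.
  by have [->|->|[l ->]] := ord_splitP j; rewrite /Es ?block_mxEul ?block_mxEur !mxE //= ?mulr0 ?mulr1.
have e2j : Es j2 j = oms * (j == j1)%:R.
  by have [->|->|[l ->]] := ord_splitP j; rewrite /Es ?block_mxEul ?block_mxEur !mxE //= ?mulr0 ?mulr1.
rewrite lhs e1j e2j !mxE !eqxx !andTb !rmorphM rmorphN !rmorph_nat.
rewrite [RHS]mulrDr [in RHS]mulrACA iK2; ring.
Qed.

End CriticalEigenvalue.

(** The critical exponent 'i oms is itself an eigenvalue, so the bound on imaginary parts applies to
    it. *)
Lemma critical_frequency_bound (R : realType) (m : nat) (oms : R) (Ets : 'M[R]_m) :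
  (forall mu, complex_eigenvalue (exponent_mx 0 oms Ets) mu -> - 2^-1 < complex.Im mu < 2^-1) ->
  oms < 2^-1.
Proof.
move=> h; have i2 : ('i%C : R[i]) * 'i%C = -1 by apply: complex_eq; rewrite ?reM ?imM /= ?oppr0; ring.
have := h _ (exponent_eigenvalue (real_complex R : {rmorphism R -> R[i]}) oms Ets i2).
by rewrite imM /= mul0r mul1r add0r => /andP[].
Qed.

Theorem theorem4p2 (R : realType) (m : nat)
  (F : 'cV[R]_(2 + m) -> R -> R -> 'cV[R]_(2 + m))
  (lams oms : R) (vs : R -> 'cV[R]_(2 + m)) (Ps : R -> 'M[R]_(2 + m))
  (Ets : 'M[R]_m)
  (r : R) (v : R -> R -> 'cV[R]_(2 + m)) (P : R -> R -> 'M[R]_(2 + m))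
  (alphaR alphaI : R -> R) (Et : R -> 'M[R]_m)
  (HF : forcing F)
  (Hpoint : neimark_sacker_point F lams vs Ps oms Ets)
  (Hr : 0 < r)
  (Hcont : smooth_continuation F lams vs Ps oms Ets r v P alphaR alphaI Et)
  (Htrans : derive1 alphaR lams != 0)
  (Hom3 : oms != 3^-1) (Hom4 : oms != 4^-1) :
  let E := fun lam => exponent_mx (alphaR lam) (alphaI lam) (Et lam) in
  let G := G_fun F v P E in
  exists (eps0 d : R) (lamF omF : R -> R) (cF : R -> modes R (2 + m)),
    let aF k eps := cos_mode (cF eps) k in
    let bF k eps := sin_mode (cF eps) k in
    [/\ 0 < eps0, 0 < d,
        forall eps, `|eps| < eps0 ->
          [/\ truncated_solution G eps (lamF eps) (omF eps) (zF cF eps),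
              near_bifurcation d lams oms (lamF eps) (omF eps) (zF cF eps),
              forall lam om z,
                truncated_solution G eps lam om z ->
                near_bifurcation d lams oms lam om z ->
                [/\ lam = lamF eps, om = omF eps
                  & forall theta phi, z theta phi = zF cF eps theta phi],
              ip (aF 1%N eps) (fun=> e1) + ip (bF 1%N eps) (fun=> e2) = 0
            & ip (aF 1%N eps) (fun=> e2) - ip (bF 1%N eps) (fun=> e1) = 0]
      & forall (lam2 om2 : R) (cE : modes R (2 + m)),
          asymptotic_solution G lams oms lam2 om2 cE ->
          [/\ (fun eps => lamE lams lam2 eps - lamF eps)
                =O_ (0 : R) (fun eps : R => eps ^+ 4),
              (fun eps => omE oms om2 eps - omF eps)
                =O_ (0 : R) (fun eps : R => eps ^+ 4),
              (forall k, k \in [:: 0; 2]%N ->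
                 unif_bigO (fun eps theta =>
                   aE cE k eps theta - aF k eps theta) 3) /\
              unif_bigO (fun eps theta => bE cE 2 eps theta - bF 2%N eps theta) 3
            & forall k, k \in [:: 1; 3]%N ->
                unif_bigO (fun eps theta =>
                  aE cE k eps theta - aF k eps theta) 4 /\
                unif_bigO (fun eps theta =>
                  bE cE k eps theta - bF k eps theta) 4]].
Proof.
move=> E G.
have [_ _ oms0 hEts hIm] := Hpoint; have oms_lt := critical_frequency_bound hIm.
have [_ base [sv sP] [sR sI sE] fl] := Hcont.
(* The bound 1 keeps the states in the fixed box where H is controlled; r / 2 keeps [lam] inside the
   domain of the continuation. *)
pose d := Num.min 1 (r / 2).
have d0 : 0 < d by rewrite lt_min ltr01 divr_gt0.
have d1 : d <= 1 by rewrite ge_min lexx.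
have dr : d <= r / 2 by rewrite ge_min lexx orbT.
have kder : der alphaR lams (derive1 alphaR lams).
  have h0 : [set lam : R | `|lam - lams| < r] lams by rewrite /= subrr normr0.
  have [_ /(_ 1)] := sR [::] lams h0; rewrite derive1E; exact: derivableP.
apply: (branch_theorem Hr base (Hfun_lipschitz_local Hr HF sv sP fl) (Hfun_lipschitz Hr HF sv sP fl)
  (fun z lam e hl => Hfun_periodic HF fl z e hl) d1 dr (exponent_taylor Hr sR sI sE) kder Htrans
  oms0 oms_lt Hom3 Hom4 hEts (fun z lam th e hl => G_H fl z th e hl) d0).
by move=> lam2 om2 M C0 e0 *; exact: (parity_gain Hr HF sv sP sR sI sE fl (M := M) (C0 := C0) (e0 := e0)).
Qed.
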